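(* Let $q\ge 3$ and assume the Generalized Riemann Hypothesis for $L(s,\chi)$ for every non-principal Dirichlet character $\chi$ modulo $q$. Let $a,b$ be distinct invertible residue classes modulo $q$. Then there is a constant $C$ (depending on $q,a,b$) such that, as $x\to\infty$, \[\frac{1}{x}\int_{ 2}^x \bigl(\pi_{1/2}(u;q,a)-\pi_{1/2}(u;q,b)\bigr)\mathrm{d}u=-\mathrm{M}(q;a,b)\log \log x+C+O\left(\frac{\log \log x}{\log x}\right).\]
   Context: For $x\ge 2$, $\pi_{1/2}(x;q,a)=\sum_{p\le x,\ p\equiv a \bmod q} p^{-1/2}$, the sum over primes. For a non-principal Dirichlet character $\chi$ mod $q$, $m_\chi:=\mathrm{ord}_{s=1/2}L(s,\chi)$. Let $r(a)=\#\{x\in(\mathbb Z/q\mathbb Z)^\times: x^2=a\}$ and $\mathrm{M}(q;a,b)=\frac{1}{2\varphi(q)}\Bigl(r(a)-r(b)+2\sum_{\chi\ne\chi_0}(\chi(a)-\chi(b))m_\chi\Bigr)$, the sum over non-principal characters mod $q$. *)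

(* Defs.v *)
From HB Require Import structures.
From mathcomp Require Import all_boot all_order all_algebra.
From mathcomp Require Import all_classical all_reals all_analysis.
From mathcomp Require Import complex.
Set Implicit Arguments. Unset Strict Implicit. Unset Printing Implicit Defensive.
Import Order.TTheory GRing.Theory Num.Theory numFieldTopology.Exports numFieldNormedType.Exports.
Local Open Scope classical_set_scope.
Local Open Scope ring_scope.

(* The complex numbers over a real type R, seen as a numClosedFieldType so that
   MathComp-Analysis provides its (normed) topology. *)
Definition Cx (R : realType) : numClosedFieldType := (R[i] : numClosedFieldType).

Definition cR (R : realType) (x : R) : Cx R := Complex x 0.

(* n^{-s} = exp(-s log n) for a positive integer n and complex s = sigma + i t:
   n^{-s} = n^{-sigma} (cos (t log n) - i sin (t log n)). *)
Definition npow_neg (R : realType) (n : nat) (s : Cx R) : Cx R :=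
  Complex (expR (- complex.Re s * ln (n%:R : R)) * cos (complex.Im s * ln (n%:R : R)))
          (- (expR (- complex.Re s * ln (n%:R : R)) * sin (complex.Im s * ln (n%:R : R)))).

Definition is_dchar (R : realType) (q : nat) (chi : nat -> Cx R) : Prop :=
  [/\ (forall n, chi (n + q)%N = chi n),
      (forall m n, chi (m * n)%N = chi m * chi n) &
      (forall n, chi n != 0 <-> coprime n q)].

Definition principal_char (R : realType) (q : nat) : nat -> Cx R :=
  fun n => if coprime n q then 1 else 0.

Definition nonprincipal_chars (R : realType) (q : nat) : set (nat -> Cx R) :=
  [set chi | is_dchar q chi /\ chi <> @principal_char R q].

(* L(s, chi) = sum_{n >= 1} chi(n) n^{-s}, the Dirichlet series (which converges
   for complex.Re s > 0 when chi is non-principal, and there agrees with the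
   analytically continued L-function). *)
Definition Lchi (R : realType) (chi : nat -> Cx R) (s : Cx R) : Cx R :=
  limn (fun N => \sum_(1 <= n < N) chi n * npow_neg n s).

Definition half (R : realType) : Cx R := cR (2^-1 : R).

Definition is_order_at_half (R : realType) (chi : nat -> Cx R) (m : nat) : Prop :=
  exists2 c : Cx R, c != 0 &
    (Lchi chi s / (s - @half R) ^+ m) @[s --> (@half R)^'] --> c.

Definition m_chi (R : realType) (chi : nat -> Cx R) : nat :=
  xget 0%N [set m | is_order_at_half chi m].

Definition rsq (q a : nat) : nat :=
  #|[set x : 'I_q | coprime x q && (x * x == a %[mod q])%N]|.

Definition Mqab (R : realType) (q a b : nat) : Cx R :=
  (2 * (totient q)%:R)^-1 *
  ((rsq q a)%:R - (rsq q b)%:R +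
   2 * \sum_(chi \in @nonprincipal_chars R q) (chi a - chi b) * (m_chi chi)%:R).

Definition pi_half (R : realType) (q a : nat) (x : R) : R :=
  \sum_(p < (Num.truncn x).+1 | [&& prime p, (p%:R <= x) & (p == a %[mod q])%N])
     (Num.sqrt (p%:R : R))^-1.

Definition avg_diff (R : realType) (q a b : nat) (x : R) : R :=
  x^-1 * Rintegral (@lebesgue_measure R) `[2%R, x]
                   (fun u => pi_half q a u - pi_half q b u).

(* Main.v *)
Require Import Defs.
From HB Require Import structures.
From mathcomp Require Import all_boot all_order all_algebra.
From mathcomp Require Import all_fingroup all_solvable all_field all_character.
From mathcomp Require Import all_classical all_reals all_analysis.
From mathcomp Require Import complex.
From mathcomp Require Import ring lra zify.
Import Order.TTheory GRing.Theory Num.Theory numFieldTopology.Exports numFieldNormedType.Exports.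
Set Implicit Arguments. Unset Strict Implicit. Unset Printing Implicit Defensive.
Local Open Scope classical_set_scope.
Local Open Scope ring_scope.

(* Integrating over [2, x] attaches to each prime p <= x the weight p^(-1/2) (1 - p/x), so by
   orthogonality everything reduces to character sums over primes with this Fejer weight.
   Under GRH, Perron's formula with the kernel e^(vs) / (s (s + 1)), v = ln X, moved to the line
   Re s = 1/2 + 1/(1 + v), gives
     sum_(n <= X) Lambda(n) chi(n) n^(-1/2) (1 - n/X) = - m_chi ln X + O(ln ln X):
   the pole of L'/L at 1/2 yields the main term, while on that line |L'/L| is locally at most a
   sum of 1/|s - rho| over O(ln(2 + |t|)) points rho to the left, plus O(ln(2 + |t|)), whose
   integral against the kernel is O(ln ln X). By Mertens, the squares of primes contribute
   [chi^2 = chi_0] (ln X)/2 + O(1), the origin of r(a) - r(b), and higher powers O(1). Summing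
   twice by parts removes the factor ln p and turns - M ln N into - M ln ln N.
   No complex integration is used: contour integrals are Riemann sums, holomorphic functions are
   uniform limits of polynomials, and the local bound for L'/L is first proved for polynomials,
   where Borel-Caratheodory follows from averages over roots of unity. *)

(** * Complex numbers and elementary estimates *)

Section ComplexBasics.
Variable R : realType.
Local Notation C := (Cx R).
Implicit Types (x y : R) (z w s : C).

(** The abscissa 1/2 + 1/(1 + v) balances two effects. There e^(vs), with s measured from 1/2, has
    modulus at most e, while every point rho is still at distance at least 1/(2(1 + v)), so that one
    unit of height costs O(ln(1 + v)) per point: this is the ln ln X of the error. The factor s + 1
    makes the kernel decay like t^(-2), hence ln(2 + |t|) is summable against it, and truncation at
    a height N costs nothing once N is chosen after X. The number 2 pi never appears: the prime sum
    and the polar part m/s go through the same truncated formula with the same factor [kernel_mass],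
    which is divided out at the end. The points rho are not zeros of L but zeros of a polynomial
    close to L and L' on a disc. They are therefore only known to lie left of 1/2 + 1/(2(1 + v)),
    and every estimate for polynomials has to depend on radii and suprema alone, never on the
    degree. *)

Definition nm z : R := Normc.normc z.

Lemma normE z : `|z| = cR (nm z).
Proof. by []. Qed.

Lemma nmE z : nm z = Num.sqrt (complex.Re z ^+ 2 + complex.Im z ^+ 2).
Proof. by case: z. Qed.

Lemma nm_ge0 z : 0 <= nm z.
Proof. by rewrite nmE sqrtr_ge0. Qed.

Lemma nm0 : nm 0 = 0. Proof. exact: Normc.normc0. Qed.
Lemma nm1 : nm 1 = 1. Proof. exact: Normc.normc1. Qed.
Lemma nmM z w : nm (z * w) = nm z * nm w. Proof. exact: Normc.normcM. Qed.
Lemma nmV z : nm z^-1 = (nm z)^-1. Proof. exact: Normc.normcV. Qed.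
Lemma nmN z : nm (- z) = nm z. Proof. exact: normcN. Qed.
Lemma nmD z w : nm (z + w) <= nm z + nm w. Proof. exact: le_normcD. Qed.

Lemma nm_eq0 z : (nm z == 0) = (z == 0).
Proof. by apply/eqP/eqP => [/Normc.eq0_normc //|->]; exact: nm0. Qed.

Lemma nm_gt0 z : (0 < nm z) = (z != 0).
Proof. by rewrite lt_def nm_ge0 andbT nm_eq0. Qed.

Lemma nmX z n : nm (z ^+ n) = nm z ^+ n.
Proof. by elim: n => [|n IH]; rewrite ?expr0 ?nm1 // !exprS nmM IH. Qed.

Lemma nmB z w : nm (z - w) <= nm z + nm w.
Proof. by rewrite (le_trans (nmD _ _)) // nmN. Qed.

Lemma nmBC z w : nm (z - w) = nm (w - z).
Proof. by rewrite -nmN opprB. Qed.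

Lemma nm_tri z w s : nm (z - s) <= nm (z - w) + nm (w - s).
Proof. by rewrite (le_trans _ (nmD _ _)) // addrA subrK. Qed.

Lemma nm_lB z w : nm z - nm w <= nm (z - w).
Proof. by rewrite lerBlDr (le_trans _ (nmD _ _)) // subrK. Qed.

Lemma nm_lD z w : nm z - nm w <= nm (z + w).
Proof. by rewrite -(nmN w) -{2}(opprK w) nm_lB. Qed.

Lemma nm_cR x : nm (cR x) = `|x|.
Proof. by rewrite nmE /= expr0n addr0 sqrtr_sqr. Qed.

Lemma nm_nat n : nm n%:R = n%:R :> R.
Proof.
have -> : n%:R = cR (n%:R) :> C by rewrite /cR -[RHS]/((n%:R : R)%:C%C) rmorph_nat.
by rewrite nm_cR ger0_norm.
Qed.

Lemma nm_sum (I : Type) (r : seq I) (P : pred I) (F : I -> C) :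
  nm (\sum_(i <- r | P i) F i) <= \sum_(i <- r | P i) nm (F i).
Proof.
elim/big_ind2: _ => [|x1 y1 x2 y2 h1 h2|//]; first by rewrite nm0.
by rewrite (le_trans (nmD _ _)) // lerD.
Qed.

Lemma nm_prod (I : Type) (r : seq I) (P : pred I) (F : I -> C) :
  nm (\prod_(i <- r | P i) F i) = \prod_(i <- r | P i) nm (F i).
Proof. by elim/big_ind2: _ => [|x1 y1 x2 y2 <- <-|//]; rewrite ?nm1 ?nmM. Qed.

Lemma nm_sqr z : nm z ^+ 2 = complex.Re z ^+ 2 + complex.Im z ^+ 2.
Proof. by rewrite nmE sqr_sqrtr // addr_ge0 ?sqr_ge0. Qed.

Lemma absRe_le z : `|complex.Re z| <= nm z.
Proof. by rewrite nmE -sqrtr_sqr ler_wsqrtr // lerDl sqr_ge0. Qed.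

Lemma absIm_le z : `|complex.Im z| <= nm z.
Proof. by rewrite nmE -sqrtr_sqr ler_wsqrtr // lerDr sqr_ge0. Qed.

Lemma nm_ReIm z : nm z <= `|complex.Re z| + `|complex.Im z|.
Proof.
have h : 0 <= `|complex.Re z| + `|complex.Im z| by rewrite addr_ge0.
rewrite -(ler_pXn2r (n:=2)) ?nnegrE ?nm_ge0 // nm_sqr sqrrD !real_normK ?num_real //.
by rewrite addrAC lerDl mulrn_wge0 // mulr_ge0.
Qed.

Lemma ReD z w : complex.Re (z + w) = complex.Re z + complex.Re w.
Proof. by case: z w => a b [c d]. Qed.
Lemma ImD z w : complex.Im (z + w) = complex.Im z + complex.Im w.
Proof. by case: z w => a b [c d]. Qed.
Lemma ReN z : complex.Re (- z) = - complex.Re z. Proof. by case: z. Qed.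
Lemma ImN z : complex.Im (- z) = - complex.Im z. Proof. by case: z. Qed.
Lemma ReM z w : complex.Re (z * w) =
  complex.Re z * complex.Re w - complex.Im z * complex.Im w.
Proof. by case: z w => a b [c d]. Qed.
Lemma ImM z w : complex.Im (z * w) =
  complex.Re z * complex.Im w + complex.Im z * complex.Re w.
Proof. by case: z w => a b [c d]. Qed.
Lemma Re_sum (I : Type) (r : seq I) (P : pred I) (F : I -> C) :
  complex.Re (\sum_(i <- r | P i) F i) = \sum_(i <- r | P i) complex.Re (F i).
Proof. by elim/big_ind2: _ => // x1 y1 x2 y2 <- <-; rewrite ReD. Qed.

Lemma Cext z w : complex.Re z = complex.Re w -> complex.Im z = complex.Im w -> z = w.
Proof. by case: z w => a b [c d] /= -> ->. Qed.

Lemma cR0 : cR 0 = 0 :> C. Proof. by []. Qed.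
Lemma cR1 : cR 1 = 1 :> C. Proof. by []. Qed.
Lemma cRD x y : cR (x + y) = cR x + cR y.
Proof. by apply: Cext; rewrite /= ?addr0. Qed.
Lemma cRN x : cR (- x) = - cR x.
Proof. by apply: Cext; rewrite /= ?oppr0. Qed.
Lemma cRB x y : cR (x - y) = cR x - cR y.
Proof. by rewrite cRD cRN. Qed.
Lemma cRM x y : cR (x * y) = cR x * cR y.
Proof. by apply: Cext; rewrite ?ReM ?ImM /= ?mulr0 ?mul0r ?subr0 ?addr0. Qed.
Lemma cRX x n : cR (x ^+ n) = cR x ^+ n.
Proof. by elim: n => [|n IH]; rewrite ?expr0 ?cR1 // !exprS cRM IH. Qed.
Lemma cRV x : cR (x^-1) = (cR x)^-1.
Proof. exact: (fmorphV (real_complex R)). Qed.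
Lemma cR_nat n : cR n%:R = n%:R :> C.
Proof. exact: (rmorph_nat (real_complex R)). Qed.
Lemma cR_sum (I : Type) (r : seq I) (P : pred I) (F : I -> R) :
  cR (\sum_(i <- r | P i) F i) = \sum_(i <- r | P i) cR (F i).
Proof. by elim/big_ind2: _ => // x1 y1 x2 y2 <- <-; rewrite cRD. Qed.
Lemma cR_eq0 x : (cR x == 0) = (x == 0).
Proof. by rewrite -nm_eq0 nm_cR normr_eq0. Qed.
Lemma ler_cR x y : (cR x <= cR y) = (x <= y).
Proof. exact: lecR. Qed.

Lemma cscale x z : cR x * z = Complex (x * complex.Re z) (x * complex.Im z).
Proof. by apply: Cext; rewrite ?ReM ?ImM /= !mul0r ?subr0 ?addr0. Qed.

Definition ci : C := Complex 0 1.
Definition cj z : C := Complex (complex.Re z) (- complex.Im z).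
Lemma cjE z : cj z = conjc (z : R[i]). Proof. by case: z. Qed.
Lemma nm_cj z : nm (cj z) = nm z.
Proof. by rewrite !nmE /= sqrrN. Qed.
Lemma cjM z w : cj (z * w) = cj z * cj w.
Proof. by rewrite !cjE rmorphM. Qed.
Lemma cjD z w : cj (z + w) = cj z + cj w.
Proof. by rewrite !cjE rmorphD. Qed.
Lemma cj_sum (I : Type) (r : seq I) (P : pred I) (F : I -> C) :
  cj (\sum_(i <- r | P i) F i) = \sum_(i <- r | P i) cj (F i).
Proof. by rewrite !cjE rmorph_sum; apply: eq_bigr => i _; rewrite cjE. Qed.
Lemma cj_cR x : cj (cR x) = cR x.
Proof. by apply: Cext; rewrite /= ?oppr0. Qed.
Lemma mul_cj z : z * cj z = cR (nm z ^+ 2).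
Proof. by apply: Cext; rewrite ?ReM ?ImM nm_sqr /=; ring. Qed.

Lemma mvt_ex (f df : R -> R) (a b : R) : a <= b ->
  (forall x, a <= x <= b -> is_derive x 1 f (df x)) ->
  exists2 c, a <= c <= b & f b - f a = df c * (b - a).
Proof.
move=> ab fd.
have fd' x : x \in `]a, b[%R -> is_derive x 1 f (df x).
  by rewrite in_itv /= => /andP[h1 h2]; apply: fd; rewrite !ltW.
have fc : {within `[a, b], continuous f}.
  apply: derivable_within_continuous => x xab.
  by have [] := fd x; move: xab; rewrite in_itv.
by have [c] := MVT_segment ab fd' fc; rewrite in_itv /=; exists c.
Qed.

Lemma mvt_le (f df : R -> R) (a b B : R) : a <= b ->
  (forall x, a <= x <= b -> is_derive x 1 f (df x)) ->
  (forall x, a <= x <= b -> `|df x| <= B) -> `|f b - f a| <= B * (b - a).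
Proof.
move=> ab fd hB; have [c cab ->] := mvt_ex ab fd.
by rewrite normrM (ger0_norm (_ : 0 <= b - a)) ?subr_ge0 // ler_wpM2r ?subr_ge0 // hB.
Qed.

Lemma sin_abs_le y : `|sin y| <= `|y|.
Proof.
wlog y0 : y / 0 <= y => [h|].
  case: (lerP 0 y) => [/h//|/ltW y0].
  by rewrite -normrN -sinN -(normrN y) h // oppr_ge0.
have := @mvt_le sin cos 0 y 1 y0.
rewrite sin0 !subr0 mul1r (ger0_norm y0); apply => x _; last exact: cos_max.
Qed.

Lemma cos_ge1B y : 1 - y ^+ 2 / 2 <= cos y.
Proof.
have -> : cos y = 1 - 2 * sin (y / 2) ^+ 2.
  by rewrite {1}(splitr y) cosD -!expr2 cos2sin2; ring.
have h2 : sin (y / 2) ^+ 2 <= (y / 2) ^+ 2.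
  rewrite -[leLHS]real_normK ?num_real // -[leRHS]real_normK ?num_real //.
  by rewrite lerXn2r ?nnegrE // sin_abs_le.
have h4 : (y / 2) ^+ 2 = y ^+ 2 / 4 by field.
by rewrite h4 in h2; lra.
Qed.

Lemma sin_sub_le y : `|y| <= 1 -> `|sin y - y| <= y ^+ 2.
Proof.
wlog y0 : y / 0 <= y => [h|].
  case: (lerP 0 y) => [/h//|/ltW y0] y1.
  have -> : sin y - y = - (sin (- y) - - y) by rewrite sinN; ring.
  by rewrite normrN -(sqrrN y) h ?oppr_ge0 // normrN.
rewrite (ger0_norm y0) => y1.
have hd x : 0 <= x <= y -> is_derive x 1 (fun x => sin x - x) (cos x - 1).
  by move=> _; exact: is_deriveB.
have hb x : 0 <= x <= y -> `|cos x - 1| <= y ^+ 2 / 2.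
  move=> /andP[x0 xy]; rewrite distrC ger0_norm ?subr_ge0 ?cos_le1 //.
  have := cos_ge1B x; have : x ^+ 2 <= y ^+ 2 by rewrite lerXn2r ?nnegrE // (le_trans x0).
  lra.
have := mvt_le y0 hd hb; rewrite sin0 subrr !subr0 => h; apply: (le_trans h).
have := sqr_ge0 y; nra.
Qed.

(** The upper bound comes from e^x (1 - x) <= 1, that is from 1 + y <= e^y at y = -x. *)
Lemma expR_sub_le x : x <= 2^-1 -> 0 <= expR x - 1 - x <= 2 * x ^+ 2.
Proof.
move=> x1; apply/andP; split.
  by rewrite -addrA -opprD subr_ge0 expR_ge1Dx.
have h : expR x * (1 - x) <= 1.
  have := expR_ge1Dx (- x); have := expRxMexpNx_1 x; have := expR_gt0 x; nra.
have := sqr_ge0 x; have := expR_gt0 x; nra.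
Qed.

Definition cexp z : C :=
  Complex (expR (complex.Re z) * cos (complex.Im z)) (expR (complex.Re z) * sin (complex.Im z)).

Lemma cexpD z w : cexp (z + w) = cexp z * cexp w.
Proof.
by apply: Cext; rewrite ?ReM ?ImM /= ReD ImD expRD ?cosD ?sinD; ring.
Qed.

Lemma cexp0 : cexp 0 = 1.
Proof. by apply: Cext; rewrite /= expR0 ?cos0 ?sin0 mul1r. Qed.

Lemma nm_cexp z : nm (cexp z) = expR (complex.Re z).
Proof.
rewrite nmE /= !exprMn -mulrDr cos2Dsin2 mulr1 sqrtr_sqr ger0_norm //; exact: expR_ge0.
Qed.

Lemma cexp_neq0 z : cexp z != 0.
Proof. by rewrite -nm_gt0 nm_cexp expR_gt0. Qed.

Lemma cexpN z : cexp (- z) = (cexp z)^-1.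
Proof.
apply: (mulfI (cexp_neq0 z)); rewrite -cexpD subrr cexp0 divff //; exact: cexp_neq0.
Qed.

Lemma cexpMn n z : cexp (n%:R * z) = cexp z ^+ n.
Proof.
elim: n => [|n IH]; first by rewrite mul0r cexp0 expr0.
by rewrite -natr1 mulrDl mul1r cexpD IH exprSr.
Qed.

Lemma cexp_cR x : cexp (cR x) = cR (expR x).
Proof. by apply: Cext; rewrite /= ?cos0 ?sin0 ?mulr1 ?mulr0. Qed.

Lemma npow_negE n s : npow_neg n s = cexp (- s * cR (ln n%:R)).
Proof.
apply: Cext; rewrite /npow_neg /cexp /= ?ReM ?ImM ?ReN ?ImN /= ?mulr0 ?subr0 ?add0r.
  by rewrite [in RHS](mulNr (complex.Im s)) cosN.
by rewrite [in RHS](mulNr (complex.Im s)) sinN mulrN.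
Qed.

(** With w = x + iy the squared left side is (1 - e^x)^2 + 2 e^x (1 - cos y), and for x <= 0 the two
    parts are at most x^2 and y^2. Being valid for large w too, it controls n^(-s) - (n + 1)^(-s)
    for every s with nonnegative real part. *)
Lemma cexp_sub1_le w : complex.Re w <= 0 -> nm (cexp w - 1) <= nm w.
Proof.
move=> x0; rewrite -(ler_pXn2r (n:=2)) ?nnegrE ?nm_ge0 // !nm_sqr ReD ImD ReN ImN /=.
set x := complex.Re w in x0 *; set y := complex.Im w.
have e1 : expR x <= 1 by rewrite expR_le1.
have e0 := expR_gt0 x; have e2 := expR_ge1Dx x; have c1 := cos_ge1B y.
have cs := cos2Dsin2 y.
have -> : (expR x * cos y - 1) ^+ 2 + (expR x * sin y - 0) ^+ 2 =
  (1 - expR x) ^+ 2 + 2 * expR x * (1 - cos y).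
  transitivity (expR x ^+2 * (cos y ^+ 2 + sin y ^+ 2) - 2 * expR x * cos y + 1).
    by ring.
  by rewrite cs; ring.
have h1 : (1 - expR x) ^+ 2 <= x ^+ 2.
  rewrite -(sqrrN x) lerXn2r ?nnegrE; lra.
have h2 : 2 * expR x * (1 - cos y) <= 2 * 1 * (y ^+ 2 / 2).
  have h3 := cos_le1 y; apply: ler_pM; lra.
lra.
Qed.

Lemma cexp_sub2_le w : nm w <= 2^-1 -> nm (cexp w - 1 - w) <= 4 * nm w ^+ 2.
Proof.
move=> hw; rewrite (le_trans (nm_ReIm _)) // nm_sqr !ReD !ImD !ReN !ImN /=.
have := le_trans (absRe_le w) hw; have := le_trans (absIm_le w) hw.
set x := complex.Re w; set y := complex.Im w => hy hx.
have x2 : x <= 2^-1 by rewrite (le_trans _ hx) // ler_norm.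
have /andP[e1 e2] := expR_sub_le x2.
have e3 : expR x <= 2 by move: hx; rewrite ler_norml => /andP[h1 h2]; nra.
have c1 := cos_ge1B y; have c2 := cos_le1 y.
have y1 : `|y| <= 1 by lra.
have s1 := sin_sub_le y1; have e0 := expR_gt0 x.
have hxx : x ^+ 2 = `|x| ^+ 2 by rewrite real_normK ?num_real.
have hyy : y ^+ 2 = `|y| ^+ 2 by rewrite real_normK ?num_real.
have nx0 := normr_ge0 x; have ny0 := normr_ge0 y.
have A : `|expR x * cos y - 1 - x| <= 2 * x ^+ 2 + y ^+ 2.
  have -> : expR x * cos y - 1 - x = (expR x - 1 - x) - expR x * (1 - cos y) by ring.
  rewrite (le_trans (ler_normB _ _)) // lerD //; first by rewrite ger0_norm.
  rewrite normrM (ger0_norm (ltW e0)) ger0_norm ?subr_ge0 //; nra.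
have Ex : `|expR x - 1| <= 2 * `|x|.
  have -> : expR x - 1 = (expR x - 1 - x) + x by ring.
  apply: (le_trans (ler_normD _ _)); rewrite (ger0_norm e1); rewrite hxx in e2; nra.
have B : `|expR x * sin y - 0 - y| <= 2 * y ^+ 2 + 2 * `|x| * `|y|.
  have -> : expR x * sin y - 0 - y = expR x * (sin y - y) + (expR x - 1) * y by ring.
  rewrite (le_trans (ler_normD _ _)) // !normrM (ger0_norm (ltW e0)) lerD //.
    by rewrite ler_pM // ltW.
  by rewrite ler_wpM2r.
rewrite (le_trans (lerD A B)) // hxx hyy.
have := sqr_ge0 (`|x| - `|y|); nra.
Qed.

End ComplexBasics.

(** * Polynomials on a disc *)

Section PolyTools.
Variable R : realType.
Local Notation C := (Cx R).
Implicit Types (x y : R) (z w s : C) (P Q : {poly C}).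

(** X^n - 1 splits over the algebraically closed field and is separable in characteristic 0, and n
    distinct n-th roots of unity always include a primitive one. *)
Lemma prim_root_ex n : (0 < n)%N -> exists w : C, n.-primitive_root w.
Proof.
move=> n_gt0; pose p : {poly C} := 'X^n - 1.
have [r Dp] := closed_field_poly_normal p.
rewrite (monicP _) ?monicXnsubC // scale1r in Dp.
have rn1 : all n.-unity_root r by apply/allP=> z; rewrite -root_prod_XsubC -Dp.
have sz_r : (n < (size r).+1)%N.
  by rewrite -(size_prod_XsubC r id) -Dp size_XnsubC.
have [|z] := hasP (has_prim_root n_gt0 rn1 _ sz_r); last by exists z.
by rewrite -separable_prod_XsubC -Dp separable_Xn_sub_1 // pnatr_eq0 -lt0n.
Qed.

Lemma nm_prim_root n (w : C) : n.-primitive_root w -> nm w = 1.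
Proof.
move=> hw; have n0 := prim_order_gt0 hw; apply/eqP.
by rewrite -(pexpr_eq1 n0) ?nm_ge0 // -nmX prim_expr_order // nm1.
Qed.

Lemma sum_prim_root n (w : C) j : n.-primitive_root w ->
  \sum_(k < n) w ^+ (k * j) = if (n %| j)%N then n%:R else 0.
Proof.
move=> hw; case: ifP => [|/negbT] h.
  under eq_bigr => k _.
    have -> : w ^+ (k * j) = 1 by apply/eqP; rewrite -(prim_order_dvd hw) dvdn_mull.
    over.
  by rewrite sumr_const card_ord.
have h1 : w ^+ j != 1 by rewrite -(prim_order_dvd hw).
under eq_bigr do rewrite mulnC exprM.
have h2 := subrX1 (w ^+ j) n.
apply: (mulfI (_ : w ^+ j - 1 != 0)); first by rewrite subr_eq0.
by rewrite -h2 -exprM mulnC exprM (prim_expr_order hw) expr1n subrr mulr0.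
Qed.

(** Cauchy's integral formula with the circle replaced by the n-th roots of unity. It is exact
    because the degree is below n, so that no other coefficient aliases onto index j. The factor
    [w ^+ (k * (n - j))] is w^(-kj) written with a natural exponent. *)
Lemma coef_avg P n (w : C) (r : C) j : n.-primitive_root w -> (size P <= n)%N -> (j < n)%N ->
  \sum_(k < n) P.[r * w ^+ k] * w ^+ (k * (n - j)) = n%:R * (P`_j * r ^+ j).
Proof.
move=> hw sP jn.
under eq_bigr => k _.
  rewrite (horner_coef_wide _ sP) mulr_suml.
  under eq_bigr => i _.
    rewrite (_ : _ * _ = (P`_i * r ^+ i) * w ^+ (k * (i + (n - j)))); last first.
      by rewrite exprMn -exprM mulnDr exprD; ring.
    over.
  over.
rewrite exchange_big /= (bigD1 (Ordinal jn)) //= [X in _ + X]big1 ?addr0.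
  rewrite -mulr_sumr sum_prim_root // subnKC ?(ltnW jn) // dvdnn; ring.
move=> i ij; rewrite -mulr_sumr sum_prim_root //.
have -> : (n %| i + (n - j))%N = false; last by rewrite mulr0.
apply/negP => /dvdnP [q hq].
have ni := ltn_ord i; have hij : (i : nat) != j by [].
by case: q hq => [|[|q]] hq; rewrite ?mul0n ?mul1n ?mulSn in hq; lia.
Qed.

Lemma coef_bound P r M j : 0 < r -> (forall z, nm z = r -> nm P.[z] <= M) ->
  nm P`_j * r ^+ j <= M.
Proof.
move=> r0 hM; set n := maxn (size P) j.+1.
have n0 : (0 < n)%N by rewrite (leq_trans _ (leq_maxr _ _)).
have [w hw] := prim_root_ex n0.
have := coef_avg (cR r) hw (leq_maxl _ _ : (size P <= n)%N) (leq_maxr _ _ : (j < n)%N).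
move=> h; have : n%:R * (nm P`_j * r ^+ j) <= n%:R * M.
  have -> : n%:R * (nm P`_j * r ^+ j) = nm (n%:R * (P`_j * cR r ^+ j)).
    by rewrite !nmM nm_nat nmX nm_cR (gtr0_norm r0).
  rewrite -h (le_trans (nm_sum _ _ _)) //.
  rewrite (_ : n%:R * M = \sum_(k < n) M); last by rewrite sumr_const card_ord mulr_natl.
  apply: ler_sum => k _; rewrite nmM !nmX (nm_prim_root hw) expr1n mulr1.
  by apply: hM; rewrite nmM nm_cR (gtr0_norm r0) nmX (nm_prim_root hw) expr1n mulr1.
by rewrite ler_pM2l ?ltr0n.
Qed.

(** Partial sums of the binomial series of (1 - x)^(-m-1). By Pascal's rule, multiplication by 1 - x
    turns the sum of order m + 1 into the one of order m minus a boundary term. The orders 0, 1, 2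
    serve for a polynomial, its derivative and its second-order remainder. *)
Lemma geo_binom (m n : nat) x : 0 <= x < 1 ->
  \sum_(i < n) 'C(i + m, m)%:R * x ^+ i <= (1 - x) ^- m.+1.
Proof.
move=> /andP[x0 x1]; have u0 : 0 < 1 - x by rewrite subr_gt0.
elim: m => [|m IH].
  under eq_bigr do rewrite bin0 mul1r.
  rewrite expr1 -div1r ler_pdivlMr // mulrC.
  have -> : (1 - x) * \sum_(i < n) x ^+ i = 1 - x ^+ n.
    have := subrX1 x n; set S := \sum_(i < n) _ => h; lra.
  by rewrite gerBl exprn_ge0.
rewrite exprSr invfM ler_pdivlMr // (le_trans _ IH) //.
rewrite {IH}; have : \sum_(i < n) 'C(i + m.+1, m.+1)%:R * x ^+ i * (1 - x) =
   \sum_(i < n) 'C(i + m, m)%:R * x ^+ i - (if n is k.+1 then 'C(k + m.+1, m.+1)%:R * x ^+ n else 0).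
  elim: n => [|[|n] IH]; first by rewrite !big_ord0 subr0.
    by rewrite !big_ord_recr !big_ord0 /= !add0n !binn; ring.
  rewrite big_ord_recr IH [in RHS]big_ord_recr /=.
  have e1 : 'C(n.+1 + m.+1, m.+1) = ('C(n + m.+1, m.+1) + 'C(n.+1 + m, m))%N.
    by rewrite addSn binS addSnnS.
  rewrite e1 natrD !exprS; ring.
rewrite -mulr_suml => ->; rewrite gerBl.
by case: n => // k; rewrite mulr_ge0 ?exprn_ge0.
Qed.

Section Bounded.
Variables (P : {poly C}) (r r' M : R).
Hypotheses (r'0 : 0 <= r') (rr : r' < r).
Hypothesis hM : forall z, nm z = r -> nm P.[z] <= M.
Let r0 : 0 < r. Proof. exact: le_lt_trans rr. Qed.
Let x := r' / r.
Let x01 : 0 <= x < 1. Proof. by rewrite /x divr_ge0 ?(ltW r0) //= ltr_pdivrMr // mul1r. Qed.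
Let cb j : nm P`_j <= M / r ^+ j.
Proof. by rewrite ler_pdivlMr ?exprn_gt0 // coef_bound. Qed.
Let M0 : 0 <= M.
Proof. by rewrite (le_trans _ (@coef_bound P r M 0 r0 hM)) // expr0 mulr1 nm_ge0. Qed.

(** Substitute for the maximum modulus principle: Cauchy's estimates summed as a geometric series
    lose a factor that depends on the radii only. *)
Lemma poly_max z : nm z <= r' -> nm P.[z] <= M / (1 - r' / r).
Proof.
move=> hz; rewrite horner_coef (le_trans (nm_sum _ _ _)) //.
apply: (@le_trans _ _ (M * \sum_(i < size P) 'C(i + 0, 0)%:R * x ^+ i)).
  rewrite mulr_sumr; apply: ler_sum => i _.
  rewrite bin0 mul1r nmM nmX expr_div_n mulrCA [leLHS]mulrC.
  by rewrite ler_pM ?exprn_ge0 ?nm_ge0 // lerXn2r ?nnegrE ?nm_ge0.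
by rewrite ler_wpM2l // (le_trans (geo_binom 0 _ x01)) // expr1.
Qed.

Lemma poly_deriv_max z : nm z <= r' -> nm P^`().[z] <= M / r / (1 - r' / r) ^+ 2.
Proof.
move=> hz; rewrite horner_coef (le_trans (nm_sum _ _ _)) //.
apply: (@le_trans _ _ (M / r * \sum_(i < size P^`()) 'C(i + 1, 1)%:R * x ^+ i)).
  rewrite mulr_sumr; apply: ler_sum => i _.
  rewrite coef_deriv addn1 bin1 -[P`_i.+1 *+ i.+1]mulr_natl !nmM nm_nat nmX -mulrA.
  rewrite [leRHS]mulrCA ler_wpM2l //.
  have h := cb i.+1.
  have -> : M / r * x ^+ i = M / r ^+ i.+1 * r' ^+ i.
    by rewrite /x expr_div_n exprS invfM; ring.
  by rewrite ler_pM ?exprn_ge0 ?nm_ge0 // lerXn2r ?nnegrE ?nm_ge0.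
by rewrite ler_wpM2l ?divr_ge0 ?(ltW r0) // (le_trans (geo_binom 1 _ x01)).
Qed.

Lemma pow_so (z w : C) (k : nat) (p : R) : nm z <= p -> nm (z + w) <= p ->
  nm ((z + w) ^+ k.+2 - z ^+ k.+2 - w * (k.+2%:R * z ^+ k.+1)) <=
  nm w ^+ 2 * ('C(k + 2, 2)%:R * p ^+ k).
Proof.
move=> hz hw; have p0 : 0 <= p by rewrite (le_trans _ hz) ?nm_ge0.
elim: k => [|k IH].
  rewrite add0n binn expr0 !mulr1 -nmX.
  by rewrite (_ : _ - _ = w ^+ 2) //; ring.
have -> : (z + w) ^+ k.+3 - z ^+ k.+3 - w * (k.+3%:R * z ^+ k.+2) =
  (z + w) * ((z + w) ^+ k.+2 - z ^+ k.+2 - w * (k.+2%:R * z ^+ k.+1)) +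
  w ^+ 2 * (k.+2%:R * z ^+ k.+1).
  by rewrite !exprS -!natr1; ring.
apply: (le_trans (nmD _ _)).
have -> : 'C(k.+1 + 2, 2) = ('C(k + 2, 2) + k.+2)%N by rewrite addSn binS bin1 addn2.
have -> : nm w ^+ 2 * (('C(k + 2, 2) + k.+2)%:R * p ^+ k.+1) =
  nm w ^+ 2 * ('C(k + 2, 2)%:R * p ^+ k.+1) + nm w ^+ 2 * (k.+2%:R * p ^+ k.+1).
  by rewrite natrD; ring.
rewrite lerD //.
  rewrite nmM (le_trans (ler_pM _ _ hw IH)) ?nm_ge0 // [p ^+ k.+1]exprS.
  by rewrite le_eqVlt; apply/orP; left; apply/eqP; ring.
rewrite nmM nmX ler_wpM2l ?exprn_ge0 ?nm_ge0 // nmM nm_nat nmX.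
by rewrite ler_wpM2l // lerXn2r ?nnegrE ?nm_ge0.
Qed.

(** The bound sees P through [M] and not through its degree, so it survives uniform limits and gives
    each of them a derivative with quadratic remainder. *)
Lemma poly_so z w : nm z <= r' -> nm (z + w) <= r' ->
  nm (P.[z + w] - P.[z] - w * P^`().[z]) <= M / r ^+ 2 / (1 - r' / r) ^+ 3 * nm w ^+ 2.
Proof.
move=> hz hw; set n := size P.
have sP : (size P <= n.+2)%N by rewrite /n; lia.
have sP' : (size P^`() <= n.+1)%N.
  apply/leq_sizeP => j hj; rewrite coef_deriv nth_default ?mul0rn //.
  by apply: leq_trans (leqnSn j); apply: ltnW.
rewrite !(horner_coef_wide _ sP) (horner_coef_wide _ sP') mulr_sumr -sumrB.
rewrite big_ord_recl /= !expr0 subrr add0r -sumrB big_ord_recl /=.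
rewrite /bump /= !expr1 coef_deriv expr0 mulr1n mulr1 (_ : _ - _ - _ = 0) ?add0r; last by ring.
rewrite (le_trans (nm_sum _ _ _)) //.
apply: (@le_trans _ _ (M / r ^+ 2 * nm w ^+ 2 * \sum_(i < n) 'C(i + 2, 2)%:R * x ^+ i)).
  rewrite mulr_sumr; apply: ler_sum => i _; rewrite /= !add1n coef_deriv -[P`_i.+2 *+ i.+2]mulr_natl.
  have -> : P`_i.+2 * (z + w) ^+ i.+2 - P`_i.+2 * z ^+ i.+2 - w * (i.+2%:R * P`_i.+2 * z ^+ i.+1)
   = P`_i.+2 * ((z + w) ^+ i.+2 - z ^+ i.+2 - w * (i.+2%:R * z ^+ i.+1)) by ring.
  rewrite nmM (le_trans (ler_pM _ _ (cb _) (pow_so i hz hw))) ?nm_ge0 //.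
  rewrite le_eqVlt; apply/orP; left; apply/eqP; rewrite /x expr_div_n !exprS.
  by field; rewrite expf_neq0 gt_eqF.
rewrite [leRHS]mulrAC ler_wpM2l ?mulr_ge0 ?invr_ge0 ?exprn_ge0 ?nm_ge0 ?(ltW r0) //.
by rewrite (le_trans (geo_binom 2 _ x01)).
Qed.

End Bounded.

(** Stands in for infinite series: an estimate is proved for every truncation with an error D x^n,
    and this error is then dropped. *)
Lemma lim_geom (a b D x : R) : 0 <= x < 1 -> (forall n, a <= b + D * x ^+ n) -> a <= b :> R.
Proof.
move=> /andP[x0 x1] h; apply/ler_addgt0Pr => e e0.
have hc : (fun n => x ^+ n) @ \oo --> (0 : R) by apply: cvg_expr; rewrite ger0_norm.
have e1 : 0 < e / (1 + `|D|) by rewrite divr_gt0 // ltr_pwDl.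
have [N _ /(_ N (leqnn N))] := (cvgrPdist_le _ _).1 hc _ e1.
rewrite sub0r normrN ger0_norm ?exprn_ge0 // => hN.
rewrite (le_trans (h N)) // lerD2l (le_trans (ler_norm _)) // normrM.
rewrite (ger0_norm (_ : 0 <= x ^+ N)) ?exprn_ge0 //.
rewrite (le_trans (ler_wpM2l _ hN)) // mulrA ler_pdivrMr ?ltr_pwDl //.
by rewrite mulrDr mulr1 mulrC lerDr ltW.
Qed.

End PolyTools.

(** * Averages of ln |h| over roots of unity and the Borel-Caratheodory theorem *)

Section LogAvg.
Variable R : realType.
Local Notation C := (Cx R).
Implicit Types (x y : R) (z w s : C) (P Q : {poly C}).

Lemma cinvE z : z^-1 = cR (nm z ^- 2) * cj z.
Proof.
have [->|z0] := eqVneq z 0.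
  by rewrite invr0; apply: Cext; rewrite ?ReM ?ImM /= ?oppr0 !mulr0 ?subr0 ?addr0.
apply: (mulfI z0); rewrite divff // mulrCA mul_cj -cRM mulVf ?cR1 //.
by rewrite expf_neq0 // nm_eq0.
Qed.

Lemma Re_cRM x z : complex.Re (cR x * z) = x * complex.Re z.
Proof. by rewrite cscale. Qed.

Lemma Re_div z w : complex.Re (z / w) = complex.Re (z * cj w) / nm w ^+ 2.
Proof. by rewrite cinvE mulrCA Re_cRM mulrC. Qed.

(** Real part of the series of log(1 - w), by the mean value theorem along the ray tw, 0 <= t <= 1.
    No complex logarithm is needed: ln |1 - tw| is half the logarithm of the real polynomial [q],
    and after adding the partial sum [p] the derivative collapses to the real part of -w (tw)^K / (1
    - tw). *)
Lemma ln_nm_series (w : C) K : nm w < 1 ->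
  `| ln (nm (1 - w)) + \sum_(i < K) complex.Re (w ^+ i.+1) / i.+1%:R | <=
  nm w ^+ K.+1 / (1 - nm w).
Proof.
move=> w1.
pose q : {poly R} := 1 - (2 * complex.Re w)%:P * 'X + (nm w ^+ 2)%:P * 'X^2.
pose p : {poly R} := \poly_(i < K.+1) (complex.Re (w ^+ i) / i%:R).
have dpos t : 0 <= t <= 1 -> 1 - nm w <= nm (1 - cR t * w).
  move=> /andP[t0 t1]; rewrite (le_trans _ (nm_lB _ _)) // nm1 lerD2l lerN2.
  by rewrite nmM nm_cR ger0_norm // ler_piMl ?nm_ge0.
have w1' : 0 < 1 - nm w by rewrite subr_gt0.
have qE t : q.[t] = nm (1 - cR t * w) ^+ 2.
  rewrite [RHS]nm_sqr /q nm_sqr !ReD !ImD !ReN !ImN !ReM !ImM /=.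
  by rewrite !hornerE /=; ring.
have q0 t : 0 <= t <= 1 -> 0 < q.[t].
  by move=> /dpos h; rewrite qE exprn_gt0 // (lt_le_trans w1').
pose f : R -> R := 2^-1 \*: (@ln R \o horner q) + horner p.
pose df : R -> R := fun t => 2^-1 *: (q.[t]^-1 * q^`().[t]) + p^`().[t].
have fd (t : R) : 0 <= t <= 1 -> is_derive t 1 f (df t).
  move=> /q0 qt.
  have h1 : is_derive t 1 (@ln R \o horner q) (q.[t]^-1 * q^`().[t]).
    exact: is_derive1_comp (is_derive1_ln qt) (is_derive_poly q t).
  have h2 := @is_deriveZ _ _ _ _ 2^-1 _ _ _ h1.
  exact: is_deriveD h2 (is_derive_poly p t).
have dfE (t : R) : 0 <= t <= 1 -> df t = complex.Re (- w * (cR t * w) ^+ K / (1 - cR t * w)).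
  move=> t01; set d := 1 - cR t * w.
  have d0 : d != 0 by rewrite -nm_gt0 (lt_le_trans w1') // dpos.
  have -> : - w * (cR t * w) ^+ K / d = - w / d + w * ((1 - (cR t * w) ^+ K) / d) by field.
  rewrite ReD /df; congr (_ + _).
    rewrite Re_div qE -/d /GRing.scale /= mulrCA [RHS]mulrC; congr (_ * _).
    rewrite /q derivD derivB derivC !derivM !derivC !derivX !hornerE /= ReM ReN ImN /d /= !ReD !ImD !ReN !ImN !ReM !ImM /= nm_sqr.
    by field.
  have -> : (1 - (cR t * w) ^+ K) / d = \sum_(i < K) (cR t * w) ^+ i.
    apply: (mulIf d0); rewrite mulfVK // /d.
    have := subrX1 (cR t * w) K; set S := \sum_(i < K) _ => h.
    by rewrite -[1 - _ in LHS]opprB h; ring.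
  have sp : (size p^`() <= K)%N.
    apply/leq_sizeP => j hj; rewrite coef_deriv coef_poly ltnS ltnNge hj /=.
    exact: mul0rn.
  rewrite (horner_coef_wide _ sp) mulr_sumr Re_sum; apply: eq_bigr => i _.
  rewrite coef_deriv coef_poly ltnS ltn_ord -[_ *+ i.+1]mulr_natr mulfVK ?pnatr_eq0 //.
  rewrite exprMn mulrCA -exprS -cRX ReM /= mul0r subr0 mulrC //.
have hb (t : R) : 0 <= t <= 1 -> `|df t| <= nm w ^+ K.+1 / (1 - nm w).
  move=> t01; rewrite dfE // (le_trans (absRe_le _)) //.
  rewrite 2!nmM nmV nmN nmX ler_pM ?mulr_ge0 ?invr_ge0 ?exprn_ge0 ?nm_ge0 //.
    rewrite exprS ler_wpM2l ?nm_ge0 // lerXn2r ?nnegrE ?nm_ge0 // nmM nm_cR.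
    by case/andP: t01 => t0 t1; rewrite ger0_norm // ler_piMl ?nm_ge0.
  by rewrite lef_pV2 ?posrE ?dpos // (lt_le_trans w1') // dpos.
have := mvt_le ler01 fd hb; rewrite subr0 mulr1.
have -> : f 0 = 0.
  rewrite /f !fctE /= qE mul0r subr0 nm1 expr1n ln1 scaler0 add0r horner_coef0 coef_poly /=.
  by rewrite invr0 mulr0.
have -> : f 1 = ln (nm (1 - w)) + \sum_(i < K) complex.Re (w ^+ i.+1) / i.+1%:R.
  rewrite /f !fctE /= qE mul1r lnXn; last by rewrite (lt_le_trans w1') // -[w in X in _ <= X]mul1r dpos // ler01 lexx.
  congr (_ + _); first by rewrite -mulr_natl /GRing.scale /=; field.
  rewrite (horner_coef_wide _ (size_poly _ _)) big_ord_recl coef_poly /= invr0 mulr0 mul0r add0r.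
  by apply: eq_bigr => i _; rewrite expr1n mulr1 coef_poly /= /bump /= add1n ltnS ltn_ord.
by rewrite subr0.
Qed.

Lemma ReM2 z w : complex.Re z * complex.Re w = 2^-1 * complex.Re (z * w + cj z * w).
Proof. by rewrite ReD !ReM /=; field. Qed.

(* The weight is nonnegative and picks out one coefficient of ln |h|, as in the proof of the Borel-Caratheodory theorem. *)
Lemma weighted_root_avg N (zt u a : C) (n j : nat) : N.-primitive_root zt ->
  (0 < n)%N -> (0 < j)%N -> (n + j < N)%N ->
  \sum_(k < N) (1 + complex.Re (u * zt ^+ (k * (N - j)))) * complex.Re (a * zt ^+ (k * n)) =
  if n == j then N%:R / 2 * complex.Re (u * a) else 0.
Proof.
move=> hz n0 j0 nj.
have cz k : cj (zt ^+ (k * (N - j))) = zt ^+ (k * j).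
  apply: (mulfI (_ : zt ^+ (k * (N - j)) != 0)).
    by rewrite -nm_gt0 nmX (nm_prim_root hz) expr1n.
  rewrite mul_cj nmX (nm_prim_root hz) !expr1n cR1 -exprD -mulnDr subnK; last by lia.
  by rewrite mulnC exprM (prim_expr_order hz) expr1n.
transitivity (complex.Re (a * \sum_(k < N) zt ^+ (k * n)) +
  2^-1 * complex.Re (u * a * \sum_(k < N) zt ^+ (k * (N - j + n)) + cj u * a * \sum_(k < N) zt ^+ (k * (j + n)))).
  rewrite !mulr_sumr ReD !Re_sum -!big_split mulr_sumr -big_split /=; apply: eq_bigr => k _.
  rewrite mulrDl mul1r ReM2 cjM cz ReD; congr (_ + 2^-1 * (_ + _)); congr (complex.Re _).
    by rewrite mulnDr exprD; ring.
  by rewrite mulnDr exprD; ring.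
rewrite !(sum_prim_root _ hz).
have -> : (N %| n)%N = false by apply/negP => /dvdn_leq; lia.
have -> : (N %| j + n)%N = false by apply/negP => /dvdn_leq; lia.
rewrite !mulr0 addr0 add0r.
have [->|nej] := eqVneq n j.
  rewrite subnK ?dvdnn; last by lia.
  by rewrite -cR_nat ReM /= mulr0 subr0; ring.
have -> : (N %| N - j + n)%N = false.
  apply/negP => /dvdnP[[|[|q]]]; rewrite ?mul0n ?mul1n ?mulSn => h; lia.
by rewrite !mulr0.
Qed.

Lemma pow_rot (w r zt : C) (k i : nat) :
  (w * (r * zt ^+ k)) ^+ i = (w * r) ^+ i * zt ^+ (k * i).
Proof. by rewrite mulrA [LHS]exprMn -exprM. Qed.

Lemma ln_nm_series_rot (w r zt : C) (k K : nat) : nm (w * (r * zt ^+ k)) < 1 ->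
  `| ln (nm (1 - w * (r * zt ^+ k))) +
     \sum_(i < K) complex.Re ((w * r) ^+ i.+1 * zt ^+ (k * i.+1)) / i.+1%:R | <=
  nm (w * (r * zt ^+ k)) ^+ K.+1 / (1 - nm (w * (r * zt ^+ k))).
Proof.
move=> h; have := ln_nm_series K h; congr (`| _ + _ | <= _).
by apply: eq_bigr => i _; rewrite pow_rot.
Qed.

Section BC.
Variables (ws : seq C) (c : C) (r M : R).
Hypotheses (r0 : 0 < r) (c0 : c != 0) (hws : forall w, w \in ws -> nm w * r < 1).
Hypothesis hM : forall z, nm z = r -> nm (c * \prod_(w <- ws) (1 - w * z)) <= M.

(** The nonnegative weight [lam] is averaged against ln |h| <= ln M over roots of unity. Expanding
    ln |h| by [ln_nm_series], the constant part gives ln |c| and the oscillating part of the weight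
    isolates the power sum of order j + 1. The errors of the expansion decay geometrically and are
    removed by [lim_geom]. *)
Lemma borel_caratheodory_coef j : nm (\sum_(w <- ws) w ^+ j.+1) * r ^+ j.+1 <= 2 * j.+1%:R * ln (M / nm c).
Proof.
have [y /andP[y0 y1] hy] : exists2 y, 0 <= y < 1 & forall w, w \in ws -> nm w * r <= y.
  elim: (ws) hws => [|a l IH] h; first by exists 0; rewrite ?lexx ?ltr01.
  have [y /andP[y0 y1] hy] := IH (fun w hw => h w (mem_behead (s := a :: l) hw)).
  exists (Num.max y (nm a * r)) => [|w].
    by rewrite le_max y0 gt_max y1 h // mem_head.
  rewrite inE => /orP[/eqP ->|/hy h1]; first by rewrite le_max lexx orbT.
  by rewrite le_max h1.
set S := \sum_(w <- ws) w ^+ j.+1.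
(* The rotation [u] makes the isolated term equal to -|S|, which enters ln |h| with a minus sign, so
   that the upper bound on ln |h| bounds |S|. *)
have [u u1 uS] : exists2 u : C, nm u = 1 & complex.Re (u * S) = - nm S.
  have [->|S0] := eqVneq S 0; first by exists 1; rewrite ?nm1 // mulr0 nm0 oppr0.
  exists (- (cj S * cR (nm S)^-1)).
    rewrite nmN nmM nm_cj nm_cR ger0_norm ?invr_ge0 ?nm_ge0 // divff ?nm_eq0 //.
  rewrite mulNr ReN mulrAC [cj S * S]mulrC mul_cj -cRM /=.
  by rewrite expr2 mulfK // nm_eq0.
have M0 : 0 < M.
  rewrite (lt_le_trans _ (hM (_ : nm (cR r) = r))) ?nm_cR ?gtr0_norm // nm_gt0 mulf_neq0 //.
  rewrite prodf_seq_neq0; apply/allP => w hw; apply/implyP => _.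
  rewrite -nm_gt0 (lt_le_trans _ (nm_lB _ _)) // nm1 nmM nm_cR gtr0_norm // subr_gt0.
  exact: hws.
have c1 : 0 < nm c by rewrite nm_gt0.
set J := j.+1; pose D := 2 * J%:R * ((size ws)%:R / (1 - y)).
apply: (@lim_geom R _ _ D y); first by rewrite y0.
(* K >= j + 1 keeps the wanted coefficient in the truncated series, and N > K + J prevents any other
   term from aliasing onto it. *)
move=> n0; pose N := (n0 + J + J.+1)%N; pose K := (n0 + J)%N.
have n0K : (n0 <= K.+1)%N by rewrite ltnW // ltnS leq_addr.
have N0 : (0 < N)%N by rewrite /N addnS.
have [zt hz] := prim_root_ex R N0.
pose lam (k : 'I_N) := 1 + complex.Re (u * zt ^+ (k * (N - J))).
have lam0 k : 0 <= lam k.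
  have := absRe_le (u * zt ^+ (k * (N - J))).
  by rewrite nmM u1 nmX (nm_prim_root hz) expr1n mulr1 ler_norml /lam => /andP[]; lra.
have lams : \sum_(k < N) lam k = N%:R.
  rewrite big_split /= sumr_const card_ord -Re_sum -mulr_sumr sum_prim_root //.
  have -> : (N %| N - J)%N = false by apply/negP => /dvdn_leq; rewrite /N; lia.
  by rewrite mulr0 addr0.
pose e := y ^+ n0 / (1 - y).
pose G (k : 'I_N) := \sum_(w <- ws) \sum_(i < K) complex.Re ((w * cR r) ^+ i.+1 * zt ^+ (k * i.+1)) / i.+1%:R.
have key k : lam k * (ln (nm c) - G k - (size ws)%:R * e) <= lam k * ln M.
  rewrite ler_wpM2l //.
  have hzk : nm (cR r * zt ^+ k) = r.
    by rewrite nmM nm_cR (gtr0_norm r0) nmX (nm_prim_root hz) expr1n mulr1.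
  apply: (@le_trans _ _ (ln (nm (c * \prod_(w <- ws) (1 - w * (cR r * zt ^+ k)))))); last first.
    rewrite ler_ln ?posrE ?hM // nm_gt0 mulf_neq0 //.
    rewrite prodf_seq_neq0; apply/allP => w hw; apply/implyP => _.
    by rewrite -nm_gt0 (lt_le_trans _ (nm_lB _ _)) // nm1 nmM hzk subr_gt0 hws.
  rewrite nmM nm_prod lnM ?posrE //; last first.
    rewrite big_seq; apply: prodr_gt0 => w hw.
    by rewrite (lt_le_trans _ (nm_lB _ _)) // nm1 nmM hzk subr_gt0 hws.
  rewrite -addrA lerD2l /G.
  suff gen (l : seq C) : {subset l <= ws} ->
    - \sum_(w <- l) \sum_(i < K) complex.Re ((w * cR r) ^+ i.+1 * zt ^+ (k * i.+1)) / i.+1%:R -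
    (size l)%:R * e <= ln (\prod_(i <- l) nm (1 - i * (cR r * zt ^+ k))) by apply: gen.
  elim: l => [|w l IH] sub; first by rewrite !big_nil /= mul0r ln1 oppr0 addr0.
  have wi : w \in ws by apply: sub; rewrite mem_head.
  have ww : nm (w * (cR r * zt ^+ k)) <= y by rewrite nmM hzk hy.
  have wp : 0 < nm (1 - w * (cR r * zt ^+ k)).
    by rewrite (lt_le_trans _ (nm_lB _ _)) // nm1 subr_gt0 (le_lt_trans ww).
  rewrite !big_cons /= lnM ?posrE //; last first.
    rewrite big_seq; apply: prodr_gt0 => w' hw'.
    by rewrite (lt_le_trans _ (nm_lB _ _)) // nm1 nmM hzk subr_gt0 hws // sub // inE hw' orbT.
  have := IH (fun w' hw' => sub w' (mem_behead (s := w :: l) hw')).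
  have := @ln_nm_series_rot w (cR r) zt k K (le_lt_trans ww y1).
  have he : nm (w * (cR r * zt ^+ k)) ^+ K.+1 / (1 - nm (w * (cR r * zt ^+ k))) <= e.
    rewrite /e ler_pM ?exprn_ge0 ?nm_ge0 ?invr_ge0 ?subr_ge0 //.
    - by rewrite (le_trans ww) // ltW.
    - rewrite (@le_trans _ _ (y ^+ K.+1)) ?lerXn2r ?nnegrE ?nm_ge0 //.
      by rewrite ler_wiXn2l // ltW.
    - by rewrite lef_pV2 ?posrE ?subr_gt0 ?lerD2l ?lerN2 // (le_lt_trans ww).
  move=> /ler_normlP[h1 _] h2.
  rewrite -natr1 mulrDl mul1r; lra.
have := ler_sum (index_enum 'I_N) (fun k (_ : true) => key k).
rewrite -mulr_suml lams.
have -> : \sum_(i < N) lam i * (ln (nm c) - G i - (size ws)%:R * e) =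
   N%:R * ln (nm c) - N%:R * ((size ws)%:R * e) + N%:R / 2 / J%:R * (nm S * r ^+ J).
  under eq_bigr do rewrite !mulrBr.
  rewrite !sumrB -!mulr_suml lams.
  suff -> : \sum_(i < N) lam i * G i = - (N%:R / 2 / J%:R * (nm S * r ^+ J)) by ring.
  transitivity (\sum_(w <- ws) \sum_(i < K) \sum_(k < N) lam k *
     complex.Re ((w * cR r) ^+ i.+1 * zt ^+ (k * i.+1)) / i.+1%:R).
    rewrite /G; under eq_bigr do rewrite mulr_sumr; rewrite exchange_big /=.
    apply: eq_bigr => w _; under eq_bigr do rewrite mulr_sumr; rewrite exchange_big /=.
    by apply: eq_bigr => i _; apply: eq_bigr => k _; rewrite mulrA.
  have jK : (j < K)%N by rewrite /K /J; lia.
  transitivity (\sum_(w <- ws) N%:R / 2 / J%:R * r ^+ J * complex.Re (u * w ^+ J)).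
    apply: eq_bigr => w _; rewrite (bigD1 (Ordinal jK)) //= [X in _ + X]big1 ?addr0.
      rewrite -mulr_suml weighted_root_avg // ?eqxx; last by rewrite /N /J; lia.
      have -> : u * (w * cR r) ^+ j.+1 = cR (r ^+ J) * (u * w ^+ J).
        by rewrite exprMn -cRX mulrCA mulrC -mulrA mulrCA.
      by rewrite Re_cRM; ring.
    move=> i ij; rewrite -mulr_suml weighted_root_avg //; last by have := ltn_ord i; rewrite /N /K /J; lia.
    case: eqP => h; last by rewrite mul0r.
    by case/eqP: ij; apply: val_inj => /=; case: h.
  rewrite -mulr_sumr -Re_sum -mulr_sumr uS; ring.
move=> h.
have hN : 0 < N%:R :> R by rewrite ltr0n.
have hJ : 0 < J%:R :> R by rewrite ltr0n.
rewrite ln_div ?posrE //.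
have h' : nm S * r ^+ J / 2 / J%:R <= ln M - ln (nm c) + (size ws)%:R * e.
  rewrite -(ler_pM2l hN); move: h; set E := (size ws)%:R * e.
  have -> : N%:R * (nm S * r ^+ J / 2 / J%:R) = N%:R / 2 / J%:R * (nm S * r ^+ J) by ring.
  lra.
have -> : nm S * r ^+ J = 2 * J%:R * (nm S * r ^+ J / 2 / J%:R) by field; rewrite gt_eqF.
have -> : 2 * J%:R * (ln M - ln (nm c)) + D * y ^+ n0 =
  2 * J%:R * (ln M - ln (nm c) + (size ws)%:R * e) by rewrite /D /e; ring.
by rewrite ler_pM2l // mulr_gt0.
Qed.

(** The sum is -h'/h, whose Taylor coefficients are the power sums bounded by
    [borel_caratheodory_coef]; their factor i + 1 is absorbed by the binomial series of order 1. *)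
Lemma borel_caratheodory_deriv r' z : 0 <= r' -> r' < r -> nm z <= r' ->
  nm (\sum_(w <- ws) w / (1 - w * z)) <= 2 * ln (M / nm c) / r / (1 - r' / r) ^+ 2.
Proof.
move=> r'0 rr hz.
pose x := r' / r.
have x01 : 0 <= x < 1 by rewrite /x divr_ge0 ?(ltW r0) //= ltr_pdivrMr // mul1r.
have x0 : 0 <= x by case/andP: x01.
have wx w : w \in ws -> nm (w * z) <= x.
  move=> hw; rewrite nmM (le_trans (ler_wpM2l (nm_ge0 _) hz)) // /x.
  rewrite mulrC ler_wpM2l // -[leRHS]mul1r ler_pdivlMr // ltW //; exact: hws.
have L0 : 0 <= 2 * ln (M / nm c).
  have := borel_caratheodory_coef 0; rewrite mulr1 => h; apply: le_trans h.
  by rewrite mulr_ge0 ?nm_ge0 ?exprn_ge0 // ltW.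
pose D := \sum_(w <- ws) nm w / (1 - x).
apply: (@lim_geom R _ _ D x) => // n.
have -> : \sum_(w <- ws) w / (1 - w * z) =
  \sum_(i < n) (\sum_(w <- ws) w ^+ i.+1) * z ^+ i + \sum_(w <- ws) w * (w * z) ^+ n / (1 - w * z).
  under [X in _ = X + _]eq_bigr do rewrite mulr_suml.
  rewrite exchange_big /= -big_split /= big_seq [RHS]big_seq; apply: eq_bigr => w hw.
  have d0 : 1 - w * z != 0.
    rewrite -nm_gt0 (lt_le_trans _ (nm_lB _ _)) // nm1 subr_gt0 (le_lt_trans (wx _ hw)) //.
    by case/andP: x01.
  have -> : \sum_(i < n) w ^+ i.+1 * z ^+ i = w * ((1 - (w * z) ^+ n) / (1 - w * z)).
    rewrite (eq_bigr (fun i : 'I_n => w * (w * z) ^+ i)); last first.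
      by move=> i _; rewrite exprMn exprS mulrA.
    rewrite -mulr_sumr; congr (_ * _); apply: (mulIf d0); rewrite mulfVK //.
    have := subrX1 (w * z) n; set S := \sum_(i < n) _ => h.
    by rewrite -[RHS]opprB h; ring.
  by field.
rewrite (le_trans (nmD _ _)) // lerD //.
  rewrite (le_trans (nm_sum _ _ _)) //.
  apply: (@le_trans _ _ (2 * ln (M / nm c) / r * \sum_(i < n) 'C(i + 1, 1)%:R * x ^+ i)).
    rewrite mulr_sumr; apply: ler_sum => i _; rewrite nmM nmX addn1 bin1.
    have h := borel_caratheodory_coef i.
    have -> : 2 * ln (M / nm c) / r * (i.+1%:R * x ^+ i) =
      (2 * i.+1%:R * ln (M / nm c) / r ^+ i.+1) * r' ^+ i.
      by rewrite /x expr_div_n exprS invfM; ring.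
    rewrite ler_pM ?exprn_ge0 ?nm_ge0 ?lerXn2r ?nnegrE ?nm_ge0 //.
    by rewrite ler_pdivlMr ?exprn_gt0.
  by rewrite ler_wpM2l ?divr_ge0 ?(ltW r0) // (le_trans (geo_binom 1 _ x01)).
rewrite (le_trans (nm_sum _ _ _)) // /D mulr_suml big_seq [leRHS]big_seq.
apply: ler_sum => w hw; rewrite !nmM nmV nmX -mulrA [leRHS]mulrAC -mulrA ler_wpM2l ?nm_ge0 //.
rewrite ler_pM ?exprn_ge0 ?nm_ge0 ?invr_ge0 ?nm_ge0 ?lerXn2r ?nnegrE ?nm_ge0 ?wx //.
have h1 : 1 - x <= nm (1 - w * z).
  by rewrite (le_trans _ (nm_lB _ _)) // nm1 lerD2l lerN2 wx.
have h2 : 0 < 1 - x by rewrite subr_gt0; case/andP: x01.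
by rewrite lef_pV2 ?posrE // (lt_le_trans h2).
Qed.
End BC.
End LogAvg.

(** * Logarithmic derivatives of products of linear factors *)

Section GenericField.
Variable F : fieldType.
Implicit Types (rs : seq F) (f : F -> F).

Lemma logderiv_prod rs (z : F) : (forall p, p \in rs -> z != p) ->
  (\prod_(p <- rs) ('X - p%:P))^`().[z] =
  (\prod_(p <- rs) ('X - p%:P)).[z] * \sum_(p <- rs) (z - p)^-1.
Proof.
elim: rs => [|a l IH] h; first by rewrite !big_nil derivC horner0 mulr0.
have za : z - a != 0 by rewrite subr_eq0 h // mem_head.
rewrite !big_cons derivM !hornerE IH; last by move=> p hp; rewrite h // inE hp orbT.
by rewrite derivXsubC hornerC; field.
Qed.

Lemma prod_split_filter (P : pred F) rs f : \prod_(p <- rs) f p =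
  \prod_(p <- [seq p <- rs | P p]) f p * \prod_(p <- [seq p <- rs | ~~ P p]) f p.
Proof. by rewrite !big_filter (bigID P). Qed.

Lemma sum_split_filter (P : pred F) rs f : \sum_(p <- rs) f p =
  \sum_(p <- [seq p <- rs | P p]) f p + \sum_(p <- [seq p <- rs | ~~ P p]) f p.
Proof. by rewrite !big_filter (bigID P). Qed.
End GenericField.

(** * The local bound for P'/P *)

Section PolyLogDeriv.
Variable R : realType.
Local Notation C := (Cx R).
Implicit Types (x y : R) (z w s : C) (P Q : {poly C}).

(** On the circle |z| = Rr a zero p inside may be exchanged for its reflection outside without
    changing the modulus, because z times the conjugate of z is Rr^2 there. *)
Lemma nm_blaschke (Rr : R) (p z : C) : 0 < Rr -> nm z = Rr ->
  nm (cR Rr * (1 - cj p / cR (Rr ^+ 2) * z)) = nm (z - p).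
Proof.
move=> R0 hz.
have e : z * (cj (z - p)) = cR (Rr ^+ 2) * (1 - cj p / cR (Rr ^+ 2) * z).
  have hz2 : z * cj z = cR (Rr ^+ 2) by rewrite mul_cj hz.
  have r2 : cR (Rr ^+ 2) != 0 by rewrite cR_eq0 expf_neq0 // gt_eqF.
  have -> : cj (z - p) = cj z - cj p by rewrite !cjE rmorphB.
  by rewrite mulrBr hz2; move: (cR _) r2 => Q Q0; field.
have R00 : Rr != 0 by rewrite gt_eqF.
apply: (mulfI R00).
have := congr1 (@nm R) e; rewrite !nmM nm_cj hz !nm_cR expr2 normrM (gtr0_norm R0).
by move=> h; rewrite h; ring.
Qed.

(** Zeros with |p| <= r are replaced by reflected ones, which gives a function without zeros in |z|
    <= r and with the same modulus on |z| = Rr, to which Borel-Caratheodory applies. At 0 each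
    reflection gains a factor of at least Rr/r, and this bounds the number of zeros as in Jensen's
    formula. [K] depends on the three radii only. *)
Lemma poly_logderiv (Rr r r' : R) : 0 <= r' -> r' < r -> r < Rr ->
  exists2 K : R, 0 <= K & forall (f : {poly C}) (M a : R), 0 < a -> a <= nm f.[0] ->
    (forall z, nm z = Rr -> nm f.[z] <= M) ->
    exists I : seq C, [/\ (size I)%:R <= K * (1 + ln (M / a)),
      (forall p, p \in I -> root f p /\ nm p <= r) &
      (forall z, nm z <= r' -> f.[z] != 0 ->
        nm (f^`().[z] / f.[z]) <= \sum_(p <- I) (nm (z - p))^-1 + K * (1 + ln (M / a)))].
Proof.
move=> r'0 r'r rR; have r0 : 0 < r := le_lt_trans r'0 r'r.
have R0 : 0 < Rr := lt_trans r0 rR.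
(* [K1] is the constant of the Jensen count and [k1] bounds the term of one reflected zero in the
   logarithmic derivative. [K2] combines the Borel-Caratheodory constant with the loss 1 - r/Rr of
   [poly_max] and with [k1] for all reflected zeros. *)
pose K1 := (ln (Rr / r))^-1.
pose k1 := (r / Rr ^+ 2) / (1 - r * r' / Rr ^+ 2).
pose K2 := 2 / r / (1 - r' / r) ^+ 2 * (1 + ln ((1 - r / Rr)^-1)) + k1 * K1.
have K10 : 0 < K1 by rewrite invr_gt0 ln_gt0 // ltr_pdivlMr // mul1r.
have rR1 : 0 < 1 - r / Rr <= 1.
  by rewrite subr_gt0 ltr_pdivrMr // mul1r rR /= gerBl divr_ge0 // ltW.
have lnl : 0 <= ln ((1 - r / Rr)^-1).
  by rewrite ln_ge0 // invf_ge1 //; case/andP: rR1.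
have rr'1 : 0 < 1 - r * r' / Rr ^+ 2.
  rewrite subr_gt0 ltr_pdivrMr ?exprn_gt0 // mul1r expr2.
  apply: (@le_lt_trans _ _ (Rr * r')); first by rewrite ler_wpM2r // ltW.
  by rewrite ltr_pM2l // (lt_trans r'r).
have k10 : 0 <= k1.
  by rewrite divr_ge0 ?(ltW rr'1) // divr_ge0 ?exprn_ge0 ?(ltW r0) ?(ltW R0).
have K20 : 0 <= K2.
  apply: addr_ge0; last by rewrite mulr_ge0 // ltW.
  apply: mulr_ge0; last by rewrite addr_ge0.
  rewrite divr_ge0 ?divr_ge0 ?(ltW r0) // exprn_ge0 //.
  by rewrite subr_ge0 ler_pdivrMr // mul1r ltW.
exists (K1 + K2); first by rewrite addr_ge0 // ltW.
move=> f M a a0 af hM.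
have f00 : f.[0] != 0 by rewrite -nm_gt0 (lt_le_trans a0).
have fn0 : f != 0 by apply: contra_neq f00 => ->; rewrite horner0.
have [rs frs] := closed_field_poly_normal f.
set lc := lead_coef f in frs.
have lc0 : lc != 0 by rewrite lead_coef_eq0.
pose isin := fun p : C => nm p <= r.
pose I := [seq p <- rs | isin p]; pose O := [seq p <- rs | ~~ isin p].
have fz z : f.[z] = lc * \prod_(p <- I) (z - p) * \prod_(p <- O) (z - p).
  rewrite frs hornerZ horner_prod -mulrA; congr (_ * _).
  by rewrite (prod_split_filter isin); congr (_ * _); apply: eq_bigr => p _; rewrite hornerXsubC.
have rootf p : p \in rs -> root f p.
  by move=> hp; rewrite frs rootZ // root_prod_XsubC.
have On0 p : p \in O -> p != 0.
  rewrite mem_filter => /andP[]; rewrite /isin -ltNge => h _.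
  by rewrite -nm_gt0 (lt_trans r0).
have Ir p : p \in I -> nm p <= r by rewrite mem_filter => /andP[].
(* The companion [hp] is c times a product of factors 1 - w z, where w is the inverse of a far zero
   or belongs to the reflection of a near one; [c] is its value at 0. *)
pose inw (p : C) := cj p / cR (Rr ^+ 2).
pose ws := map (fun p : C => p^-1) O ++ map inw I.
pose c := lc * \prod_(p <- O) (- p) * cR Rr ^+ size I.
have c0 : c != 0.
  have prodO0 : \prod_(p <- O) (- p) != 0.
    by rewrite prodf_seq_neq0; apply/allP => p hp; rewrite oppr_eq0 On0.
  have RC0 : cR Rr ^+ size I != 0 by rewrite expf_neq0 // cR_eq0 gt_eqF.
  by rewrite /c mulf_neq0 // mulf_neq0.
pose hp : {poly C} := c *: \prod_(w <- ws) (1 - w *: 'X).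
have hpE z : hp.[z] = c * \prod_(w <- ws) (1 - w * z).
  rewrite hornerZ horner_prod; congr (_ * _); apply: eq_bigr => w _.
  by rewrite hornerD hornerN hornerZ hornerX hornerC.
have hO z : \prod_(p <- O) (z - p) = \prod_(p <- O) (- p) * \prod_(p <- O) (1 - p^-1 * z).
  rewrite -big_split /= big_seq [RHS]big_seq; apply: eq_bigr => p /On0 hp0; by field.
have hMh z : nm z = Rr -> nm hp.[z] <= M.
  move=> hz; rewrite (le_trans _ (hM z hz)) // hpE fz hO /ws big_cat /= !big_map /c.
  rewrite !nmM nmX nm_cR (gtr0_norm R0) !nm_prod.
  have -> : \prod_(p <- I) nm (z - p) = Rr ^+ size I * \prod_(p <- I) nm (1 - inw p * z).
    elim: (I) => [|p l IH]; first by rewrite !big_nil mulr1.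
    rewrite !big_cons IH -(nm_blaschke p R0 hz) nmM nm_cR (gtr0_norm R0) /= (exprS Rr (size l)) /inw; ring.
  by rewrite le_eqVlt; apply/orP; left; apply/eqP; ring.
have cM : nm c <= M.
  have := @coef_bound R hp Rr M 0 R0 hMh; rewrite expr0 mulr1 -horner_coef0 hpE.
  by rewrite big1 ?mulr1 // => w _; rewrite mulr0 subr0.
have M0 : 0 < M by rewrite (lt_le_trans _ cM) // nm_gt0.
(* The inequality of Jensen: every near zero satisfies |p| <= r, whereas its reflected factor
   contributes Rr at 0. *)
have ca : a * (Rr / r) ^+ size I <= nm c.
  rewrite (le_trans (ler_wpM2r _ af)) ?exprn_ge0 ?divr_ge0 ?(ltW R0) ?(ltW r0) //.
  rewrite fz !nmM !nm_prod nmX nm_cR (gtr0_norm R0) expr_div_n.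
  have hI : \prod_(p <- I) nm (0 - p) <= r ^+ size I.
    elim: (I) Ir => [|p l IH] h; first by rewrite big_nil expr0.
    rewrite big_cons /= (exprS r (size l)) ler_pM ?nm_ge0 //.
    - by apply: prodr_ge0 => q _; rewrite nm_ge0.
    - by rewrite sub0r nmN h // mem_head.
    - by apply: IH => q hq; rewrite h // inE hq orbT.
  have -> : \prod_(p <- O) nm (0 - p) = \prod_(p <- O) nm (- p).
    by apply: eq_bigr => p _; rewrite sub0r.
  set A := \prod_(p <- O) _; have A0 : 0 <= A by apply: prodr_ge0 => q _; rewrite nm_ge0.
  rewrite mulrA ler_pdivrMr ?exprn_gt0 //.
  rewrite (_ : _ * _ * _ * _ = nm lc * A * Rr ^+ size I * \prod_(p <- I) nm (0 - p)); last by ring.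
  by rewrite ler_wpM2l // !mulr_ge0 ?nm_ge0 ?exprn_ge0 ?(ltW R0).
have ac : a <= nm c.
  rewrite (le_trans _ ca) // ler_peMr ?(ltW a0) // exprn_ege1 //.
  by rewrite ler_pdivlMr // mul1r ltW.
pose L := ln (M / a).
have L0 : 0 <= L by rewrite ln_ge0 // ler_pdivlMr // mul1r (le_trans ac).
have sI : (size I)%:R <= K1 * L.
  rewrite mulrC ler_pdivlMr ?ln_gt0 ?ltr_pdivlMr ?mul1r //.
  rewrite mulrC mulr_natr -lnXn ?divr_gt0 // /L ler_ln ?posrE ?exprn_gt0 ?divr_gt0 //.
  by rewrite ler_pdivlMr // mulrC (le_trans ca).
exists I; split => [|p hp0|z hz fz0].
- rewrite (le_trans sI) // -/L.
  have -> : (K1 + K2) * (1 + L) = K1 * L + (K1 + K2 * (1 + L)) by ring.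
  by rewrite lerDl addr_ge0 ?(ltW K10) // mulr_ge0 // addr_ge0.
- by split; [apply: rootf; move: hp0; rewrite mem_filter => /andP[]|exact: Ir].
have zrs p : p \in rs -> z != p.
  by move=> /rootf; apply: contraTneq => <-.
have -> : f^`().[z] / f.[z] = \sum_(p <- rs) (z - p)^-1.
  rewrite [in f^`()]frs derivZ !hornerZ logderiv_prod // mulrA -hornerZ -frs.
  by rewrite mulrAC mulfV // mul1r.
have hws w : w \in ws -> nm w * r < 1.
  rewrite mem_cat => /orP[/mapP[p hp0 ->]|/mapP[p /Ir hp0 ->]].
    rewrite nmV mulrC ltr_pdivrMr ?nm_gt0 ?On0 // mul1r.
    by move: hp0; rewrite mem_filter => /andP[]; rewrite /isin -ltNge.
  rewrite /inw nmM nm_cj nmV nm_cR ger0_norm ?exprn_ge0 ?(ltW R0) // mulrAC.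
  rewrite ltr_pdivrMr ?exprn_gt0 // mul1r (le_lt_trans (ler_wpM2r (ltW r0) hp0)) //.
  by rewrite -expr2 ltrXn2r // ?nnegrE ?ltW.
have M1 z' : nm z' = r -> nm (c * \prod_(w <- ws) (1 - w * z')) <= M / (1 - r / Rr).
  move=> hz'; rewrite -hpE; apply: (@poly_max R hp Rr r M (ltW r0) rR hMh).
  by rewrite hz'.
have bc := borel_caratheodory_deriv r0 c0 hws M1 r'0 r'r hz.
(* f'/f is the polar sum over near zeros plus the logarithmic derivative of [hp], minus the part of
   the latter that comes from the reflected zeros. *)
have -> : \sum_(p <- rs) (z - p)^-1 = \sum_(p <- I) (z - p)^-1 -
   (\sum_(w <- ws) w / (1 - w * z) - \sum_(p <- I) inw p / (1 - inw p * z)).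
  rewrite /ws big_cat /= !big_map addrK (sum_split_filter isin); congr (_ + _).
  rewrite -sumrN big_seq [RHS]big_seq; apply: eq_bigr => p hpO.
  have p0 := On0 _ hpO; have zp : z - p != 0.
    by rewrite subr_eq0 zrs //; move: hpO; rewrite mem_filter => /andP[].
  have zp' : p - z != 0 by rewrite -opprB oppr_eq0.
  have -> : 1 - p^-1 * z = (p - z) / p by field.
  by rewrite -opprB; field; rewrite p0 zp'.
rewrite (le_trans (nmB _ _)) // lerD //.
  by rewrite (le_trans (nm_sum _ _ _)) // le_eqVlt; apply/orP; left; apply/eqP;
     apply: eq_bigr => p _; rewrite nmV.
have hk1 : nm (\sum_(p <- I) inw p / (1 - inw p * z)) <= k1 * (K1 * L).
  rewrite (le_trans (nm_sum _ _ _)) // (@le_trans _ _ (\sum_(p <- I) k1)) //; last first.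
    rewrite big_const_seq count_predT iter_addr_0 -mulr_natr ler_wpM2l //.
  rewrite big_seq [leRHS]big_seq; apply: ler_sum => p /Ir hpI.
  have nw : nm (inw p) <= r / Rr ^+ 2.
    by rewrite /inw nmM nm_cj nmV nm_cR ger0_norm ?exprn_ge0 ?(ltW R0) // ler_pM ?invr_ge0 ?exprn_ge0 ?nm_ge0 ?(ltW R0).
  rewrite nmM nmV ler_pM ?invr_ge0 ?nm_ge0 //.
  have h1 : 1 - r * r' / Rr ^+ 2 <= nm (1 - inw p * z).
    rewrite (le_trans _ (nm_lB _ _)) // nm1 lerD2l lerN2 nmM mulrAC ler_pM ?nm_ge0 //.
  by rewrite lef_pV2 ?posrE // (lt_le_trans rr'1).
rewrite (le_trans (nmB _ _)) // (le_trans (lerD bc hk1)) //.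
have lnb : ln (M / (1 - r / Rr) / nm c) <= L + ln ((1 - r / Rr)^-1).
  case/andP: rR1 => h1 h2; have h3 : 0 < nm c by rewrite nm_gt0.
  rewrite /L -lnM ?posrE ?divr_gt0 ?invr_gt0 // ler_ln ?posrE ?mulr_gt0 ?invr_gt0 //.
  rewrite mulrAC ler_wpM2r ?invr_ge0 ?(ltW h1) // ler_wpM2l ?(ltW M0) //.
  by rewrite lef_pV2 ?posrE.
set q := 2 / r / (1 - r' / r) ^+ 2 in K20 *.
have q0 : 0 <= q.
  by rewrite /q !divr_ge0 ?exprn_ge0 ?(ltW r0) // subr_ge0 ler_pdivrMr // mul1r ltW.
have -> : 2 * ln (M / (1 - r / Rr) / nm c) / r / (1 - r' / r) ^+ 2 = q * ln (M / (1 - r / Rr) / nm c).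
  by rewrite /q; ring.
rewrite -/L (le_trans (lerD (ler_wpM2l q0 lnb) (lexx _))) // /K2 -/q.
move: lnl; set l := ln _ => lnl.
have e1 : 0 <= q * (1 + L * l) by rewrite mulr_ge0 // addr_ge0 // mulr_ge0.
have e2 : 0 <= K1 * (1 + L) by rewrite mulr_ge0 ?addr_ge0 // ltW.
have e3 : 0 <= k1 * K1 by rewrite mulr_ge0 // ltW.
have -> : (K1 + (q * (1 + l) + k1 * K1)) * (1 + L) =
  (q * (L + l) + k1 * (K1 * L)) + (q * (1 + L * l) + K1 * (1 + L) + k1 * K1) by ring.
by rewrite lerDl !addr_ge0.
Qed.

End PolyLogDeriv.

(** * Uniform limits of polynomials *)

Section PolyApprox.
Variable R : realType.
Local Notation C := (Cx R).
Implicit Types (x y : R) (z w s : C) (p q : {poly C}) (f g : C -> C).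

Lemma eqW x y : x = y -> x <= y. Proof. by move=> ->. Qed.

Definition invS (n : nat) : R := (n.+1%:R)^-1.

Lemma invS_ge0 n : 0 <= invS n. Proof. by rewrite invr_ge0. Qed.

Lemma invS_le1 n : invS n <= 1. Proof. by rewrite invf_le1 ?ltr0n // ler1n. Qed.

Lemma inv_succ_small e : 0 < e -> exists n : nat, invS n <= e.
Proof.
move=> e0; exists (Num.truncn e^-1); rewrite -[leRHS]invrK lef_pV2 ?posrE ?invr_gt0 ?ltr0n //.
by rewrite ltW // truncnS_gt.
Qed.

(** The limit is the supremum of the lower bounds v n - A/(n + 1). The explicit rate is kept because
    later limits are taken uniformly in a parameter. *)
Lemma cauchy_rate_real (v : nat -> R) (A : R) :
  (forall n m, `|v n - v m| <= A * (invS n + invS m)) ->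
  exists l, forall n, `|v n - l| <= A * invS n.
Proof.
move=> h; pose S := [set v n - A * invS n | n in [set: nat]].
have ub m : ubound S (v m + A * invS m).
  by move=> _ [n _ <-]; have := h n m; rewrite mulrDr ler_norml => /andP[_]; lra.
have S0 : S !=set0 by exists (v 0%N - A * invS 0); exists 0%N.
have hS : has_sup S by split => //; exists (v 0%N + A * invS 0); exact: ub.
exists (sup S) => n; rewrite ler_norml; apply/andP; split.
  by have := ge_sup S0 (ub n); lra.
by have := @ub_le_sup _ S hS.2 (v n - A * invS n) (ex_intro2 _ _ n I erefl); lra.
Qed.

Lemma cauchy_rate (u : nat -> C) (A : R) :
  (forall n m, nm (u n - u m) <= A * (invS n + invS m)) ->
  exists l, forall n, nm (u n - l) <= 2 * A * invS n.
Proof.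
move=> h.
have [a ha] : exists l, forall n, `|complex.Re (u n) - l| <= A * invS n.
  apply: cauchy_rate_real => n m; apply: le_trans (h n m).
  by rewrite -ReN -ReD absRe_le.
have [b hb] : exists l, forall n, `|complex.Im (u n) - l| <= A * invS n.
  apply: cauchy_rate_real => n m; apply: le_trans (h n m).
  by rewrite -ImN -ImD absIm_le.
exists (Complex a b) => n; rewrite (le_trans (nm_ReIm _)) // ReD ImD ReN ImN /=.
by rewrite -mulrA; have := ha n; have := hb n; lra.
Qed.

(* Uniform limits of polynomials on |z| <= r: they stand in for holomorphic functions. *)
Definition polylim (r : R) (f : C -> C) := forall e, 0 < e ->
  exists p, forall z, nm z <= r -> nm (f z - p.[z]) <= e.

Lemma polylim_poly r p : polylim r (fun z => p.[z]).
Proof. by move=> e e0; exists p => z _; rewrite subrr nm0 ltW. Qed.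

Lemma polylim_ext r f g : (forall z, nm z <= r -> f z = g z) -> polylim r f -> polylim r g.
Proof. by move=> h hf e /hf[p hp]; exists p => z hz; rewrite -h ?hp. Qed.

Lemma polylim_lim r f : (forall e, 0 < e -> exists2 g, polylim r g &
  forall z, nm z <= r -> nm (f z - g z) <= e) -> polylim r f.
Proof.
move=> h e e0; have e2 : 0 < e / 2 by rewrite divr_gt0.
have [g hg hfg] := h _ e2; have [p hp] := hg _ e2; exists p => z hz.
by rewrite (le_trans (nm_tri _ (g z) _)) // [leRHS]splitr lerD ?hfg ?hp.
Qed.

Lemma polylimD r f g : polylim r f -> polylim r g -> polylim r (fun z => f z + g z).
Proof.
move=> hf hg e e0; have e2 : 0 < e / 2 by rewrite divr_gt0.
have [p hp] := hf _ e2; have [q hq] := hg _ e2; exists (p + q) => z hz.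
rewrite hornerD opprD addrACA (le_trans (nmD _ _)) // [leRHS]splitr.
by rewrite lerD ?hp ?hq.
Qed.

Lemma polylimZ r (c : C) f : polylim r f -> polylim r (fun z => c * f z).
Proof.
move=> hf e e0; have c0 : 0 < 1 + nm c by rewrite ltr_pwDl // nm_ge0.
have [p hp] := hf (e / (1 + nm c)) (divr_gt0 e0 c0); exists (c *: p) => z hz.
rewrite hornerZ -mulrBr nmM (le_trans (ler_wpM2l (nm_ge0 _) (hp z hz))) //.
by rewrite mulrCA ger_pMr // ler_pdivrMr // mul1r lerDr.
Qed.

Lemma polylim_sum r (I : Type) (l : seq I) (F : I -> C -> C) :
  (forall i, polylim r (F i)) -> polylim r (fun z => \sum_(i <- l) F i z).
Proof.
move=> h; elim: l => [|a l IH].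
  by apply: (polylim_ext _ (@polylim_poly r 0)) => z _; rewrite big_nil horner0.
by apply: (polylim_ext _ (polylimD (h a) IH)) => z _; rewrite big_cons.
Qed.

Lemma nm_powB (a b : C) n m : nm a <= m -> nm b <= m ->
  nm (a ^+ n.+1 - b ^+ n.+1) <= n.+1%:R * nm (a - b) * m ^+ n.
Proof.
move=> ha hb; rewrite subrXX nmM mulrAC mulrC ler_wpM2r ?nm_ge0 //.
rewrite (le_trans (nm_sum _ _ _)) //.
rewrite (_ : n.+1%:R * m ^+ n = \sum_(i < n.+1) m ^+ n); last first.
  by rewrite sumr_const card_ord mulr_natl.
apply: ler_sum => i _; rewrite nmM !nmX.
have hi : (n.+1.-1 - i + i = n)%N by rewrite /= subnK // -ltnS.
rewrite -[in leRHS]hi exprD ler_pM ?exprn_ge0 ?nm_ge0 // lerXn2r ?nnegrE ?nm_ge0 //.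
  exact: le_trans (nm_ge0 _) ha.
exact: le_trans (nm_ge0 _) hb.
Qed.

(** The approximants are (1 + az/n)^n. Comparing n-th powers reduces the claim to e^w - 1 - w =
    O(|w|^2) at w = az/n, and n such errors of order 1/n^2 sum to O(1/n). *)
Lemma polylim_cexp r (a : C) : 0 <= r -> polylim r (fun z => cexp (a * z)).
Proof.
move=> r0 e e0; pose q := nm a * r.
have q0 : 0 <= q by rewrite mulr_ge0 ?nm_ge0.
pose K := 4 * q ^+ 2 * expR q.
have K0 : 0 <= K.
  by apply: mulr_ge0; [apply: mulr_ge0; rewrite ?exprn_ge0|exact: expR_ge0].
have e1 : 0 < Num.min (e / (1 + K)) (2^-1 / (1 + q)).
  by rewrite lt_min !divr_gt0 // ltr_pwDl.
have [n hn] := inv_succ_small e1; rewrite /invS in hn.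
move: hn; rewrite le_min => /andP[hn1 hn2].
have n0 : 0 < n.+1%:R :> R by rewrite ltr0n.
exists ((1 + (a / n.+1%:R) *: 'X) ^+ n.+1) => z hz.
rewrite horner_exp hornerD hornerZ hornerX hornerC.
set w := a / n.+1%:R * z.
have hw : nm w <= q / n.+1%:R.
  rewrite /w !nmM nmV nm_nat mulrAC ler_wpM2r ?invr_ge0 //.
  by rewrite ler_wpM2l ?nm_ge0.
have -> : a * z = n.+1%:R * w by rewrite /w; have := pnatr_eq0 C n.+1; move: (n.+1%:R) => N /negbT N0; field.
rewrite cexpMn.
have hw2 : nm w <= 2^-1.
  rewrite (le_trans hw) // (le_trans (ler_wpM2l q0 hn2)) // mulrCA ger_pMr //.
  by rewrite ler_pdivrMr ?ltr_pwDl // mul1r lerDr.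
have hm1 : nm (cexp w) <= expR (q / n.+1%:R).
  by rewrite nm_cexp ler_expR (le_trans _ hw) // (le_trans (ler_norm _)) // absRe_le.
have hm2 : nm (1 + w) <= expR (q / n.+1%:R).
  rewrite (le_trans (nmD _ _)) // nm1 (le_trans _ (expR_ge1Dx _)) // lerD2l //.
rewrite (le_trans (nm_powB n hm1 hm2)) //.
have h3 : nm (cexp w - (1 + w)) <= 4 * (q / n.+1%:R) ^+ 2.
  rewrite opprD addrA (le_trans (cexp_sub2_le hw2)) // ler_wpM2l // lerXn2r ?nnegrE ?nm_ge0 //.
  by rewrite divr_ge0.
have h4 : expR (q / n.+1%:R) ^+ n <= expR q.
  by rewrite -expRM_natl ler_expR mulrA ler_pdivrMr // mulrC ler_wpM2l // ler_nat.
have -> : e = (1 + K) * (e / (1 + K)) by field; rewrite gt_eqF // ltr_pwDl.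
apply: (@le_trans _ _ (K * n.+1%:R^-1)).
  have -> : K * n.+1%:R^-1 = n.+1%:R * (4 * (q / n.+1%:R) ^+ 2) * expR q.
    by rewrite /K; have := pnatr_eq0 R n.+1; move: (n.+1%:R) => N /negbT N0; field.
  rewrite ler_pM ?mulr_ge0 ?nm_ge0 ?exprn_ge0 ?expR_ge0 // ler_wpM2l //.
by rewrite ler_pM ?invr_ge0 // lerDr.
Qed.

Section Deriv.
Variables (r r' : R) (f : C -> C) (B : R).
Hypotheses (r'0 : 0 <= r') (rr : r' < r) (fpa : polylim r f).
Hypothesis fB : forall z, nm z <= r -> nm (f z) <= B.

Lemma polylim_seq : exists P : nat -> {poly C}, forall n z, nm z <= r -> nm (f z - (P n).[z]) <= invS n.
Proof.
have h n : exists p, forall z, nm z <= r -> nm (f z - p.[z]) <= invS n.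
  by apply: fpa; rewrite /invS invr_gt0 ltr0n.
by have [P hP] := choice h; exists P.
Qed.

(** Weierstrass's theorem: the derivatives of the approximating polynomials are Cauchy on the
    smaller disc by [poly_deriv_max], and both estimates pass to the limit. The first conclusion
    gives one polynomial close to f together with its derivative, which is what a comparison of
    logarithmic derivatives needs. *)
Lemma polylim_deriv : exists f' : C -> C, [/\
  (forall e, 0 < e -> exists p, (forall z, nm z <= r -> nm (f z - p.[z]) <= e) /\
                       (forall z, nm z <= r' -> nm (f' z - p^`().[z]) <= e)),
  (forall z, nm z <= r' -> nm (f' z) <= B / r / (1 - r' / r) ^+ 2) &
  (forall z w, nm z <= r' -> nm (z + w) <= r' ->
     nm (f (z + w) - f z - w * f' z) <= B / r ^+ 2 / (1 - r' / r) ^+ 3 * nm w ^+ 2)].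
Proof.
have [P hP] := polylim_seq.
have r0 : 0 < r by exact: le_lt_trans rr.
have x1 : 0 < 1 - r' / r by rewrite subr_gt0 ltr_pdivrMr // mul1r.
pose A := r^-1 / (1 - r' / r) ^+ 2.
have A0 : 0 <= A by rewrite divr_ge0 ?invr_ge0 ?exprn_ge0 ?(ltW r0) ?(ltW x1).
have hPP n m z : nm z <= r -> nm (P n - P m).[z] <= invS n + invS m.
  move=> hz; rewrite hornerD hornerN (le_trans (nm_tri _ (f z) _)) //.
  by rewrite lerD ?hP // nmBC hP.
have hd n m z : nm z <= r' ->
  nm ((P n)^`().[z] - (P m)^`().[z]) <= A * (invS n + invS m).
  move=> hz; rewrite -hornerN -hornerD -derivB.
  apply: (le_trans (poly_deriv_max (M := invS n + invS m) r'0 rr _ hz)).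
    by move=> z' hz'; apply: hPP; rewrite hz'.
  by rewrite /A; apply/eqW; ring.
have ex z : exists l, nm z <= r' -> forall n, nm ((P n)^`().[z] - l) <= 2 * A * invS n.
  case: (lerP (nm z) r') => hz; last by exists 0.
  by have [l hl] := cauchy_rate (fun n m => hd n m z hz); exists l.
have [f' hf'] := choice ex; exists f'.
have P1 e : 0 < e -> exists n, [/\ invS n <= e & 2 * A * invS n <= e].
  move=> e0; have e1 : 0 < e / (1 + 2 * A) by rewrite divr_gt0 // ltr_pwDl // mulr_ge0.
  have [n hn] := inv_succ_small e1; exists n.
  have n0 := invS_ge0 n.
  have h2 : invS n * (1 + 2 * A) <= e by rewrite -ler_pdivlMr // ltr_pwDl // mulr_ge0.
  have h3 : 0 <= invS n * (2 * A) by rewrite mulr_ge0 // mulr_ge0.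
  split; lra.
have approx e : 0 < e -> exists p, (forall z, nm z <= r -> nm (f z - p.[z]) <= e) /\
                       (forall z, nm z <= r' -> nm (f' z - p^`().[z]) <= e).
  move=> /P1[n [h1 h2]]; exists (P n); split => z hz; first by rewrite (le_trans (hP _ _ hz)).
  by rewrite nmBC (le_trans (hf' z hz n)).
split => //.
- move=> z hz; apply/ler_addgt0Pr => e e0.
  have e1 : 0 < e / (1 + A) by rewrite divr_gt0 // ltr_pwDl.
  have [p [p1 p2]] := approx _ e1; set d := e / (1 + A) in e1 p1 p2.
  have hB : forall z', nm z' = r -> nm p.[z'] <= B + d.
    move=> z' hz'; have := nm_lB p.[z'] (f z'); have := fB (eqW hz'); have := p1 _ (eqW hz').
    by rewrite nmBC; lra.
  have := poly_deriv_max r'0 rr hB hz; have := p2 _ hz; have := nm_lB (f' z) p^`().[z].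
  have -> : (B + d) / r / (1 - r' / r) ^+ 2 = B / r / (1 - r' / r) ^+ 2 + d * A by rewrite /A; ring.
  have -> : e = d * (1 + A) by rewrite /d; field; rewrite gt_eqF // ltr_pwDl.
  lra.
move=> z w hz hzw; apply/ler_addgt0Pr => e e0.
pose A3 := r ^- 2 / (1 - r' / r) ^+ 3 * nm w ^+ 2.
have A30 : 0 <= A3.
  by rewrite !mulr_ge0 ?invr_ge0 ?exprn_ge0 ?nm_ge0 ?(ltW r0) ?(ltW x1).
have D0 : 0 < 2 + nm w + A3 by have := nm_ge0 w; lra.
have e1 : 0 < e / (2 + nm w + A3) by rewrite divr_gt0.
have [p [p1 p2]] := approx _ e1; set d := e / (2 + nm w + A3) in e1 p1 p2.
have hB : forall z', nm z' = r -> nm p.[z'] <= B + d.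
  move=> z' hz'; have := nm_lB p.[z'] (f z'); have := fB (eqW hz'); have := p1 _ (eqW hz').
  by rewrite nmBC; lra.
have hr u : nm u <= r' -> nm u <= r by move=> h; rewrite (le_trans h) // ltW.
have := poly_so r'0 rr hB hz hzw.
have -> : (B + d) / r ^+ 2 / (1 - r' / r) ^+ 3 * nm w ^+ 2 =
   B / r ^+ 2 / (1 - r' / r) ^+ 3 * nm w ^+ 2 + d * A3 by rewrite /A3; ring.
have -> : e = d * (2 + nm w + A3) by rewrite /d; field; rewrite gt_eqF.
have q1 := p1 _ (hr _ hzw); have q2 := p1 _ (hr _ hz); have q3 := p2 _ hz.
move=> q4.
have -> : f (z + w) - f z - w * f' z = (p.[z + w] - p.[z] - w * p^`().[z]) +
   ((f (z + w) - p.[z + w]) - (f z - p.[z]) - w * (f' z - p^`().[z])) by ring.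
rewrite (le_trans (nmD _ _)) //.
have := le_trans (nmB (f (z + w) - p.[z + w] - (f z - p.[z])) (w * (f' z - p^`().[z])))
  (lerD (nmB _ _) (lexx _)).
have : nm (w * (f' z - p^`().[z])) <= nm w * d by rewrite nmM ler_wpM2l ?nm_ge0.
lra.
Qed.

End Deriv.

Section Factor.
Variables (r : R) (f : C -> C).
Hypotheses (r0 : 0 < r) (fpa : polylim r f).

(** Cauchy's estimates make each coefficient of the approximants converge. Either all limit
    coefficients vanish, or the first nonzero one gives the order m and the truncated quotients by
    z^m converge to g. Halving the radius turns all tails into geometric series of ratio 1/2. *)
Lemma polylim_factor : (forall z, nm z <= r / 2 -> f z = 0) \/
  exists m g, [/\ polylim (r / 2) g, g 0 != 0 & forall z, nm z <= r / 2 -> f z = z ^+ m * g z].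
Proof.
have [P hP] := polylim_seq fpa.
have hPP n m z : nm z <= r -> nm (P n - P m).[z] <= invS n + invS m.
  move=> hz; rewrite hornerD hornerN (le_trans (nm_tri _ (f z) _)) //.
  by rewrite lerD ?hP // nmBC hP.
have hc k n m : nm ((P n)`_k - (P m)`_k) <= r ^- k * (invS n + invS m).
  rewrite -coefB mulrC ler_pdivlMr ?exprn_gt0 //; apply: coef_bound => // z hz.
  by apply: hPP; rewrite hz.
have [a ha] := choice (fun k => cauchy_rate (hc k)).
have rh : r / 2 / r = 2^-1 by field; rewrite gt_eqF.
have rhn n : (2^-1) ^+ n = (r / 2) ^+ n / r ^+ n by rewrite -expr_div_n rh.
have rh0 : 0 <= r / 2 by rewrite divr_ge0 // ltW.
have h01 : 0 <= (2^-1 : R) < 1 by lra.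
have h12 : (1 - 2^-1 : R)^-1 = 2 by field.
have [al0|] := pselect (forall k, a k = 0).
  left => z hz; apply/eqP; rewrite -nm_eq0 eq_le nm_ge0 andbT.
  have PB : exists B : R, forall n z, nm z = r -> nm (P n).[z] <= B.
    have [B0 hB0] : exists B : R, forall z, nm z <= r -> nm (P 0%N).[z] <= B.
      exists (\sum_(i < size (P 0%N)) nm (P 0%N)`_i * r ^+ i) => u hu.
      rewrite horner_coef (le_trans (nm_sum _ _ _)) //; apply: ler_sum => i _.
      by rewrite nmM nmX ler_wpM2l ?nm_ge0 // lerXn2r ?nnegrE ?nm_ge0 // ltW.
    exists (B0 + 2) => n u hu; have := hPP n 0%N u (eqW hu); have := hB0 u (eqW hu).
    rewrite hornerD hornerN; have := nm_lB (P n).[u] (P 0%N).[u].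
    by have := invS_le1 n; have := invS_le1 0; lra.
  have {}[B hB] := PB.
  have B0 : 0 <= B.
    by apply: le_trans (hB 0%N (cR r) _); rewrite ?nm_ge0 // nm_cR gtr0_norm.
  (* The first K coefficients of the approximants tend to 0 and the others form a tail of size
     2^(-K), for every K. *)
  apply: (@lim_geom R _ 0 (B * 2) (2^-1)) => // K; rewrite add0r.
  apply/ler_addgt0Pr => e e0.
  pose S := \sum_(k < K) 2 * r ^- k * (r / 2) ^+ k.
  have S0 : 0 <= S by apply: sumr_ge0 => k _; rewrite !mulr_ge0 ?invr_ge0 ?exprn_ge0 // ltW.
  have e1 : 0 < e / (1 + S) by rewrite divr_gt0 // ltr_pwDl.
  have [n hn] := inv_succ_small e1.
  have hz' : nm z <= r by move: hz r0; lra.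
  have := hP n z hz'; have := nm_lB (f z) (P n).[z].
  have : nm (P n).[z] <= S * invS n + B * 2 * 2^-1 ^+ K.
    set N := maxn (size (P n)) K.
    have hN : (K + (N - K))%N = N by rewrite subnKC // leq_maxr.
    have sN : (size (P n) <= K + (N - K))%N by rewrite hN leq_maxl.
    rewrite (horner_coef_wide _ sN) big_split_ord /=.
    rewrite (le_trans (nmD _ _)) // lerD //.
      rewrite /S mulr_suml (le_trans (nm_sum _ _ _)) //; apply: ler_sum => k _.
      rewrite nmM nmX mulrAC ler_pM ?exprn_ge0 ?nm_ge0 //.
        by have := ha k n; rewrite al0 subr0.
      by rewrite lerXn2r ?nnegrE ?nm_ge0.
    rewrite (le_trans (nm_sum _ _ _)) //.
    apply: (@le_trans _ _ (B * 2^-1 ^+ K * \sum_(i < N - K) 'C(i + 0, 0)%:R * 2^-1 ^+ i)).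
      rewrite mulr_sumr; apply: ler_sum => i _; rewrite bin0 mul1r nmM nmX.
      have := @coef_bound R (P n) r B (K + i) r0 (hB n) => hcb.
      have -> : B * 2^-1 ^+ K * 2^-1 ^+ i = B / r ^+ (K + i) * (r / 2) ^+ (K + i).
        by rewrite -mulrA -exprD rhn; ring.
      rewrite ler_pM ?exprn_ge0 ?nm_ge0 //.
        by rewrite ler_pdivlMr ?exprn_gt0.
      by rewrite lerXn2r ?nnegrE ?nm_ge0.
    have hh : 0 <= B * 2^-1 ^+ K by rewrite mulr_ge0 // exprn_ge0 // invr_ge0.
    rewrite [leRHS]mulrAC ler_wpM2l //.
    by rewrite (le_trans (geo_binom 0 _ h01)) // expr1 h12.
  have : S * invS n + invS n <= e.
    have -> : e = (1 + S) * (e / (1 + S)) by field; rewrite gt_eqF // ltr_pwDl.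
    have -> : S * invS n + invS n = (1 + S) * invS n by ring.
    by rewrite ler_wpM2l // addr_ge0.
  lra.
move=> /existsNP[k0 /eqP k0a]; right.
have exk : exists k, a k != 0 by exists k0.
case: (ex_minnP exk) => m am mmin.
have al k : (k < m)%N -> a k = 0.
  by move=> km; apply/eqP; apply: contraLR km => /mmin; rewrite -leqNgt.
(* Quotient of P n by z^m; the coefficients dropped below m tend to 0 because their limits
   vanish. *)
pose Q n := drop_poly m (P n).
pose A := 2 * r ^- m.
have A0 : 0 <= A by rewrite mulr_ge0 ?invr_ge0 ?exprn_ge0 // ltW.
have hQQ n k z : nm z <= r / 2 -> nm ((Q n).[z] - (Q k).[z]) <= A * (invS n + invS k).
  move=> hz; rewrite -hornerN -hornerD.
  have -> : Q n - Q k = drop_poly m (P n - P k).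
    by apply/polyP => i; rewrite coefB !coef_drop_poly coefB.
  rewrite horner_coef (le_trans (nm_sum _ _ _)) //.
  set D := invS n + invS k.
  have D0 : 0 <= D by rewrite addr_ge0 ?invS_ge0.
  apply: (@le_trans _ _ (D * r ^- m * \sum_(i < size (drop_poly m (P n - P k))) 'C(i + 0, 0)%:R * 2^-1 ^+ i)).
    rewrite mulr_sumr; apply: ler_sum => i _; rewrite coef_drop_poly bin0 mul1r nmM nmX.
    have h := hc (i + m)%N n k.
    have -> : D * r ^- m * 2^-1 ^+ i = (r ^- (i + m) * D) * (r / 2) ^+ i.
      by rewrite rhn exprD invfM; ring.
    rewrite ler_pM ?exprn_ge0 ?nm_ge0 ?lerXn2r ?nnegrE ?nm_ge0 //.
    by rewrite coefB; exact: h.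
  have -> : A * D = D * r ^- m * 2 by rewrite /A; ring.
  rewrite ler_wpM2l ?mulr_ge0 ?invr_ge0 ?exprn_ge0 ?(ltW r0) //.
  by rewrite (le_trans (geo_binom 0 _ h01)) // expr1 h12.
have ex z : exists l, nm z <= r / 2 -> forall n, nm ((Q n).[z] - l) <= 2 * A * invS n.
  case: (lerP (nm z) (r / 2)) => hz; last by exists 0.
  by have [l hl] := cauchy_rate (fun n k => hQQ n k z hz); exists l.
have [g hg] := choice ex; exists m, g.
have small (K e : R) : 0 <= K -> 0 < e -> exists n, K * invS n <= e.
  move=> K0 e0; have e1 : 0 < e / (1 + K) by rewrite divr_gt0 // ltr_pwDl.
  have [n hn] := inv_succ_small e1; exists n.
  have -> : e = (1 + K) * (e / (1 + K)) by field; rewrite gt_eqF // ltr_pwDl.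
  by rewrite ler_pM ?invS_ge0 // lerDr.
split.
- move=> e e0; have [|n hn] := small (2 * A) e _ e0; first by rewrite mulr_ge0.
  by exists (Q n) => z hz; rewrite nmBC (le_trans (hg z hz n)).
- have -> : g 0 = a m => //.
  apply/eqP; rewrite -subr_eq0 -nm_eq0 eq_le nm_ge0 andbT; apply/ler_addgt0Pr => e e0.
  rewrite add0r; have [|n hn] := small (2 * A + 2 * r ^- m) e _ e0.
    by rewrite addr_ge0 ?mulr_ge0 ?invr_ge0 ?exprn_ge0 // ltW.
  have h0 : nm (0 : C) <= r / 2 by rewrite nm0.
  have := hg 0 h0 n; have := ha m n; rewrite horner_coef0 coef_drop_poly add0n => h1 h2.
  apply: le_trans hn; rewrite (le_trans (nm_tri _ (P n)`_m _)) // mulrDl lerD //.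
  by rewrite nmBC.
move=> z hz; apply/eqP; rewrite -subr_eq0 -nm_eq0 eq_le nm_ge0 andbT; apply/ler_addgt0Pr => e e0.
rewrite add0r.
pose S := \sum_(k < m) 2 * r ^- k * (r / 2) ^+ k.
have S0 : 0 <= S by apply: sumr_ge0 => k _; rewrite !mulr_ge0 ?invr_ge0 ?exprn_ge0 // ltW.
have hK0 : 0 <= 1 + S + nm z ^+ m * (2 * A).
  by rewrite !addr_ge0 // mulr_ge0 ?exprn_ge0 ?nm_ge0 // mulr_ge0.
have [n hn] := small _ _ hK0 e0; apply: le_trans hn.
have hz' : nm z <= r by move: hz r0; lra.
have hPz : (P n).[z] = (take_poly m (P n)).[z] + z ^+ m * (Q n).[z].
  rewrite -[in LHS](poly_take_drop m (P n)) hornerD hornerM hornerXn mulrC; ring.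
have -> : f z - z ^+ m * g z = (f z - (P n).[z]) + (take_poly m (P n)).[z] + z ^+ m * ((Q n).[z] - g z).
  by rewrite hPz; ring.
have -> : (1 + S + nm z ^+ m * (2 * A)) * invS n = invS n + S * invS n + nm z ^+ m * (2 * A * invS n) by ring.
have h3 : nm (z ^+ m * ((Q n).[z] - g z)) <= nm z ^+ m * (2 * A * invS n).
  by rewrite nmM nmX; apply: ler_wpM2l; rewrite ?exprn_ge0 ?nm_ge0 ?hg.
apply: (le_trans (nmD _ _)); apply: lerD => //.
apply: (le_trans (nmD _ _)); apply: lerD; first exact: hP.
rewrite (horner_coef_wide _ (size_take_poly _ _)) /S mulr_suml (le_trans (nm_sum _ _ _)) //.
apply: ler_sum => k _; rewrite coef_take_poly ltn_ord nmM nmX mulrAC.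
rewrite ler_pM ?exprn_ge0 ?nm_ge0 ?lerXn2r ?nnegrE ?nm_ge0 //.
by have := ha k n; rewrite al // subr0.
Qed.

End Factor.
End PolyApprox.

(** * Dirichlet characters and L-functions *)

Section LFunction.
Variable R : realType.
Local Notation C := (Cx R).
Implicit Types (x y : R) (z w s : C) (chi : nat -> C).

Lemma cauchy_nm (u : nat -> C) :
  (forall e, 0 < e -> exists N, forall n m, (N <= n)%N -> (N <= m)%N -> nm (u n - u m) <= e) ->
  exists l, forall e, 0 < e -> exists N, forall n, (N <= n)%N -> nm (u n - l) <= e.
Proof.
move=> h.
have h1 k : exists N, forall n m, (N <= n)%N -> (N <= m)%N -> nm (u n - u m) <= invS R k.
  by apply: h; rewrite /invS invr_gt0 ltr0n.
have [N hN] := choice h1.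
have hr n m : nm (u (N n) - u (N m)) <= 1 * (invS R n + invS R m).
  rewrite mul1r; set k := maxn (N n) (N m).
  rewrite (le_trans (nm_tri _ (u k) _)) // lerD //; first by rewrite hN // leq_maxl.
  by rewrite hN // leq_maxr.
have [l hl] := cauchy_rate hr; exists l => e e0.
have e3 : 0 < e / 3 by rewrite divr_gt0.
have [k hk] := inv_succ_small e3; exists (N k) => n hn.
rewrite (le_trans (nm_tri _ (u (N k)) _)) //.
have := hN k n (N k) hn (leqnn _); have := hl k; lra.
Qed.

Lemma nm_cvg_lim (u : nat -> C) l :
  (forall e, 0 < e -> exists N, forall n, (N <= n)%N -> nm (u n - l) <= e) -> limn u = l.
Proof.
move=> h; apply: cvg_lim; first exact: norm_hausdorff.
apply/cvgrPdist_le => e e0.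
have er : e = cR (complex.Re e).
  by apply: Cext => //=; move: e0; rewrite ltcE => /andP[/eqP].
have e1 : 0 < complex.Re e by move: e0; rewrite ltcE => /andP[].
have [N hN] := h _ e1; exists N => // n /= hn.
by rewrite er distrC normE ler_cR hN.
Qed.

Section Char.
Variables (q : nat) (chi : nat -> C).
Hypothesis q0 : (0 < q)%N.
Hypothesis hchi : is_dchar q chi.

Lemma chi_per n k : chi (n + k * q)%N = chi n.
Proof.
case: hchi => hp _ _; elim: k => [|k IH]; first by rewrite mul0n addn0.
by rewrite mulSn addnCA addnC hp.
Qed.

Lemma chi_modn n : chi (n %% q)%N = chi n.
Proof. by rewrite {2}(divn_eq n q) addnC chi_per. Qed.

Lemma chi_eqmod m n : m = n %[mod q] -> chi m = chi n.
Proof. by move=> h; rewrite -chi_modn h chi_modn. Qed.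

Lemma chiM m n : chi (m * n)%N = chi m * chi n.
Proof. by case: hchi. Qed.

Lemma chi_neq0 n : (chi n != 0) = coprime n q.
Proof. by case: hchi => _ _ h; apply/idP/idP => /h. Qed.

Lemma chi1 : chi 1%N = 1.
Proof.
have h : chi 1%N != 0 by rewrite chi_neq0 coprime1n.
by apply: (mulfI h); rewrite -chiM mulr1.
Qed.

Lemma chiX n k : chi (n ^ k)%N = chi n ^+ k.
Proof. by elim: k => [|k IH]; rewrite ?expn0 ?chi1 // expnS exprS chiM IH. Qed.

Lemma chi_root n : coprime n q -> chi n ^+ totient q = 1.
Proof.
move=> h; rewrite -chiX -chi1; apply: chi_eqmod; exact: Euler_exp_totient.
Qed.

Lemma nm_chi n : coprime n q -> nm (chi n) = 1.
Proof.
move=> h; apply/eqP; rewrite -(@pexpr_eq1 _ _ (totient q)) ?nm_ge0 ?totient_gt0 //.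
by rewrite -nmX chi_root // nm1.
Qed.

Lemma nm_chi_le1 n : nm (chi n) <= 1.
Proof.
have [h|h] := boolP (coprime n q); first by rewrite nm_chi.
by move: h; rewrite -chi_neq0 negbK => /eqP ->; rewrite nm0 ler01.
Qed.

Lemma sum_ord_mul (F : nat -> C) m : coprime m q -> (forall a b, a = b %[mod q] -> F a = F b) ->
  \sum_(i < q) F (m * i)%N = \sum_(i < q) F i.
Proof.
move=> hm hF.
have hlt (i : 'I_q) : (m * i %% q < q)%N by rewrite ltn_mod.
pose h (i : 'I_q) : 'I_q := Ordinal (hlt i).
have hi : injective h.
  move=> i j /(congr1 val) /= /eqP; wlog ij : i j / (i <= j)%N.
    by move=> W; case: (leqP i j) => [/W//|/ltnW /W H]; rewrite eq_sym => /H.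
  rewrite eq_sym eqn_mod_dvd ?leq_mul2l ?ij ?orbT // -mulnBr Gauss_dvdr ?(coprime_sym q) //.
  rewrite /dvdn modn_small ?(leq_ltn_trans (leq_subr _ _)) // => /eqP h0.
  by apply: val_inj => /=; move: ij h0; lia.
rewrite [RHS](reindex_inj hi) /=; apply: eq_bigr => i _; apply: hF.
by rewrite modn_mod.
Qed.

Lemma chi_sum0 : chi <> @principal_char R q -> \sum_(i < q) chi i = 0.
Proof.
move=> hn; have [m hm hm1] : exists2 m, coprime m q & chi m != 1.
  apply: contrapT => h; apply: hn; apply/funext => n; rewrite /principal_char.
  case: ifPn => hc; last by move: hc; rewrite -chi_neq0 negbK => /eqP.
  by apply/eqP/negP => /negP h1; apply: h; exists n.
have e : chi m * \sum_(i < q) chi i = \sum_(i < q) chi i.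
  rewrite mulr_sumr -[RHS](sum_ord_mul hm (@chi_eqmod)).
  by apply: eq_bigr => i _; rewrite chiM.
have hm2 : chi m - 1 != 0 by rewrite subr_eq0.
by apply: (mulfI hm2); rewrite mulr0 mulrBl mul1r e subrr.
Qed.

(** Complete periods cancel by [chi_sum0], which leaves fewer than q terms of modulus at most 1. *)
Lemma chi_psum N : chi <> @principal_char R q -> nm (\sum_(0 <= i < N) chi i) <= q%:R.
Proof.
move=> hn; rewrite (divn_eq N q).
have hb k r : \sum_(0 <= i < k * q + r) chi i = \sum_(0 <= i < r) chi i.
  elim: k => [|k IH]; first by rewrite mul0n add0n.
  rewrite mulSn -addnA (@big_cat_nat _ _ _ q) //= ?leq_addr //.
  rewrite big_mkord chi_sum0 // add0r -[X in \sum_(X <= _ < _) _]add0n big_addn addKn -IH.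
  by apply: eq_bigr => i _; case: hchi => ->.
rewrite hb (le_trans (nm_sum _ _ _)) // (le_trans (ler_sum _ (fun i _ => nm_chi_le1 i))) //.
by rewrite sumr_const_nat subn0 ler_nat ltnW // ltn_mod.
Qed.

Lemma chi_psum2 M N : chi <> @principal_char R q -> nm (\sum_(M <= i < N) chi i) <= 2 * q%:R.
Proof.
move=> hn; case: (leqP M N) => h; last by rewrite big_geq ?nm0 ?mulr_ge0 // ltnW.
have -> : \sum_(M <= i < N) chi i = \sum_(0 <= i < N) chi i - \sum_(0 <= i < M) chi i.
  by rewrite [X in _ = X - _](@big_cat_nat _ _ _ M) //= addrAC subrr add0r.
rewrite (le_trans (nmB _ _)) //; have := chi_psum N hn; have := chi_psum M hn; lra.
Qed.
End Char.

Lemma abel_le (a b : nat -> C) (B : R) M N : (M <= N)%N ->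
  (forall n, nm (\sum_(M <= i < n) a i) <= B) ->
  nm (\sum_(M <= n < N) a n * b n) <=
    B * (nm (b N) + \sum_(M <= n < N) nm (b n - b n.+1)).
Proof.
move=> MN hB; pose A n := \sum_(M <= i < n) a i.
have -> : \sum_(M <= n < N) a n * b n = A N * b N + \sum_(M <= n < N) A n.+1 * (b n - b n.+1).
  elim: N MN => [|N IH]; first by rewrite leqn0 => /eqP M0; rewrite /A M0 !big_geq // mul0r addr0.
  rewrite leq_eqVlt => /orP[/eqP <-|]; first by rewrite /A !big_geq // mul0r addr0.
  rewrite ltnS => MN; rewrite !(big_nat_recr N) //= IH // /A !(big_nat_recr N) //=.
  by ring.
rewrite (le_trans (nmD _ _)) // mulrDr nmM lerD ?ler_wpM2r ?nm_ge0 ?hB //.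
rewrite (le_trans (nm_sum _ _ _)) // mulr_sumr; apply: ler_sum => n _.
by rewrite nmM ler_wpM2r ?nm_ge0 ?hB.
Qed.

Lemma nm_npow n s : nm (npow_neg n s) = expR (- complex.Re s * ln n%:R).
Proof. by rewrite npow_negE nm_cexp ReM /= mulr0 subr0 ReN. Qed.

Lemma npow1 s : npow_neg 1 s = 1 :> C.
Proof. by rewrite npow_negE ln1 cR0 mulr0 cexp0. Qed.

(** The real power n^(-sg). At n = 0 the convention ln 0 = 0 gives the value 1, so monotonicity in n
    holds from 0 on. *)
Definition tpow (sg : R) (n : nat) : R := expR (- sg * ln n%:R).

Lemma lnS_bounds n : (0 < n)%N ->
  [/\ ln n.+1%:R = ln n%:R + ln (1 + n%:R^-1) :> R, ln (1 + n%:R^-1) <= n%:R^-1 :> R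
    & (2 * n%:R)^-1 <= ln (1 + n%:R^-1) :> R].
Proof.
move=> n0; have N0 : 0 < n%:R :> R by rewrite ltr0n.
have N1 : 1 <= n%:R :> R by rewrite ler1n.
have i0 : 0 < n%:R^-1 :> R by rewrite invr_gt0.
split.
- rewrite -lnM ?posrE ?addr_gt0 //; congr (ln _); rewrite -natr1; field; exact: lt0r_neq0.
- by apply: le_ln1Dx; lra.
have h : expR (- ln (1 + n%:R^-1)) = 1 - (n%:R + 1)^-1 :> R.
  rewrite expRN lnK ?posrE ?addr_gt0 //; field.
  by rewrite gt_eqF //= ?gt_eqF // addr_gt0.
have := expR_ge1Dx (- ln (1 + n%:R^-1) : R); rewrite h => h2.
have h3 : (2 * n%:R)^-1 <= (n%:R + 1)^-1 :> R.
  by rewrite lef_pV2 ?posrE ?mulr_gt0 ?addr_gt0 //; lra.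
lra.
Qed.

Lemma ln_nat_ge0 n : 0 <= ln n%:R :> R.
Proof. by case: n => [|n]; [rewrite ln0|rewrite ln_ge0 // ler1n]. Qed.

Lemma nm_npow_le s (sg : R) n : sg <= complex.Re s -> nm (npow_neg n s) <= tpow sg n.
Proof.
move=> h; rewrite nm_npow /tpow ler_expR ler_wpM2r ?ln_nat_ge0 // lerN2 //.
Qed.

Lemma npow_diff s n : (0 < n)%N -> (0 : R) <= complex.Re s ->
  nm (npow_neg n s - npow_neg n.+1 s) <= nm s * (nm (npow_neg n s) / n%:R).
Proof.
move=> n0 hs; have [h1 h2 h3] := lnS_bounds n0.
have N0 : 0 < n%:R :> R by rewrite ltr0n.
have y0 : 0 <= ln (1 + n%:R^-1) :> R by rewrite (le_trans _ h3) // invr_ge0 mulr_ge0.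
rewrite !npow_negE h1 cRD mulrDr cexpD -[X in X - _]mulr1 -mulrBr nmM nmBC mulrCA.
rewrite ler_wpM2l ?nm_ge0 // (le_trans (cexp_sub1_le _)) //.
  by rewrite mulNr ReN ReM /= mulr0 subr0 oppr_le0 mulr_ge0.
by rewrite nmM nmN nm_cR ger0_norm // ler_wpM2l ?nm_ge0.
Qed.

Lemma tpow_ge0 (sg : R) n : 0 <= tpow sg n. Proof. exact: expR_ge0. Qed.

(** Each term n^(-sg-1) is compared with the drop n^(-sg) - (n + 1)^(-sg), which telescopes; this
    replaces comparison with an integral. The factor 2 comes from ln(1 + 1/n) >= 1/(2n). *)
Lemma tpow_sum (sg : R) M N : 0 < sg -> (0 < M)%N -> (M <= N)%N ->
  \sum_(M <= n < N) tpow sg n / n%:R <= 2 * (1 + sg) / sg * (tpow sg M - tpow sg N).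
Proof.
move=> sg0 M0 MN.
have -> : tpow sg M - tpow sg N = \sum_(M <= n < N) (tpow sg n - tpow sg n.+1).
  by rewrite -opprB -(telescope_sumr _ MN) -sumrN; apply: eq_bigr => i _; rewrite opprB.
rewrite mulr_sumr big_nat [leRHS]big_nat; apply: ler_sum => n /andP[Mn _].
have n0 : (0 < n)%N := leq_trans M0 Mn.
have N0 : 0 < n%:R :> R by rewrite ltr0n.
have N1 : 1 <= n%:R :> R by rewrite ler1n.
have [h1 h2 h3] := lnS_bounds n0.
have i1 : n%:R^-1 <= 1 :> R by rewrite invf_le1.
rewrite /tpow h1 (mulrDr (- sg)) expRD -[X in _ * (X - _)]mulr1 -mulrBr mulrCA ler_wpM2l ?expR_ge0 //.
set y := ln (1 + n%:R^-1) in h2 h3 *.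
have i2 : (2 * n%:R)^-1 = n%:R^-1 / 2 :> R by field; rewrite gt_eqF.
rewrite i2 in h3; set v := n%:R^-1 in h2 h3 i1 *.
have h4 : expR (- sg * y) * (1 + sg * y) <= 1.
  have := expR_ge1Dx (sg * y); have := expRxMexpNx_1 (sg * y).
  by rewrite mulNr => e1 e2; rewrite -[leRHS]e1 [leRHS]mulrC ler_wpM2l ?expR_ge0.
set E := expR _ in h4 *; have E0 : 0 < E by exact: expR_gt0.
have h5 : sg * (v / 2) <= (1 + sg) * (1 - E).
  have v0 : 0 < v by rewrite invr_gt0.
  have y0 : 0 <= y by lra.
  have hE : E <= 1 by rewrite /E -expR0 ler_expR mulNr oppr_le0 mulr_ge0 // ltW.
  have hy : sg * y <= sg * 1 by rewrite ler_wpM2l ?(ltW sg0) //; lra.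
  have hv : sg * (v / 2) <= sg * y by rewrite ler_wpM2l ?(ltW sg0).
  have : (1 - E) * (sg * y) <= (1 - E) * sg by rewrite ler_wpM2l // ?subr_ge0 //; lra.
  nra.
have -> : v = 2 / sg * (sg * (v / 2)) by field; rewrite gt_eqF.
have -> : 2 * (1 + sg) / sg * (1 - E) = 2 / sg * ((1 + sg) * (1 - E)) by ring.
by rewrite ler_wpM2l // divr_ge0 // ltW.
Qed.

Lemma tpow_small (sg e : R) : 0 < sg -> 0 < e -> exists N, forall n, (N <= n)%N -> (0 < n)%N /\ tpow sg n <= e.
Proof.
move=> sg0 e0; exists (Num.truncn (expR (- ln e / sg))).+1 => n hn; split; first exact: leq_trans hn.
have n0 : 0 < n%:R :> R by rewrite ltr0n; exact: leq_trans hn.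
rewrite /tpow -[leRHS]lnK ?posrE // ler_expR mulNr lerNl.
rewrite mulrC -ler_pdivrMr // -[leLHS]expRK ler_ln ?posrE ?expR_gt0 //.
rewrite (le_trans (ltW (truncnS_gt _))) // ler_nat //.
Qed.

Lemma tpow_le1 (sg : R) n : 0 <= sg -> tpow sg n <= 1.
Proof. by move=> h; rewrite -expR0 /tpow ler_expR mulNr oppr_le0 mulr_ge0 ?ln_nat_ge0. Qed.

Lemma tpow_mono (sg : R) m n : 0 <= sg -> (m <= n)%N -> tpow sg n <= tpow sg m.
Proof.
move=> h mn; rewrite /tpow ler_expR !mulNr lerN2 ler_wpM2l //.
case: m mn => [|m] mn; first by rewrite ln0 // ln_nat_ge0.
by rewrite ler_ln ?posrE ?ltr0n ?ler_nat //; apply: leq_trans mn.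
Qed.

(** * L(s, chi) in the half-plane Re s > 0 *)

Section LSeries.
Variables (q : nat) (chi : nat -> C).
Hypothesis q0 : (0 < q)%N.
Hypothesis hchi : nonprincipal_chars q chi.
Let hd : is_dchar q chi := hchi.1.
Let hnp : chi <> @principal_char R q := hchi.2.

Definition Dp (N : nat) s : C := \sum_(1 <= n < N) chi n * npow_neg n s.

(** 2q bounds sums of chi over intervals; the second factor collects the two terms of Abel
    summation, with the constant of [tpow_sum]. *)
Definition Kq (sg : R) : R := 2 * q%:R * (1 + 2 * (1 + sg) / sg).

Lemma Kq_ge0 (sg : R) : 0 < sg -> 0 <= Kq sg.
Proof.
move=> h; rewrite /Kq mulr_ge0 ?mulr_ge0 // addr_ge0 // divr_ge0 ?(ltW h) // mulr_ge0 // addr_ge0 // ltW //.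
Qed.

Lemma Dp_tail (sg : R) s M N : 0 < sg -> sg <= complex.Re s -> (0 < M)%N -> (M <= N)%N ->
  nm (\sum_(M <= n < N) chi n * npow_neg n s) <= Kq sg * (1 + nm s) * tpow sg M.
Proof.
move=> sg0 hs M0 MN.
have Q0 : 0 <= 2 * q%:R :> R by rewrite mulr_ge0.
rewrite (le_trans (abel_le _ MN (fun n => chi_psum2 q0 hd M n hnp))) //.
have -> : Kq sg * (1 + nm s) * tpow sg M = 2 * q%:R * ((1 + 2 * (1 + sg) / sg) * (1 + nm s) * tpow sg M).
  by rewrite /Kq; ring.
rewrite ler_wpM2l //.
have k0 : 0 <= 2 * (1 + sg) / sg by rewrite divr_ge0 ?(ltW sg0) // mulr_ge0 // addr_ge0 // ltW.
have h1 : nm (npow_neg N s) <= tpow sg M.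
  by rewrite (le_trans (nm_npow_le _ hs)) // tpow_mono // ltW.
have h2 : \sum_(M <= n < N) nm (npow_neg n s - npow_neg n.+1 s) <= nm s * (2 * (1 + sg) / sg * tpow sg M).
  apply: (@le_trans _ _ (nm s * \sum_(M <= n < N) tpow sg n / n%:R)).
    rewrite mulr_sumr big_nat [leRHS]big_nat; apply: ler_sum => n /andP[Mn _].
    have n0 : (0 < n)%N := leq_trans M0 Mn.
    rewrite (le_trans (npow_diff n0 (le_trans (ltW sg0) hs))) // ler_wpM2l ?nm_ge0 //.
    by rewrite ler_wpM2r ?invr_ge0 // nm_npow_le.
  rewrite ler_wpM2l ?nm_ge0 // (le_trans (tpow_sum sg0 M0 MN)) // ler_wpM2l //.
  by rewrite gerBl tpow_ge0.
rewrite (le_trans (lerD h1 h2)) //.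
have t0 := tpow_ge0 sg M; have s0 := nm_ge0 s.
set k := 2 * (1 + sg) / sg in k0 *; set t := tpow sg M in t0 *; set u := nm s in s0 *.
have -> : (1 + k) * (1 + u) * t = t + u * (k * t) + (k * t + u * t) by ring.
by rewrite lerDl addr_ge0 // mulr_ge0.
Qed.

Lemma Dp_diff (sg : R) s M N : 0 < sg -> sg <= complex.Re s -> (0 < M)%N -> (M <= N)%N ->
  nm (Dp N s - Dp M s) <= Kq sg * (1 + nm s) * tpow sg M.
Proof.
move=> sg0 hs M0 MN; rewrite /Dp (@big_cat_nat _ _ _ M) //= addrAC subrr add0r.
exact: Dp_tail.
Qed.

(** Contains the convergence of the defining series for Re s > 0: the tail bound makes the partial
    sums Cauchy, and it then passes to their limit. The rate is uniform on bounded parts of Re s >=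
    sg. *)
Lemma L_approx (sg : R) s M : 0 < sg -> sg <= complex.Re s -> (0 < M)%N ->
  nm (Lchi chi s - Dp M s) <= Kq sg * (1 + nm s) * tpow sg M.
Proof.
move=> sg0 hs M0.
have [|l hl] := @cauchy_nm (fun N => Dp N s).
  move=> e e0; have K0 : 0 < 1 + Kq sg * (1 + nm s).
    by rewrite ltr_pwDl // mulr_ge0 ?Kq_ge0 // addr_ge0 // nm_ge0.
  have [N hN] := tpow_small sg0 (divr_gt0 e0 K0); exists N => n m.
  wlog nm_ : n m / (n <= m)%N.
    by move=> W hn hm; case: (leqP n m) => [/W|/ltnW /W]; [apply|rewrite nmBC; apply].
  move=> hn hm; have [n0 tn] := hN n hn.
  rewrite nmBC (le_trans (Dp_diff sg0 hs n0 nm_)) //.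
  have KK : 0 <= Kq sg * (1 + nm s) by rewrite mulr_ge0 ?Kq_ge0 // addr_ge0 ?nm_ge0.
  by rewrite (le_trans (ler_wpM2l KK tn)) // mulrCA ger_pMr // ler_pdivrMr // mul1r lerDr.
have -> : Lchi chi s = l by exact: nm_cvg_lim hl.
apply/ler_addgt0Pr => e e0; have [N hN] := hl _ e0.
pose n := maxn N M.
rewrite (le_trans (nm_tri _ (Dp n s) _)) // addrC lerD //.
  by rewrite Dp_diff // leq_maxr.
by rewrite nmBC hN // leq_maxl.
Qed.

Lemma L_bound (sg : R) s : 0 < sg -> sg <= complex.Re s -> nm (Lchi chi s) <= Kq sg * (1 + nm s).
Proof.
move=> sg0 hs; have := L_approx sg0 hs (ltnSn 0).
rewrite /Dp big_geq // subr0 => h; rewrite (le_trans h) // ler_piMr ?tpow_le1 ?(ltW sg0) //.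
by rewrite mulr_ge0 ?Kq_ge0 // addr_ge0 ?nm_ge0.
Qed.

Lemma Dp_polylim r N (c : C) : 0 <= r -> polylim r (fun z => Dp N (c + z)).
Proof.
move=> r0; rewrite /Dp; apply: polylim_sum => n.
apply: (@polylim_ext _ _ (fun z => (chi n * cexp (- c * cR (ln n%:R))) * cexp (- cR (ln n%:R) * z))).
  by move=> z _; rewrite npow_negE -mulrA -cexpD; congr (_ * cexp _); ring.
by apply: polylimZ; exact: polylim_cexp.
Qed.

Lemma L_polylim r (c : C) : 0 <= r -> r < complex.Re c -> polylim r (fun z => Lchi chi (c + z)).
Proof.
move=> r0 hc; apply: polylim_lim => e e0.
pose sg := complex.Re c - r; have sg0 : 0 < sg by rewrite subr_gt0.
pose K := Kq sg * (1 + (nm c + r)).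
have K0 : 0 <= K by rewrite mulr_ge0 ?Kq_ge0 // !addr_ge0 ?nm_ge0.
have K1 : 0 < 1 + K by rewrite ltr_pwDl.
have [N hN] := tpow_small sg0 (divr_gt0 e0 K1).
have [N0 tN] := hN N (leqnn _).
exists (fun z => Dp N (c + z)); first exact: Dp_polylim.
move=> z hz; have hs : sg <= complex.Re (c + z).
  by rewrite ReD /sg; have := le_trans (absRe_le z) hz; rewrite ler_norml => /andP[]; lra.
rewrite (le_trans (L_approx sg0 hs N0)) //.
apply: (@le_trans _ _ (K * (e / (1 + K)))).
  apply: ler_pM; rewrite ?tpow_ge0 //.
    by rewrite mulr_ge0 ?Kq_ge0 // addr_ge0 ?nm_ge0.
  by rewrite /K ler_wpM2l ?Kq_ge0 // lerD2l // (le_trans (nmD _ _)) // lerD2l.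
by rewrite mulrCA ger_pMr // ler_pdivrMr // mul1r lerDr.
Qed.

Lemma L_disc_bound r (sg : R) (c : C) z : 0 < sg -> sg + r <= complex.Re c -> nm z <= r ->
  nm (Lchi chi (c + z)) <= Kq sg * (1 + (nm c + r)).
Proof.
move=> sg0 hc hz.
have hs : sg <= complex.Re (c + z).
  by rewrite ReD; have := le_trans (absRe_le z) hz; rewrite ler_norml => /andP[]; lra.
rewrite (le_trans (L_bound sg0 hs)) // ler_wpM2l ?Kq_ge0 // lerD2l (le_trans (nmD _ _)) // lerD2l //.
Qed.

(** L - 1 is at most 1/2, since n^(-3) <= (1/(n - 1) - 1/n) / 2 for n >= 2 and the right side
    telescopes. *)
Lemma L_lower s : (3 : R) <= complex.Re s -> 2^-1 <= nm (Lchi chi s).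
Proof.
move=> hs; apply/ler_addgt0Pr => e e0.
have h30 : (0 : R) < 3 by [].
have K0 : 0 < 1 + Kq 3 * (1 + nm s).
  by rewrite ltr_pwDl // mulr_ge0 ?Kq_ge0 // addr_ge0 // nm_ge0.
have [N hN] := tpow_small h30 (divr_gt0 e0 K0).
have [M0 tM] := hN (N + 2)%N (leq_addr _ _); set M := (N + 2)%N in M0 tM.
have := L_approx h30 hs M0.
have hd2 : nm (Dp M s - 1) <= 2^-1.
  rewrite /Dp big_ltn; last by rewrite /M addn2.
  rewrite (chi1 hd) npow1 mulr1 addrAC subrr add0r (le_trans (nm_sum _ _ _)) //.
  apply: (@le_trans _ _ (\sum_(2 <= n < M) 2^-1 * ((n.-1)%:R^-1 - (n.-1).+1%:R^-1))).
    rewrite big_nat [leRHS]big_nat; apply: ler_sum => n /andP[n2 _].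
    rewrite nmM (le_trans (ler_pM _ _ (nm_chi_le1 q0 hd n) (nm_npow_le n hs))) ?nm_ge0 // mul1r.
    have -> : tpow 3 n = n%:R ^- 3.
      by rewrite /tpow mulNr expRN expRM_natl lnK // posrE ltr0n (leq_trans _ n2).
    case: n n2 => [//|[//|n]] _ /=.
    have n0 : 0 <= n%:R :> R by [].
    rewrite -(natr1 n.+1) -(natr1 n); set v := n%:R in n0 *.
    have -> : (v + 1)^-1 - (v + 1 + 1)^-1 = ((v + 1) * (v + 2))^-1.
      by field; rewrite !gt_eqF //; lra.
    have -> : v + 1 + 1 = v + 2 by ring.
    rewrite -invfM lef_pV2 ?posrE ?exprn_gt0 ?mulr_gt0 //; try by lra.
    rewrite -subr_ge0 (_ : _ - _ = (v + 2) * (v * v + 2 * v + 2)); last by ring.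
    by rewrite mulr_ge0 ?addr_ge0 ?mulr_ge0.
  rewrite -mulr_sumr ger_pMr ?invr_gt0 //.
  rewrite big_add1 /= (eq_bigr (fun i => - (i.+1%:R^-1 - i%:R^-1))); last by move=> i _; rewrite opprB.
  rewrite sumrN telescope_sumr ?invr1; last by rewrite /M addn2.
  by rewrite opprB gerBl invr_ge0.
have h1 : nm 1 - nm (1 - Dp M s) <= nm (Dp M s).
  have := nm_lB 1 (1 - Dp M s); rewrite opprB addrCA subrr addr0; lra.
have h2 : nm (Dp M s) - nm (Dp M s - Lchi chi s) <= nm (Lchi chi s).
  have := nm_lB (Dp M s) (Dp M s - Lchi chi s); rewrite opprB addrCA subrr addr0; lra.
rewrite nm1 nmBC in h1; rewrite nmBC in h2.
have h3 : Kq 3 * (1 + nm s) * tpow 3 M <= e.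
  have K1 : 0 <= Kq 3 * (1 + nm s) by rewrite mulr_ge0 ?Kq_ge0 // addr_ge0 ?nm_ge0.
  rewrite (le_trans (ler_wpM2l K1 tM)) // mulrCA ger_pMr // ler_pdivrMr // mul1r lerDr //.
lra.
Qed.

End LSeries.
End LFunction.

(** * Complex derivatives *)

Section ComplexDeriv.
Variable R : realType.
Local Notation C := (Cx R).
Implicit Types (x y : R) (z w s d : C) (F G f g : C -> C).

(* Complex derivative with a quadratic remainder, which is automatic for holomorphic functions. *)
Definition hasder F s d := exists K e : R, [/\ 0 <= K, 0 < e &
  forall w, nm w <= e -> nm (F (s + w) - F s - w * d) <= K * nm w ^+ 2].

Lemma hasder_uniq F s d1 d2 : hasder F s d1 -> hasder F s d2 -> d1 = d2.
Proof.
move=> [K1 [e1 [K10 e10 h1]]] [K2 [e2 [K20 e20 h2]]].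
apply/eqP; rewrite -subr_eq0 -nm_eq0 eq_le nm_ge0 andbT; apply/ler_addgt0Pr => e e0.
pose t := Num.min (Num.min e1 e2) (e / (1 + (K1 + K2))).
have K0 : 0 < 1 + (K1 + K2) by rewrite ltr_pwDl // addr_ge0.
have t0 : 0 < t by rewrite !lt_min e10 e20 divr_gt0.
have nt : nm (cR t) = t by rewrite nm_cR gtr0_norm.
have t1 : nm (cR t) <= e1 by rewrite nt /t !ge_min lexx.
have t2 : nm (cR t) <= e2 by rewrite nt /t !ge_min lexx orbT.
have t3 : t <= e / (1 + (K1 + K2)) by rewrite /t ge_min lexx orbT.
have h3 : t * nm (d1 - d2) <= t * ((K1 + K2) * t).
  have -> : t * nm (d1 - d2) = nm (cR t * (d1 - d2)) by rewrite nmM nt.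
  have -> : cR t * (d1 - d2) = (F (s + cR t) - F s - cR t * d2) - (F (s + cR t) - F s - cR t * d1) by ring.
  rewrite (le_trans (nmB _ _)) // (le_trans (lerD (h2 _ t2) (h1 _ t1))) // nt.
  by apply: eqW; ring.
rewrite add0r; move: h3; rewrite ler_pM2l // => h3; apply: (le_trans h3).
rewrite (le_trans (ler_wpM2l (addr_ge0 K10 K20) t3)) // mulrCA ger_pMr //.
by rewrite ler_pdivrMr // mul1r lerDr.
Qed.

Lemma hasder_local F G s d (e0 : R) : 0 < e0 -> (forall w, nm w <= e0 -> F (s + w) = G (s + w)) ->
  hasder G s d -> hasder F s d.
Proof.
move=> e00 h [K [e [K0 e1 hG]]]; exists K, (Num.min e e0); split => //.
  by rewrite lt_min e1.
have h0 : F s = G s by have := h 0; rewrite nm0 addr0; apply; rewrite ltW.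
by move=> w; rewrite le_min => /andP[w1 w2]; rewrite h // h0; exact: hG.
Qed.

Lemma hasder_shift F c z d : hasder (fun z => F (c + z)) z d <-> hasder F (c + z) d.
Proof.
by split=> -[K [e [K0 e0 h]]]; exists K, e; split => // w hw; have := h w hw; rewrite addrA.
Qed.

Lemma hasder_cst (c : C) s : hasder (fun=> c) s 0.
Proof. by exists 0, 1; split => // w _; rewrite subrr mulr0 subr0 nm0 mul0r. Qed.

Lemma hasderD F G s d1 d2 : hasder F s d1 -> hasder G s d2 -> hasder (fun z => F z + G z) s (d1 + d2).
Proof.
move=> [K1 [e1 [K10 e10 h1]]] [K2 [e2 [K20 e20 h2]]].
exists (K1 + K2), (Num.min e1 e2); split; [by rewrite addr_ge0|by rewrite lt_min e10|].
move=> w; rewrite le_min => /andP[w1 w2].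
have -> : F (s + w) + G (s + w) - (F s + G s) - w * (d1 + d2) =
  (F (s + w) - F s - w * d1) + (G (s + w) - G s - w * d2) by ring.
by rewrite (le_trans (nmD _ _)) // mulrDl lerD ?h1 ?h2.
Qed.

Lemma hasderZ F s d (c : C) : hasder F s d -> hasder (fun z => c * F z) s (c * d).
Proof.
move=> [K [e [K0 e0 h]]]; exists (nm c * K), e; split => //; first by rewrite mulr_ge0 ?nm_ge0.
move=> w hw; have -> : c * F (s + w) - c * F s - w * (c * d) = c * (F (s + w) - F s - w * d) by ring.
by rewrite nmM -mulrA ler_wpM2l ?nm_ge0 ?h.
Qed.

Lemma hasderB F G s d1 d2 : hasder F s d1 -> hasder G s d2 -> hasder (fun z => F z - G z) s (d1 - d2).
Proof.
move=> h1 h2; have := hasderD h1 (hasderZ (-1) h2); rewrite mulN1r.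
by apply: hasder_local ltr01 _ => w _; rewrite mulN1r.
Qed.

Lemma hasder_sum (I : Type) (l : seq I) (F : I -> C -> C) (dF : I -> C) s :
  (forall i, hasder (F i) s (dF i)) -> hasder (fun z => \sum_(i <- l) F i z) s (\sum_(i <- l) dF i).
Proof.
move=> h; elim: l => [|a l IH].
  rewrite big_nil; apply: hasder_local ltr01 _ (hasder_cst 0 s) => w _; by rewrite big_nil.
rewrite big_cons; apply: hasder_local ltr01 _ (hasderD (h a) IH) => w _; by rewrite big_cons.
Qed.

Lemma hasder_id s : hasder id s 1.
Proof. by exists 0, 1; split => // w _; rewrite mulr1 (addrC s) addrK subrr nm0 mul0r. Qed.

Lemma hasderM F G s d1 d2 : hasder F s d1 -> hasder G s d2 ->
  hasder (fun z => F z * G z) s (d1 * G s + F s * d2).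
Proof.
move=> [K1 [e1 [K10 e10 h1]]] [K2 [e2 [K20 e20 h2]]].
pose B := nm (G s) + nm d2 + K2; pose A := nm (F s) * K2 + K1 * B + nm d1 * (nm d2 + K2).
have nF := nm_ge0 (F s); have nG := nm_ge0 (G s); have n1 := nm_ge0 d1; have n2 := nm_ge0 d2.
have B0 : 0 <= B by rewrite !addr_ge0.
exists A, (Num.min (Num.min e1 e2) 1); split; last 1 first.
- move=> w; rewrite !le_min => /andP[/andP[w1 w2] w3].
  have nw := nm_ge0 w.
  set r1 := F (s + w) - F s - w * d1; set r2 := G (s + w) - G s - w * d2.
  have H1 := h1 _ w1; have H2 := h2 _ w2; rewrite -/r1 -/r2 in H1 H2.
  have -> : F (s + w) * G (s + w) - F s * G s - w * (d1 * G s + F s * d2) =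
     F s * r2 + r1 * (G s + w * d2 + r2) + w * d1 * (w * d2 + r2) by rewrite /r1 /r2; ring.
  have w22 : nm w ^+ 2 <= nm w by rewrite expr2 ler_piMr.
  have R2 : nm r2 <= K2 * nm w by rewrite (le_trans H2) // ler_wpM2l.
  have R2' : nm r2 <= K2 by rewrite (le_trans R2) // ler_piMr.
  have S1 : nm (G s + w * d2 + r2) <= B.
    rewrite (le_trans (nmD _ _)) // lerD // (le_trans (nmD _ _)) // lerD // nmM ler_piMl //.
  have S2 : nm (w * d2 + r2) <= nm w * (nm d2 + K2).
    by rewrite (le_trans (nmD _ _)) // mulrDr lerD ?nmM // [leRHS]mulrC.
  have -> : A * nm w ^+ 2 = nm (F s) * (K2 * nm w ^+ 2) + K1 * nm w ^+ 2 * B +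
     nm w * nm d1 * (nm w * (nm d2 + K2)) by rewrite /A; ring.
  apply: (le_trans (nmD _ _)); apply: lerD.
    apply: (le_trans (nmD _ _)); apply: lerD; first by rewrite nmM ler_wpM2l.
    by rewrite nmM ler_pM ?nm_ge0.
  by rewrite nmM (nmM w d1) ler_wpM2l // mulr_ge0.
- by rewrite !addr_ge0 ?mulr_ge0 ?addr_ge0.
- by rewrite !lt_min e10 e20 ltr01.
Qed.

Lemma hasderX m s : hasder (fun z => z ^+ m) s (m%:R * s ^+ m.-1).
Proof.
elim: m => [|m IH]; first by rewrite mul0r; apply: hasder_local ltr01 _ (hasder_cst 1 s).
have := hasderM (hasder_id s) IH; rewrite mul1r /=.
have -> : s ^+ m + s * (m%:R * s ^+ m.-1) = m.+1%:R * s ^+ m.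
  by case: (m) => [|k]; rewrite ?mul0r ?mulr0 ?addr0 ?mul1r //= [in RHS]exprS exprS -!natr1; ring.
by apply: hasder_local ltr01 _ => w _; rewrite exprS.
Qed.

Lemma hasder_npow n s : hasder (npow_neg n) s (- cR (ln n%:R) * npow_neg n s).
Proof.
set l : R := ln n%:R; have l0 : 0 <= l by exact: ln_nat_ge0.
exists (4 * l ^+ 2 * nm (npow_neg n s)), (2^-1 / (1 + l)); split.
- by rewrite !mulr_ge0 ?nm_ge0 ?exprn_ge0.
- by rewrite divr_gt0 // ltr_pwDl.
move=> w hw.
have hl : nm (- w * cR l) <= 2^-1.
  rewrite nmM nmN nm_cR (ger0_norm l0) (le_trans (ler_wpM2r l0 hw)) //.
  by rewrite -mulrA ger_pMr ?invr_gt0 // mulrC ler_pdivrMr ?ltr_pwDl // mul1r lerDr.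
have -> : npow_neg n (s + w) - npow_neg n s - w * (- cR l * npow_neg n s) =
  npow_neg n s * (cexp (- w * cR l) - 1 - (- w * cR l)).
  by rewrite !npow_negE -/l opprD (mulrDl (- s)) cexpD; ring.
rewrite nmM [leRHS]mulrAC mulrC ler_wpM2r ?nm_ge0 // (le_trans (cexp_sub2_le hl)) //.
rewrite nmM nmN nm_cR (ger0_norm l0) exprMn.
by apply: eqW; ring.
Qed.

(** A choice with default 0; by uniqueness it is the derivative wherever one exists. *)
Definition der F s : C := xget 0 [set d | hasder F s d].

Lemma derE F s d : hasder F s d -> der F s = d.
Proof.
move=> h; rewrite /der; case: xgetP => [d' -> h'|/(_ d) //]; exact: hasder_uniq h' h.
Qed.

Lemma derP F s d : hasder F s d -> hasder F s (der F s).
Proof. by move=> h; rewrite (derE h). Qed.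

Lemma polylim_bounded (r : R) f : 0 <= r -> polylim r f -> exists2 B : R, 0 <= B & forall z, nm z <= r -> nm (f z) <= B.
Proof.
move=> r0 /(_ 1 ltr01)[p hp]; exists (\sum_(i < size p) nm p`_i * r ^+ i + 1).
  by rewrite addr_ge0 // sumr_ge0 // => i _; rewrite mulr_ge0 ?nm_ge0 ?exprn_ge0.
move=> z hz; have := nm_lB (f z) p.[z]; have := hp z hz.
have : nm p.[z] <= \sum_(i < size p) nm p`_i * r ^+ i.
  rewrite horner_coef (le_trans (nm_sum _ _ _)) //; apply: ler_sum => i _.
  by rewrite nmM nmX ler_wpM2l ?nm_ge0 // lerXn2r ?nnegrE ?nm_ge0.
lra.
Qed.

(** Passing through the midpoint of r' and r leaves room around the closed disc of radius r', so
    that the derivative exists up to its boundary. *)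
Lemma polylim_der (r r' : R) F (c : C) (B : R) : 0 <= r' -> r' < r ->
  polylim r (fun z => F (c + z)) -> (forall z, nm z <= r -> nm (F (c + z)) <= B) ->
  let x := 1 - (r' + r) / 2 / r in
  [/\ (forall e, 0 < e -> exists p, (forall z, nm z <= r -> nm (F (c + z) - p.[z]) <= e) /\
                       (forall z, nm z <= r' -> nm (der F (c + z) - p^`().[z]) <= e)),
  (forall z, nm z <= r' -> nm (der F (c + z)) <= B / r / x ^+ 2),
  (forall z w, nm z <= r' -> nm (z + w) <= r' ->
     nm (F (c + (z + w)) - F (c + z) - w * der F (c + z)) <= B / r ^+ 2 / x ^+ 3 * nm w ^+ 2) &
  (forall z, nm z <= r' -> hasder F (c + z) (der F (c + z)))].
Proof.
move=> r'0 rr hp hB x.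
pose r1 := (r' + r) / 2.
have r10 : 0 <= r1 by rewrite divr_ge0 // addr_ge0 // (le_trans r'0) // ltW.
have r1r : r1 < r by rewrite /r1; lra.
have r'1 : r' < r1 by rewrite /r1; lra.
have [f' [h1 h2 h3]] := polylim_deriv r10 r1r hp hB.
have r0 : 0 < r by exact: le_lt_trans rr.
have x0 : 0 < x by rewrite subr_gt0 ltr_pdivrMr // mul1r.
have hd z : nm z <= r' -> hasder F (c + z) (f' z).
  move=> hz; apply/hasder_shift; exists (B / r ^+ 2 / x ^+ 3), (r1 - r'); split.
  - have B0 : 0 <= B by rewrite (le_trans _ (hB 0 _)) ?nm_ge0 // nm0 ltW.
    by rewrite !divr_ge0 ?exprn_ge0 // ?ltW.
  - by rewrite subr_gt0.
  - move=> w hw; apply: h3; first by rewrite (le_trans hz) // ltW.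
    by rewrite (le_trans (nmD _ _)) // -lerBrDl (le_trans hw) // lerD2l lerN2.
have de z : nm z <= r' -> der F (c + z) = f' z by move=> /hd /derE.
have sub z : nm z <= r' -> nm z <= r1 by move=> h; rewrite (le_trans h) // ltW.
split.
- move=> e /h1[p [p1 p2]]; exists p; split => // z hz; rewrite de // p2 // sub //.
- by move=> z hz; rewrite de // h2 // sub.
- by move=> z w hz hw; rewrite de // h3 // sub.
- by move=> z /hd /derP.
Qed.

(* Uniform first-order Taylor expansion with quadratic error: no Cauchy theorem is
   available, and this class is what the contour shift [gridint_shift] needs. *)
Definition taylor2 (K : set C) F F' := exists A h : R, [/\ 0 <= A, 0 < h &
  forall s w, K s -> K (s + w) -> nm w <= h ->
   [/\ nm (F s) <= A, nm (F' s) <= A & nm (F (s + w) - F s - w * F' s) <= A * nm w ^+ 2]].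

Lemma taylor2_lip (K : set C) F F' : taylor2 K F F' -> exists A h : R, [/\ 0 <= A, 0 < h &
  forall s w, K s -> K (s + w) -> nm w <= h -> nm (F (s + w) - F s) <= A * nm w].
Proof.
move=> [A [h [A0 h0 H]]]; exists (A * (1 + h)), h; split => //.
  by rewrite mulr_ge0 // addr_ge0 // ltW.
move=> s w Ks Kw hw; have [H1 H2 H3] := H s w Ks Kw hw.
have -> : F (s + w) - F s = (F (s + w) - F s - w * F' s) + w * F' s by ring.
rewrite (le_trans (nmD _ _)) // addrC (_ : _ * _ * _ = A * nm w + A * (h * nm w)); last by ring.
rewrite lerD //; first by rewrite nmM mulrC ler_wpM2r ?nm_ge0.
by rewrite (le_trans H3) // ler_wpM2l // expr2 ler_wpM2r ?nm_ge0.
Qed.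

Lemma taylor2_ext (K : set C) F F' G G' : (forall s, K s -> F s = G s) -> (forall s, K s -> F' s = G' s) ->
  taylor2 K F F' -> taylor2 K G G'.
Proof.
move=> h h' [A [e [A0 e0 H]]]; exists A, e; split => // s w Ks Kw hw.
by rewrite -!h // -!h' //; apply: H.
Qed.

Lemma taylor2D (K : set C) F F' G G' : taylor2 K F F' -> taylor2 K G G' ->
  taylor2 K (fun s => F s + G s) (fun s => F' s + G' s).
Proof.
move=> [A1 [h1 [A10 h10 H1]]] [A2 [h2 [A20 h20 H2]]].
exists (A1 + A2), (Num.min h1 h2); split; [by rewrite addr_ge0|by rewrite lt_min h10|].
move=> s w Ks Kw; rewrite le_min => /andP[w1 w2].
have [a1 a2 a3] := H1 s w Ks Kw w1; have [b1 b2 b3] := H2 s w Ks Kw w2.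
split; [by rewrite (le_trans (nmD _ _)) ?lerD|by rewrite (le_trans (nmD _ _)) ?lerD|].
have -> : F (s + w) + G (s + w) - (F s + G s) - w * (F' s + G' s) =
  (F (s + w) - F s - w * F' s) + (G (s + w) - G s - w * G' s) by ring.
by rewrite (le_trans (nmD _ _)) // mulrDl lerD.
Qed.

Lemma taylor2_cst (K : set C) (c : C) : taylor2 K (fun=> c) (fun=> 0).
Proof.
exists (nm c), 1; split => [||s w _ _ _]; rewrite ?nm_ge0 //; split => //; first by rewrite nm0 nm_ge0.
by rewrite subrr mulr0 subr0 nm0 mulr_ge0 ?nm_ge0 ?exprn_ge0 ?nm_ge0.
Qed.

Lemma taylor2_id (K : set C) (B : R) : (forall s, K s -> nm s <= B) -> taylor2 K id (fun=> 1).
Proof.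
move=> hB; exists (`|B| + 1), 1; split => [||s w Ks Kw hw]; rewrite ?addr_ge0 //.
split; first by rewrite (le_trans (hB _ Ks)) // (le_trans (ler_norm B)) // lerDl.
  by rewrite nm1 lerDr.
by rewrite mulr1 (addrC s) addrK subrr nm0 mulr_ge0 ?addr_ge0 ?exprn_ge0 ?nm_ge0.
Qed.

Lemma taylor2M (K : set C) F F' G G' : taylor2 K F F' -> taylor2 K G G' ->
  taylor2 K (fun s => F s * G s) (fun s => F' s * G s + F s * G' s).
Proof.
move=> [A1 [h1 [A10 h10 H1]]] [A2 [h2 [A20 h20 H2]]].
exists (4 * (A1 * A2)), (Num.min (Num.min h1 h2) 1); split.
- by rewrite mulr_ge0 // mulr_ge0.
- by rewrite !lt_min h10 h20 ltr01.
move=> s w Ks Kw; rewrite !le_min => /andP[/andP[w1 w2] w3].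
have [a1 a2 a3] := H1 s w Ks Kw w1; have [b1 b2 b3] := H2 s w Ks Kw w2.
(* The increment 0 at s + w serves to bound G at that point. *)
have [b4 _ _] := H2 (s + w) 0 Kw ltac:(by rewrite addr0) ltac:(by rewrite nm0 ltW).
have AA : 0 <= A1 * A2 by rewrite mulr_ge0.
have PQ (p q : C) : nm p <= A1 -> nm q <= A2 -> nm (p * q) <= A1 * A2.
  by move=> hp hq; rewrite nmM ler_pM ?nm_ge0.
split.
- by have := PQ _ _ a1 b1; lra.
- by rewrite (le_trans (nmD _ _)) //; have := PQ _ _ a2 b1; have := PQ _ _ a1 b2; lra.
set r1 := F (s + w) - F s - w * F' s in a3; set r2 := G (s + w) - G s - w * G' s in b3.
have -> : F (s + w) * G (s + w) - F s * G s - w * (F' s * G s + F s * G' s) =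
   F s * r2 + r1 * G (s + w) + w * F' s * (w * G' s + r2) by rewrite /r1 /r2; ring.
have nw := nm_ge0 w; set t := nm w in a3 b3 w3 nw *.
have e1 : nm (F s * r2) <= A1 * (A2 * t ^+ 2) by rewrite nmM ler_pM ?nm_ge0.
have e2 : nm (r1 * G (s + w)) <= A1 * t ^+ 2 * A2 by rewrite nmM ler_pM ?nm_ge0.
have e3 : nm (w * G' s + r2) <= t * A2 + t * A2.
  rewrite (le_trans (nmD _ _)) // lerD //; first by rewrite nmM ler_wpM2l.
  by rewrite (le_trans b3) // mulrC ler_wpM2r // expr2 ler_piMr.
have e4 : nm (w * F' s * (w * G' s + r2)) <= t * A1 * (t * A2 + t * A2).
  by rewrite nmM ler_pM ?nm_ge0 // nmM ler_wpM2l.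
rewrite (le_trans (nmD _ _)) // (le_trans (lerD (nmD _ _) (lexx _))) //.
by rewrite (le_trans (lerD (lerD e1 e2) e4)) //; apply: eqW; ring.
Qed.

Lemma taylor2V (K : set C) F F' (c : R) : 0 < c -> (forall s, K s -> c <= nm (F s)) -> taylor2 K F F' ->
  taylor2 K (fun s => (F s)^-1) (fun s => - F' s / F s ^+ 2).
Proof.
move=> c0 hc [A [h [A0 h0 H]]].
pose B := c^-1 + A / c ^+ 2 + 3 * A ^+ 2 / c ^+ 3.
have ci : 0 <= c^-1 by rewrite invr_ge0 ltW.
have B1 : 0 <= A / c ^+ 2 by rewrite divr_ge0 // exprn_ge0 // ltW.
have B2 : 0 <= 3 * A ^+ 2 / c ^+ 3 by rewrite divr_ge0 ?mulr_ge0 ?exprn_ge0 // ltW.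
exists B, (Num.min h 1); split; [by rewrite !addr_ge0|by rewrite lt_min h0 ltr01|].
move=> s w Ks Kw; rewrite !le_min => /andP[w1 w3].
have [a1 a2 a3] := H s w Ks Kw w1.
have f0 : F s != 0 by rewrite -nm_gt0 (lt_le_trans c0) ?hc.
have f1 : F (s + w) != 0 by rewrite -nm_gt0 (lt_le_trans c0) ?hc.
have iv (p : C) : c <= nm p -> nm p^-1 <= c^-1.
  by move=> hp; rewrite nmV lef_pV2 ?posrE // (lt_le_trans c0).
have ivn (p : C) n : c <= nm p -> (nm p ^+ n)^-1 <= (c ^+ n)^-1.
  move=> hp; rewrite lef_pV2 ?posrE ?exprn_gt0 ?(lt_le_trans c0) //.
  by rewrite lerXn2r ?nnegrE ?nm_ge0 ?(ltW c0).
split.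
- by have := iv _ (hc _ Ks); rewrite /B; lra.
- rewrite nmM nmN nmV nmX.
  have : nm (F' s) / nm (F s) ^+ 2 <= A / c ^+ 2 by rewrite ler_pM ?nm_ge0 ?invr_ge0 ?exprn_ge0 ?nm_ge0 ?ivn ?hc.
  by rewrite /B; lra.
set r1 := F (s + w) - F s - w * F' s in a3.
have -> : (F (s + w))^-1 - (F s)^-1 - w * (- F' s / F s ^+ 2) =
  (w * F' s * (r1 + w * F' s) - F s * r1) / (F s ^+ 2 * F (s + w)).
  by rewrite /r1; field; rewrite f0 f1.
have nw := nm_ge0 w; set t := nm w in a3 w3 nw *.
have e3 : nm (r1 + w * F' s) <= t * A + t * A.
  rewrite (le_trans (nmD _ _)) // lerD //; last by rewrite nmM ler_wpM2l.
  by rewrite (le_trans a3) // mulrC ler_wpM2r // expr2 ler_piMr.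
have e4 : nm (w * F' s * (r1 + w * F' s)) <= t * A * (t * A + t * A).
  by rewrite nmM ler_pM ?nm_ge0 // nmM ler_wpM2l.
have e1 : nm (F s * r1) <= A * (A * t ^+ 2) by rewrite nmM ler_pM ?nm_ge0.
have e5 : nm (w * F' s * (r1 + w * F' s) - F s * r1) <= 3 * A ^+ 2 * t ^+ 2.
  by rewrite (le_trans (nmB _ _)) // (le_trans (lerD e4 e1)) //; apply: eqW; ring.
have e6 : nm (F s ^+ 2 * F (s + w))^-1 <= (c ^+ 3)^-1.
  rewrite nmV nmM nmX lef_pV2 ?posrE ?exprn_gt0 ?mulr_gt0 ?exprn_gt0 ?(lt_le_trans c0 (hc _ _)) //.
  rewrite (_ : c ^+ 3 = c ^+ 2 * c); last by ring.
  by rewrite ler_pM ?exprn_ge0 ?(ltW c0) ?hc // lerXn2r ?nnegrE ?nm_ge0 ?(ltW c0) ?hc.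
rewrite nmM (le_trans (ler_pM (nm_ge0 _) (nm_ge0 _) e5 e6)) //.
rewrite (_ : 3 * A ^+ 2 * t ^+ 2 / c ^+ 3 = 3 * A ^+ 2 / c ^+ 3 * t ^+ 2); last by ring.
by rewrite ler_wpM2r ?exprn_ge0 // /B lerDr addr_ge0.
Qed.

Lemma taylor2_cexp (K : set C) (v B : R) : 0 <= B -> (forall s, K s -> nm s <= B) ->
  taylor2 K (fun s => cexp (s * cR v)) (fun s => cR v * cexp (s * cR v)).
Proof.
move=> B0 hB; pose E := expR (B * `|v|).
have E0 : 0 < E by exact: expR_gt0.
exists ((1 + `|v| + 4 * `|v| ^+ 2) * E), (2^-1 / (1 + `|v|)); split.
- by rewrite mulr_ge0 ?(ltW E0) // !addr_ge0 // mulr_ge0 // exprn_ge0.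
- by rewrite divr_gt0 // ltr_pwDl.
move=> s w Ks Kw hw.
have v0 := normr_ge0 v; have v2 : 0 <= 4 * `|v| ^+ 2 by rewrite mulr_ge0 // exprn_ge0.
have hE : nm (cexp (s * cR v)) <= E.
  rewrite nm_cexp ler_expR (le_trans (ler_norm _)) // (le_trans (absRe_le _)) // nmM nm_cR.
  by rewrite ler_wpM2r // hB.
split.
- by rewrite (le_trans hE) // ler_peMl ?(ltW E0) //; lra.
- by rewrite nmM nm_cR ler_pM ?nm_ge0 //; lra.
have hl : nm (w * cR v) <= 2^-1.
  rewrite nmM nm_cR (le_trans (ler_wpM2r v0 hw)) // -mulrA ger_pMr ?invr_gt0 //.
  by rewrite mulrC ler_pdivrMr ?ltr_pwDl // mul1r lerDr.
have -> : cexp ((s + w) * cR v) - cexp (s * cR v) - w * (cR v * cexp (s * cR v)) =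
  cexp (s * cR v) * (cexp (w * cR v) - 1 - w * cR v).
  by rewrite (mulrDl s) cexpD; ring.
rewrite nmM (le_trans (ler_pM (nm_ge0 _) (nm_ge0 _) hE (cexp_sub2_le hl))) //.
rewrite nmM nm_cR exprMn (_ : E * (4 * _) = 4 * `|v| ^+ 2 * E * nm w ^+ 2); last by ring.
by rewrite ler_wpM2r ?exprn_ge0 ?nm_ge0 // ler_wpM2r ?(ltW E0) //; lra.
Qed.

(** A radius and a bound common to all centres in K make the constants of the expansion uniform over
    K. *)
Lemma taylor2_polylim (K : set C) F (r B : R) : 0 < r -> 0 <= B ->
  (forall c, K c -> polylim r (fun z => F (c + z)) /\ forall z, nm z <= r -> nm (F (c + z)) <= B) ->
  taylor2 K F (der F).
Proof.
move=> r0 B0 H; pose x := 1 - (r / 2 + r) / 2 / r.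
have x0 : 0 < x.
  have -> : x = 4^-1 by rewrite /x; field; rewrite gt_eqF.
  by rewrite invr_gt0.
exists (B + B / r / x ^+ 2 + B / r ^+ 2 / x ^+ 3), (r / 2).
have b1 : 0 <= B / r / x ^+ 2 by rewrite !divr_ge0 ?exprn_ge0 // ltW.
have b2 : 0 <= B / r ^+ 2 / x ^+ 3 by rewrite !divr_ge0 ?exprn_ge0 // ltW.
split; [by rewrite !addr_ge0|by rewrite divr_gt0|].
move=> s w Ks Kw hw; have [Hp HB] := H s Ks.
have rh : 0 <= r / 2 by rewrite divr_ge0 // ltW.
have rr : r / 2 < r by lra.
have [_ h2 h3 _] := polylim_der rh rr Hp HB.
have z0 : nm (0 : C) <= r / 2 by rewrite nm0.
have z1 : nm (0 : C) <= r by rewrite nm0 ltW.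
have := h2 0 z0; have := HB 0 z1; have := h3 0 w z0; rewrite add0r addr0 -/x => H3 H1 H2.
split; [by lra|by lra|].
by rewrite (le_trans (H3 hw)) // ler_wpM2r ?exprn_ge0 ?nm_ge0 // lerDr addr_ge0.
Qed.

(* Compactness of [a, b] in the form of real induction. *)
Lemma creep (T : Type) (Y : set T) (f : R -> T -> R) (a b : R) : a <= b ->
  (forall x, a <= x <= b -> exists eta c : R, [/\ 0 < eta, 0 < c &
     forall x', a <= x' <= b -> `|x' - x| <= eta -> forall t : T, Y t -> c <= f x' t]) ->
  exists2 c, 0 < c & forall x, a <= x <= b -> forall t : T, Y t -> c <= f x t.
Proof.
move=> ab H.
pose S := [set x | a <= x <= b /\ exists2 c, 0 < c & forall x', a <= x' <= x -> forall t : T, Y t -> c <= f x' t].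
have Sa : S a.
  split; first by rewrite lexx.
  have [|eta [c [e0 c0 hc]]] := H a; first by rewrite lexx.
  exists c => // x' /andP[h1 h2]; have -> : x' = a by apply/eqP; rewrite eq_le h1 h2.
  by apply: hc; rewrite ?lexx // subrr normr0 ltW.
have ubS : ubound S b by move=> x [/andP[]].
have hS : has_sup S by split; [exists a|exists b].
have s1 : a <= sup S by apply: ub_le_sup hS.2 _ Sa.
have s2 : sup S <= b by apply: ge_sup => //; exists a.
have [|eta [c [e0 c0 hc]]] := H (sup S); first by rewrite s1 s2.
have [x [/andP[x1 x2] [c' c'0 hc']] xs] := sup_adherent e0 hS.
have ext x' : a <= x' <= b -> x' <= sup S + eta -> forall y : T, Y y -> Num.min c c' <= f x' y.
  move=> /andP[h1 h2] h3 y Yy; rewrite ge_min; case: (lerP x' x) => hx.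
    by rewrite (hc' x') ?orbT // h1.
  rewrite hc ?h1 // ler_norml; apply/andP; split; lra.
exists (Num.min c c'); first by rewrite lt_min c0.
move=> x' hx' y Yy; refine (ext x' hx' _ y Yy).
pose m := Num.min b (sup S + eta).
have Sm : S m.
  have mb : m <= b by rewrite ge_min lexx.
  have ms : m <= sup S + eta by rewrite ge_min lexx orbT.
  split; first by rewrite mb andbT le_min ab (le_trans s1) // lerDl ltW.
  exists (Num.min c c'); first by rewrite lt_min c0.
  by move=> u /andP[u1 u2] y' Yy'; apply: ext => //; rewrite ?u1 ?(le_trans u2).
have ms : m <= sup S by apply: ub_le_sup hS.2 _ Sm.
have : b <= sup S + eta.
  by move: ms; rewrite /m; case: (leP b (sup S + eta)) => // _; lra.
by case/andP: hx' => _; lra.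
Qed.

Definition rect (x1 x2 y1 y2 : R) : set C :=
  [set s | x1 <= complex.Re s <= x2 /\ y1 <= complex.Im s <= y2].

Lemma rect_bound x1 x2 y1 y2 : exists2 B : R, 0 <= B & forall s, rect x1 x2 y1 y2 s -> nm s <= B.
Proof.
exists (`|x1| + `|x2| + (`|y1| + `|y2|)); first by rewrite !addr_ge0.
move=> s [/andP[a b] /andP[c d]]; rewrite (le_trans (nm_ReIm _)) // lerD //.
  rewrite ler_norml; apply/andP; split.
    have := ler_norm (- x1); rewrite normrN; have := normr_ge0 x2; lra.
  have := ler_norm x2; have := normr_ge0 x1; lra.
rewrite ler_norml; apply/andP; split.
  have := ler_norm (- y1); rewrite normrN; have := normr_ge0 y2; lra.
have := ler_norm y2; have := normr_ge0 y1; lra.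
Qed.

(** Compactness one coordinate at a time: [creep] in y for fixed x, with a trivial parameter, then
    [creep] in x with y as the parameter. The Lipschitz bound carries half of a lower bound over to
    neighbouring points. *)
Lemma rect_inf x1 x2 y1 y2 F F' : x1 <= x2 -> y1 <= y2 -> taylor2 (rect x1 x2 y1 y2) F F' ->
  (forall s, rect x1 x2 y1 y2 s -> F s != 0) ->
  exists2 c : R, 0 < c & forall s, rect x1 x2 y1 y2 s -> c <= nm (F s).
Proof.
move=> x12 y12 hF Fn0; have [A [h [A0 h0 lip]]] := taylor2_lip hF.
pose f x y := nm (F (Complex x y)).
have A1 : 0 < 1 + A by rewrite ltr_pwDl.
have lip1 (s s' : C) : rect x1 x2 y1 y2 s -> rect x1 x2 y1 y2 s' -> nm (s' - s) <= h ->
  nm (F s) - A * nm (s' - s) <= nm (F s').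
  move=> Ks Ks' d; have := lip s (s' - s) Ks; rewrite addrC subrK => /(_ Ks' d) H.
  by have := nm_lB (F s) (F s'); rewrite nmBC; lra.
have small c : 0 < c -> exists2 eta, 0 < eta & eta <= h /\ A * eta <= c / 2.
  move=> c0; have c2 : 0 < c / 2 / (1 + A) by rewrite !divr_gt0.
  exists (Num.min h (c / 2 / (1 + A))); first by rewrite lt_min h0 c2.
  split; first by rewrite ge_min lexx.
  apply: (@le_trans _ _ (A * (c / 2 / (1 + A)))); first by rewrite ler_wpM2l // ge_min lexx orbT.
  by rewrite mulrCA ger_pMr ?divr_gt0 // ler_pdivrMr // mul1r lerDr.
have step1 x : x1 <= x <= x2 -> exists2 c, 0 < c & forall y, y1 <= y <= y2 -> forall u : unit, setT u -> c <= f x y.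
  move=> hx; apply: creep => // y hy.
  have fy : 0 < f x y by rewrite nm_gt0 Fn0 //; split.
  have [eta e0 [e1 e2]] := small _ fy; exists eta, (f x y / 2); split => //; first by rewrite divr_gt0.
  move=> y' hy' d _ _.
  have dd : nm (Complex x y' - Complex x y : C) = `|y' - y|.
    by rewrite nmE ReD ImD ReN ImN /= subrr expr0n add0r sqrtr_sqr.
  have := lip1 (Complex x y) (Complex x y') (conj hx hy) (conj hx hy').
  rewrite dd => /(_ (le_trans d e1)); have : A * `|y' - y| <= A * eta by rewrite ler_wpM2l.
  rewrite -/(f x y) -/(f x y'); lra.
have [x hx|c c0 hc] := @creep R [set y | y1 <= y <= y2] f x1 x2 x12.
  have [c c0 hc] := step1 x hx.
  have [eta e0 [e1 e2]] := small _ c0; exists eta, (c / 2); split => //; first by rewrite divr_gt0.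
  move=> x' hx' d y hy.
  have dd : nm (Complex x' y - Complex x y : C) = `|x' - x|.
    by rewrite nmE ReD ImD ReN ImN /= subrr expr0n addr0 sqrtr_sqr.
  have := lip1 (Complex x y) (Complex x' y) (conj hx hy) (conj hx' hy).
  rewrite dd => /(_ (le_trans d e1)); have : A * `|x' - x| <= A * eta by rewrite ler_wpM2l.
  have := hc y hy tt I; rewrite -/(f x y) -/(f x' y); lra.
exists c => // s [hx hy].
by have := hc _ hx _ hy; rewrite /f; case: (s).
Qed.

End ComplexDeriv.

(** * A discretised Perron formula *)

Section Grid.
Variable R : realType.
Local Notation C := (Cx R).
Implicit Types (x y v e : R) (z w s c : C) (F G : C -> C).
Local Notation invS := (@invS R).

Lemma invS_gt0 m : 0 < invS m. Proof. by rewrite invr_gt0. Qed.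

Definition grid_size (N m : nat) : nat := (2 * N * m.+1)%N.
Definition grid_edge (N m k : nat) : R := k%:R * invS m - N%:R.
Definition grid_mid (N m k : nat) : R := grid_edge N m k + invS m / 2.
(* Midpoint Riemann sum, over 2N(m+1) cells, of the integral of F(sg + it) dt for |t| <= N. *)
Definition gridint (N m : nat) (sg : R) F : C := cR (invS m) * \sum_(0 <= k < grid_size N m) F (Complex sg (grid_mid N m k)).

Lemma grid_edgeS N m k : grid_edge N m k.+1 = grid_mid N m k + invS m / 2.
Proof. by rewrite /grid_mid /grid_edge -natr1; field. Qed.

Lemma grid_edge0 N m : grid_edge N m 0 = - N%:R. Proof. by rewrite /grid_edge mul0r sub0r. Qed.

Lemma grid_size_invS N m : (grid_size N m)%:R * invS m = 2 * N%:R.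
Proof. by rewrite /grid_size /invS natrM -mulrA divff ?mulr1 ?natrM // pnatr_eq0. Qed.

Lemma grid_edgeN N m : grid_edge N m (grid_size N m) = N%:R.
Proof. by rewrite /grid_edge grid_size_invS; ring. Qed.

Lemma grid_edge_mono N m j k : (j <= k)%N -> grid_edge N m j <= grid_edge N m k.
Proof. by move=> jk; rewrite lerB // ler_wpM2r ?invS_ge0 // ler_nat. Qed.

Lemma grid_edge_bound N m k : (k <= grid_size N m)%N -> - N%:R <= grid_edge N m k <= N%:R.
Proof.
move=> kN; by have := grid_edge_mono N m (leq0n k); have := grid_edge_mono N m kN; rewrite grid_edge0 grid_edgeN => -> ->.
Qed.

Lemma grid_mid_bound N m k : (k < grid_size N m)%N -> - N%:R <= grid_mid N m k <= N%:R.
Proof.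
move=> kN; have /andP[h1 _] := grid_edge_bound (ltnW kN); have /andP[_ h2] := grid_edge_bound kN.
by have := invS_gt0 m; move: h2; rewrite grid_edgeS /grid_mid; lra.
Qed.

Lemma grid_edge_half N m : grid_edge N m (N * m.+1) = 0.
Proof. by rewrite /grid_edge natrM /invS mulfK ?subrr // pnatr_eq0. Qed.

(** 0 is itself an edge of the grid, so no cell straddles it and the sums of 1/(1 + t^2) reduce to
    one sign of t. *)
Lemma grid_edge_sign N m k : 0 <= grid_edge N m k \/ grid_edge N m k.+1 <= 0.
Proof. by case: (leqP (N * m.+1) k) => h; [left|right]; rewrite -(grid_edge_half N m) grid_edge_mono. Qed.

Lemma gridint_le N m sg F (g : nat -> R) :
  (forall k, (k < grid_size N m)%N -> nm (F (Complex sg (grid_mid N m k))) <= g k) ->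
  nm (gridint N m sg F) <= invS m * \sum_(0 <= k < grid_size N m) g k.
Proof.
move=> h; rewrite /gridint nmM nm_cR ger0_norm ?invS_ge0 // ler_wpM2l ?invS_ge0 //.
rewrite (le_trans (nm_sum _ _ _)) // big_nat_cond [leRHS]big_nat_cond ler_sum // => k.
by rewrite andbT => /andP[_ kN]; exact: h.
Qed.

Lemma sumr_cst (n : nat) x : \sum_(0 <= k < n) x = n%:R * x.
Proof. by rewrite sumr_const_nat subn0 mulr_natl. Qed.

Lemma gridint_sup N m sg F B :
  (forall k, (k < grid_size N m)%N -> nm (F (Complex sg (grid_mid N m k))) <= B) ->
  nm (gridint N m sg F) <= 2 * N%:R * B.
Proof.
move=> h; rewrite (le_trans (gridint_le h)) // sumr_cst mulrA (mulrC (invS m)) grid_size_invS; exact: lexx.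
Qed.

Lemma gridint_ext N m sg F G :
  (forall t, - N%:R <= t <= N%:R -> F (Complex sg t) = G (Complex sg t)) -> gridint N m sg F = gridint N m sg G.
Proof.
move=> h; congr (_ * _); rewrite big_nat_cond [RHS]big_nat_cond; apply: eq_bigr => k.
by rewrite andbT => /andP[_ kN]; rewrite h // grid_mid_bound.
Qed.

Lemma gridint_shift1 N m sg F : gridint N m sg (fun s => F (s + 1)) = gridint N m (sg + 1) F.
Proof.
by congr (_ * _); apply: eq_bigr => k _; congr F; apply: Cext; rewrite ?ReD ?ImD /= ?addr0.
Qed.

Lemma gridintD N m sg F G : gridint N m sg (fun s => F s + G s) = gridint N m sg F + gridint N m sg G.
Proof. by rewrite /gridint big_split mulrDr. Qed.

Lemma gridintZ N m sg c F : gridint N m sg (fun s => c * F s) = c * gridint N m sg F.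
Proof. by rewrite /gridint -mulr_sumr mulrCA. Qed.

Lemma gridintB N m sg F G : gridint N m sg (fun s => F s - G s) = gridint N m sg F - gridint N m sg G.
Proof. by rewrite /gridint sumrB mulrBr. Qed.

Lemma gridint_sum N m sg (I : Type) (l : seq I) (F : I -> C -> C) :
  gridint N m sg (fun s => \sum_(i <- l) F i s) = \sum_(i <- l) gridint N m sg (F i).
Proof. by rewrite /gridint exchange_big mulr_sumr. Qed.

(** The midpoints are symmetric about 0, so reversing the index realises s -> -s. *)
Lemma gridint_sym N m sg F : gridint N m (- sg) F = gridint N m sg (fun s => F (- s)).
Proof.
rewrite /gridint; congr (_ * _); rewrite big_nat_rev /= add0n.
rewrite big_nat_cond [RHS]big_nat_cond; apply: eq_bigr => k; rewrite andbT => /andP[_ kN].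
congr F; apply: Cext => //=; rewrite /grid_mid /grid_edge natrB // mulrBl grid_size_invS -natr1.
by field.
Qed.

Lemma telescope_grid_le N m (a : nat -> R) (G : R -> R) :
  (forall k, (k < grid_size N m)%N -> a k <= G (grid_edge N m k.+1) - G (grid_edge N m k)) ->
  \sum_(0 <= k < grid_size N m) a k <= G N%:R - G (- N%:R).
Proof.
move=> h; rewrite -{1}(grid_edgeN N m) -(grid_edge0 N m) -(telescope_sumr (fun k => G (grid_edge N m k))) //.
rewrite big_nat_cond [leRHS]big_nat_cond ler_sum // => k; rewrite andbT => /andP[_ kN]; exact: h.
Qed.

(* Replaces arctan as a bounded function whose increments control the sums of 1/(1+t^2). *)
Definition alg_atan (t : R) : R := t / (1 + `|t|).

(** Over a cell with midpoint u at distance at least h/2 from 0 the increment is h / ((1 + u)^2 -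
    h^2/4), which is comparable with h/(1 + u^2) because h <= 1. *)
Lemma alg_atan_diff N m k t : t = grid_mid N m k ->
  invS m / (2 * (1 + t ^+ 2)) <= alg_atan (grid_edge N m k.+1) - alg_atan (grid_edge N m k) <= 2 * invS m / (1 + t ^+ 2).
Proof.
move=> tE; set h := invS m.
have h0 : 0 < h by exact: invS_gt0.
have h1 : h <= 1 by exact: invS_le1.
have eE : grid_edge N m k = t - h / 2 by rewrite tE /grid_mid -/h; ring.
have eE' : grid_edge N m k.+1 = t + h / 2 by rewrite grid_edgeS tE.
rewrite eE eE'.
suff H u : 0 <= u - h / 2 -> h / (2 * (1 + u ^+ 2)) <= alg_atan (u + h / 2) - alg_atan (u - h / 2) <= 2 * h / (1 + u ^+ 2).
  case: (grid_edge_sign N m k); rewrite ?eE ?eE' => s1; first exact: H.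
  have := H (- t); rewrite sqrrN => Ht.
  have -> : alg_atan (t + h / 2) - alg_atan (t - h / 2) = alg_atan (- t + h / 2) - alg_atan (- t - h / 2); last by apply: Ht; lra.
  have GN (w : R) : alg_atan (- w) = - alg_atan w by rewrite /alg_atan normrN mulNr.
  have -> : t + h / 2 = - (- t - h / 2) by ring.
  have -> : t - h / 2 = - (- t + h / 2) by ring.
  by rewrite !GN; ring.
move=> u0; rewrite /alg_atan !ger0_norm //; last by lra.
have -> : (u + h / 2) / (1 + (u + h / 2)) - (u - h / 2) / (1 + (u - h / 2)) =
   h / ((1 + u) ^+ 2 - h ^+ 2 / 4).
  by field; apply/and3P; split; apply/lt0r_neq0; nra.
have P1 : 0 < 1 + u ^+ 2 by nra.
have P2 : 0 < (1 + u) ^+ 2 - h ^+ 2 / 4 by nra.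
have u00 : 0 <= u by lra.
have hsq : h ^+ 2 <= 1 by nra.
apply/andP; split; first by rewrite ler_wpM2l ?(ltW h0) // lef_pV2 ?posrE //; first (by have := sqr_ge0 (u - 1); have := sqr_ge0 h; nra); nra.
rewrite ler_pdivrMr // mulrAC ler_pdivlMr // (mulrC 2) -mulrA ler_wpM2l ?(ltW h0) //; nra.
Qed.

Lemma alg_atan_le1 t : `|alg_atan t| <= 1.
Proof.
have n0 := normr_ge0 t; have p : 0 < 1 + `|t| by lra.
rewrite /alg_atan normrM normfV (ger0_norm (ltW p)) ler_pdivrMr // mul1r; lra.
Qed.

Lemma sum_1t2 N m : invS m * \sum_(0 <= k < grid_size N m) (1 + grid_mid N m k ^+ 2)^-1 <= 4.
Proof.
have H : \sum_(0 <= k < grid_size N m) invS m / (2 * (1 + grid_mid N m k ^+ 2)) <= alg_atan N%:R - alg_atan (- N%:R).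
  by apply: telescope_grid_le => k _; have /andP[] := alg_atan_diff (erefl (grid_mid N m k)).
have := alg_atan_le1 N%:R; have := alg_atan_le1 (- N%:R); rewrite !ler_norml => /andP[a1 a2] /andP[b1 b2].
rewrite mulr_sumr; suff -> : \sum_(0 <= i < grid_size N m) invS m * (1 + grid_mid N m i ^+ 2)^-1 =
  2 * \sum_(0 <= k < grid_size N m) invS m / (2 * (1 + grid_mid N m k ^+ 2)) by lra.
rewrite mulr_sumr; apply: eq_bigr => k _; rewrite invfM.
have : (2 : R) != 0 by []. by move: (_^-1) (invS m) => X Y h; field.
Qed.

Lemma sum_1t2_ge N m : (0 < N)%N -> 2^-1 <= invS m * \sum_(0 <= k < grid_size N m) (1 + grid_mid N m k ^+ 2)^-1.
Proof.
move=> N0.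
have H : \sum_(0 <= k < grid_size N m) - (2 * invS m / (1 + grid_mid N m k ^+ 2)) <= (- alg_atan N%:R) - (- alg_atan (- N%:R)).
  by apply: (@telescope_grid_le _ _ _ (fun t => - alg_atan t)) => k _; have /andP[_] := alg_atan_diff (erefl (grid_mid N m k)); lra.
have GN : alg_atan (- N%:R) = - alg_atan N%:R by rewrite /alg_atan normrN mulNr.
have G2 : 2^-1 <= alg_atan N%:R.
  rewrite /alg_atan ger0_norm ?ler0n // ler_pdivlMr; last by rewrite ltr_pwDl.
  have : 1 <= N%:R :> R by rewrite ler1n. lra.
rewrite GN opprK sumrN in H.
rewrite mulr_sumr.
suff E : \sum_(0 <= k < grid_size N m) 2 * invS m / (1 + grid_mid N m k ^+ 2) =
  2 * \sum_(0 <= i < grid_size N m) invS m * (1 + grid_mid N m i ^+ 2)^-1 by rewrite E in H; lra.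
by rewrite mulr_sumr; apply: eq_bigr => k _; rewrite mulrA.
Qed.

(** Cauchy's theorem for a rectangle, discretised. The line is moved in m + 1 steps of width eta.
    One step changes the sum by eta times the Riemann sum of F', and that sum telescopes vertically
    to the values of F at the two ends, bounded by B. The quadratic remainders of all cells add up
    to O(1/(m + 1)). *)
Lemma gridint_shift (N : nat) (sg1 sg2 B e : R) F F' : sg1 <= sg2 ->
  taylor2 (rect sg1 sg2 (- N%:R) N%:R) F F' ->
  (forall sg, sg1 <= sg <= sg2 -> nm (F (Complex sg N%:R)) <= B /\ nm (F (Complex sg (- N%:R))) <= B) ->
  0 < e -> exists m0, forall m, (m0 <= m)%N ->
    nm (gridint N m sg2 F - gridint N m sg1 F) <= 2 * (sg2 - sg1) * B + e.
Proof.
move=> s12 [A [h0 [A0 h00 hF]]] hB e0.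
pose d := sg2 - sg1; have d0 : 0 <= d by rewrite subr_ge0.
pose K := N%:R * A * d * (1 + 2 * d).
have N0 : (0 : R) <= N%:R by rewrite ler0n.
have K0 : 0 <= K.
  by apply: mulr_ge0; [apply: mulr_ge0 => //; exact: mulr_ge0|rewrite addr_ge0 // mulr_ge0].
have [m0 hm0] : exists m0, invS m0 <= Num.min (e / (1 + K)) (h0 / (1 + d)).
  by apply: inv_succ_small; rewrite lt_min !divr_gt0 //; lra.
exists m0 => m mm; set h := invS m.
have hh0 : 0 < h by exact: invS_gt0.
have hm : h <= Num.min (e / (1 + K)) (h0 / (1 + d)).
  by apply: le_trans hm0; rewrite lef_pV2 ?posrE // ler_nat.
move: hm; rewrite le_min => /andP[he hh].
have hh' : h * (1 + d) <= h0 by rewrite -ler_pdivlMr //; lra.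
have he' : h * (1 + K) <= e by rewrite -ler_pdivlMr //; lra.
pose eta := d * h.
have eta0 : 0 <= eta by rewrite mulr_ge0 // ltW.
pose sg i := sg1 + i%:R * eta.
have sg0 : sg 0%N = sg1 by rewrite /sg mul0r addr0.
have m1h : m.+1%:R * h = 1 by rewrite /h /invS divff // pnatr_eq0.
have sgm : sg m.+1 = sg2.
  by rewrite /sg /eta mulrCA m1h mulr1 /d; ring.
have sgb i : (i <= m.+1)%N -> sg1 <= sg i <= sg2.
  move=> im; rewrite /sg lerDl mulr_ge0 //=.
  rewrite -[leRHS]sgm /sg lerD2l ler_wpM2r // ler_nat //.
have Nh : (grid_size N m)%:R * h = 2 * N%:R by exact: grid_size_invS.
have step i : (i < m.+1)%N -> nm (gridint N m (sg i.+1) F - gridint N m (sg i) F) <=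
    2 * eta * B + N%:R * A * h * eta + 2 * N%:R * A * eta ^+ 2.
  move=> im; have b1 := sgb i (ltnW im); have b2 := sgb i.+1 im.
  have sgS : sg i.+1 = sg i + eta by rewrite /sg -natr1; ring.
  pose S := \sum_(0 <= k < grid_size N m) F' (Complex (sg i) (grid_mid N m k)).
  (* Horizontal Taylor expansion from abscissa sg i to the next one, at each midpoint. *)
  have H1 : nm (gridint N m (sg i.+1) F - gridint N m (sg i) F - cR h * (cR eta * S)) <= 2 * N%:R * A * eta ^+ 2.
    rewrite /gridint -mulrBr -mulrBr nmM nm_cR ger0_norm ?(ltW hh0) //.
    rewrite /S mulr_sumr -!sumrB.
    apply: (@le_trans _ _ (h * \sum_(0 <= k < grid_size N m) (A * eta ^+ 2))); last first.
      by rewrite sumr_cst mulrA (mulrC h) Nh; apply: eqW; ring.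
    rewrite ler_wpM2l ?(ltW hh0) // (le_trans (nm_sum _ _ _)) //.
    rewrite big_nat_cond [leRHS]big_nat_cond ler_sum // => k; rewrite andbT => /andP[_ kN].
    have tb := grid_mid_bound kN.
    have r1 : rect sg1 sg2 (- N%:R) N%:R (Complex (sg i) (grid_mid N m k)) by [].
    have E : Complex (sg i.+1) (grid_mid N m k) = Complex (sg i) (grid_mid N m k) + cR eta :> C.
      by apply: Cext; rewrite ?ReD ?ImD /= ?addr0.
    have r2 : rect sg1 sg2 (- N%:R) N%:R (Complex (sg i) (grid_mid N m k) + cR eta) by rewrite -E.
    have ne : nm (cR eta : C) = eta by rewrite nm_cR ger0_norm.
    have [|_ _] := hF _ _ r1 r2; first by rewrite ne /eta; nra.
    by rewrite ne -E.
  (* Vertical expansion about the midpoint of each cell: its end values differ by ih F' up to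
     O(h^2), and the differences telescope. The same sum S as in [H1] appears, which is the
     Cauchy-Riemann relation. *)
  have H2 : nm (ci R * cR h * S - (F (Complex (sg i) N%:R) - F (Complex (sg i) (- N%:R)))) <= N%:R * A * h.
    rewrite -{1}(grid_edgeN N m) -(grid_edge0 N m) -(telescope_sumr (fun k => F (Complex (sg i) (grid_edge N m k)))) //.
    rewrite /S mulr_sumr -sumrB.
    apply: (@le_trans _ _ (\sum_(0 <= k < grid_size N m) (A * (h ^+ 2 / 2)))); last first.
      rewrite sumr_cst.
      have -> : (grid_size N m)%:R * (A * (h ^+ 2 / 2)) = A * h / 2 * ((grid_size N m)%:R * h) by ring.
      by rewrite Nh; apply: eqW; field.
    rewrite (le_trans (nm_sum _ _ _)) //.
    rewrite big_nat_cond [leRHS]big_nat_cond ler_sum // => k; rewrite andbT => /andP[_ kN].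
    have tb := grid_mid_bound kN; have eb := grid_edge_bound (ltnW kN); have eb' := grid_edge_bound kN.
    set s := Complex (sg i) (grid_mid N m k).
    have r1 : rect sg1 sg2 (- N%:R) N%:R s by [].
    pose w : C := Complex 0 (h / 2).
    have nw : nm w = h / 2.
      have -> : w = ci R * cR (h / 2) by apply: Cext; rewrite ?ReM ?ImM /=; ring.
      by rewrite nmM nm_cR ger0_norm ?divr_ge0 ?(ltW hh0) // nmE /= expr0n expr1n add0r sqrtr1 mul1r.
    have E1 : Complex (sg i) (grid_edge N m k.+1) = s + w.
      by rewrite grid_edgeS; apply: Cext; rewrite ?ReD ?ImD /= ?addr0.
    have E2 : Complex (sg i) (grid_edge N m k) = s + - w.
      by apply: Cext; rewrite ?ReD ?ImD ?ReN ?ImN /= ?oppr0 ?addr0 // /grid_mid -/h; ring.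
    have wh : nm w <= h0 by rewrite nw; nra.
    have r2 : rect sg1 sg2 (- N%:R) N%:R (s + w) by rewrite -E1.
    have [_ _ P1] := hF s w r1 r2 wh.
    have wh' : nm (- w) <= h0 by rewrite nmN.
    have r3 : rect sg1 sg2 (- N%:R) N%:R (s + - w) by rewrite -E2.
    have [_ _ P2] := hF s (- w) r1 r3 wh'.
    rewrite E1 E2.
    have -> : ci R * cR h * F' s - (F (s + w) - F (s + - w)) =
      (F (s + - w) - F s - (- w) * F' s) - (F (s + w) - F s - w * F' s).
      have -> : ci R * cR h = w + w by apply: Cext; rewrite ?ReM ?ImM ?ReD ?ImD /=; field.
      by ring.
    rewrite (le_trans (nmB _ _)) // (le_trans (lerD P2 P1)) // nmN nw; apply: eqW; by field.
  have [B1 B2] := hB _ b1.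
  have ci1 : nm (ci R) = 1 by rewrite nmE /= expr0n expr1n add0r sqrtr1.
  have H3 : nm (cR h * (cR eta * S)) <= eta * (2 * B + N%:R * A * h).
    have -> : nm (cR h * (cR eta * S)) = eta * nm (ci R * cR h * S).
      by rewrite !nmM ci1 !nm_cR (ger0_norm eta0); ring.
    rewrite ler_wpM2l //.
    set X := F _ - F _ in H2.
    have hX : nm X <= 2 * B by rewrite (le_trans (nmB _ _)) //; lra.
    have -> : ci R * cR h * S = X + (ci R * cR h * S - X) by ring.
    by rewrite (le_trans (nmD _ _)) // lerD.
  set U := gridint N m (sg i.+1) F - _ in H1 *; set V := cR h * _ in H1 H3.
  have -> : U = V + (U - V) by ring.
  rewrite (le_trans (nmD _ _)) // (le_trans (lerD H3 H1)) //; apply: eqW; ring.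
have -> : gridint N m sg2 F - gridint N m sg1 F = \sum_(0 <= i < m.+1) (gridint N m (sg i.+1) F - gridint N m (sg i) F).
  by rewrite (telescope_sumr (fun i => gridint N m (sg i) F)) // sgm sg0.
apply: (@le_trans _ _ (\sum_(0 <= i < m.+1) (2 * eta * B + N%:R * A * h * eta + 2 * N%:R * A * eta ^+ 2))).
  rewrite (le_trans (nm_sum _ _ _)) //.
  rewrite big_nat_cond [leRHS]big_nat_cond ler_sum // => k; rewrite andbT => /andP[_ kN]; exact: step.
rewrite sumr_cst.
have -> : m.+1%:R * (2 * eta * B + N%:R * A * h * eta + 2 * N%:R * A * eta ^+ 2) =
  (m.+1%:R * h) * (2 * d * B) + (m.+1%:R * h) * h * K.
  by rewrite /eta /K; ring.
rewrite m1h !mul1r -/d.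
have -> : 2 * d * B = 2 * d * B * 1 by rewrite mulr1.
rewrite mulr1 lerD2l; nra.
Qed.

End Grid.

(** * The Perron kernel with Fejer weight *)

Section Kernel.
Variable R : realType.
Local Notation C := (Cx R).
Implicit Types (x y v u e : R) (z w s c : C) (F G : C -> C).
Local Notation invS := (@invS R).
Local Notation grid_mid := (@grid_mid R).

Lemma nm_Re_le s : complex.Re s <= nm s.
Proof. exact: le_trans (ler_norm _) (absRe_le s). Qed.

Lemma nm_add1 s : 0 <= complex.Re s -> nm s <= nm (s + 1).
Proof.
move=> h; rewrite -(ler_pXn2r (n := 2)) ?nnegrE ?nm_ge0 // !nm_sqr ReD ImD /= addr0.
by rewrite lerD2r ler_pXn2r ?nnegrE //; lra.
Qed.

(** The residues at 0 and -1 are 1 and -e^(-v), and their sum is the Fejer weight; the decay is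
    quadratic on vertical lines. *)
Definition perron_kernel v s : C := cexp (s * cR v) / (s * (s + 1)).

Lemma perron_kernel_le v s (d : R) : 0 <= complex.Re s -> 0 < d -> d <= nm s ->
  nm (perron_kernel v s) <= expR (complex.Re s * v) / d ^+ 2.
Proof.
move=> r0 d0 ds; rewrite /perron_kernel nmM nm_cexp nmV nmM ReM /= mulr0 subr0.
rewrite ler_wpM2l ?expR_ge0 // lef_pV2 ?posrE ?exprn_gt0 //.
  by rewrite expr2 ler_pM ?(ltW d0) // (le_trans ds) // nm_add1.
by rewrite mulr_gt0 ?(lt_le_trans d0) // (le_trans ds) // nm_add1.
Qed.

Lemma taylor2_pole x1 x2 y1 y2 : 0 < x1 -> exists F', taylor2 (rect x1 x2 y1 y2) (fun s : C => (s * (s + 1))^-1) F'.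
Proof.
move=> x10; have [B B0 hB] := rect_bound x1 x2 y1 y2.
have h1 := taylor2_id hB.
have h2 := taylor2M h1 (taylor2D h1 (taylor2_cst (rect x1 x2 y1 y2) 1)).
have x12 : 0 < x1 ^+ 2 by rewrite exprn_gt0.
eexists; apply: (taylor2V x12 _ h2) => s [/andP[a1 _] _].
rewrite nmM expr2 ler_pM ?(ltW x10) //; first by rewrite (le_trans a1) ?nm_Re_le.
by rewrite (le_trans a1) // (le_trans (nm_Re_le s)) // nm_add1 // (le_trans _ a1) // ltW.
Qed.

Lemma taylor2_perron_kernel v x1 x2 y1 y2 : 0 < x1 -> exists F', taylor2 (rect x1 x2 y1 y2) (perron_kernel v) F'.
Proof.
move=> x10; have [B B0 hB] := rect_bound x1 x2 y1 y2.
have [F' hF'] := taylor2_pole x2 y1 y2 x10.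
by eexists; exact: (taylor2M (taylor2_cexp v B0 hB) hF').
Qed.

(* Plays the role of the factor 2 pi of Perron's formula; only the lower bound [kernel_mass_ge] matters. *)
Definition kernel_mass (N m : nat) : C := gridint N m (5 / 2) (fun s => s^-1) + gridint N m (7 / 2) (fun s => s^-1).

(** The real part of 1/s is positive on both lines, and on Re s = 5/2 it is at least 2/5 times 1/(1
    + t^2), whose Riemann sum is at least 1/2. *)
Lemma kernel_mass_ge N m : (0 < N)%N -> 5^-1 <= nm (kernel_mass N m).
Proof.
move=> N0.
have ReW sg : complex.Re (gridint N m sg (fun s => s^-1)) =
    invS m * \sum_(0 <= k < grid_size N m) sg / (sg ^+ 2 + grid_mid N m k ^+ 2).
  rewrite /gridint cscale /= Re_sum; congr (_ * _); apply: eq_bigr.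
apply: le_trans (nm_Re_le _); rewrite /kernel_mass ReD !ReW.
have h0 := invS_gt0 R m.
have H1 := sum_1t2_ge R m N0.
have H2 : 0 <= invS m * \sum_(0 <= k < grid_size N m) (7 / 2) / ((7 / 2) ^+ 2 + grid_mid N m k ^+ 2).
  apply: mulr_ge0; first exact: ltW.
  by apply: sumr_ge0 => k _; rewrite divr_ge0 ?addr_ge0 ?sqr_ge0 // divr_ge0.
have H3 : 2 / 5 * (invS m * \sum_(0 <= k < grid_size N m) (1 + grid_mid N m k ^+ 2)^-1) <=
    invS m * \sum_(0 <= k < grid_size N m) (5 / 2) / ((5 / 2) ^+ 2 + grid_mid N m k ^+ 2).
  rewrite mulrCA ler_wpM2l ?(ltW h0) // mulr_sumr ler_sum // => k _.
  set t := grid_mid N m k; have t2 := sqr_ge0 t.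
  rewrite ler_pdivlMr; last by lra.
  by rewrite mulrAC ler_pdivrMr; lra.
move: H1 H2 H3; set X := invS m * _; set Y := invS m * _; set Z := invS m * _; lra.
Qed.

(** For v <= 0 the exponential does not grow to the right, so the line is moved to Re s = N, where
    the kernel is O(N^(-2)) on a segment of length 2N. *)
Lemma perron_term_neg v (N : nat) e : v <= 0 -> (3 <= N)%N -> 0 < e -> exists m0, forall m, (m0 <= m)%N ->
  nm (gridint N m (5 / 2) (perron_kernel v)) <= 4 * expR (5 / 2 * v) / N%:R + e.
Proof.
move=> v0 N3 e0.
have N3' : 3 <= N%:R :> R by rewrite (ler_nat _ 3).
have N0 : 0 < N%:R :> R by lra.
have c0 : (0 : R) < 5 / 2 by rewrite divr_gt0.
have [F' hF'] := taylor2_perron_kernel v N%:R (- N%:R) N%:R c0.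
have cN : 5 / 2 <= N%:R :> R by lra.
set X := expR (5 / 2 * v).
have FB s : 5 / 2 <= complex.Re s -> N%:R <= nm s -> nm (perron_kernel v s) <= X / N%:R ^+ 2.
  move=> a1 a2; rewrite (le_trans (perron_kernel_le v _ N0 a2)) //; first by lra.
  by rewrite ler_wpM2r ?invr_ge0 ?exprn_ge0 ?(ltW N0) // ler_expR; nra.
have nIm (sg t : R) : `|t| <= nm (Complex sg t : C) by exact: (@absIm_le _ (Complex sg t)).
have [sg /andP[a1 a2]|m0 hm0] := gridint_shift cN hF' (B := X / N%:R ^+ 2) _ e0.
  split; apply: FB => //; apply: le_trans (nIm _ _); rewrite ?normrN ger0_norm //.
exists m0 => m /hm0 H.
have H2 : nm (gridint N m N%:R (perron_kernel v)) <= 2 * N%:R * (X / N%:R ^+ 2).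
  apply: gridint_sup => k kN; apply: FB => //; exact: (@nm_Re_le (Complex N%:R _)).
have -> : gridint N m (5 / 2) (perron_kernel v) = gridint N m N%:R (perron_kernel v) - (gridint N m N%:R (perron_kernel v) - gridint N m (5 / 2) (perron_kernel v)) by ring.
rewrite (le_trans (nmB _ _)) // (le_trans (lerD H2 H)) //.
rewrite addrA lerD2r.
have -> : 2 * N%:R * (X / N%:R ^+ 2) = 2 * (X / N%:R) by field; exact: lt0r_neq0.
have -> : 2 * (N%:R - 5 / 2) * (X / N%:R ^+ 2) = 2 * (X / N%:R) - 5 * (X / N%:R ^+ 2) by field; exact: lt0r_neq0.
have -> : 4 * X / N%:R = 4 * (X / N%:R) by ring.
have : 0 <= X / N%:R ^+ 2 by rewrite divr_ge0 ?expR_ge0 // exprn_ge0 // ltW.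
move: (X / N%:R) (X / _) => a b; lra.
Qed.

(** (e^(vs) - 1)/s extends over 0: e^(vs) - 1 is factored at 0, where its order is neither infinite,
    as e^(vr) > 1, nor 0, as it vanishes there. This gives a pole-free function to move across 0. *)
Lemma E1_ex v (r : R) : 0 < v -> 0 < r -> exists E1 E1' : C -> C,
  taylor2 [set s | nm s <= r] E1 E1' /\ forall s, nm s <= r -> s * E1 s = cexp (s * cR v) - 1.
Proof.
move=> v0 r0; pose f s : C := cexp (cR v * s) + (-1).
have r40 : 0 < 4 * r by rewrite mulr_gt0.
have fp : polylim (4 * r) f.
  by apply: polylimD; [exact: polylim_cexp (ltW r40)|apply: (polylim_ext _ (polylim_poly (4 * r) (-1)%:P)) => z _; rewrite hornerC].
have r2 : 4 * r / 2 = 2 * r by field.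
have [h|[[|m] [g [gp g0 fg]]]] := polylim_factor r40 fp; rewrite r2 in h || rewrite r2 in gp fg.
- exfalso; pose x := r.
  have := h (cR x); rewrite nm_cR ger0_norm ?(ltW r0) // => /(_ ltac:(rewrite /x; lra)).
  rewrite /f -cRM cexp_cR -cR1 -cRN -cRD => /eqP; rewrite cR_eq0.
  have : 1 < expR (v * x) by rewrite expR_gt1 mulr_gt0.
  by move=> a /eqP; lra.
- exfalso; have := fg 0; rewrite nm0 expr0 mul1r /f mulr0 cexp0 subrr => /(_ ltac:(lra)) /esym/eqP.
  by rewrite (negbTE g0).
have gp2 : polylim (2 * r) (fun z => z ^+ m * g z).
  have := gp. move=> _ e' e'0.
  have [B B0 hB] := polylim_bounded (ltW (ltac:(rewrite mulr_gt0 //) : 0 < 2 * r)) gp.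
  have q0 : 0 < e' / (1 + (2 * r) ^+ m).
    by rewrite divr_gt0 // ltr_pwDl // exprn_ge0 // mulr_ge0 // ltW.
  have [p hp] := gp _ q0; exists ('X^m * p) => z hz.
  rewrite hornerM hornerXn -mulrBr nmM nmX.
  apply: (@le_trans _ _ ((2 * r) ^+ m * (e' / (1 + (2 * r) ^+ m)))).
    by rewrite ler_pM ?exprn_ge0 ?nm_ge0 ?hp //; apply: lerXn2r; rewrite ?nnegrE ?nm_ge0 // mulr_ge0 // ltW.
  by rewrite mulrCA ger_pMr // ler_pdivrMr ?mul1r ?lerDr // ltr_pwDl // exprn_ge0 // mulr_ge0 // ltW.
pose E1 z : C := z ^+ m * g z.
have r20 : 0 <= 2 * r by rewrite mulr_ge0 // ltW.
have [B B0 hB] := polylim_bounded r20 gp2.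
have gp3 : polylim (2 * r) (fun z => E1 (0 + z)) by apply: (polylim_ext _ gp2) => z _; rewrite add0r.
have hB3 z : nm z <= 2 * r -> nm (E1 (0 + z)) <= B by rewrite add0r; exact: hB.
have rr : r < 2 * r by lra.
have [_ d1 d2 _] := polylim_der (ltW r0) rr gp3 hB3.
set A1 := B / _ / _ in d1; set A2 := B / _ / _ in d2.
exists E1, (der E1); split; last first.
  move=> s hs; have := fg s; rewrite /f (mulrC (cR v)) => ->; last by lra.
  by rewrite /E1 exprS mulrA.
exists (Num.max B (Num.max A1 A2)), 1; split => //.
  by rewrite le_max B0.
move=> s w /= hs hw _; split.
- by rewrite le_max; have := hB s; rewrite /E1 => -> //; lra.
- by have := d1 s hs; rewrite add0r => h; rewrite !le_max h !orbT.
have := d2 s w hs hw; rewrite !add0r => h; rewrite (le_trans h) // ler_wpM2r ?exprn_ge0 ?nm_ge0 //.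
by rewrite !le_max lexx !orbT.
Qed.

Lemma taylor2_sub (K K' : set C) F F' : (forall s, K s -> K' s) -> taylor2 K' F F' -> taylor2 K F F'.
Proof.
move=> h [A [d [A0 d0 H]]]; exists A, d; split => // s w h1 h2 h3; exact: H (h _ h1) (h _ h2) h3.
Qed.

Lemma taylor2_shift (K K' : set C) F F' c : (forall s, K s -> K' (s + c)) -> taylor2 K' F F' ->
  taylor2 K (fun s => F (s + c)) (fun s => F' (s + c)).
Proof.
move=> h [A [d [A0 d0 H]]]; exists A, d; split => // s w h1 h2 h3.
have -> : s + w + c = s + c + w by ring.
apply: H => //; first exact: h.
by have -> : s + c + w = s + w + c by [ring]; exact: h.
Qed.

Lemma perron_term_pos v (N : nat) e : 0 < v -> (3 <= N)%N -> 0 < e -> exists m0, forall m, (m0 <= m)%N ->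
  nm (gridint N m (5 / 2) (perron_kernel v) - kernel_mass N m * cR (1 - expR (- v))) <= 40 * expR (5 / 2 * v) / N%:R + e.
Proof.
move=> v0 N3 e0.
have N3' : 3 <= N%:R :> R by rewrite (ler_nat _ 3).
have N0 : 0 < N%:R :> R by lra.
have r0 : 0 < 5 + N%:R :> R by lra.
have [E1 [E1' [hso hE]]] := E1_ex v0 r0.
set q := expR (- v); have q0 : 0 < q by exact: expR_gt0.
have q1 : q <= 1 by rewrite -expR0 ler_expR; lra.
(* The kernel with both poles removed: off the poles it equals the kernel minus 1/s plus e^(-v)/(s +
   1). *)
pose G s := E1 s - cR q * E1 (s + 1).
have inr s : rect (- (7 / 2)) (7 / 2) (- N%:R) N%:R s -> nm s <= 5 + N%:R.
  move=> [/andP[a1 a2] /andP[b1 b2]]; rewrite (le_trans (nm_ReIm _)) // lerD //.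
    by rewrite ler_norml; apply/andP; split; lra.
  by rewrite ler_norml; apply/andP; split.
pose K : set C := rect (- (7 / 2)) (5 / 2) (- N%:R) N%:R.
have K1 s : K s -> nm s <= 5 + N%:R.
  by move=> [/andP[a1 a2] b]; apply: inr; split => //; apply/andP; split => //; lra.
have K2 s : K s -> nm (s + 1) <= 5 + N%:R.
  move=> [/andP[a1 a2] b]; apply: inr; split; rewrite ?ReD ?ImD /= ?addr0 //.
  by apply/andP; split; lra.
have hG : exists G', taylor2 K G G'.
  have h1 := taylor2_sub (K := K) K1 hso.
  have h2 := taylor2_shift (K := K) K2 hso.
  have h3 := taylor2D h1 (taylor2M (taylor2_cst K (- cR q)) h2).
  eexists; apply: (taylor2_ext _ _ h3) => // s _.
  by rewrite /G mulNr.
have [G' hG'] := hG.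
have GE s : K s -> s != 0 -> s + 1 != 0 -> G s = perron_kernel v s - s^-1 + cR q * (s + 1)^-1.
  move=> Ks s0 s1.
  have e1 : E1 s = (cexp (s * cR v) - 1) / s by rewrite -(hE s (K1 s Ks)) mulrC mulKf.
  have e2 : E1 (s + 1) = (cexp (s * cR v) * cR (expR v) - 1) / (s + 1).
    have ee : cexp ((s + 1) * cR v) = cexp (s * cR v) * cR (expR v) by rewrite mulrDl mul1r cexpD cexp_cR.
    rewrite -ee -(hE _ (K2 s Ks)).
    by rewrite mulrC mulKf.
  have e3 : cR q * cR (expR v) = 1 :> C by rewrite -cRM /q expRN mulVf ?cR1 // lt0r_neq0 // expR_gt0.
  rewrite /G e1 e2 /perron_kernel.
  have -> : cR q * ((cexp (s * cR v) * cR (expR v) - 1) / (s + 1)) =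
    (cexp (s * cR v) * (cR q * cR (expR v)) - cR q) / (s + 1) by ring.
  by rewrite e3; field; rewrite s0 s1.
set X := expR (5 / 2 * v).
have X1 : 1 <= X by rewrite -expR0 ler_expR; nra.
have hor s : -(7/2) <= complex.Re s <= 5 / 2 -> `|complex.Im s| = N%:R -> nm (G s) <= 3 * X / N%:R.
  move=> /andP[a1 a2] b.
  have sim : - N%:R <= complex.Im s <= N%:R by rewrite -ler_norml b.
  have n1 : N%:R <= nm s by rewrite -b absIm_le.
  have n2 : N%:R <= nm (s + 1) by rewrite -b (le_trans _ (absIm_le _)) // ImD /= addr0.
  have s0 : s != 0 by rewrite -nm_gt0 (lt_le_trans N0).
  have s1 : s + 1 != 0 by rewrite -nm_gt0 (lt_le_trans N0).
  rewrite GE //; last by split => //; rewrite a1.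
  have i1 : (nm s)^-1 <= N%:R^-1 by rewrite lef_pV2 ?posrE // (lt_le_trans N0).
  have i2 : (nm (s + 1))^-1 <= N%:R^-1 by rewrite lef_pV2 ?posrE // (lt_le_trans N0).
  have B1 : nm (perron_kernel v s) <= X / N%:R.
    rewrite /perron_kernel nmM nm_cexp nmV nmM invfM ReM /= mulr0 subr0.
    apply: ler_pM; rewrite ?expR_ge0 ?mulr_ge0 ?invr_ge0 ?nm_ge0 //; first by rewrite ler_expR; nra.
    apply: (@le_trans _ _ (N%:R^-1 * 1)); last by rewrite mulr1.
    rewrite ler_pM ?invr_ge0 ?nm_ge0 // (le_trans i2) // invf_le1 //; clear - R N0 N3' n2; lra.
  have B2 : nm (s^-1) <= X / N%:R.
    by rewrite nmV (le_trans i1) // ler_peMl // invr_ge0 ltW.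
  have B3 : nm (cR q * (s + 1)^-1) <= X / N%:R.
    rewrite nmM nm_cR nmV (ger0_norm (ltW q0)) ler_pM ?(ltW q0) ?invr_ge0 ?nm_ge0 //; lra.
  rewrite (le_trans (nmD _ _)) // (le_trans (lerD (nmB _ _) (lexx _))) //.
  rewrite -mulrA; move: B1 B2 B3; set Y := X / _; clear - R; lra.
have s12 : - (7 / 2) <= 5 / 2 :> R by lra.
have e2 : 0 < e / 2 by rewrite divr_gt0.
have [sg h|m1 hm1] := gridint_shift s12 hG' (B := 3 * X / N%:R) _ e2.
  by split; apply: hor => //=; rewrite ?normrN ger0_norm // ltW.
have nv : - v <= 0 by lra.
have [m2 hm2] := perron_term_neg nv N3 e2.
exists (maxn m1 m2) => m; rewrite geq_max => /andP[/hm1 H1 /hm2 H2].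
have WG1 : gridint N m (5 / 2) G = gridint N m (5 / 2) (perron_kernel v) - gridint N m (5 / 2) (fun s => s^-1)
     + cR q * gridint N m (7 / 2) (fun s => s^-1).
  rewrite (@gridint_ext _ _ _ _ _ (fun s => perron_kernel v s - s^-1 + cR q * (s + 1)^-1)); last first.
    move=> t ht; apply: GE.
    - by split => //=; apply/andP; split; clear - R; lra.
    - by apply/eqP => /(congr1 (@complex.Re R)) /=; clear - R; lra.
    - by apply/eqP => /(congr1 (@complex.Re R)); rewrite ReD /=; clear - R; lra.
  rewrite gridintD gridintB gridintZ (gridint_shift1 _ _ _ (fun s => s^-1)).
  by have -> : 5 / 2 + 1 = 7 / 2 :> R by field.
have WG2 : gridint N m (- (7 / 2)) G = cR q * gridint N m (5 / 2) (perron_kernel (- v)) + gridint N m (7 / 2) (fun s => s^-1)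
     - cR q * gridint N m (5 / 2) (fun s => s^-1).
  (* The grid on Re s = -7/2 is reflected to Re s = 7/2 and read as a shift of Re s = 5/2 by 1,
     which together is s -> -1 - s. *)
  rewrite gridint_sym; have -> : 7 / 2 = 5 / 2 + 1 :> R by field.
  rewrite -!gridint_shift1 -!gridintZ -gridintD -gridintB; apply: gridint_ext => t /andP[t1 t2].
  set s : C := Complex (5 / 2) t.
  have s0 : s != 0 by apply/eqP => /(congr1 (@complex.Re R)) /=; clear - R; lra.
  have s1 : s + 1 != 0 by apply/eqP => /(congr1 (@complex.Re R)); rewrite ReD /=; clear - R; lra.
  have E : - (s + 1) + 1 = - s by ring.
  rewrite GE; first last.
  - by rewrite E oppr_eq0.
  - by rewrite oppr_eq0.
  - by split; rewrite ?ReN ?ImN ?ReD ?ImD /= ?addr0; apply/andP; split; clear - R t1 t2; lra.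
  rewrite E /perron_kernel mulNr cRN mulrN mulrDl mul1r cexpN cexpD cexp_cR cexpN E.
  have -> : (cexp (s * cR v) * cR (expR v))^-1 = cR q * (cexp (s * cR v))^-1.
    by rewrite invfM -cRV -expRN mulrC.
  by move: (cexp _)^-1 => Z; field; rewrite s0 s1.
set A := gridint N m (5 / 2) (fun s => s^-1) in WG1 WG2.
set B := gridint N m (7 / 2) (fun s => s^-1) in WG1 WG2.
have -> : gridint N m (5 / 2) (perron_kernel v) - kernel_mass N m * cR (1 - q) =
  (gridint N m (5 / 2) G - gridint N m (- (7 / 2)) G) + cR q * gridint N m (5 / 2) (perron_kernel (- v)).
  by rewrite WG1 WG2 /kernel_mass -/A -/B cRB cR1; ring.
rewrite (le_trans (nmD _ _)) // (le_trans (lerD H1 (lexx _))) //.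
have H3 : nm (cR q * gridint N m (5 / 2) (perron_kernel (- v))) <= 4 * X / N%:R + e / 2.
  rewrite nmM nm_cR (ger0_norm (ltW q0)).
  apply: (@le_trans _ _ (1 * (4 * expR (5 / 2 * - v) / N%:R + e / 2))); first by rewrite ler_pM ?(ltW q0) ?nm_ge0.
  rewrite mul1r lerD2r ler_wpM2r ?invr_ge0 ?(ltW N0) // ler_wpM2l // (le_trans _ X1) //.
  by rewrite -[leRHS]expR0 ler_expR; nra.
rewrite (le_trans (lerD (lexx _) H3)) //.
have -> : 2 * (5 / 2 - - (7 / 2)) * (3 * X / N%:R) = 36 * (X / N%:R) by field; exact: lt0r_neq0.
rewrite -!mulrA; move: (X / _) => Y; clear - R; lra.
Qed.

(** At v = ln X - ln n this is 1 - n/X for n <= X and 0 beyond. *)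
Definition fejer_weight v : R := if v <= 0 then 0 else 1 - expR (- v).

Lemma perron_term v (N : nat) e : (3 <= N)%N -> 0 < e -> exists m0, forall m, (m0 <= m)%N ->
  nm (gridint N m (5 / 2) (perron_kernel v) - kernel_mass N m * cR (fejer_weight v)) <= 40 * expR (5 / 2 * v) / N%:R + e.
Proof.
move=> N3 e0; rewrite /fejer_weight; case: (leP v 0) => v0; last exact: perron_term_pos.
have [m0 hm0] := perron_term_neg v0 N3 e0; exists m0 => m /hm0 H; rewrite cR0 mulr0 subr0 (le_trans H) //.
rewrite lerD2r ler_wpM2r ?invr_ge0 // ler_wpM2r ?expR_ge0 //; lra.
Qed.

(** Arbitrary real frequencies u i, instead of logarithms of integers, let one statement cover both
    -L'/L and the polar part 1/s. The error consists of the approximation of D, integrated against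
    the kernel, and of the truncation at height N. *)
Lemma perron_sum (I : Type) (l : seq I) (b : I -> C) (u : I -> R) (D : C -> C) v (N : nat) eps e :
  (3 <= N)%N -> 0 < e ->
  (forall t, - N%:R <= t <= N%:R -> let s := Complex (5 / 2) t in
     nm (D s - \sum_(i <- l) b i * cexp (- s * cR (u i))) <= eps) ->
  exists m0, forall m, (m0 <= m)%N ->
    nm (gridint N m (5 / 2) (fun s => D s * perron_kernel v s) - kernel_mass N m * \sum_(i <- l) b i * cR (fejer_weight (v - u i))) <=
    4 * eps * expR (5 / 2 * v) + 40 * expR (5 / 2 * v) / N%:R * (\sum_(i <- l) nm (b i) * expR (- (5 / 2) * u i)) + e.
Proof.
move=> N3 e0 hD.
have H1 : exists m0, forall m, (m0 <= m)%N ->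
   nm (\sum_(i <- l) b i * gridint N m (5 / 2) (perron_kernel (v - u i)) - kernel_mass N m * \sum_(i <- l) b i * cR (fejer_weight (v - u i))) <=
   40 * expR (5 / 2 * v) / N%:R * (\sum_(i <- l) nm (b i) * expR (- (5 / 2) * u i)) + e.
  elim: l {hD} e e0 => [|i l IH] e e0.
    by exists 0%N => m _; rewrite !big_nil mulr0 subrr nm0 mulr0 add0r ltW.
  have e2 : 0 < e / 2 by rewrite divr_gt0.
  have nb : 0 < 1 + nm (b i) by rewrite ltr_pwDl ?nm_ge0.
  have [m1 hm1] := IH _ e2.
  have [m2 hm2] := perron_term (v - u i) N3 (divr_gt0 e2 nb).
  exists (maxn m1 m2) => m; rewrite geq_max => /andP[/hm1 H1 /hm2 H2].
  rewrite !big_cons.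
  set S1 := \sum_(j <- l) _ in H1 *; set S2 := \sum_(j <- l) _ in H1 *; set S3 := \sum_(j <- l) _ in H1 *.
  have -> : b i * gridint N m (5 / 2) (perron_kernel (v - u i)) + S1 - kernel_mass N m * (b i * cR (fejer_weight (v - u i)) + S2) =
    b i * (gridint N m (5 / 2) (perron_kernel (v - u i)) - kernel_mass N m * cR (fejer_weight (v - u i))) + (S1 - kernel_mass N m * S2) by ring.
  rewrite (le_trans (nmD _ _)) // (le_trans (lerD (lexx _) H1)) // nmM.
  rewrite (le_trans (lerD (ler_wpM2l (nm_ge0 _) H2) (lexx _))) //.
  have -> : expR (5 / 2 * (v - u i)) = expR (5 / 2 * v) * expR (- (5 / 2) * u i).
    by rewrite -expRD; congr expR; ring.
  have : nm (b i) * (e / 2 / (1 + nm (b i))) <= e / 2.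
    by rewrite mulrCA ger_pMr // ler_pdivrMr // mul1r lerDr.
  set Y := nm (b i) * (e / 2 / _) => hY.
  rewrite mulrDr -/Y.
  set E := expR (5 / 2 * v); set q := N%:R^-1; set Z := expR _.
  have -> : nm (b i) * (40 * (E * Z) * q) = 40 * E * q * (nm (b i) * Z) by ring.
  rewrite (mulrDr (40 * E * q)); move: (40 * E * q * _) (40 * E * q * _) => a1 a2; lra.
have [m0 hm0] := H1; exists m0 => m /hm0 {}H1.
set S2 := kernel_mass N m * _ in H1 *.
set S1 := \sum_(i <- l) b i * gridint _ _ _ _ in H1.
have -> : gridint N m (5 / 2) (fun s => D s * perron_kernel v s) - S2 =
   (gridint N m (5 / 2) (fun s => D s * perron_kernel v s) - S1) + (S1 - S2) by ring.
rewrite (le_trans (nmD _ _)) // -addrA lerD //.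
have -> : S1 = gridint N m (5 / 2) (fun s => (\sum_(i <- l) b i * cexp (- s * cR (u i))) * perron_kernel v s).
  rewrite /S1; under eq_bigr do rewrite -gridintZ.
  rewrite -gridint_sum; apply: gridint_ext => t _; rewrite mulr_suml; apply: eq_bigr => i _.
  rewrite -mulrA; congr (_ * _); rewrite /perron_kernel mulrA -cexpD; congr (cexp _ / _).
  by rewrite cRB; ring.
rewrite -gridintB.
have B1 : nm (gridint N m (5 / 2) (fun s => D s * perron_kernel v s - (\sum_(i <- l) b i * cexp (- s * cR (u i))) * perron_kernel v s)) <=
   invS m * \sum_(0 <= k < grid_size N m) eps * expR (5 / 2 * v) * (1 + grid_mid N m k ^+ 2)^-1.
  apply: gridint_le => k kN; rewrite -mulrBl nmM.
  have := hD _ (grid_mid_bound R kN) => /=; set s : C := Complex _ _ => h.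
  rewrite -mulrA ler_pM ?nm_ge0 //.
  have t0 : 0 < Num.sqrt (1 + grid_mid N m k ^+ 2) by rewrite sqrtr_gt0 ltr_pwDl // sqr_ge0.
  have t2 : Num.sqrt (1 + grid_mid N m k ^+ 2) <= nm s.
    rewrite nmE ler_wsqrtr //= lerD2r -[leLHS](expr1n _ 2) ler_pXn2r ?nnegrE //; lra.
  have := perron_kernel_le v _ t0 t2; rewrite sqr_sqrtr ?addr_ge0 ?sqr_ge0 // => -> //=; lra.
rewrite (le_trans B1) // -mulr_sumr mulrCA.
have eps0 : 0 <= eps.
  apply: le_trans (hD 0 _); rewrite ?nm_ge0 //; by rewrite oppr_le0 ler0n.
have := sum_1t2 R N m; set Q := invS m * _ => hQ.
have : 0 <= eps * expR (5 / 2 * v) by rewrite mulr_ge0 ?expR_ge0.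
have -> : 4 * eps * expR (5 / 2 * v) = 4 * (eps * expR (5 / 2 * v)) by ring.
move: (eps * _) => a a0; nra.
Qed.

End Kernel.

(** * The von Mangoldt function *)

Section VonMangoldt.
Variable R : realType.
Local Notation C := (Cx R).
Implicit Types (x y e : R) (z w s c : C).
Local Notation tpow := (@tpow R).

Lemma sum_delta (V : zmodType) (a b j : nat) (F : nat -> V) :
  \sum_(a <= n < b) (if n == j then F n else 0) = if (a <= j < b)%N then F j else 0.
Proof. by rewrite -big_mkcond big_nat1_eq. Qed.

Lemma big_nat_cut (V : zmodType) (a b c : nat) (P : pred nat) (F : nat -> V) : (b <= c)%N ->
  (forall i, (b <= i < c)%N -> P i -> F i = 0) ->
  \sum_(a <= i < c | P i) F i = \sum_(a <= i < b | P i) F i.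
Proof.
move=> bc h; rewrite (big_nat_widen _ _ _ _ _ bc) big_mkcondr /=.
rewrite big_nat_cond [RHS]big_nat_cond; apply: eq_bigr => i /andP[/andP[_ ic] Pi].
by case: ltnP => // bi; rewrite h // bi.
Qed.

(** The von Mangoldt function as a sum over candidate pairs (p, k), at most one of which satisfies n
    = p^k; sums over n then become sums over prime powers by exchange. *)
Definition Lam (n : nat) : R :=
  \sum_(0 <= p < n.+1 | prime p) \sum_(1 <= k < n.+1) (if n == (p ^ k)%N then ln p%:R else 0).

Lemma Lam_widen X n : (n < X)%N -> Lam n =
  \sum_(0 <= p < X | prime p) \sum_(1 <= k < X) (if n == (p ^ k)%N then ln p%:R else 0).
Proof.
move=> nX; rewrite (@big_nat_cut _ _ n.+1 X) //; last first.
  move=> p /andP[np _] pp; rewrite big_nat_cond big1 // => k; rewrite andbT => /andP[k1 _].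
  have := leq_pexp2l (prime_gt0 pp) k1; rewrite expn1; case: eqP => // <-; lia.
apply: eq_bigr => p pp; rewrite [RHS](@big_nat_cut _ _ n.+1) // => k /andP[nk _] _.
have := ltn_expl k (prime_gt1 pp); case: eqP => // <-; lia.
Qed.

Lemma Lam_ge0 n : 0 <= Lam n.
Proof.
by apply: sumr_ge0 => p _; apply: sumr_ge0 => k _; case: ifP => // _; exact: ln_nat_ge0.
Qed.

(** Stated for any additive family phi, so that real weights, complex weights and divisibility
    conditions are all covered. *)
Lemma Lam_sum (V : zmodType) (phi : nat -> R -> V) X :
  (forall n, phi n 0 = 0) -> (forall n, {morph phi n : x y / x + y >-> x + y}) ->
  \sum_(1 <= n < X) phi n (Lam n) =
  \sum_(0 <= p < X | prime p) \sum_(1 <= k < X | (p ^ k < X)%N) phi (p ^ k)%N (ln p%:R).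
Proof.
move=> h0 hD.
transitivity (\sum_(1 <= n < X) \sum_(0 <= p < X | prime p) \sum_(1 <= k < X)
   (if n == (p ^ k)%N then phi n (ln p%:R) else 0)).
  apply: eq_big_nat => n /andP[_ nX]; rewrite (Lam_widen nX) (big_morph _ (hD n) (h0 n)).
  apply: eq_bigr => p pp; rewrite (big_morph _ (hD n) (h0 n)).
  by apply: eq_bigr => k _; case: ifP.
rewrite exchange_big_nat /=; apply: eq_bigr => p pp; rewrite exchange_big_nat /= [RHS]big_mkcond.
apply: eq_bigr => k _; rewrite sum_delta.
by rewrite expn_gt0 prime_gt0.
Qed.

Lemma ln_prod_nat (I : Type) (l : seq I) (P : pred I) (F : I -> nat) : (forall i, P i -> (0 < F i)%N) ->
  ln (\prod_(i <- l | P i) F i)%:R = \sum_(i <- l | P i) ln (F i)%:R :> R.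
Proof.
move=> h; suff [//] : ln (\prod_(i <- l | P i) F i)%:R = \sum_(i <- l | P i) ln (F i)%:R :> R
  /\ (0 < \prod_(i <- l | P i) F i)%N.
elim/big_rec2: _ => [|i y x Pi [<- x0]]; first by rewrite ln1.
by rewrite natrM lnM ?posrE ?ltr0n ?h // muln_gt0 h.
Qed.

(** In the factorisation of n each prime p is counted once for every k >= 1 with p^k dividing n. *)
Lemma ln_Lam n : (0 < n)%N -> ln n%:R = \sum_(1 <= d < n.+1) (if (d %| n)%N then Lam d else 0).
Proof.
move=> n0; rewrite (Lam_sum (phi := fun d x => if (d %| n)%N then x else 0)); first last.
- by move=> d x y; case: ifP => // _; rewrite addr0.
- by move=> d; case: ifP.
rewrite -{1}(partnT n0) (widen_partn _ (leqnn n)) ln_prod_nat; last first.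
  by move=> i _; rewrite expn_gt0; case: i => [|//]; rewrite lognE.
rewrite [RHS]big_mkcond; apply: eq_bigr => p _; case: ifP => pp; last first.
  by rewrite lognE pp /= expn0 ln1.
have p0 : 0 < p%:R :> R by rewrite ltr0n prime_gt0.
rewrite natrX lnXn // big_mkcond /=.
transitivity (\sum_(1 <= k < (logn p n).+1) (ln p%:R : R)).
  by rewrite sumr_const_nat subn1.
have lX : ((logn p n).+1 <= n.+1)%N by rewrite ltnS ltnW // ltn_logl.
rewrite (big_nat_widen _ _ _ _ _ lX) big_mkcond; apply: eq_bigr => k _ /=.
rewrite ltnS -pfactor_dvdn //.
case: ifP => [h|//]; first by rewrite ltnS dvdn_leq.
by case: ifP.
Qed.

Lemma Lam_le_ln n : (0 < n)%N -> Lam n <= ln n%:R.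
Proof.
move=> n0; rewrite (ln_Lam n0) big_nat_recr //= dvdnn lerDr sumr_ge0 // => d _.
by case: ifP => // _; exact: Lam_ge0.
Qed.

Lemma sum_mul (V : zmodType) (d M : nat) (G : nat -> V) : (0 < d)%N ->
  \sum_(1 <= n < M) (if (d %| n)%N then G n else 0) = \sum_(1 <= m < M | (d * m < M)%N) G (d * m)%N.
Proof.
move=> d0; transitivity (\sum_(1 <= n < M) \sum_(1 <= m < M) (if n == (d * m)%N then G n else 0)); last first.
  rewrite exchange_big_nat [RHS]big_mkcond; apply: eq_big_nat => m /andP[m1 _].
  by rewrite sum_delta muln_gt0 d0 m1.
apply: eq_big_nat => n /andP[n1 nM].
case: ifP => [/dvdnP[k E]|nd]; last first.
  rewrite big1 // => m _; case: eqP => // E; by rewrite E dvdn_mulr in nd.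
rewrite E in n1 nM *.
transitivity (\sum_(1 <= m < M) (if m == k then G (k * d)%N else 0)).
  rewrite sum_delta; case: ifP => // /negP []; apply/andP; split.
    by move: n1; rewrite muln_gt0 => /andP[].
  by apply: leq_ltn_trans nM; rewrite leq_pmulr.
by apply: eq_bigr => m _; rewrite (mulnC k) eqn_pmul2l // eq_sym.
Qed.

(** The convolution identity Lambda * 1 = ln in summed form, with n = dm. It yields ln n!, the
    product of Dirichlet polynomials and the bound at s = 1 for characters. *)
Lemma hyperbola (V : zmodType) (phi : nat -> R -> V) M :
  (forall n, phi n 0 = 0) -> (forall n, {morph phi n : x y / x + y >-> x + y}) ->
  \sum_(1 <= n < M) phi n (ln n%:R) =
  \sum_(1 <= d < M) \sum_(1 <= m < M | (d * m < M)%N) phi (d * m)%N (Lam d).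
Proof.
move=> h0 hD.
transitivity (\sum_(1 <= n < M) \sum_(1 <= d < M) (if (d %| n)%N then phi n (Lam d) else 0)).
  apply: eq_big_nat => n /andP[n1 nM]; rewrite ln_Lam // (big_morph _ (hD n) (h0 n)).
  rewrite [RHS](@big_nat_cut _ _ n.+1) //.
    by apply: eq_bigr => d _; case: ifP.
  by move=> d /andP[nd _] _; case: ifP => // /(dvdn_leq n1); lia.
rewrite exchange_big_nat /=; apply: eq_big_nat => d /andP[d1 _].
exact: (sum_mul M (fun n => phi n (Lam d)) d1).
Qed.

Definition psi (n : nat) : R := \sum_(1 <= d < n.+1) Lam d.

Lemma psi_mono m n : (m <= n)%N -> psi m <= psi n.
Proof.
move=> mn; rewrite /psi (@big_cat_nat _ _ _ m.+1 1 n.+1) //= lerDl sumr_ge0 // => d _.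
exact: Lam_ge0.
Qed.

Lemma ln_fact n : ln n`!%:R = \sum_(1 <= d < n.+1) Lam d * (n %/ d)%:R :> R.
Proof.
rewrite fact_prod big_nat_cond ln_prod_nat; last by move=> i; rewrite andbT => /andP[].
rewrite -big_nat_cond (hyperbola (phi := fun _ x => x)) //.
apply: eq_big_nat => d /andP[d0 dn].
transitivity (\sum_(1 <= m < (n %/ d).+1) Lam d).
  have h : ((n %/ d).+1 <= n.+1)%N by rewrite ltnS leq_div.
  rewrite (big_nat_widen _ _ _ _ _ h); apply: eq_bigl => m.
  by rewrite !ltnS leq_divRL // mulnC.
by rewrite sumr_const_nat subn1 mulr_natr.
Qed.

Lemma ln_fact_ge n : n%:R * ln n%:R - n%:R <= ln n`!%:R :> R.
Proof.
elim: n => [|[|n] IH]; first by rewrite mul0r fact0 ln1 subr0.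
  by rewrite (_ : 1`! = 1%N) // ln1; lra.
rewrite factS natrM lnM ?posrE ?ltr0n ?fact_gt0 //.
have [E h _] := @lnS_bounds R n.+1 isT.
have : n.+1%:R * ln (1 + n.+1%:R^-1) <= 1 :> R.
  have n0 : 0 < n.+1%:R :> R by rewrite ltr0n.
  apply: (@le_trans _ _ (n.+1%:R * n.+1%:R^-1)); first by rewrite ler_wpM2l // ltW.
  by rewrite divff // lt0r_neq0.
move: IH; rewrite E -(@natr1 _ n.+1); set a : R := n.+1%:R; set l := ln a; set u := ln (1 + _); set f := ln _.
nra.
Qed.

Lemma ln_fact_le n : ln n`!%:R <= n%:R * ln n%:R :> R.
Proof.
elim: n => [|n IH]; first by rewrite mul0r fact0 ln1.
rewrite factS natrM lnM ?posrE ?ltr0n ?fact_gt0 // -{2}(@natr1 _ n) mulrDl mul1r addrC lerD2r.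
rewrite (le_trans IH) // ler_wpM2l //.
case: n {IH} => [|n]; first by rewrite ln0 // ln1.
by rewrite ler_ln ?posrE ?ltr0n // ler_nat.
Qed.

Lemma bin2n_le n : ('C(2 * n, n) <= 4 ^ n)%N.
Proof.
rewrite -[4%N]/(2 ^ 2)%N -expnM -[X in (_ <= X ^ _)%N]/(1 + 1)%N expnDn.
have nn : (n < (2 * n).+1)%N by lia.
rewrite (bigD1 (Ordinal nn)) //= !exp1n !muln1; exact: leq_addr.
Qed.

Lemma ln2_le1 : ln 2 <= 1 :> R.
Proof.
have := @expR_ge1Dx R 1; rewrite -[X in X <= _]lnK ?posrE; last by lra.
by rewrite ler_expR.
Qed.

(** Chebyshev's argument: the logarithm of the binomial coefficient of 2n over n is at most 2n ln 2,
    and in its expansion every d with n < d <= 2n has coefficient 1, the others a nonnegative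
    one. *)
Lemma psi_double n : psi (2 * n) <= psi n + 2 * n%:R.
Proof.
have H1 : ln (2 * n)`!%:R - 2 * ln n`!%:R <= 2 * n%:R :> R.
  have nn : (n <= 2 * n)%N by lia.
  have := bin_fact nn; have -> : (2 * n - n = n)%N by lia.
  move=> <-; rewrite !natrM !lnM ?posrE ?mulr_gt0 ?ltr0n ?fact_gt0 ?bin_gt0 //.
  set f := ln n`!%:R.
  have : ln 'C(2 * n, n)%:R <= ln (4 ^ n)%:R :> R by rewrite ler_ln ?posrE ?ltr0n ?bin_gt0 ?expn_gt0 // ler_nat bin2n_le.
  have -> : (4 ^ n = 2 ^ (2 * n))%N by rewrite expnM.
  rewrite natrX lnXn // -[_ *+ (2 * n)]mulr_natl natrM; have := ln2_le1; have := ler0n R n; nra.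
have H2 : psi (2 * n) - psi n <= ln (2 * n)`!%:R - 2 * ln n`!%:R.
  have -> : ln n`!%:R = \sum_(1 <= d < (2 * n).+1) Lam d * (n %/ d)%:R :> R.
    rewrite ln_fact; apply/esym/big_nat_cut; first by lia.
    by move=> d /andP[nd _] _; rewrite divn_small // mulr0.
  have -> : psi n = \sum_(1 <= d < (2 * n).+1) (if (d <= n)%N then Lam d else 0).
    rewrite /psi [RHS](@big_nat_cut _ _ n.+1) //; last 2 first.
    - by lia.
    - by move=> d /andP[nd _] _; case: ifP => //; lia.
    by apply: eq_big_nat => d /andP[_ dn]; rewrite -ltnS dn.
  rewrite ln_fact /psi mulr_sumr -!sumrB big_nat_cond [leRHS]big_nat_cond ler_sum // => d.
  rewrite andbT => /andP[d1 d2].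
  have L0 := Lam_ge0 d.
  have -> : Lam d * ((2 * n) %/ d)%:R - 2 * (Lam d * (n %/ d)%:R) = Lam d * (((2 * n) %/ d)%:R - (2 * (n %/ d))%:R).
    by rewrite natrM; ring.
  have h : (2 * (n %/ d) <= (2 * n) %/ d)%N by rewrite leq_divRL // -mulnA leq_mul2l leq_trunc_div.
  rewrite -natrB //; case: ifP => dn; first by rewrite subrr mulr_ge0.
  rewrite subr0 ler_peMr // ler1n subn_gt0 (@divn_small n d) //; last by lia.
  by rewrite muln0 divn_gt0 //; lia.
lra.
Qed.

(** Strong induction through u = [uphalf n]: psi(n) <= psi(u) + 2u <= 8u <= 4(n + 1), which is at
    most 6n for n >= 2. *)
Lemma psi_le n : psi n <= 6 * n%:R.
Proof.
elim/ltn_ind: n => [[|[|n]]] IH.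
- by rewrite /psi big_geq // mulr0.
- rewrite /psi big_nat1 (le_trans (@Lam_le_ln 1 isT)) // ln1 mulr1; lra.
have h1 : (uphalf n.+2 < n.+2)%N by rewrite uphalfE; lia.
have h2 : (n.+2 <= 2 * uphalf n.+2)%N by rewrite uphalfE; lia.
have h3 : (2 * uphalf n.+2 <= n.+3)%N by rewrite uphalfE; lia.
have := IH _ h1; have := psi_double (uphalf n.+2); have := psi_mono h2.
have : (2 * uphalf n.+2)%:R <= n.+3%:R :> R by rewrite ler_nat.
rewrite natrM -(@natr1 _ n.+2); set u : R := (uphalf _)%:R.
have : 2 <= n.+2%:R :> R by rewrite (ler_nat _ 2).
move: (n.+2%:R) => a; lra.
Qed.

(** ln n! is the sum of Lambda(d) floor(n/d); dropping the floors costs at most psi(n) <= 6n, and ln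
    n! lies between n ln n - n and n ln n. *)
Lemma Mertens_Lam n : (0 < n)%N ->
  ln n%:R - 1 <= \sum_(1 <= d < n.+1) Lam d / d%:R <= ln n%:R + 6.
Proof.
move=> n0; have N0 : 0 < n%:R :> R by rewrite ltr0n.
set S := \sum_(_ <= _ < _) _.
have A1 : ln n`!%:R <= n%:R * S.
  rewrite ln_fact mulr_sumr big_nat_cond [leRHS]big_nat_cond ler_sum // => d.
  rewrite andbT => /andP[d1 _]; have d0 : 0 < d%:R :> R by rewrite ltr0n.
  rewrite mulrCA ler_wpM2l ?Lam_ge0 // ler_pdivlMr // -natrM ler_nat leq_trunc_div //.
have A2 : n%:R * S <= ln n`!%:R + psi n.
  rewrite ln_fact /psi mulr_sumr -big_split /= big_nat_cond [leRHS]big_nat_cond ler_sum // => d.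
  rewrite andbT => /andP[d1 _]; have d0 : 0 < d%:R :> R by rewrite ltr0n.
  rewrite mulrCA -{3}(mulr1 (Lam d)) -mulrDr ler_wpM2l ?Lam_ge0 // ler_pdivrMr // natr1 -natrM ler_nat.
  by rewrite ltnW // ltn_ceil.
have := ln_fact_ge n; have := ln_fact_le n; have := psi_le n => p1 p2 p3.
have B1 : n%:R * (ln n%:R - 1) <= n%:R * S by rewrite mulrBr mulr1; lra.
have B2 : n%:R * S <= n%:R * (ln n%:R + 6) by rewrite mulrDr; lra.
by rewrite -(ler_pM2l N0) B1 -(ler_pM2l N0) B2.
Qed.

Lemma ln_tpow (sg : R) n : 0 < sg -> ln n%:R * tpow (2 * sg) n <= tpow sg n / sg.
Proof.
move=> sg0; rewrite ler_pdivlMr // /tpow.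
set l := ln n%:R; have -> : - (2 * sg) * l = - sg * l + - sg * l by ring.
rewrite expRD; have : expR (sg * l) * expR (- sg * l) = 1 by rewrite -expRD mulNr subrr expR0.
have := expR_ge1Dx (sg * l); have := expR_ge0 (- sg * l).
have -> : l * (expR (- sg * l) * expR (- sg * l)) * sg = (sg * l) * expR (- sg * l) * expR (- sg * l) by ring.
set E := expR (- sg * l); set E' := expR (sg * l); set u := sg * l => E0 h1 h2.
rewrite ler_piMl //; nra.
Qed.

Lemma geo_tail (r rho : R) j X : 0 <= r -> r <= rho -> rho < 1 ->
  \sum_(j <= k < X) r ^+ k <= r ^+ j / (1 - rho).
Proof.
move=> r0 rr r1; have d0 : 0 < 1 - rho by lra.
case: (leqP X j) => jX; first by rewrite big_geq // divr_ge0 ?exprn_ge0 // ltW.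
rewrite ler_pdivlMr //.
have H : (\sum_(j <= k < X) r ^+ k) * (1 - r) = r ^+ j - r ^+ X.
  rewrite mulr_suml -[RHS]opprB -(telescope_sumr (fun k => r ^+ k)) ?(ltnW jX) // -sumrN.
  by apply: eq_bigr => k _; rewrite exprS; ring.
have S0 : 0 <= \sum_(j <= k < X) r ^+ k by apply: sumr_ge0 => k _; rewrite exprn_ge0.
have := exprn_ge0 X r0; move: H; set S := \sum_(_ <= _ < _) _ in S0 *; set a := r ^+ j; set b := r ^+ X => H b0.
nra.
Qed.

Lemma tpowX (sg : R) n k : (0 < n)%N -> tpow sg (n ^ k) = tpow sg n ^+ k.
Proof.
move=> n0; rewrite /tpow natrX lnXn ?ltr0n // mulrnAr -[_ *+ k]mulr_natl expRM_natl; exact: erefl.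
Qed.

Lemma tpowD (sg1 sg2 : R) n : tpow (sg1 + sg2) n = tpow sg1 n * tpow sg2 n.
Proof. by rewrite /tpow -expRD; congr expR; ring. Qed.

Lemma tpow1 n : (0 < n)%N -> tpow 1 n = n%:R^-1.
Proof. by move=> n0; rewrite /tpow mulN1r expRN lnK // posrE ltr0n. Qed.

Lemma tpow_one (sg : R) : tpow sg 1 = 1.
Proof. by rewrite /tpow ln1 mulr0 expR0. Qed.

Lemma tpowMn (sg : R) m n : (0 < m)%N -> (0 < n)%N -> tpow sg (m * n) = tpow sg m * tpow sg n.
Proof. by move=> m0 n0; rewrite /tpow natrM lnM ?posrE ?ltr0n // mulrDr expRD. Qed.

Lemma tpow3 n : (0 < n)%N -> tpow 3 n = tpow 1 n * n%:R^-1 * n%:R^-1.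
Proof.
move=> n0; rewrite -tpow1 // -!tpowD; have -> // : (3 : R) = 1 + 1 + 1; by ring.
Qed.

Lemma exp_small (a e : R) : 0 < a -> 0 < e -> exists J0, forall J, (J0 <= J)%N -> expR (- a) ^+ J <= e.
Proof.
move=> a0 e0; exists (Num.truncn (e^-1 / a)).+1 => J hJ; rewrite -expRM_natl.
have h : e^-1 <= J%:R * a.
  rewrite -ler_pdivrMr //; apply: (@le_trans _ _ (Num.truncn (e^-1 / a)).+1%:R); last by rewrite ler_nat.
  by rewrite ltW // truncnS_gt.
have := expR_ge1Dx (J%:R * a); have := expR_gt0 (J%:R * - a).
have : expR (J%:R * - a) * expR (J%:R * a) = 1 by rewrite -expRD mulrN addNr expR0.
have : e * e^-1 = 1 by rewrite divff // lt0r_neq0.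
have i0 : 0 < e^-1 by rewrite invr_gt0.
move=> h1 h2 h3 h4; rewrite -(ler_pM2r i0) h1 -[leRHS]h2 ler_wpM2l ?(ltW h3) //; lra.
Qed.

Lemma tpow2 (sg : R) n : tpow (2 * sg) n = tpow sg n ^+ 2.
Proof. by rewrite mulrDl mul1r tpowD. Qed.

(** For each prime the sum over k is geometric with ratio at most 2^(-sg), so its leading term p^(-1
    - 2 eta) decides. One eta absorbs ln p, the other makes the sum over p converge. *)
Lemma prime_power_tail (sg eta : R) j : 0 < sg -> 0 < eta -> sg *+ j = 1 + 2 * eta ->
  exists2 K : R, 0 <= K & forall X,
    \sum_(0 <= p < X | prime p) \sum_(j <= k < X) ln p%:R * tpow sg p ^+ k <= K.
Proof.
move=> sg0 eta0 hj; pose rho := tpow sg 2.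
have rho1 : rho < 1.
  by rewrite /rho /tpow -[ltRHS]expR0 ltr_expR mulNr oppr_lt0 mulr_gt0 // ln_gt0 // ltr1n.
have d0 : 0 < 1 - rho by lra.
exists (2 * (1 + eta) / eta / eta / (1 - rho)).
  have eta0' := ltW eta0; have d0' := ltW d0.
  do 3! [apply: divr_ge0 => //]; apply: mulr_ge0 => //; exact: addr_ge0.
move=> X; apply: (@le_trans _ _ (\sum_(1 <= p < X) tpow eta p / p%:R / eta / (1 - rho))).
  rewrite [leRHS](big_nat_widenl 1 0) // [leLHS]big_mkcond [leRHS]big_mkcond /=.
  apply: ler_sum => p _.
  case: ifP => pp; last first.
    by case: ifP => // _; rewrite !divr_ge0 ?tpow_ge0 // ltW.
  rewrite prime_gt0 // -mulr_sumr.
  have t2 : tpow sg p <= rho by apply: tpow_mono; rewrite ?prime_gt1 // ltW.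
  rewrite (le_trans (ler_wpM2l (ln_nat_ge0 _ p) (geo_tail _ _ (tpow_ge0 _ p) t2 rho1))) //.
  rewrite mulrA ler_wpM2r ?invr_ge0 ?(ltW d0) //.
  have -> : tpow sg p ^+ j = tpow (2 * eta) p / p%:R.
    rewrite -tpow1 ?prime_gt0 // -tpowD (addrC _ 1) -hj /tpow -expRM_natl; congr expR.
    by rewrite -mulr_natl; ring.
  by rewrite mulrA (mulrAC (tpow eta p)) ler_wpM2r ?invr_ge0 // ln_tpow.
rewrite -!mulr_suml !ler_wpM2r ?invr_ge0 ?(ltW d0) ?(ltW eta0) //.
case: (leqP X 1) => X1; first by rewrite big_geq // mulr_ge0 ?mulr_ge0 ?addr_ge0 ?invr_ge0 ?(ltW eta0).
rewrite (le_trans (tpow_sum eta0 _ (ltnW X1))) // ler_piMr ?divr_ge0 ?mulr_ge0 ?addr_ge0 ?(ltW eta0) //.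
have := tpow_ge0 eta X; have := @tpow_le1 R eta 1 (ltW eta0); lra.
Qed.

End VonMangoldt.

(** * The order of L at 1/2 and its logarithmic derivative *)

Section LOrder.
Variable R : realType.
Local Notation C := (Cx R).
Implicit Types (x y : R) (z w s c : C) (F G : C -> C).

Lemma dnbhs_limP F (a l : C) : (F s @[s --> a^'] --> l) <->
  (forall e : R, 0 < e -> exists2 r : R, 0 < r &
     forall z, 0 < nm z -> nm z < r -> nm (F (a + z) - l) <= e).
Proof.
split.
- move=> /cvgrPdist_le h e e0.
  have e0' : 0 < cR e :> C by rewrite ltcE /= eqxx.
  have := h _ e0'; rewrite /dnbhs /within /= => /nbhs_ballP [r /= r0 hr].
  exists (complex.Re r); first by move: r0; rewrite ltcE => /andP[].
  move=> z z0 zr; have := hr (a + z); rewrite /ball_ /= => H.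
  have H1 : `|a - (a + z)| < r.
    rewrite opprD addrA subrr sub0r normE nmN ltcE /=; rewrite zr andbT.
    by move: r0; rewrite ltcE => /andP[/eqP ->].
  have H2 : a + z != a by rewrite -subr_eq0 addrAC subrr add0r -nm_gt0.
  by have := H H1 H2; rewrite distrC normE ler_cR.
move=> h; apply/cvgrPdist_le => e e0.
have er : e = cR (complex.Re e).
  by apply: Cext => //=; move: e0; rewrite ltcE => /andP[/eqP].
have e1 : 0 < complex.Re e by move: e0; rewrite ltcE => /andP[].
have [r r0 hr] := h _ e1.
rewrite /dnbhs /within /=; apply/nbhs_ballP; exists (cR r); first by rewrite /= ltcE /= eqxx.
move=> s; rewrite /ball_ /= normE ltcE /= eqxx /= => sr sa.
have -> : s = a + (s - a) by ring.
rewrite distrC normE er ler_cR; apply: hr; last by rewrite nmBC.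
by rewrite nm_gt0 subr_eq0.
Qed.

Lemma small_lt3 (a b c : R) : 0 < a -> 0 < b -> 0 < c -> exists t : R, [/\ 0 < t, t <= a, t < b & t <= c].
Proof.
move=> a0 b0 c0; exists (Num.min a (Num.min (b / 2) c)); split.
- by rewrite !lt_min a0 c0 divr_gt0.
- by rewrite ge_min lexx.
- apply: (@le_lt_trans _ _ (b / 2)); last by rewrite ltr_pdivrMr // ltr_pMr //; lra.
  by rewrite !ge_min lexx orbT.
- by rewrite !ge_min lexx !orbT.
Qed.

Lemma powdiv_lt (z u : C) (k m : nat) : z != 0 -> (k < m)%N ->
  z ^+ m * u / z ^+ k = z * z ^+ (m - k).-1 * u.
Proof.
move=> z0 km; have -> : z ^+ m = z * z ^+ (m - k).-1 * z ^+ k.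
  by rewrite -exprS -exprD; congr (z ^+ _); lia.
by rewrite mulrAC mulfK // expf_neq0.
Qed.

Lemma powdiv_gt (z u : C) (k m : nat) : z != 0 -> (m < k)%N ->
  z ^+ m * u / z ^+ k = u / (z * z ^+ (k - m).-1).
Proof.
move=> z0 km; have -> : z ^+ k = z * z ^+ (k - m).-1 * z ^+ m.
  by rewrite -exprS -exprD; congr (z ^+ _); lia.
have Z0 : z ^+ m != 0 by rewrite expf_neq0.
by rewrite [X in _ / X = _]mulrC -mulf_div divff // mul1r.
Qed.

Variables (q : nat) (chi : nat -> C).
Hypothesis q0 : (0 < q)%N.
Hypothesis hchi : nonprincipal_chars q chi.
Hypothesis hG : forall s, 2^-1 < complex.Re s -> Lchi chi s != 0.
Local Notation L := (Lchi chi).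
Local Notation Ld := (der (Lchi chi)).
Local Notation hf := (@Defs.half R).

(** Near 1/2, L = z^m g(z) with g(0) nonzero, so L'/L - m/z = g'/g stays bounded. The alternative of
    [polylim_factor], L vanishing identically, contradicts the hypothesis at 1/2 + 1/16. *)
Lemma L_order : exists m : nat, exists C0 e0 : R,
  [/\ is_order_at_half chi m, (forall m', is_order_at_half chi m' -> m' = m), 0 < e0 &
   forall z, 0 < nm z -> nm z <= e0 -> nm (Ld (hf + z) / L (hf + z) - m%:R / z) <= C0].
Proof.
have hp : polylim (4^-1) (fun z => L (hf + z)).
  by apply: (L_polylim q0 hchi); rewrite /Defs.half /= ?invr_ge0 //; lra.
have i4 : (0 : R) < 4^-1 by rewrite invr_gt0.
have [h0|[m [g [gpa g0 Lg]]]] := polylim_factor i4 hp.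
  have : L (hf + cR 16^-1) = 0 by apply: h0; rewrite nm_cR ger0_norm //; lra.
  by move/eqP; rewrite (negbTE (hG _)) // ReD /Defs.half /=; lra.
have r8 : 4^-1 / 2 = 8^-1 :> R by field.
rewrite r8 in gpa Lg.
have i8 : (0 : R) <= 8^-1 by rewrite invr_ge0.
have [Bg Bg0 hBg] := polylim_bounded i8 gpa.
have gpa0 : polylim 8^-1 (fun z => g (0 + z)) by apply: (polylim_ext _ gpa) => z _; rewrite add0r.
have hBg0 z : nm z <= 8^-1 -> nm (g (0 + z)) <= Bg by rewrite add0r; exact: hBg.
have i16 : (0 : R) <= 16^-1 by rewrite invr_ge0.
have i168 : (16^-1 : R) < 8^-1 by lra.
have [_ d1 d2 d3] := polylim_der i16 i168 gpa0 hBg0.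
set D1 := Bg / _ / _ in d1; set D2 := Bg / _ / _ in d2.
have z16 : nm (0 : C) <= 16^-1 by rewrite nm0.
have D10 : 0 <= D1 by apply: le_trans (d1 0 z16); exact: nm_ge0.
have D20 : 0 <= D2.
  have h : nm (cR 16^-1 : C) <= 16^-1 by rewrite nm_cR ger0_norm.
  have := d2 0 (cR 16^-1) z16; rewrite add0r => /(_ h) /(le_trans (nm_ge0 _)).
  by rewrite pmulr_lge0 // exprn_gt0 // nm_cR gtr0_norm // invr_gt0.
have ng0 : 0 < nm (g 0) by rewrite nm_gt0.
have glip z : nm z <= 16^-1 -> nm (g z - g 0) <= (D1 + D2) * nm z.
  move=> hz; have := d2 0 z z16; rewrite !add0r => /(_ hz) h.
  have := d1 0 z16; rewrite add0r => h'.
  have -> : g z - g 0 = (g z - g 0 - z * der g 0) + z * der g 0 by ring.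
  rewrite (le_trans (nmD _ _)) // mulrDl addrC lerD //; first by rewrite nmM mulrC ler_wpM2r ?nm_ge0.
  by rewrite (le_trans h) // ler_wpM2l // expr2 ler_piMr ?nm_ge0 // (le_trans hz) //; lra.
pose e0 := Num.min 16^-1 (nm (g 0) / 2 / (1 + (D1 + D2))).
have DD : 0 < 1 + (D1 + D2) by rewrite ltr_pwDl // addr_ge0.
have e00 : 0 < e0.
  by rewrite lt_min; apply/andP; split; [rewrite invr_gt0|rewrite divr_gt0 // divr_gt0].
have e016 : e0 <= 16^-1 by rewrite ge_min lexx.
have e0g : e0 <= nm (g 0) / 2 / (1 + (D1 + D2)) by rewrite ge_min lexx orbT.
clearbody e0.
have e16 z : nm z <= e0 -> nm z <= 16^-1 by move=> h; exact: le_trans h e016.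
have glow z : nm z <= e0 -> nm (g 0) / 2 <= nm (g z).
  move=> hz; have h := glip z (e16 z hz); have := nm_lB (g 0) (g z); rewrite nmBC.
  have : (D1 + D2) * nm z <= nm (g 0) / 2.
    apply: (@le_trans _ _ ((D1 + D2) * (nm (g 0) / 2 / (1 + (D1 + D2))))).
      by rewrite ler_wpM2l ?addr_ge0 // (le_trans hz).
    by rewrite mulrCA ger_pMr ?divr_gt0 // ler_pdivrMr // mul1r lerDr.
  lra.
have Fz k z : 0 < nm z -> nm z <= e0 -> L (hf + z) / (hf + z - hf) ^+ k = z ^+ m * g z / z ^+ k.
  move=> z0 hz; rewrite (addrC hf z) addrK addrC Lg // (le_trans (e16 _ hz)) // ltW //.
exists m, (D1 / (nm (g 0) / 2)), e0; split => //.
- exists (g 0) => //; apply/dnbhs_limP => e ep.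
  have r0 : 0 < Num.min e0 (e / (1 + (D1 + D2))) by rewrite lt_min e00 /= divr_gt0.
  exists (Num.min e0 (e / (1 + (D1 + D2)))) => // z z0.
  rewrite lt_min => /andP[z1 z2]; rewrite Fz ?(ltW z1) // mulrAC divff ?mul1r; last first.
    by rewrite expf_neq0 // -nm_gt0.
  rewrite (le_trans (glip _ (e16 _ (ltW z1)))) //.
  apply: (@le_trans _ _ ((D1 + D2) * (e / (1 + (D1 + D2))))); first by rewrite ler_wpM2l ?addr_ge0 // ltW.
  by rewrite mulrCA ger_pMr // ler_pdivrMr // mul1r lerDr.
(* For m' < m the quotient tends to 0 and for m' > m it is unbounded, so a nonzero limit c' excludes
   both. Uniqueness matters because [m_chi] selects an order by choice. *)
- move=> m' [c' c'0 /dnbhs_limP hc].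
  have nc' : 0 < nm c' by rewrite nm_gt0.
  case: (ltngtP m' m) => // hm.
    have c4 : 0 < nm c' / 4 by rewrite divr_gt0.
    have [r r0 hr] := hc _ c4.
    have BB : 0 < 1 + Bg by rewrite ltr_pwDl.
    have [t [t0 te0 tr tB]] := small_lt3 e00 r0 (divr_gt0 c4 BB).
       have nt : nm (cR t) = t by rewrite nm_cR gtr0_norm.
    have := hr (cR t); rewrite nt => /(_ t0 tr).
    have tc : cR t != 0 :> C by rewrite cR_eq0 gt_eqF.
    rewrite Fz ?nt // (powdiv_lt _ tc hm).
    set u := _ * g _ => hu.
    have : nm u <= nm c' / 4.
      rewrite /u !nmM nmX nt; have t1 : t <= 1 by rewrite (le_trans te0) //; lra.
      have tt1 : t ^+ (m - m').-1 <= 1 by rewrite exprn_ile1 // ltW.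
      apply: (@le_trans _ _ (t * Bg)).
        rewrite ler_pM ?mulr_ge0 ?exprn_ge0 ?nm_ge0 ?(ltW t0) //.
          by rewrite ler_piMr // ltW.
        by apply: hBg; rewrite nt (le_trans te0) //; lra.
      rewrite (le_trans (ler_wpM2r Bg0 tB)) // mulrAC -mulrA ger_pMr ?divr_gt0 //.
      by rewrite ler_pdivrMr // mul1r lerDr.
    have := nm_lB c' u; rewrite nmBC => h1 h2; exfalso; lra.
  have [r r0 hr] := hc 1 ltr01.
  have cc : 0 < 2 + nm c' by rewrite addr_gt0.
  have g02 : 0 < nm (g 0) / 2 by rewrite divr_gt0.
  have [t [t0 te0 tr tB]] := small_lt3 e00 r0 (divr_gt0 g02 cc).
   have nt : nm (cR t) = t by rewrite nm_cR gtr0_norm.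
  have := hr (cR t); rewrite nt => /(_ t0 tr).
  have tc : cR t != 0 :> C by rewrite cR_eq0 gt_eqF.
  rewrite Fz ?nt // (powdiv_gt _ tc hm).
  set u := g _ / _ => hu.
  have : 2 + nm c' <= nm u.
    rewrite /u nmM nmV nmM nmX nt ler_pdivlMr ?mulr_gt0 ?exprn_gt0 //.
    have t1 : t <= 1 by rewrite (le_trans te0) //; lra.
    have tt1 : t ^+ (m' - m).-1 <= 1 by rewrite exprn_ile1 // ltW.
    apply: (@le_trans _ _ (nm (g 0) / 2)); last by apply: glow; rewrite nt.
    apply: (@le_trans _ _ ((2 + nm c') * t)).
      by rewrite ler_wpM2l ?(ltW cc) // ler_piMr // ltW.
    by rewrite mulrC -ler_pdivlMr.
  have := nm_lB u c' => h1 h2; exfalso; lra.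
move=> z z0 hz.
have zn0 : z != 0 by rewrite -nm_gt0.
have gz0 : g z != 0 by rewrite -nm_gt0 (lt_le_trans _ (glow z hz)) // divr_gt0.
have LdE : Ld (hf + z) = m%:R * z ^+ m.-1 * g z + z ^+ m * der g z.
  apply: derE; apply/hasder_shift.
  have h1 := d3 z (e16 z hz); rewrite add0r in h1.
  apply: (hasder_local (e0 := 16^-1) _ _ (hasderM (hasderX m z) h1)); first by rewrite invr_gt0.
  move=> w hw; rewrite Lg // (le_trans (nmD _ _)) // (le_trans (lerD (e16 _ hz) hw)) //; lra.
rewrite LdE Lg; last by rewrite (le_trans (e16 _ hz)) // ltW.
have -> : (m%:R * z ^+ m.-1 * g z + z ^+ m * der g z) / (z ^+ m * g z) - m%:R / z = der g z / g z.
  case: (m) => [|k]; first by rewrite /= !mul0r !expr0 !mul1r add0r subr0.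
  rewrite /= exprS; have zk : z ^+ k != 0 by rewrite expf_neq0.
  by move: (z ^+ k) zk (k.+1%:R : C) => Z Z0 K; field; rewrite zn0 Z0 gz0.
rewrite nmM nmV ler_pM ?nm_ge0 ?invr_ge0 ?nm_ge0 //.
  by have := d1 z (e16 z hz); rewrite add0r.
by rewrite lef_pV2 ?posrE ?divr_gt0 ?nm_gt0 // glow.
Qed.

Lemma L_taylor2 x1 x2 y1 y2 : 0 < x1 -> taylor2 (rect x1 x2 y1 y2) L Ld /\ taylor2 (rect x1 x2 y1 y2) Ld (der Ld).
Proof.
move=> x10; have [B B0 hB] := rect_bound x1 x2 y1 y2.
pose r := x1 / 2; have r0 : 0 < r by rewrite divr_gt0.
pose M := Kq q r * (1 + (B + r)).
have M0 : 0 <= M by rewrite mulr_ge0 ?Kq_ge0 // !addr_ge0 // ltW.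
have H c : rect x1 x2 y1 y2 c -> polylim r (fun z => L (c + z)) /\ forall z, nm z <= r -> nm (L (c + z)) <= M.
  move=> hc; have [/andP[c1 _] _] := hc; have cB := hB _ hc.
  split; first by apply: (L_polylim q0 hchi); rewrite ?(ltW r0) // (lt_le_trans _ c1) // /r; lra.
  move=> z hz; have hh : r + r <= complex.Re c by rewrite (le_trans _ c1) // /r; lra.
  rewrite (le_trans (L_disc_bound q0 hchi r0 hh hz)) // ler_wpM2l ?Kq_ge0 //.
  by rewrite lerD2l lerD2r.
split; first exact: taylor2_polylim r0 M0 H.
have r20 : 0 <= r / 2 by rewrite divr_ge0 // ltW.
have r2r : r / 2 < r by lra.
pose x : R := 1 - (r / 2 + r) / 2 / r.
have xE : x = 4^-1 by rewrite /x; field; rewrite gt_eqF.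
apply: (@taylor2_polylim _ _ _ (r / 2) (M / r / x ^+ 2)).
- by rewrite divr_gt0.
- by rewrite xE !divr_ge0 ?exprn_ge0 ?invr_ge0 // ltW.
move=> c hc; have [h1 h2] := H c hc.
have [a1 a2 a3 a4] := polylim_der r20 r2r h1 h2.
split => //; move=> e /a1[p [_ p2]]; by exists p^`().
Qed.

Lemma L_inf x1 x2 y1 y2 : 2^-1 < x1 -> x1 <= x2 -> y1 <= y2 ->
  exists2 c : R, 0 < c & forall s, rect x1 x2 y1 y2 s -> c <= nm (L s).
Proof.
move=> x10 x12 y12; have x1p : 0 < x1 by lra.
apply: (rect_inf x12 y12 (L_taylor2 x2 y1 y2 x1p).1) => s [/andP[h _] _].
by apply: hG; rewrite (lt_le_trans x10).
Qed.

Definition Dp' N s : C := \sum_(1 <= n < N) chi n * (- cR (ln n%:R) * npow_neg n s).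

(** L minus its partial sum is small on a whole disc around s, hence so is its derivative by
    Cauchy's estimate; no separate study of the differentiated series is made. *)
Lemma Dp'_cvg s e : (0 : R) < complex.Re s -> (0 : R) < e ->
  exists N, forall n, (N <= n)%N -> nm (Dp' n s - Ld s) <= e.
Proof.
move=> s0 e0; pose r := complex.Re s / 2.
have r0 : 0 < r by rewrite divr_gt0.
have r20 : 0 <= r / 2 by rewrite divr_ge0 // ltW.
have r2r : r / 2 < r by lra.
pose x : R := 1 - (r / 2 + r) / 2 / r.
have xE : x = 4^-1 by rewrite /x; field; rewrite gt_eqF.
pose K := Kq q r * (1 + (nm s + r)) / r / x ^+ 2.
have KK0 : 0 <= Kq q r * (1 + (nm s + r)) by rewrite mulr_ge0 ?Kq_ge0 // !addr_ge0 ?nm_ge0 // ltW.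
have K0 : 0 <= K by rewrite /K xE !divr_ge0 ?exprn_ge0 ?invr_ge0 // ltW.
have K1 : 0 < 1 + K by rewrite ltr_pwDl.
have [N hN] := tpow_small r0 (divr_gt0 e0 K1); exists N => n hn.
have [n0 tn] := hN n hn.
pose F := fun z => L z - Dp chi n z.
have Lp : polylim r (fun z => L (s + z)) by apply: (L_polylim q0 hchi); rewrite ?(ltW r0) // /r; lra.
have LB z : nm z <= r -> nm (L (s + z)) <= Kq q r * (1 + (nm s + r)).
  by move=> hz; apply: (L_disc_bound q0 hchi r0) => //; rewrite /r; lra.
have Fp : polylim r (fun z => F (s + z)).
  apply: (polylim_ext _ (polylimD Lp (polylimZ (-1) (@Dp_polylim _ chi r n s (ltW r0))))) => z _.
  by rewrite /F mulN1r.
have FB z : nm z <= r -> nm (F (s + z)) <= Kq q r * (1 + (nm s + r)) * tpow r n.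
  move=> hz; have hs : r <= complex.Re (s + z).
    by rewrite ReD; have := le_trans (absRe_le z) hz; rewrite ler_norml => /andP[]; rewrite /r; lra.
  rewrite (le_trans (L_approx q0 hchi r0 hs n0)) // ler_wpM2r ?tpow_ge0 // ler_wpM2l ?Kq_ge0 //.
  by rewrite lerD2l (le_trans (nmD _ _)) // lerD2l.
have z0 : nm (0 : C) <= r / 2 by rewrite nm0.
have [_ f2 _ f4] := polylim_der r20 r2r Fp FB.
have [_ _ _ l4] := polylim_der r20 r2r Lp LB.
have := f4 0 z0; have := l4 0 z0; have := f2 0 z0; rewrite !addr0 => B1 hL hF.
have hD : hasder (Dp chi n) s (Dp' n s).
  by apply: hasder_sum => k; apply: hasderZ; exact: hasder_npow.
have E := hasder_uniq hF (hasderB hL hD).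
rewrite nmBC -E (le_trans B1) // -/x.
have -> : Kq q r * (1 + (nm s + r)) * tpow r n / r / x ^+ 2 = K * tpow r n by rewrite /K; ring.
rewrite (le_trans (ler_wpM2l K0 tn)) // mulrCA ger_pMr // ler_pdivrMr // mul1r lerDr //.
Qed.

Definition log_height (T : R) : R := 1 + ln (2 + `|T|).

Lemma log_height_ge1 T : 1 <= log_height T.
Proof. by rewrite /log_height lerDl ln_ge0 //; have := normr_ge0 T; lra. Qed.

(** [poly_logderiv] is applied to a polynomial p close to L and L' on the disc of centre 3 + iT and
    radius 29/10. The disc stays in Re s >= 1/10, where L grows at most linearly, and |L| >= 1/2 at
    the centre. The list I consists of zeros of p; how close p must be depends on delta and T, but
    [C1] does not. *)
Lemma L_window : exists2 C1 : R, 0 <= C1 & forall T delta : R, 0 < delta -> delta <= 1 ->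
  exists I : seq C, [/\ (size I)%:R <= C1 * log_height T,
    (forall p, p \in I -> complex.Re p <= 2^-1 + delta / 2) &
    forall s, nm (s - Complex 3 T) <= 13 / 5 -> 2^-1 + delta <= complex.Re s ->
      nm (Ld s / L s) <= \sum_(p <- I) (nm (s - p))^-1 + C1 * log_height T].
Proof.
have r'0 : (0 : R) <= 13 / 5 by rewrite divr_ge0.
have r'r : (13 / 5 : R) < 11 / 4 by lra.
have rR : (11 / 4 : R) < 29 / 10 by lra.
have r0 : (0 : R) <= 11 / 4 by rewrite divr_ge0.
have [K K0 hK] := @poly_logderiv R _ _ _ r'0 r'r rR.
have sg0 : (0 : R) < 1 / 20 by lra.
pose A := 4 * Kq q (1 / 20 : R) + 1.
have A1 : 1 <= A by rewrite /A lerDr mulr_ge0 ?Kq_ge0.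
have A0 : 0 < A by rewrite (lt_le_trans ltr01).
exists (K * (2 + ln (4 * A)) + 1).
  by rewrite addr_ge0 // mulr_ge0 // addr_ge0 // ln_ge0 //; lra.
move=> T delta d0 d1; set c : C := Complex 3 T.
have cT : nm c <= 3 + `|T| by rewrite (le_trans (nm_ReIm _)) //= ger0_norm.
pose M0 := Kq q (1 / 20 : R) * (1 + (nm c + 29 / 10)).
have Kq0 := Kq_ge0 q sg0.
have MA : M0 + 1 <= A * (2 + `|T|).
  have nT := normr_ge0 T.
  have : M0 <= Kq q (1 / 20) * (4 * (2 + `|T|)) by rewrite ler_wpM2l //; lra.
  rewrite /A; nra.
have Lp : polylim (29 / 10) (fun z => L (c + z)) by apply: (L_polylim q0 hchi); rewrite /=; lra.
have LB z : nm z <= 29 / 10 -> nm (L (c + z)) <= M0.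
  by move=> hz; apply: (L_disc_bound q0 hchi sg0) => //=; lra.
have [l1 l2 _ _] := polylim_der r0 rR Lp LB.
set B' := M0 / _ / _ in l2.
have B'0 : 0 <= B' by apply: le_trans (l2 0 _); rewrite ?nm_ge0 ?nm0.
have M00 : 0 <= M0 by apply: le_trans (LB 0 _); rewrite ?nm_ge0 ?nm0.
have x1 : 2^-1 < 2^-1 + delta / 2 :> R by rewrite ltrDl divr_gt0.
have x2 : 2^-1 + delta / 2 <= 6 :> R by lra.
have y12 : T - 3 <= T + 3 by lra.
have [c0 c00 hc0] := L_inf x1 x2 y12.
have inrect z : nm z <= 11 / 4 -> 2^-1 + delta / 2 <= complex.Re (c + z) ->
    rect (2^-1 + delta / 2) 6 (T - 3) (T + 3) (c + z).
  move=> hz h; have := le_trans (absRe_le z) hz; have := le_trans (absIm_le z) hz.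
  rewrite !ler_norml => /andP[i1 i2] /andP[j1 j2].
  split; rewrite ?h ?ImD ?ReD /=; first by clear - R q chi q0 hchi hG i1 i2 j1 j2; lra.
  by apply/andP; split; clear - R q chi q0 hchi hG i1 i2 j1 j2; lra.
(* The three bounds give |p| >= 1/4 at the centre, |p| >= c0/2 to the right of 1/2 + delta/2, and
   logarithmic derivatives of L and p that differ by at most 1. *)
pose e := Num.min 4^-1 (Num.min (c0 / 2) (c0 * (c0 / 2) / (1 + (B' + M0)))).
have BM : 0 < 1 + (B' + M0) by rewrite ltr_pwDl // addr_ge0.
have c02 : 0 < c0 / 2 by rewrite divr_gt0.
have e0 : 0 < e.
  by rewrite !lt_min invr_gt0 c02 /= ltr0n /=; apply: divr_gt0 => //; apply: mulr_gt0.
have e1 : e <= 4^-1 by rewrite ge_min lexx.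
have e2 : e <= c0 / 2 by rewrite !ge_min lexx orbT.
have e3 : e <= c0 * (c0 / 2) / (1 + (B' + M0)) by rewrite !ge_min lexx !orbT.
have [p [p1 p2]] := l1 e e0.
have sub z : nm z <= 11 / 4 -> nm z <= 29 / 10 by move=> h; rewrite (le_trans h) // ltW.
(* This is where GRH confines the zeros of p: right of 1/2 + delta/2 the modulus of L has a positive
   minimum on the rectangle, which p inherits up to a factor 2. *)
have plow z : nm z <= 11 / 4 -> 2^-1 + delta / 2 <= complex.Re (c + z) -> c0 / 2 <= nm p.[z].
  move=> hz h; have := hc0 _ (inrect z hz h); have := p1 z (sub z hz).
  have := nm_lB (L (c + z)) p.[z]; move: e2; clear - R q chi q0 hchi hG; lra.
have a0 : (0 : R) < 4^-1 by [].
have pa0 : 4^-1 <= nm p.[0].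
  have := @L_lower R q chi q0 hchi c (lexx _).
  have := p1 0; rewrite nm0 addr0 => /(_ ltac:(by [])).
  have := nm_lB (L c) p.[0]; move: e1; clear - R q chi q0 hchi hG; lra.
have pM z : nm z = 29 / 10 -> nm p.[z] <= M0 + 1.
  move=> hz; have := p1 z (eqW hz); have := LB z (eqW hz).
  have := nm_lB p.[z] (L (c + z)); rewrite nmBC; move: e1; clear - R q chi q0 hchi hG; lra.
have [I [I1 I2 I3]] := hK p (M0 + 1) 4^-1 a0 pa0 pM.
have lnM : 1 + ln ((M0 + 1) / 4^-1) <= (2 + ln (4 * A)) * log_height T.
  have h : ln ((M0 + 1) / 4^-1) <= ln (4 * A) + ln (2 + `|T|).
    have nT := normr_ge0 T; have T2 : 0 < 2 + `|T| by clear - R q chi q0 hchi hG nT; lra.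
    have A4 : 0 < 4 * A by rewrite mulr_gt0.
    have h1 : 0 < (M0 + 1) * 4 by clear - R q chi q0 hchi hG M00; lra.
    rewrite -lnM ?posrE // invrK ler_ln ?posrE // ?(mulr_gt0 A4 T2) //.
    by rewrite -mulrA; move: MA; set P := A * _; clear - R q chi q0 hchi hG; lra.
  have l1' : 0 <= ln (4 * A) by rewrite ln_ge0 //; clear - R q chi q0 hchi hG A1; lra.
  have := log_height_ge1 T; rewrite /log_height; set v := ln (2 + `|T|) in h * => hv; clear - R q chi q0 hchi hG h hv l1'; nra.
have KlnM : K * (1 + ln ((M0 + 1) / 4^-1)) <= K * (2 + ln (4 * A)) * log_height T.
  by rewrite -mulrA ler_wpM2l.
have lg0 : 0 <= log_height T by rewrite (le_trans ler01) // log_height_ge1.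
exists (map (fun z => c + z) I); split.
- rewrite size_map (le_trans I1) // (le_trans KlnM) // ler_wpM2r // lerDl //.
- move=> _ /mapP[z /I2 [rz hz] ->]; rewrite leNgt; apply/negP => h.
  have := plow z hz (ltW h); move: rz; rewrite /root => /eqP ->.
  by rewrite nm0 leNgt divr_gt0.
move=> s hs hre; pose z := s - c.
have sz : s = c + z by rewrite /z; ring.
have hz : nm z <= 13 / 5 by [].
have hz' : nm z <= 11 / 4 by rewrite (le_trans hz) // ltW.
have hre' : 2^-1 + delta / 2 <= complex.Re (c + z) by rewrite -sz; clear - R q chi q0 hchi hG d0 hre; lra.
have pz := plow z hz' hre'.
have Lz := hc0 _ (inrect z hz' hre').
have pz0 : p.[z] != 0 by rewrite -nm_gt0 (lt_le_trans _ pz) // divr_gt0.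
have Lz0 : L (c + z) != 0 by rewrite -nm_gt0 (lt_le_trans c00).
have H := I3 z hz pz0.
have H2 : nm (Ld s / L s - p^`().[z] / p.[z]) <= 1.
  rewrite sz; have -> : Ld (c + z) / L (c + z) - p^`().[z] / p.[z] =
     (L (c + z) * (Ld (c + z) - p^`().[z]) - Ld (c + z) * (L (c + z) - p.[z])) / (L (c + z) * p.[z]).
    by field; rewrite pz0 Lz0.
  rewrite nmM nmV ler_pdivrMr ?nm_gt0 ?mulf_neq0 // mul1r (le_trans (nmB _ _)) //.
  apply: (@le_trans _ _ (c0 * (c0 / 2))); last by rewrite nmM ler_pM ?(ltW c00) ?(ltW c02).
  apply: (@le_trans _ _ ((B' + M0) * e)).
    rewrite !nmM addrC mulrDl lerD // ler_pM ?nm_ge0 //; first exact: l2.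
    - by rewrite p1 // sub.
    - by rewrite LB // sub.
    - exact: p2.
  rewrite (le_trans (ler_wpM2l _ e3)) ?addr_ge0 // mulrCA ger_pMr ?(mulr_gt0 c00 c02) //.
  by rewrite ler_pdivrMr // mul1r lerDr.
have -> : Ld s / L s = (Ld s / L s - p^`().[z] / p.[z]) + p^`().[z] / p.[z] by ring.
rewrite (le_trans (nmD _ _)) // (le_trans (lerD H2 H)) // big_map.
have -> : \sum_(j <- I) (nm (s - (c + j)))^-1 = \sum_(j <- I) (nm (z - j))^-1.
  by apply: eq_bigr => j _; rewrite sz; congr (nm _)^-1; ring.
have h1 := log_height_ge1 T; move: KlnM; set KL := K * _ * log_height T; set KX := K * (1 + _); rewrite (_ : (K * (2 + ln (4 * A)) + 1) * log_height T = KL + log_height T); first by move=> lk; clear - R q chi q0 hchi hG h1 lk; lra.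
by rewrite /KL; ring.
Qed.

End LOrder.

(** * The pole 1/s as a limit of exponential sums *)

Section PoleApprox.
Variable R : realType.
Local Notation C := (Cx R).
Implicit Types (x y v e th : R) (z w s c : C).

(** With w = e^(-th s) the sum is th (1 - w^J)/(1 - w), and 1 - w equals th s up to a relative error
    of order th |s|. The condition th |s| <= 1/8 keeps 1 - w away from 0. *)
Lemma geo_pole s th (J : nat) : 0 < th -> 5 / 2 <= complex.Re s -> th * nm s <= 8^-1 ->
  nm (s^-1 - \sum_(0 <= j < J) cR th * cexp (- s * cR (th * j%:R))) <=
  8 * th + expR (- (5 / 2 * th)) ^+ J.
Proof.
move=> th0 sr hs; pose z := - s * cR th; pose w := cexp z.
have ns : 5 / 2 <= nm s by rewrite (le_trans sr) // nm_Re_le.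
have s0 : s != 0 by rewrite -nm_gt0; lra.
have nz : nm z = th * nm s by rewrite /z nmM nmN nm_cR (gtr0_norm th0) mulrC.
have nz0 : 0 < nm z by rewrite nz mulr_gt0 // nm_gt0.
have hz : nm (w - 1 - z) <= 4 * nm z ^+ 2 by apply: cexp_sub2_le; rewrite nz; lra.
have w1 : nm z / 2 <= nm (1 - w).
  have -> : 1 - w = - (z + (w - 1 - z)) by ring.
  have := nm_lD z (w - 1 - z); rewrite nmN.
  have : 4 * nm z ^+ 2 <= nm z / 2 by rewrite nz in nz0 *; nra.
  lra.
have w10 : 1 - w != 0 by rewrite -nm_gt0 (lt_le_trans _ w1) // divr_gt0.
have E : \sum_(0 <= j < J) cR th * cexp (- s * cR (th * j%:R)) = cR th * ((1 - w ^+ J) / (1 - w)).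
  rewrite -mulr_sumr; congr (_ * _).
  have -> : \sum_(0 <= j < J) cexp (- s * cR (th * j%:R)) = \sum_(0 <= j < J) w ^+ j.
    by apply: eq_bigr => j _; rewrite -cexpMn /z cRM cR_nat; congr cexp; ring.
  apply: (mulIf w10); rewrite mulfVK // mulr_suml -[RHS]opprB -[in RHS](expr0 w).
  rewrite -(telescope_sumr (fun k => w ^+ k)) // -sumrN.
  by apply: eq_bigr => k _; rewrite exprS; ring.
have thz : cR th = - z / s by rewrite /z; field.
have hw : nm w = expR (- (complex.Re s * th)).
  by rewrite /w nm_cexp /z ReM ReN /= mulr0 subr0 mulNr.
clearbody w; clearbody z.
have -> : s^-1 - \sum_(0 <= j < J) cR th * cexp (- s * cR (th * j%:R)) =
   - (w - 1 - z) / (s * (1 - w)) - (w ^+ J * z) / (s * (1 - w)).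
  by rewrite E thz; field; rewrite s0 w10.
have th2 : (s * (1 - w)) != 0 by rewrite mulf_neq0.
rewrite (le_trans (nmB _ _)) // !nmM nmN !nmV !nmM nmX lerD //.
  rewrite ler_pdivrMr ?mulr_gt0 ?nm_gt0 // (le_trans hz) //.
  have : nm s * (nm z / 2) <= nm s * nm (1 - w) by rewrite ler_wpM2l ?nm_ge0.
  have -> : nm z ^+ 2 = th * (nm s * nm z) by rewrite nz; ring.
  have p : 0 < nm s * nm z by apply: mulr_gt0 => //; rewrite nm_gt0.
  nra.
apply: (@le_trans _ _ (expR (- (complex.Re s * th)) ^+ J * 1)).
  rewrite hw -mulrA ler_wpM2l ?exprn_ge0 ?expR_ge0 // ler_pdivrMr ?mulr_gt0 ?nm_gt0 // mul1r.
  have : nm s * (nm z / 2) <= nm s * nm (1 - w) by rewrite ler_wpM2l ?nm_ge0.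
  nra.
rewrite mulr1; apply: lerXn2r; rewrite ?nnegrE ?expR_ge0 // ler_expR; nra.
Qed.

Definition fejer_primitive y : R := if y <= 0 then 0 else y - 1 + expR (- y).

Lemma fejer_primitive_up y th : 0 < th -> th * fejer_weight y <= fejer_primitive (y + th) - fejer_primitive y.
Proof.
move=> th0; rewrite /fejer_weight /fejer_primitive.
have E : expR (- (y + th)) = expR (- y) * expR (- th) by rewrite -expRD; congr expR; ring.
have := expR_ge1Dx (- th); have := expR_gt0 (- y); have := expR_ge1Dx (- (y + th)).
case: (leP y 0) => y0; case: (leP (y + th) 0) => y1; rewrite ?E => h1 h2 h3; nra.
Qed.

Lemma fejer_primitive_lo y th : 0 < th -> fejer_primitive y - fejer_primitive (y - th) <= th * fejer_weight y.
Proof.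
move=> th0; rewrite /fejer_weight /fejer_primitive.
have E : expR (- (y - th)) = expR (- y) * expR th by rewrite -expRD; congr expR; ring.
have e1 : expR (- y) * expR y = 1 by rewrite -expRD addNr expR0.
have := expR_ge1Dx th; have := expR_gt0 (- y); have := expR_ge1Dx y.
case: (leP y 0) => y0; case: (leP (y - th) 0) => y1; rewrite ?E => h1 h2 h3; nra.
Qed.

(** A Riemann sum of a nondecreasing function, enclosed between increments of its primitive; the
    primitive at v is v + O(1). *)
Lemma fejer_weight_sum v th (J : nat) : 0 <= v -> 0 < th -> v <= th * J%:R ->
  `|\sum_(0 <= j < J) th * fejer_weight (v - th * j%:R) - v| <= 1 + th.
Proof.
move=> v0 th0 vJ.
have U : \sum_(0 <= j < J) th * fejer_weight (v - th * j%:R) <= fejer_primitive (v + th) - fejer_primitive (v + th - th * J%:R).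
  have -> : fejer_primitive (v + th) - fejer_primitive (v + th - th * J%:R) =
     \sum_(0 <= j < J) (- fejer_primitive (v + th - th * j.+1%:R) - - fejer_primitive (v + th - th * j%:R)).
    by rewrite (telescope_sumr (fun j : nat => - fejer_primitive (v + th - th * j%:R))) // mulr0 subr0; ring.
  apply: ler_sum => j _; have := fejer_primitive_up (v - th * j%:R) th0; rewrite -natr1.
  have -> : v - th * j%:R + th = v + th - th * j%:R by ring.
  have -> : v + th - th * (j%:R + 1) = v - th * j%:R by ring.
  lra.
have Lo : fejer_primitive v - fejer_primitive (v - th * J%:R) <= \sum_(0 <= j < J) th * fejer_weight (v - th * j%:R).
  have -> : fejer_primitive v - fejer_primitive (v - th * J%:R) =
     \sum_(0 <= j < J) (- fejer_primitive (v - th * j.+1%:R) - - fejer_primitive (v - th * j%:R)).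
    by rewrite (telescope_sumr (fun j : nat => - fejer_primitive (v - th * j%:R))) // mulr0 subr0; ring.
  apply: ler_sum => j _; have := fejer_primitive_lo (v - th * j%:R) th0; rewrite -natr1.
  have -> : v - th * (j%:R + 1) = v - th * j%:R - th by ring.
  lra.
move: U Lo; set S := \sum_(_ <= _ < _) _.
have P0 y : 0 <= fejer_primitive y.
  by rewrite /fejer_primitive; case: (leP y 0) => // y0; have := expR_ge1Dx (- y); lra.
have := P0 (v + th - th * J%:R).
have -> : fejer_primitive (v - th * J%:R) = 0 by rewrite /fejer_primitive; case: leP => //; lra.
have : fejer_primitive (v + th) <= v + th.
  rewrite /fejer_primitive; case: (leP (v + th) 0) => h; first by lra.
  have : expR (- (v + th)) <= 1 by rewrite -[leRHS]expR0 ler_expR; lra.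
  lra.
have : v - 1 <= fejer_primitive v.
  by rewrite /fejer_primitive; case: (leP v 0) => h; [lra|have := expR_ge0 (- v); lra].
by move=> a1 a2 a3 a4 a5; rewrite ler_norml; apply/andP; split; lra.
Qed.

(* 1/s is close to a geometric sum th * sum_j exp(-j th s), so that Perron's formula
   for exponential sums also evaluates the polar part m/s, which yields the term in ln X. *)
Lemma pole_data v (N : nat) eps : 0 <= v -> 0 < eps -> exists (J : nat) (th : R),
  [/\ 0 < th,
   (forall t, - N%:R <= t <= N%:R -> nm ((Complex (5 / 2) t : C)^-1 -
      \sum_(0 <= j < J) cR th * cexp (- (Complex (5 / 2) t : C) * cR (th * j%:R))) <= eps),
   \sum_(0 <= j < J) th * expR (- (5 / 2) * (th * j%:R)) <= 1 &
   `|\sum_(0 <= j < J) th * fejer_weight (v - th * j%:R) - v| <= 2].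
Proof.
move=> v0 eps0.
have N3 : 0 < 8 * (N%:R + 3) :> R by rewrite mulr_gt0 // ltr_pwDr.
(* The first bound ensures th |s| <= 1/8 on the segment |t| <= N, as [geo_pole] requires, and the
   second makes its error 8 th at most eps/2. *)
pose th := Num.min (8 * (N%:R + 3))^-1 (eps / 16).
have th0 : 0 < th by rewrite lt_min invr_gt0 N3 divr_gt0.
have th1 : th * (8 * (N%:R + 3)) <= 1.
  by rewrite -ler_pdivlMr // mul1r ge_min lexx.
have th2 : th <= eps / 16 by rewrite ge_min lexx orbT.
clearbody th.
have N0 := ler0n R N.
have th3 : th <= 1 / 24 by nra.
have r0 : 0 <= expR (- (5 / 2 * th)) < 1.
  by rewrite expR_ge0 -[ltRHS]expR0 ltr_expR; nra.
have e2 : 0 < eps / 2 by rewrite divr_gt0.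
have a0 : 0 < 5 / 2 * th by lra.
have [J1 hJ1] := exp_small a0 e2.
have [J2 hJ2] : exists n : nat, v / th <= n%:R.
  by exists (Num.truncn (v / th)).+1; rewrite ltW // truncnS_gt.
exists (maxn J1 J2), th; split => //.
- move=> t /andP[t1 t2]; set s : C := Complex _ _.
  have ns : nm s <= N%:R + 3.
    rewrite (le_trans (nm_ReIm _)) //= ger0_norm; last by lra.
    have : `|t| <= N%:R by rewrite ler_norml t1 t2.
    lra.
  rewrite (le_trans (geo_pole _ th0 _ _)) //; first by nra.
  have := hJ1 (maxn J1 J2) (leq_maxl _ _); lra.
- set r := expR (- (5 / 2 * th)) in r0.
  move: r0 => /andP[r0 r1].
  have -> : \sum_(0 <= j < maxn J1 J2) th * expR (- (5 / 2) * (th * j%:R)) = th * \sum_(0 <= j < maxn J1 J2) r ^+ j.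
    rewrite mulr_sumr; apply: eq_bigr => j _; rewrite /r -expRM_natl; congr (_ * expR _); ring.
  rewrite (le_trans (ler_wpM2l (ltW th0) (geo_tail _ _ r0 (lexx r) r1))) // expr0.
  rewrite mul1r ler_pdivrMr; last by lra.
  rewrite mul1r /r; have := expR_ge1Dx (5 / 2 * th).
  have := expR_gt0 (- (5 / 2 * th)); have : expR (- (5 / 2 * th)) * expR (5 / 2 * th) = 1 by rewrite -expRD addNr expR0.
  set E := expR (- _); set E' := expR _ => h1 h2 h3; nra.
rewrite (le_trans (fejer_weight_sum v0 th0 _)) //; last by lra.
rewrite mulrC -ler_pdivrMr // (le_trans hJ2) // ler_nat; exact: leq_maxr.
Qed.

End PoleApprox.

(** * The Dirichlet series of -L'/L *)

Section LogDerivSeries.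
Variable R : realType.
Local Notation C := (Cx R).
Implicit Types (x y v e : R) (z w s c : C).
Local Notation tpow := (@tpow R).
Local Notation Lam := (@Lam R).
Variables (q : nat) (chi : nat -> C).
Hypothesis q0 : (0 < q)%N.
Hypothesis hchi : nonprincipal_chars q chi.
Let hd : is_dchar q chi := hchi.1.
Local Notation L := (Lchi chi).
Local Notation Ld := (der (Lchi chi)).

Definition Lam_dsum M s : C := \sum_(1 <= n < M) cR (Lam n) * chi n * npow_neg n s.

Lemma Lam_tpow n : (0 < n)%N -> Lam n * tpow 3 n <= tpow 1 n / n%:R.
Proof.
move=> n0; have N0 : 0 < n%:R :> R by rewrite ltr0n.
have : Lam n <= n%:R by rewrite (le_trans (Lam_le_ln _ n0)) // ltW // ln_sublinear.
rewrite tpow3 // => h; rewrite mulrA ler_pdivrMr // mulrC.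
by rewrite ler_wpM2l // mulr_ge0 ?invr_ge0 ?tpow_ge0.
Qed.

Lemma npow_mul m n s : (0 < m)%N -> (0 < n)%N -> npow_neg (m * n) s = npow_neg m s * npow_neg n s.
Proof.
by move=> m0 n0; rewrite !npow_negE natrM lnM ?posrE ?ltr0n // cRD mulrDr cexpD.
Qed.

Lemma Lam_dsum_tail s M M' : 3 <= complex.Re s -> (0 < M)%N -> (M <= M')%N -> nm (Lam_dsum M' s - Lam_dsum M s) <= 4 * tpow 1 M.
Proof.
move=> hs M0 MM; rewrite /Lam_dsum (@big_cat_nat _ _ _ M) //= addrAC subrr add0r.
rewrite (le_trans (nm_sum _ _ _)) //.
apply: (@le_trans _ _ (\sum_(M <= n < M') tpow 1 n / n%:R)).
  rewrite big_nat_cond [leRHS]big_nat_cond ler_sum // => n /andP[/andP[Mn _] _].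
  have n0 : (0 < n)%N by exact: leq_trans Mn.
  rewrite (le_trans _ (Lam_tpow n0)) // !nmM nm_cR (ger0_norm (Lam_ge0 _ _)) -mulrA.
  rewrite ler_wpM2l ?Lam_ge0 // -[leRHS]mul1r ler_pM ?nm_ge0 ?(nm_chi_le1 q0 hd) //.
  exact: nm_npow_le.
rewrite (le_trans (tpow_sum ltr01 M0 MM)) //.
have := tpow_ge0 (1:R) M'; lra.
Qed.

Lemma Lam_dsum_bound s M : 3 <= complex.Re s -> nm (Lam_dsum M s) <= 4.
Proof.
move=> hs; case: M => [|M]; first by rewrite /Lam_dsum big_geq // nm0.
have := @Lam_dsum_tail s 1 M.+1 hs isT isT; rewrite {2}/Lam_dsum big_geq // subr0 tpow1 // invr1; lra.
Qed.

(** In the product of the two partial sums the terms with dm < M cancel against the differentiated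
    series by [hyperbola]. In the others dm >= M lets half a power of dm be traded for M^(-1/2);
    what is left is a product of two convergent sums, each at most 6. *)
Lemma Lam_dsum_mul s M : 3 <= complex.Re s -> (0 < M)%N -> nm (Lam_dsum M s * Dp chi M s + Dp' chi M s) <= 36 * tpow 2^-1 M.
Proof.
move=> hs M0.
have E : - Dp' chi M s = \sum_(1 <= d < M) \sum_(1 <= m < M | (d * m < M)%N)
    (cR (Lam d) * chi d * npow_neg d s) * (chi m * npow_neg m s).
  rewrite /Dp' -sumrN.
  transitivity (\sum_(1 <= n < M) cR (ln n%:R) * (chi n * npow_neg n s)).
    by apply: eq_bigr => n _; ring.
  rewrite (hyperbola (phi := fun n x => cR x * (chi n * npow_neg n s))); first last.
  - by move=> n x y; rewrite cRD mulrDl.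
  - by move=> n; rewrite cR0 mul0r.
  apply: eq_big_nat => d /andP[d1 _]; rewrite big_nat_cond [RHS]big_nat_cond.
  apply: eq_bigr => m /andP[/andP[m1 _] _]; rewrite (chiM hd) npow_mul //; ring.
have -> : Lam_dsum M s * Dp chi M s + Dp' chi M s = \sum_(1 <= d < M) \sum_(1 <= m < M | ~~ (d * m < M)%N)
    (cR (Lam d) * chi d * npow_neg d s) * (chi m * npow_neg m s).
  have -> : Dp' chi M s = - - Dp' chi M s by rewrite opprK.
  rewrite E /Lam_dsum /Dp mulr_suml -sumrB; apply: eq_bigr => d _.
  by rewrite mulr_sumr (bigID (fun m => d * m < M)%N) /= addrAC subrr add0r.
have h32 : (0 : R) < 2^-1 by rewrite invr_gt0.
have T32 : \sum_(1 <= n < M) tpow 2^-1 n / n%:R <= 6.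
  rewrite (le_trans (tpow_sum h32 _ M0)) //.
  have := tpow_ge0 (2^-1 : R) M; rewrite tpow_one; lra.
apply: (@le_trans _ _ (\sum_(1 <= d < M) \sum_(1 <= m < M)
   tpow 2^-1 M * (tpow 2^-1 d / d%:R) * (tpow 2^-1 m / m%:R))).
  rewrite (le_trans (nm_sum _ _ _)) //.
  rewrite big_nat_cond [leRHS]big_nat_cond ler_sum // => d /andP[/andP[d1 _] _].
  rewrite (le_trans (nm_sum _ _ _)) // big_mkcond.
  rewrite big_nat_cond [leRHS]big_nat_cond ler_sum // => m /andP[/andP[m1 _] _].
  case: ifP => [|_]; last first.
    by rewrite !mulr_ge0 ?tpow_ge0 ?invr_ge0.
  rewrite -leqNgt => hM.
  have B1 : nm (cR (Lam d) * chi d * npow_neg d s) <= tpow 1 d / d%:R.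
    rewrite (le_trans _ (Lam_tpow d1)) // !nmM nm_cR (ger0_norm (Lam_ge0 _ _)) -mulrA.
    rewrite ler_wpM2l ?Lam_ge0 // -[leRHS]mul1r ler_pM ?nm_ge0 ?(nm_chi_le1 q0 hd) //.
    exact: nm_npow_le.
  have B2 : nm (chi m * npow_neg m s) <= tpow 1 m / m%:R.
    rewrite nmM -[leRHS]mul1r ler_pM ?nm_ge0 ?(nm_chi_le1 q0 hd) //.
    rewrite (le_trans (nm_npow_le m hs)) // tpow3 // ler_piMr //.
      by rewrite mulr_ge0 ?tpow_ge0 ?invr_ge0.
    by rewrite invf_le1 ?ltr0n // ler1n.
  rewrite nmM (le_trans (ler_pM (nm_ge0 _) (nm_ge0 _) B1 B2)) //.
  have E1 n : tpow 1 n = tpow 2^-1 n * tpow 2^-1 n by rewrite -tpowD (_ : 2^-1 + 2^-1 = 1 :> R) //; field.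
  rewrite !E1.
  have : tpow 2^-1 d * tpow 2^-1 m <= tpow 2^-1 M.
    by rewrite -tpowMn //; apply: tpow_mono => //; exact: ltW.
  have : 0 <= tpow 2^-1 d * tpow 2^-1 m * d%:R^-1 * m%:R^-1 by rewrite !mulr_ge0 ?tpow_ge0 ?invr_ge0.
  set A := tpow _ d; set B := tpow _ m; set D := tpow _ M; set X := d%:R^-1; set Y := m%:R^-1 => h1 h2.
  have -> : A * A * X * (B * B * Y) = (A * B) * (A * B * X * Y) by ring.
  have -> : D * (A * X) * (B * Y) = D * (A * B * X * Y) by ring.
  exact: ler_wpM2r.
have -> : \sum_(1 <= d < M) \sum_(1 <= m < M) tpow 2^-1 M * (tpow 2^-1 d / d%:R) * (tpow 2^-1 m / m%:R)
  = tpow 2^-1 M * ((\sum_(1 <= n < M) tpow 2^-1 n / n%:R) * (\sum_(1 <= n < M) tpow 2^-1 n / n%:R)).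
  rewrite mulr_suml mulr_sumr; apply: eq_bigr => d _; rewrite !mulr_sumr; apply: eq_bigr => m _; ring.
rewrite mulrC ler_wpM2r ?tpow_ge0 //.
have S0 : 0 <= \sum_(1 <= n < M) tpow 2^-1 n / n%:R by apply: sumr_ge0 => n _; rewrite divr_ge0 ?tpow_ge0.
nra.
Qed.

(** The identity is proved at a much larger truncation M', where all errors are below e, and then M'
    is cut back to M at the cost of a tail. *)
Lemma Lam_dsum_logderiv s M : 3 <= complex.Re s -> (0 < M)%N -> nm (Lam_dsum M s + Ld s / L s) <= 4 * tpow 1 M.
Proof.
move=> hs M0; apply/ler_addgt0Pr => e e0.
have s0 : 0 < complex.Re s by lra.
have nL := L_lower q0 hchi hs.
have L0 : L s != 0 by rewrite -nm_gt0; lra.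
(* The errors total 4 e1 + e1 + e1 = e/2, and dividing by |L| >= 1/2 gives e. *)
pose e1 := e / 12; have e10 : 0 < e1 by rewrite divr_gt0.
have [N1 h1] := Dp'_cvg q0 hchi s0 e10.
have h2i : (0 : R) < 2^-1 by rewrite invr_gt0.
have e36 : 0 < e1 / 36 by rewrite divr_gt0.
have [N2 h2] := tpow_small h2i e36.
have K0 : 0 < 1 + Kq q 1 * (1 + nm s).
  by rewrite ltr_pwDl // mulr_ge0 ?addr_ge0 ?nm_ge0 // Kq_ge0.
have [N3 h3] := tpow_small (@ltr01 R) (divr_gt0 e10 K0).
pose M' := maxn M (maxn N1 (maxn N2 N3)).
have MM : (M <= M')%N by rewrite /M' !leq_max leqnn ?orbT.
have l1 : (N1 <= M')%N by rewrite /M' !leq_max leqnn ?orbT.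
have l2 : (N2 <= M')%N by rewrite /M' !leq_max leqnn ?orbT.
have l3 : (N3 <= M')%N by rewrite /M' !leq_max leqnn ?orbT.
have M'0 : (0 < M')%N by exact: leq_trans MM.
have A1 := h1 _ l1; have [_ A2] := h2 _ l2; have [_ A3] := h3 _ l3.
have A4 : nm (L s - Dp chi M' s) <= e1.
  have h13 : 1 <= complex.Re s by lra.
  rewrite (le_trans (L_approx q0 hchi ltr01 h13 M'0)) //.
  rewrite (le_trans (ler_wpM2l _ A3)) ?mulr_ge0 ?addr_ge0 ?nm_ge0 ?Kq_ge0 //.
  by rewrite mulrCA ger_pMr // ler_pdivrMr // mul1r lerDr.
have A5 := Lam_dsum_mul hs M'0.
have A6 := Lam_dsum_bound M' hs.
have A7 := Lam_dsum_tail hs M0 MM.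
have -> : Lam_dsum M s + Ld s / L s = (Lam_dsum M' s * (L s - Dp chi M' s) + (Lam_dsum M' s * Dp chi M' s + Dp' chi M' s)
    - (Dp' chi M' s - Ld s)) / L s - (Lam_dsum M' s - Lam_dsum M s).
  by field.
rewrite (le_trans (nmB _ _)) // addrC lerD //.
rewrite nmM nmV ler_pdivrMr ?nm_gt0 // (le_trans (nmB _ _)) // (le_trans (lerD (nmD _ _) (lexx _))) //.
rewrite nmM.
have : nm (Lam_dsum M' s) * nm (L s - Dp chi M' s) <= 4 * e1 by rewrite ler_pM ?nm_ge0.
have : 36 * tpow 2^-1 M' <= e1 by move: A2; lra.
move: A5 A1 nL; set X := nm _; set Y := nm _; set Z := nm (L s) => A5 A1 nL h h'.
have : e * 2^-1 <= e * Z by rewrite ler_wpM2l // ltW.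
rewrite /e1 in h h' A1 *; lra.
Qed.

End LogDerivSeries.

(** * Sums over prime powers under GRH *)

Section CellSums.
Variable R : realType.
Implicit Types (x y h d : R).
Local Notation invS := (@invS R).
Local Notation grid_mid := (@grid_mid R).
Local Notation grid_edge := (@grid_edge R).

Lemma ln1_ge x : 0 <= x -> x / (1 + x) <= ln (1 + x).
Proof.
move=> x0; have x1 : 0 < 1 + x by lra.
have i0 : 0 < (1 + x)^-1 by rewrite invr_gt0.
have e1 : (1 + x) * (1 + x)^-1 = 1 by rewrite divff // lt0r_neq0.
have := @le_ln1Dx R (- (x / (1 + x))).
have E : x / (1 + x) = 1 - (1 + x)^-1 by field; exact: lt0r_neq0.
have -> : 1 + - (x / (1 + x)) = (1 + x)^-1 by rewrite E; ring.
rewrite lnV ?posrE // => h; have := h ltac:(rewrite E; lra); lra.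
Qed.

(* A primitive of 1 / (d + |y|). *)
Definition signed_log d y : R := if 0 <= y then ln (1 + y / d) else - ln (1 - y / d).

Lemma signed_logN d y : signed_log d (- y) = - signed_log d y.
Proof.
rewrite /signed_log oppr_ge0; case: (ltgtP y 0) => [h|h|->]; rewrite ?mulNr ?opprK //.
by rewrite mul0r subr0 addr0 ln1 oppr0.
Qed.

Lemma signed_log_pos d y : 0 < d -> 0 <= y -> signed_log d y = ln (d + y) - ln d.
Proof.
move=> d0 y0; rewrite /signed_log y0 -ln_div ?posrE //; last by lra.
by congr ln; field; exact: lt0r_neq0.
Qed.

(** A lower bound for each increment makes Riemann sums of 1/(d + |y|) telescope. The condition h <=
    d handles a cell that straddles 0, where d + |y| varies by at most a factor 2. *)
Lemma signed_log_step d h y : 0 < d -> 0 < h -> h <= d ->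
  h / (2 * (d + `|y|)) <= signed_log d (y + h / 2) - signed_log d (y - h / 2).
Proof.
move=> d0 h0 hd.
wlog y0 : y / 0 <= y.
  move=> H; case: (leP 0 y) => y0; first exact: H.
  have := H (- y); rewrite normrN => /(_ ltac:(lra)).
  have -> : - y + h / 2 = - (y - h / 2) by ring.
  have -> : - y - h / 2 = - (y + h / 2) by ring.
  rewrite !signed_logN; lra.
rewrite (ger0_norm y0).
have lnle (a b : R) : 0 < a -> a <= b -> (b - a) / b <= ln b - ln a.
  move=> a0 ab; have b0 : 0 < b by lra.
  have x0 : 0 <= (b - a) / a by rewrite divr_ge0; lra.
  have := ln1_ge x0; have -> : 1 + (b - a) / a = b / a by field; exact: lt0r_neq0.
  rewrite ln_div ?posrE //; have -> // : (b - a) / a / (b / a) = (b - a) / b.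
  by field; apply/andP; split; exact: lt0r_neq0.
case: (leP 0 (y - h / 2)) => yh.
  rewrite !signed_log_pos //; last by lra.
  have := lnle (d + (y - h / 2)) (d + (y + h / 2)) ltac:(lra) ltac:(lra).
  have -> : d + (y + h / 2) - (d + (y - h / 2)) = h by field.
  move=> H; rewrite (_ : _ - _ - _ = ln (d + (y + h / 2)) - ln (d + (y - h / 2))); last by ring.
  apply: le_trans H; rewrite ler_wpM2l ?(ltW h0) // lef_pV2 ?posrE; lra.
have -> : y - h / 2 = - (h / 2 - y) by ring.
rewrite signed_logN opprK !signed_log_pos //; try lra.
have h1 := lnle d (d + (y + h / 2)) d0 ltac:(lra).
have h2 := lnle d (d + (h / 2 - y)) d0 ltac:(lra).
have dh : 0 < d + h by lra.
have g1 : (y + h / 2) / (d + h) <= (d + (y + h / 2) - d) / (d + (y + h / 2)).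
  by rewrite (addrAC d) subrr add0r ler_wpM2l ?lef_pV2 ?posrE; lra.
have g2 : (h / 2 - y) / (d + h) <= (d + (h / 2 - y) - d) / (d + (h / 2 - y)).
  by rewrite (addrAC d) subrr add0r ler_wpM2l ?lef_pV2 ?posrE; lra.
have g3 : h / (2 * (d + y)) <= h / (d + h).
  by rewrite ler_wpM2l ?(ltW h0) // lef_pV2 ?posrE; lra.
have E : (y + h / 2) / (d + h) + (h / 2 - y) / (d + h) = h / (d + h) by rewrite -mulrDl; congr (_ / _); field.
lra.
Qed.

Lemma signed_log_diff1 d y : 0 < d -> signed_log d (y + 1) - signed_log d y <= 2 * ln (1 + d^-1).
Proof.
move=> d0; have i0 : 0 < d^-1 by rewrite invr_gt0.
have dd : d * d^-1 = 1 by rewrite divff // lt0r_neq0.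
set l := ln (1 + d^-1).
have l0 : 0 <= l by rewrite ln_ge0 //; lra.
have key x : 0 <= x -> signed_log d (x + 1) - signed_log d x <= l.
  move=> x0; rewrite !signed_log_pos //; last by lra.
  have -> : ln (d + (x + 1)) - ln d - (ln (d + x) - ln d) = ln (d + (x + 1)) - ln (d + x) by ring.
  rewrite lerBlDr -lnM ?posrE; try lra.
  rewrite ler_ln ?posrE; try lra; last by rewrite mulr_gt0; lra.
  rewrite mulrDl mul1r mulrDr (mulrC _ d) dd; have : 0 <= d^-1 * x by rewrite mulr_ge0 // ltW.
  lra.
have mono1 x : 0 <= x -> x <= 1 -> signed_log d x <= l.
  move=> x0 x1; rewrite /signed_log x0 ler_ln ?posrE; try lra.
    by rewrite lerD2l -[leRHS]mul1r ler_wpM2r // ltW.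
  by have : 0 <= x / d by [rewrite divr_ge0 // ltW]; lra.
case: (leP 0 y) => y0; first by have := key y y0; lra.
case: (leP 0 (y + 1)) => y1.
  have := mono1 (y + 1) y1 ltac:(lra); have := mono1 (- y) ltac:(lra) ltac:(lra).
  rewrite signed_logN; lra.
have := key (- (y + 1)) ltac:(lra).
have -> : - (y + 1) + 1 = - y by ring.
rewrite !signed_logN; lra.
Qed.

Lemma sum_cst_seq (I : Type) (l : seq I) x : \sum_(i <- l) x = (size l)%:R * x.
Proof. by elim: l => [|i l IH]; rewrite ?big_nil ?mul0r // big_cons IH -nat1r mulrDl mul1r. Qed.

Lemma big_nat_blocks (A B : nat) (f : nat -> R) :
  \sum_(0 <= k < A * B) f k = \sum_(0 <= c < A) \sum_(0 <= j < B) f (c * B + j)%N.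
Proof.
elim: A => [|A IH]; first by rewrite mul0n !big_geq.
rewrite big_nat_recr //= -IH mulSn addnC (@big_cat_nat _ _ _ (A * B)) //=; last exact: leq_addr.
by congr (_ + _); rewrite -[X in \sum_(X <= _ < _) _]add0n big_addn addKn; apply: eq_bigr => j _; rewrite addnC.
Qed.

Definition cell_mid (N c : nat) : R := c%:R - N%:R + 2^-1.

Lemma grid_mid_cell N m c j : (j < m.+1)%N -> `|grid_mid N m (c * m.+1 + j) - cell_mid N c| <= 2^-1.
Proof.
move=> jm; rewrite /grid_mid /grid_edge /cell_mid natrD natrM.
have m1 : m.+1%:R * invS m = 1 by rewrite /invS divff // pnatr_eq0.
have -> : (c%:R * m.+1%:R + j%:R) * invS m - N%:R + invS m / 2 - (c%:R - N%:R + 2^-1) =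
  c%:R * (m.+1%:R * invS m - 1) + j%:R * invS m + invS m / 2 - 2^-1 by ring.
rewrite m1 subrr mulr0 add0r.
have r0 := invS_gt0 R m.
have : j.+1%:R * invS m <= 1 by rewrite -[leRHS]m1 ler_wpM2r ?(ltW r0) // ler_nat.
rewrite -natr1 mulrDl mul1r; have : 0 <= j%:R * invS m by rewrite mulr_ge0 // ltW.
by move: (j%:R * invS m) => a a0 a1; rewrite ler_norml; apply/andP; split; lra.
Qed.

(** The price of one point at height y and horizontal distance d over a unit of the line. With d of
    order 1/(1 + ln X) it is the source of ln ln X. The mesh has to be finer than d. *)
Lemma cell_sum N m c d y : 0 < d -> invS m <= d ->
  invS m * \sum_(0 <= j < m.+1) (d + `|grid_mid N m (c * m.+1 + j) - y|)^-1 <= 4 * ln (1 + d^-1).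
Proof.
move=> d0 hd; have h0 := invS_gt0 R m.
have H : \sum_(0 <= j < m.+1) invS m / (2 * (d + `|grid_mid N m (c * m.+1 + j) - y|)) <=
   signed_log d (grid_edge N m (c * m.+1 + m.+1) - y) - signed_log d (grid_edge N m (c * m.+1) - y).
  have -> : signed_log d (grid_edge N m (c * m.+1 + m.+1) - y) - signed_log d (grid_edge N m (c * m.+1) - y) = \sum_(0 <= j < m.+1)
      (signed_log d (grid_edge N m (c * m.+1 + j.+1) - y) - signed_log d (grid_edge N m (c * m.+1 + j) - y)).
    by rewrite (telescope_sumr (fun j => signed_log d (grid_edge N m (c * m.+1 + j) - y))) // addn0.
  apply: ler_sum => j _; rewrite addnS grid_edgeS.
  have -> : grid_mid N m (c * m.+1 + j) + invS m / 2 - y = grid_mid N m (c * m.+1 + j) - y + invS m / 2 by ring.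
  have -> : grid_edge N m (c * m.+1 + j) - y = grid_mid N m (c * m.+1 + j) - y - invS m / 2 by rewrite /grid_mid; ring.
  exact: signed_log_step.
have E : grid_edge N m (c * m.+1 + m.+1) - y = grid_edge N m (c * m.+1) - y + 1.
  have m1 : m.+1%:R * invS m = 1 by rewrite /invS divff // pnatr_eq0.
  by rewrite /grid_edge natrD mulrDl m1; ring.
have := signed_log_diff1 (grid_edge N m (c * m.+1) - y) d0; rewrite -E => H2.
have -> : invS m * \sum_(0 <= j < m.+1) (d + `|grid_mid N m (c * m.+1 + j) - y|)^-1 =
  2 * \sum_(0 <= j < m.+1) invS m / (2 * (d + `|grid_mid N m (c * m.+1 + j) - y|)).
  rewrite !mulr_sumr; apply: eq_bigr => j _; rewrite invfM.
  by move: (_^-1) => X; field.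
lra.
Qed.

(** Convergence of the sum of ln T / T^2, uniformly in N, through the majorant n^(-3/2); here the
    quadratic decay of the kernel is spent. *)
Lemma log_height_sum N : \sum_(0 <= c < 2 * N) log_height (cell_mid N c) / (1 + cell_mid N c ^+ 2) <= 240.
Proof.
have Tpos n : (0 < n)%N -> log_height (n%:R - 2^-1 : R) / (1 + (n%:R - 2^-1) ^+ 2) <= 20 * (tpow 2^-1 n / n%:R).
  move=> n0; have n1 : 1 <= n%:R :> R by rewrite ler1n.
  have N0 : 0 < n%:R :> R by lra.
  have l1 : log_height (n%:R - 2^-1 : R) <= 3 + ln n%:R.
    rewrite /log_height ger0_norm; last by lra.
    have l2 := ln2_le1 R.
    have : ln (2 + (n%:R - 2^-1)) <= ln (2 * 2 * n%:R) :> R.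
      by rewrite ler_ln ?posrE; lra.
    by rewrite !lnM ?posrE //; lra.
  have l2 : (1 + (n%:R - 2^-1) ^+ 2)^-1 <= 4 * (n%:R^-1 * n%:R^-1) :> R.
    rewrite -invfM -[4]invrK -invfM lef_pV2 ?posrE; nra.
  have L0 := ln_nat_ge0 R n.
  have T1 : tpow 1 n = n%:R^-1 :> R by rewrite tpow1.
  have h12 : (0 : R) < 2^-1 by rewrite invr_gt0.
  have t1 : ln n%:R * tpow 1 n <= 2 * tpow 2^-1 n :> R.
    have := @ln_tpow R 2^-1 n h12; rewrite invrK mulfV // => h.
    by rewrite (mulrC 2).
  have t2 : tpow 1 n <= tpow 2^-1 n :> R.
    by rewrite /tpow ler_expR; lra.
  apply: (@le_trans _ _ ((3 + ln n%:R) * (4 * (n%:R^-1 * n%:R^-1)))).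
    have lp : 0 <= log_height (n%:R - 2^-1 : R) by rewrite (le_trans ler01) // log_height_ge1.
    have ip : 0 <= (1 + (n%:R - 2^-1) ^+ 2)^-1 :> R by rewrite invr_ge0 addr_ge0 ?sqr_ge0.
    exact: ler_pM.
  have -> : (3 + ln n%:R) * (4 * (n%:R^-1 * n%:R^-1)) = 4 * (3 * tpow 1 n + ln n%:R * tpow 1 n) * n%:R^-1 :> R by rewrite T1; ring.
  by rewrite mulrA ler_wpM2r ?invr_ge0 ?(ltW N0) //; lra.
have half : \sum_(N <= c < 2 * N) log_height (cell_mid N c) / (1 + cell_mid N c ^+ 2) <= 120.
  rewrite -{1}(add0n N) big_addn.
  have -> : (2 * N - N = N)%N by lia.
  apply: (@le_trans _ _ (\sum_(0 <= c < N) 20 * (tpow 2^-1 c.+1 / c.+1%:R))).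
    apply: ler_sum => c _; have := Tpos c.+1 isT.
    have -> // : cell_mid N (c + N) = c.+1%:R - 2^-1.
    by rewrite /cell_mid natrD -natr1; field.
  rewrite -mulr_sumr -(big_add1 _ _ 0 N.+1 xpredT (fun c => tpow 2^-1 c / c%:R)).
  have h12 : (0 : R) < 2^-1 by rewrite invr_gt0.
  have := @tpow_sum R 2^-1 1 N.+1 h12 isT isT; rewrite tpow_one.
  have := tpow_ge0 (2^-1 : R) N.+1; lra.
rewrite (@big_cat_nat _ _ _ N) //=; last by lia.
suff -> : \sum_(0 <= c < N) log_height (cell_mid N c) / (1 + cell_mid N c ^+ 2) = \sum_(N <= c < 2 * N) log_height (cell_mid N c) / (1 + cell_mid N c ^+ 2) by lra.
rewrite big_nat_rev /= add0n -[X in _ = \sum_(X <= _ < _) _]add0n big_addn.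
have -> : (2 * N - N = N)%N by lia.
rewrite big_nat_cond [RHS]big_nat_cond; apply: eq_bigr => c; rewrite andbT => /andP[_ cN].
have -> : cell_mid N (c + N) = - cell_mid N (N - c.+1).
  by rewrite /cell_mid natrD natrB // -natr1; field.
by rewrite /log_height normrN sqrrN.
Qed.

End CellSums.

(** * The explicit formula for Fejer-weighted sums of Lambda chi *)

Section ExplicitFormula.
Variable R : realType.
Local Notation C := (Cx R).
Implicit Types (x y v : R) (z w s c : C).
Local Notation invS := (@invS R).
Local Notation grid_mid := (@grid_mid R).
Variables (q : nat) (chi : nat -> C).
Hypothesis q0 : (0 < q)%N.
Hypothesis hchi : nonprincipal_chars q chi.
Hypothesis hG : forall s, 2^-1 < complex.Re s -> Lchi chi s != 0.
Let hd : is_dchar q chi := hchi.1.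
Local Notation L := (Lchi chi).
Local Notation Ld := (der (Lchi chi)).
Local Notation hf := (@Defs.half R).
Variables (mo : nat) (C0 e0 : R).
Hypothesis e00 : 0 < e0.
Hypothesis hord : forall z, 0 < nm z -> nm z <= e0 -> nm (Ld (hf + z) / L (hf + z) - mo%:R / z) <= C0.

(* -L'/L recentred at 1/2 with its pole of residue -mo removed. *)
Definition regularized s : C := - (Ld (s + hf) / L (s + hf)) + mo%:R * s^-1.

Lemma nm_half_ge (a : R) z : 0 < a -> a <= complex.Re z -> (nm z)^-1 <= 2 * (a + `|complex.Im z|)^-1.
Proof.
move=> a0 az; have h1 := le_trans az (nm_Re_le z); have h2 := absIm_le z.
have n0 := normr_ge0 (complex.Im z).
by rewrite -[2]invrK -invfM lef_pV2 ?posrE; lra.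
Qed.

(** (5/2)^2 + (1/2)^2 = 6.5 is below (13/5)^2 = 6.76, which explains the inner radius in
    [L_window]. *)
Lemma in_window s (T : R) : 0 <= complex.Re s <= 5 / 2 -> `|complex.Im s - T| <= 2^-1 ->
  nm (s + hf - Complex 3 T) <= 13 / 5.
Proof.
move=> /andP[r0 r1] hi; rewrite -(ler_pXn2r (n := 2)) ?nnegrE ?nm_ge0 // nm_sqr.
rewrite !ReD !ImD ReN ImN /= addr0.
have : (complex.Im s - T) ^+ 2 <= 4^-1.
  by move: hi; rewrite ler_norml => /andP[]; nra.
have : (complex.Re s + 2^-1 - 3) ^+ 2 <= 25 / 4 by nra.
by lra.
Qed.

(** On Re s = 1/(1 + v) the factor e^(vs) is at most e. Near 0 the recentred function is bounded by
    [hord] and only the kernel is singular; elsewhere [L_window] with delta = 1/(1 + v) applies. The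
    list I serves a whole unit of heights, which allows summation cell by cell. *)
Lemma line_bound : exists2 K : R, 0 <= K & forall v T : R, 0 <= v -> exists I : seq R,
  (size I)%:R <= K * log_height T /\ forall s, complex.Re s = (1 + v)^-1 -> `|complex.Im s - T| <= 2^-1 ->
   nm (regularized s * perron_kernel v s) <= K / (1 + T ^+ 2) * (\sum_(y <- I) ((1 + v)^-1 / 2 + `|complex.Im s - y|)^-1 + log_height T).
Proof.
have [C1 C10 hW] := L_window q0 hchi hG.
pose E := expR 1 : R; have E0 : 0 < E by exact: expR_gt0.
pose e1 := Num.min e0 1.
have e10 : 0 < e1 by rewrite lt_min e00 ltr01.
have e11 : e1 <= 1 by rewrite ge_min lexx orbT.
have e1e : e1 <= e0 by rewrite ge_min lexx.
clearbody e1.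
have i10 : 0 < e1^-1 by rewrite invr_gt0.
pose K1 := 4 * E / e1 * (2 + C1 + mo%:R / e1).
have mo0 : 0 <= mo%:R :> R by exact: ler0n.
have me0 : 0 <= mo%:R / e1 by rewrite divr_ge0 // ltW.
have K10 : 0 <= K1 by apply: mulr_ge0; [apply: mulr_ge0; [lra|exact: ltW]|lra].
pose K2 := 8 * E * `|C0|; have K20 : 0 <= K2 by rewrite mulr_ge0 ?normr_ge0 // mulr_ge0 // ltW.
exists (K1 + K2 + (1 + C1)); first by lra.
move=> v T v0; set dl := (1 + v)^-1.
have v1 : 0 < 1 + v by lra.
have dl0 : 0 < dl by rewrite invr_gt0.
have dv : dl * (1 + v) = 1 by rewrite mulVf // lt0r_neq0.
have dl1 : dl <= 1 by nra.
have [I [I1 I2 I3]] := hW T dl dl0 dl1.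
have lg1 := log_height_ge1 T.
(* The extra height 0 accounts for the kernel's own pole. *)
exists (0 :: map (@complex.Im R) I); split.
  rewrite /= size_map -natr1.
  have h : 0 <= (K1 + K2) * log_height T by apply: mulr_ge0; lra.
  rewrite (_ : (K1 + K2 + (1 + C1)) * log_height T = (K1 + K2) * log_height T + log_height T + C1 * log_height T); last by ring.
  by move: I1 h; set a := C1 * _; set b := (K1 + K2) * _; lra.
move=> s sR; set t := complex.Im s => ht.
have t2 : (1 + T ^+ 2) <= 2 * (1 + t ^+ 2).
  have u2 : (t - T) ^+ 2 <= 4^-1 by move: ht; rewrite ler_norml => /andP[]; nra.
  have := sqr_ge0 (2 * t - T); nra.
have T1 : 0 < 1 + T ^+ 2 by rewrite ltr_pwDl ?sqr_ge0.
have t1 : 0 < 1 + t ^+ 2 by rewrite ltr_pwDl ?sqr_ge0.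
have i2 : (1 + t ^+ 2)^-1 <= 2 * (1 + T ^+ 2)^-1.
  by rewrite -[2]invrK -invfM lef_pV2 ?posrE //; clear - R q chi q0 hchi hG hd mo C0 e0 e00 hord t2 T1 t1; lra.
have Tp : 0 < (1 + T ^+ 2)^-1 by rewrite invr_gt0.
have tp : 0 < (1 + t ^+ 2)^-1 by rewrite invr_gt0.
have sI : complex.Im s = t by [].
have ns : 0 < nm s by apply: lt_le_trans (nm_Re_le s); rewrite sR.
have ns1 : 0 < nm (s + 1) by apply: (lt_le_trans ns); apply: nm_add1; rewrite sR ltW.
have Fle : nm (perron_kernel v s) <= E * ((nm s)^-1 * (nm (s + 1))^-1).
  rewrite /perron_kernel nmM nm_cexp nmV nmM invfM ler_wpM2r ?mulr_ge0 ?invr_ge0 ?nm_ge0 //.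
  by rewrite ReM /= mulr0 subr0 ler_expR; nra.
rewrite big_cons subr0.
set Sg := \sum_(y <- _) _.
have Sg0 : 0 <= Sg by apply: sumr_ge0 => y _; rewrite invr_ge0 addr_ge0 ?normr_ge0 // divr_ge0 // ltW.
set P0 := (dl / 2 + `|t|)^-1.
have P00 : 0 <= P0 by rewrite invr_ge0 addr_ge0 ?normr_ge0 // divr_ge0 // ltW.
have d20 : 0 < dl / 2 by rewrite divr_gt0.
rewrite nmM.
(* Close to the pole |t| <= 1, so 1/(1 + T^2) is bounded below and may be inserted for free. *)
case: (leP (nm s) e1) => hs.
  have h1 : nm (regularized s) <= `|C0|.
    rewrite (le_trans _ (ler_norm C0)) //; have := hord ns (le_trans hs e1e).
    by rewrite /regularized addrC -nmN (addrC s hf); congr (nm _ <= _); ring.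
  have h2 : (nm s)^-1 <= 2 * P0.
    by rewrite /P0 -sI; apply: nm_half_ge => //; rewrite sR; clear - R q chi q0 hchi hG hd mo C0 e0 e00 hord dl0; lra.
  have h3 : (nm (s + 1))^-1 <= 1.
    rewrite invf_le1 //; apply: le_trans (nm_Re_le _); rewrite ReD /= sR; clear - R q chi q0 hchi hG hd mo C0 e0 e00 hord dl0; lra.
  have tt : t ^+ 2 <= 1.
    have := le_trans (absIm_le s) hs; rewrite sI ler_norml => /andP[u1 u2]; clear - R q chi q0 hchi hG hd mo C0 e0 e00 hord u1 u2 e11; nra.
  have h4 : 1 <= 4 * (1 + T ^+ 2)^-1.
    have : 2^-1 <= (1 + t ^+ 2)^-1 by rewrite lef_pV2 ?posrE //; clear - R q chi q0 hchi hG hd mo C0 e0 e00 hord tt; lra.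
    by move=> tt2; clear - R q chi q0 hchi hG hd mo C0 e0 e00 hord tt2 i2; lra.
  apply: (@le_trans _ _ (`|C0| * (E * (2 * P0 * 1)))).
    apply: ler_pM; rewrite ?nm_ge0 // (le_trans Fle) // ler_wpM2l ?(ltW E0) //.
    by apply: ler_pM; rewrite ?invr_ge0 ?nm_ge0.
  have -> : `|C0| * (E * (2 * P0 * 1)) = `|C0| * E * 2 * P0 by ring.
  apply: (@le_trans _ _ (K2 / (1 + T ^+ 2) * P0)).
    rewrite ler_wpM2r // /K2; have : 0 <= `|C0| * E * 2 by rewrite !mulr_ge0 ?normr_ge0 // ltW.
    have -> : 8 * E * `|C0| / (1 + T ^+ 2) = `|C0| * E * 2 * (4 / (1 + T ^+ 2)) by ring.
    by move=> A0; rewrite ler_peMr.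
  apply: ler_pM => //; first by rewrite divr_ge0 // ltW.
    by rewrite ler_wpM2r ?(ltW Tp) //; clear - R q chi q0 hchi hG hd mo C0 e0 e00 hord K10 C10; lra.
  by clear - R q chi q0 hchi hG hd mo C0 e0 e00 hord Sg0 lg1; lra.
have lowprod : (nm s)^-1 * (nm (s + 1))^-1 <= 2 / e1 * (1 + t ^+ 2)^-1.
  rewrite -invfM -[2 / e1]invrK -invfM lef_pV2 ?posrE ?mulr_gt0 ?invr_gt0 ?divr_gt0 //.
  rewrite invf_div -(ler_pXn2r (n := 2)) ?nnegrE //; first last.
  - by rewrite mulr_ge0 ?nm_ge0.
  - by rewrite mulr_ge0 ?(ltW t1) // divr_ge0 // ltW.
  rewrite !exprMn !nm_sqr ReD ImD sR sI /= addr0.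
  have q1 : e1 ^+ 2 / 2 * (1 + t ^+ 2) <= dl ^+ 2 + t ^+ 2.
    have a1 : e1 ^+ 2 <= dl ^+ 2 + t ^+ 2.
      by have := nm_sqr s; rewrite sR sI => <-; rewrite ler_pXn2r ?nnegrE ?nm_ge0 ?(ltW hs) // ltW.
    have a2 : e1 ^+ 2 * t ^+ 2 <= t ^+ 2.
      by rewrite ler_piMl ?sqr_ge0 // expr_le1 // ltW.
    by have a3 := sqr_ge0 dl; clear - R q chi q0 hchi hG hd mo C0 e0 e00 hord a1 a2 a3; lra.
  have q2 : 1 + t ^+ 2 <= (dl + 1) ^+ 2 + t ^+ 2 by clear - R q chi q0 hchi hG hd mo C0 e0 e00 hord dl0; nra.
  apply: (@le_trans _ _ ((e1 ^+ 2 / 2 * (1 + t ^+ 2)) * (1 + t ^+ 2))); last first.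
    apply: ler_pM => //; last exact: ltW.
    by apply: mulr_ge0; [rewrite divr_ge0 ?sqr_ge0|exact: ltW].
  have : 0 <= e1 ^+ 2 * (1 + t ^+ 2) ^+ 2 by rewrite mulr_ge0 ?sqr_ge0.
  have -> : e1 ^+ 2 * 2^-1 ^+ 2 * (1 + t ^+ 2) ^+ 2 = 4^-1 * (e1 ^+ 2 * (1 + t ^+ 2) ^+ 2) by field.
  have -> : e1 ^+ 2 / 2 * (1 + t ^+ 2) * (1 + t ^+ 2) = 2^-1 * (e1 ^+ 2 * (1 + t ^+ 2) ^+ 2) by field.
  by move: (e1 ^+ 2 * _) => A A0; clear - R q chi q0 hchi hG hd mo C0 e0 e00 hord A0; lra.
have hD : nm (regularized s) <= 2 * Sg + C1 * log_height T + mo%:R / e1.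
  have nmo : nm (mo%:R * s^-1) <= mo%:R / e1.
    by rewrite nmM nm_nat nmV ler_wpM2l // lef_pV2 ?posrE // ltW.
  rewrite /regularized (le_trans (nmD _ _)) // nmN lerD //.
  have win : nm (s + hf - Complex 3 T) <= 13 / 5 by apply: in_window; rewrite ?sR ?sI //; apply/andP; split; clear - R q chi q0 hchi hG hd mo C0 e0 e00 hord dl0 dl1; lra.
  have re : 2^-1 + dl <= complex.Re (s + hf) by rewrite ReD sR /= addrC.
  rewrite (le_trans (I3 _ win re)) // lerD2r.
  rewrite /Sg big_map mulr_sumr big_seq [leRHS]big_seq ler_sum // => p pI.
  have := I2 p pI => hp.
  have -> : t - complex.Im p = complex.Im (s + hf - p) by rewrite !ImD ImN /= addr0.
  by apply: nm_half_ge => //; rewrite !ReD ReN sR /=; clear - R q chi q0 hchi hG hd mo C0 e0 e00 hord hp; lra.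
apply: (@le_trans _ _ ((2 * Sg + C1 * log_height T + mo%:R / e1) * (E * (2 / e1 * (2 * (1 + T ^+ 2)^-1))))).
  apply: ler_pM; rewrite ?nm_ge0 // (le_trans Fle) // ler_wpM2l ?(ltW E0) // (le_trans lowprod) //.
  by rewrite ler_wpM2l // divr_ge0 // ltW.
apply: (@le_trans _ _ ((2 + C1 + mo%:R / e1) * (Sg + log_height T) * (E * (2 / e1 * (2 * (1 + T ^+ 2)^-1))))).
  rewrite ler_wpM2r ?mulr_ge0 ?(ltW E0) ?(ltW i10) ?(ltW Tp) //.
  move: hD me0 Sg0 lg1 C10 => _; move: (mo%:R / e1) Sg (log_height T) => M' G l m1 g1 l1 c1; clear - R q chi q0 hchi hG hd mo C0 e0 e00 hord m1 g1 l1 c1; nra.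
have -> : (2 + C1 + mo%:R / e1) * (Sg + log_height T) * (E * (2 / e1 * (2 * (1 + T ^+ 2)^-1))) =
  K1 / (1 + T ^+ 2) * (Sg + log_height T) by rewrite /K1; ring.
apply: ler_pM; first exact: mulr_ge0 K10 (ltW Tp).
- by clear - R q chi q0 hchi hG hd mo C0 e0 e00 hord Sg0 lg1; lra.
- by rewrite ler_wpM2r ?(ltW Tp) //; clear - R q chi q0 hchi hG hd mo C0 e0 e00 hord K20 C10; lra.
- by clear - R q chi q0 hchi hG hd mo C0 e0 e00 hord P00; lra.
Qed.

(** The unit cell at height T costs log_height T / (1 + T^2), once for the number of points, times
    ln(1 + v) for each of them; the sum over cells is [log_height_sum]. The bound does not depend on
    N. *)
Lemma gridint_regularized : exists2 K : R, 0 <= K & forall (v : R) (N m : nat), 0 <= v -> invS m <= (1 + v)^-1 / 2 ->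
  nm (gridint N m (1 + v)^-1 (fun s => regularized s * perron_kernel v s)) <= K * (1 + ln (1 + v)).
Proof.
have [K K0 hK] := line_bound.
have KK : 0 <= K * (8 * K + 1) by apply: mulr_ge0 => //; lra.
exists (K * (8 * K + 1) * 240); first by apply: mulr_ge0; [exact: KK|lra].
move=> v N m v0 hm; set dl := (1 + v)^-1.
have v1 : 0 < 1 + v by lra.
have dl0 : 0 < dl by rewrite invr_gt0.
have d20 : 0 < dl / 2 by rewrite divr_gt0.
set Q := 1 + ln (1 + v).
have Q1 : 1 <= Q by rewrite lerDl ln_ge0 //; lra.
have lnQ : ln (1 + (dl / 2)^-1) <= 2 * Q.
  rewrite invf_div /dl invrK.
  have : ln (1 + 2 * (1 + v)) <= ln (3 * (1 + v)) by rewrite ler_ln ?posrE; lra.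
  rewrite lnM ?posrE //.
  have : ln 3 <= 2 :> R.
    have := @le_ln1Dx R 2 ltac:(lra); have -> : (1 + 2 : R) = 3 by ring. by [].
  rewrite /Q; have : 0 <= ln (1 + v) by rewrite ln_ge0 //; lra.
  move: (ln (1 + v)) (ln (1 + _)) (ln 3) => a b c; lra.
have m1 : m.+1%:R * invS m = 1 by rewrite /invS divff // pnatr_eq0.
have h0 := invS_gt0 R m.
apply: (@le_trans _ _ (invS m * \sum_(0 <= k < grid_size N m) nm (regularized (Complex dl (grid_mid N m k)) * perron_kernel v (Complex dl (grid_mid N m k))))).
  exact: gridint_le.
rewrite /grid_size big_nat_blocks mulr_sumr.
apply: (@le_trans _ _ (\sum_(0 <= c < 2 * N) K * (8 * K + 1) * Q * (log_height (cell_mid R N c) / (1 + cell_mid R N c ^+ 2)))); last first.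
  by rewrite -mulr_sumr mulrAC ler_wpM2r ?(le_trans ler01) // ler_wpM2l // log_height_sum.
apply: ler_sum => c _; set T := cell_mid R N c.
have [I [I1 I2]] := hK v T v0.
have lg1 := log_height_ge1 T.
have T1 : 0 < 1 + T ^+ 2 by rewrite ltr_pwDl ?sqr_ge0.
have Tp : 0 < (1 + T ^+ 2)^-1 by rewrite invr_gt0.
apply: (@le_trans _ _ (invS m * \sum_(0 <= j < m.+1) K / (1 + T ^+ 2) *
   (\sum_(y <- I) (dl / 2 + `|grid_mid N m (c * m.+1 + j) - y|)^-1 + log_height T))).
  rewrite ler_wpM2l ?(ltW h0) // big_nat_cond [leRHS]big_nat_cond ler_sum // => j.
  rewrite andbT => /andP[_ jm]; apply: I2 => //=; exact: grid_mid_cell.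
rewrite -mulr_sumr mulrCA big_split /= sumr_cst mulrDr.
have -> : invS m * (m.+1%:R * log_height T) = log_height T by rewrite mulrA (mulrC (invS m)) m1 mul1r.
have B : invS m * \sum_(0 <= j < m.+1) \sum_(y <- I) (dl / 2 + `|grid_mid N m (c * m.+1 + j) - y|)^-1 <= K * log_height T * (8 * Q).
  rewrite exchange_big mulr_sumr.
  apply: (@le_trans _ _ (\sum_(y <- I) 8 * Q)).
    apply: ler_sum => y _; rewrite (le_trans (cell_sum N c y d20 hm)) //; lra.
  rewrite sum_cst_seq ler_wpM2r //; lra.
have -> : K * (8 * K + 1) * Q * (log_height T / (1 + T ^+ 2)) = K / (1 + T ^+ 2) * (K * log_height T * (8 * Q) + Q * log_height T) by ring.
rewrite ler_wpM2l ?mulr_ge0 ?(ltW Tp) // lerD // ler_peMl //; lra.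
Qed.

(** Deliberately crude in v and dl: N is chosen after both, so any decay in N is enough. The
    logarithmic derivative is O(N/dl) and the kernel O(N^(-2)). *)
Lemma horizontal_bound : exists2 K : R, 0 <= K & forall (v dl : R) (N : nat) s, 0 <= v -> 0 < dl -> dl <= 1 -> (0 < N)%N ->
  dl <= complex.Re s <= 5 / 2 -> `|complex.Im s| = N%:R ->
  nm (regularized s * perron_kernel v s) <= K / dl * expR (5 / 2 * v) / N%:R.
Proof.
have [C1 C10 hW] := L_window q0 hchi hG.
have mo0 : 0 <= mo%:R :> R by exact: ler0n.
exists (3 * (3 * C1 + mo%:R)); first by lra.
move=> v dl N s v0 dl0 dl1 N0 /andP[s1 s2] hs.
have N1 : 1 <= N%:R :> R by rewrite ler1n.
have Np : 0 < N%:R :> R by lra.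
set T := complex.Im s.
have [I [I1 I2 I3]] := hW T dl dl0 dl1.
have lg1 := log_height_ge1 T.
have lg2 : log_height T <= 3 * N%:R.
  rewrite /log_height hs; have := @le_ln1Dx R (1 + N%:R) ltac:(lra).
  have -> : 1 + (1 + N%:R) = 2 + N%:R :> R by ring.
  lra.
have nN : N%:R <= nm s by rewrite -hs absIm_le.
have ip : 0 < dl^-1 by rewrite invr_gt0.
have i1 : 1 <= dl^-1 by rewrite invf_ge1.
have win : nm (s + hf - Complex 3 T) <= 13 / 5.
  by apply: in_window; rewrite ?subrr ?normr0 ?invr_ge0 //; apply/andP; split; lra.
have re : 2^-1 + dl <= complex.Re (s + hf) by rewrite ReD /=; lra.
have hD : nm (regularized s) <= (3 * C1 + mo%:R) * log_height T / dl.
  rewrite /regularized (le_trans (nmD _ _)) // nmN.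
  have a1 : nm (mo%:R * s^-1) <= mo%:R * log_height T / dl.
    rewrite nmM nm_nat nmV; apply: (@le_trans _ _ (mo%:R * 1)); first by rewrite ler_wpM2l // invf_le1; lra.
    rewrite -mulrA ler_wpM2l // -[leLHS]mulr1 ler_pM //; lra.
  have a2 : \sum_(p <- I) (nm (s + hf - p))^-1 <= C1 * log_height T * (2 * dl^-1).
    apply: (@le_trans _ _ (\sum_(p <- I) 2 * dl^-1)).
      rewrite big_seq [leRHS]big_seq ler_sum // => p pI.
      rewrite -[2]invrK -invfM lef_pV2 ?posrE; first last.
      - by rewrite mulr_gt0 ?invr_gt0.
      - apply: lt_le_trans (nm_Re_le _); rewrite !ReD ReN /=; have := I2 p pI; lra.
      by apply: le_trans (nm_Re_le _); rewrite !ReD ReN /=; have := I2 p pI; lra.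
    by rewrite sum_cst_seq ler_wpM2r //; lra.
  have a3 : C1 * log_height T <= C1 * log_height T * dl^-1 by rewrite ler_peMr // mulr_ge0 //; lra.
  have := I3 _ win re => a4.
  have -> : (3 * C1 + mo%:R) * log_height T / dl = C1 * log_height T * (2 * dl^-1) + C1 * log_height T * dl^-1 + mo%:R * log_height T / dl by ring.
  by rewrite lerD // (le_trans a4) // lerD.
have hF : nm (perron_kernel v s) <= expR (5 / 2 * v) / N%:R ^+ 2.
  rewrite (le_trans (perron_kernel_le v _ Np nN)) //; first by lra.
  by rewrite ler_wpM2r ?invr_ge0 ?exprn_ge0 ?(ltW Np) // ler_expR; nra.
rewrite nmM (le_trans (ler_pM (nm_ge0 _) (nm_ge0 _) hD hF)) //.
have -> : 3 * (3 * C1 + mo%:R) / dl * expR (5 / 2 * v) / N%:R =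
   (3 * C1 + mo%:R) * (3 * N%:R) / dl * (expR (5 / 2 * v) / N%:R ^+ 2).
  by field; apply/andP; split; exact: lt0r_neq0.
rewrite ler_wpM2r ?divr_ge0 ?expR_ge0 ?exprn_ge0 ?(ltW Np) // ler_wpM2r ?(ltW ip) //.
by rewrite ler_wpM2l //; lra.
Qed.

Lemma taylor2_regularized (v dl y1 y2 : R) : 0 < dl -> dl <= 1 -> y1 <= y2 ->
  exists F', taylor2 (rect dl (5 / 2) y1 y2) (fun s => regularized s * perron_kernel v s) F'.
Proof.
move=> dl0 dl1 y12.
set K := rect _ _ _ _.
have Ksh s : K s -> rect (2^-1 + dl) 3 y1 y2 (s + hf).
  move=> [/andP[a1 a2] /andP[b1 b2]]; split; rewrite ?ReD ?ImD /= ?addr0; last by rewrite b1.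
  by apply/andP; split; lra.
have hp : 0 < 2^-1 + dl by rewrite ltr_wpDl // invr_ge0.
have [h1 h2] := L_taylor2 q0 hchi 3 y1 y2 hp.
have x1 : 2^-1 < 2^-1 + dl by rewrite ltrDl.
have x2 : 2^-1 + dl <= 3 by lra.
have [c c0 hc] := L_inf q0 hchi hG x1 x2 y12.
have h3 := taylor2_shift Ksh (taylor2M h2 (taylor2V c0 hc h1)).
have [B B0 hB] := rect_bound dl (5 / 2) y1 y2.
have hdl s : K s -> dl <= nm s.
  by move=> [/andP[a1 _] _]; rewrite (le_trans a1) // nm_Re_le.
have h4 := taylor2V dl0 hdl (taylor2_id hB).
have [F' h5] := taylor2_perron_kernel v (5 / 2) y1 y2 dl0.
have h6 := taylor2M (taylor2D (taylor2M (taylor2_cst K (-1)) h3) (taylor2M (taylor2_cst K mo%:R) h4)) h5.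
eexists; apply: (taylor2_ext _ _ h6) => // s _.
by rewrite /regularized mulN1r.
Qed.

Definition Lam_char_sum (X : nat) : C :=
  \sum_(1 <= n < X.+1) cR (Lam R n * (tpow 2^-1 n * (1 - n%:R / X%:R))) * chi n.

Lemma fejer_weight_ln (X n : nat) : (0 < X)%N -> (0 < n)%N ->
  fejer_weight (ln X%:R - ln n%:R) = if (n <= X)%N then 1 - n%:R / X%:R else 0 :> R.
Proof.
move=> X0 n0; have X1 : 0 < X%:R :> R by rewrite ltr0n.
have n1 : 0 < n%:R :> R by rewrite ltr0n.
rewrite /fejer_weight subr_le0 ler_ln ?posrE // ler_nat opprB expRD expRN !lnK ?posrE //.
case: (ltngtP n X) => // ->.
by rewrite divff ?subrr // lt0r_neq0.
Qed.

(** On Re s = 5/2 Perron's formula is applied to -L'/L and to mo/s. Their sum has no pole at 1/2 and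
    is moved to 1/(1 + v), where [gridint_regularized] bounds it. Dividing by [kernel_mass], of
    modulus at least 1/5, produces the factor 5. *)
Lemma Lam_char_sum_bound : exists2 K : R, 0 <= K & forall X : nat, (0 < X)%N ->
  nm (Lam_char_sum X + mo%:R * cR (ln X%:R)) <= K * (1 + ln (1 + ln X%:R)).
Proof.
have [K1 K10 hK1] := gridint_regularized.
have [K2 K20 hK2] := horizontal_bound.
have mo0 : 0 <= mo%:R :> R by exact: ler0n.
exists (5 * (K1 + 10) + 2 * mo%:R); first by lra.
move=> X X0; set v := ln X%:R.
have v0 : 0 <= v by exact: ln_nat_ge0.
have v1 : 0 < 1 + v by lra.
set dl := (1 + v)^-1.
have dl0 : 0 < dl by rewrite invr_gt0.
have dl1 : dl <= 1 by rewrite invf_le1 //; lra.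
pose c1 := expR (5 / 2 * v); have c10 : 0 < c1 by exact: expR_gt0.
(* The summands after 3 bring the truncation errors of the two Perron formulas and the horizontal
   sides of the contour shift below 1 each. *)
have [N hN] : exists N : nat, 3 + 160 * c1 + 40 * c1 * mo%:R + 5 * (K2 / dl * c1) <= N%:R.
  exists (Num.truncn (3 + 160 * c1 + 40 * c1 * mo%:R + 5 * (K2 / dl * c1))).+1.
  by rewrite ltW // truncnS_gt.
have p1 : 0 <= 40 * c1 * mo%:R by rewrite !mulr_ge0 // ltW.
have p2 : 0 <= K2 / dl * c1 by apply: mulr_ge0; [rewrite divr_ge0 // ltW|exact: ltW].
have N3' : 3 <= N%:R :> R by lra.
have N3 : (3 <= N)%N by rewrite -(ler_nat R).
have N0 : (0 < N)%N by exact: leq_trans N3.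
have Np : 0 < N%:R :> R by lra.
have q1 : 160 * c1 / N%:R <= 1 by rewrite ler_pdivrMr //; lra.
have q2 : 40 * c1 * mo%:R / N%:R <= 1 by rewrite ler_pdivrMr //; lra.
have q3 : 5 * (K2 / dl * c1 / N%:R) <= 1 by rewrite mulrA ler_pdivrMr //; lra.
clear hN.
have i16 : 0 < (16 * c1)^-1 by rewrite invr_gt0 mulr_gt0.
have [M1 hM1] := tpow_small (@ltr01 R) i16.
pose M := maxn X.+1 M1.
have [M0 tM] := hM1 M (leq_maxr _ _).
have XM : (X.+1 <= M)%N by exact: leq_maxl.
pose b n : C := cR (Lam R n) * chi n * cR (tpow 2^-1 n).
have half0 : (0 : R) < 2^-1 by rewrite invr_gt0.
(* Recentring at 1/2 turns the abscissa 5/2 into 3, where [Lam_dsum_logderiv] holds, and puts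
   n^(-1/2) into the coefficients b. *)
have hD t : - N%:R <= t <= N%:R -> let s := Complex (5 / 2) t in
    nm (- (Ld (s + hf) / L (s + hf)) - \sum_(n <- index_iota 1 M) b n * cexp (- s * cR (ln n%:R))) <= 4 * tpow 1 M.
  move=> _; set s : C := Complex (5 / 2) t; rewrite /=.
  have re : 3 <= complex.Re (s + hf) by rewrite ReD /=; clear - R q chi q0 hchi hG hd mo C0 e0 e00 hord; lra.
  have := Lam_dsum_logderiv q0 hchi re M0; rewrite -nmN; congr (nm _ <= _).
  rewrite opprD addrC; congr (_ - _); apply: eq_bigr => n _; rewrite /b npow_negE.
  have -> : cexp (- (s + hf) * cR (ln n%:R)) = cexp (- s * cR (ln n%:R)) * cR (tpow 2^-1 n).
    by rewrite opprD mulrDl cexpD; congr (_ * _); rewrite /Defs.half -cRN -cRM cexp_cR.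
  by ring.
have one : 0 < 1 / (1 + mo%:R) :> R by rewrite divr_gt0 // ltr_pwDl.
have [m1 hm1] := @perron_sum R _ (index_iota 1 M) b (fun n => ln n%:R) (fun s => - (Ld (s + hf) / L (s + hf))) v N _ _ N3 (@ltr01 R) hD.
have eps0 : 0 < (4 * c1 * (1 + mo%:R))^-1 by rewrite invr_gt0 !mulr_gt0 // ltr_pwDl.
have [J [th [th0 J1 J2 J3]]] := pole_data N v0 eps0.
have [m2 hm2] := @perron_sum R _ (index_iota 0 J) (fun=> cR th) (fun j => th * j%:R) (fun s => s^-1) v N _ _ N3 one J1.
have NN : - N%:R <= N%:R :> R by clear - R q chi q0 hchi hG hd mo C0 e0 e00 hord Np; lra.
have [F' hF'] := taylor2_regularized v dl0 dl1 NN.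
have dl52 : dl <= 5 / 2 by clear - R q chi q0 hchi hG hd mo C0 e0 e00 hord dl1; lra.
have [sg hsg|m3 hm3] := gridint_shift (B := K2 / dl * c1 / N%:R) dl52 hF' _ (@ltr01 R).
  by split; apply: hK2 => //=; rewrite ?normrN ger0_norm // ltW.
have d20 : 0 < dl / 2 by rewrite divr_gt0.
have [m4 hm4] := inv_succ_small d20.
(* The mesh is fixed last: fine enough for both Perron formulas, for the contour shift and for the
   distance dl/2 to the points rho. *)
pose m := maxn (maxn m1 m2) (maxn m3 m4).
have /hm1 A1 : (m1 <= m)%N by exact: leq_trans (leq_maxl _ _) (leq_maxl _ _).
have /hm2 A2 : (m2 <= m)%N by exact: leq_trans (leq_maxr _ _) (leq_maxl _ _).
have /hm3 A3 : (m3 <= m)%N by exact: leq_trans (leq_maxl _ _) (leq_maxr _ _).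
have A4 : invS m <= dl / 2.
  by apply: le_trans hm4; rewrite lef_pV2 ?posrE // ler_nat ltnS; exact: leq_trans (leq_maxr _ _) (leq_maxr _ _).
have A5 := hK1 v N m v0 A4.
rewrite -/dl in A5; set Q := 1 + ln (1 + v) in A5 *.
have Q1 : 1 <= Q by rewrite lerDl ln_ge0 // lerDl.
have kE : \sum_(n <- index_iota 1 M) b n * cR (fejer_weight (v - ln n%:R)) = Lam_char_sum X.
  rewrite (@big_nat_cut _ 1 X.+1 M) //.
    apply: eq_big_nat => n /andP[n1 nX]; rewrite fejer_weight_ln // -ltnS nX /b.
    by rewrite !cRM; ring.
  by move=> n /andP[nX _] _; rewrite fejer_weight_ln //; [rewrite leqNgt nX mulr0|exact: leq_trans nX].
rewrite kE in A1.
have bs : \sum_(n <- index_iota 1 M) nm (b n) * expR (- (5 / 2) * ln n%:R) <= 4.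
  apply: (@le_trans _ _ (\sum_(1 <= n < M) tpow 1 n / n%:R)).
    rewrite big_nat_cond [leRHS]big_nat_cond ler_sum // => n /andP[/andP[n1 _] _].
    rewrite (le_trans _ (Lam_tpow _ n1)) // /b !nmM !nm_cR (ger0_norm (Lam_ge0 _ _)) (ger0_norm (tpow_ge0 _ _)).
    have -> : tpow 3 n = tpow 2^-1 n * expR (- (5 / 2) * ln n%:R) :> R.
      by rewrite /tpow -expRD; congr expR; field.
    rewrite mulrA ler_wpM2r ?expR_ge0 // ler_wpM2r ?tpow_ge0 // ler_piMr ?Lam_ge0 //.
    exact: nm_chi_le1 q0 hd _.
  rewrite (le_trans (tpow_sum ltr01 _ M0)) // tpow_one.
  by clear - R q chi q0 hchi hG hd mo C0 e0 e00 hord M; have := tpow_ge0 (1 : R) M; lra.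
have B1 : nm (gridint N m (5 / 2) (fun s => - (Ld (s + hf) / L (s + hf)) * perron_kernel v s) - kernel_mass R N m * Lam_char_sum X) <= 3.
  rewrite (le_trans A1) // -/c1.
  have a1 : 4 * (4 * tpow 1 M) * c1 <= 1.
    have -> : 4 * (4 * tpow 1 M) * c1 = tpow 1 M * (16 * c1) by ring.
    by rewrite -ler_pdivlMr ?mulr_gt0 // mul1r.
  have a2 : 40 * c1 / N%:R * (\sum_(n <- index_iota 1 M) nm (b n) * expR (- (5 / 2) * ln n%:R)) <= 1.
    rewrite (le_trans (ler_wpM2l _ bs)) //; first by rewrite divr_ge0 ?mulr_ge0 ?(ltW c10) ?(ltW Np).
    by apply: le_trans q1; apply: eqW; ring.
  by clear - R q chi q0 hchi hG hd mo C0 e0 e00 hord a1 a2; lra.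
set SJ := \sum_(j <- index_iota 0 J) cR th * cR (fejer_weight (v - th * j%:R)) in A2.
have B2 : mo%:R * nm (gridint N m (5 / 2) (fun s => s^-1 * perron_kernel v s) - kernel_mass R N m * SJ) <= 3.
  rewrite (le_trans (ler_wpM2l mo0 A2)) // -/c1.
  have a1 : mo%:R * (4 * (4 * c1 * (1 + mo%:R))^-1 * c1) <= 1 :> R.
    have -> : 4 * (4 * c1 * (1 + mo%:R))^-1 * c1 = (1 + mo%:R)^-1 :> R.
      by field; apply/andP; split; apply: lt0r_neq0 => //; lra.
    by rewrite ler_pdivrMr ?mul1r ?lerDr // ltr_pwDl.
  have a2 : mo%:R * (1 / (1 + mo%:R)) <= 1 :> R by rewrite mulrA mulr1 ler_pdivrMr ?mul1r ?lerDr // ltr_pwDl.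
  have a3 : mo%:R * (40 * c1 / N%:R * (\sum_(j <- index_iota 0 J) nm (cR th : C) * expR (- (5 / 2) * (th * j%:R)))) <= 1.
    apply: le_trans q2.
    rewrite mulrA (_ : 40 * c1 * mo%:R / N%:R = mo%:R * (40 * c1 / N%:R) * 1); last by ring.
    apply: ler_wpM2l; first by rewrite mulr_ge0 // divr_ge0 ?mulr_ge0 ?(ltW c10) ?(ltW Np).
    by rewrite nm_cR (gtr0_norm th0).
  rewrite 2!mulrDr; apply: le_trans (lerD (lerD a1 a3) a2) _; clear - R q chi q0 hchi hG hd mo C0 e0 e00 hord; lra.
have SJE : SJ = cR (\sum_(0 <= j < J) th * fejer_weight (v - th * j%:R)).
  by rewrite cR_sum; apply: eq_bigr => j _; rewrite cRM.
have B3 : nm (SJ - cR v) <= 2 by rewrite SJE -cRB nm_cR.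
have B4 : nm (gridint N m (5 / 2) (fun s => regularized s * perron_kernel v s)) <= K1 * Q + 2.
  have -> : gridint N m (5 / 2) (fun s => regularized s * perron_kernel v s) = gridint N m dl (fun s => regularized s * perron_kernel v s) +
    (gridint N m (5 / 2) (fun s => regularized s * perron_kernel v s) - gridint N m dl (fun s => regularized s * perron_kernel v s)) by ring.
  rewrite (le_trans (nmD _ _)) // lerD // (le_trans A3) //.
  have : 2 * (5 / 2 - dl) * (K2 / dl * c1 / N%:R) <= 5 * (K2 / dl * c1 / N%:R).
    by rewrite ler_wpM2r ?divr_ge0 ?(ltW Np) //; clear - R q chi q0 hchi hG hd mo C0 e0 e00 hord dl0; lra.
  by clear - R q chi q0 hchi hG hd mo C0 e0 e00 hord q3; lra.
have B5 : nm (kernel_mass R N m * (Lam_char_sum X + mo%:R * SJ)) <= K1 * Q + 8.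
  have -> : kernel_mass R N m * (Lam_char_sum X + mo%:R * SJ) = gridint N m (5 / 2) (fun s => regularized s * perron_kernel v s)
     - (gridint N m (5 / 2) (fun s => - (Ld (s + hf) / L (s + hf)) * perron_kernel v s) - kernel_mass R N m * Lam_char_sum X)
     - mo%:R * (gridint N m (5 / 2) (fun s => s^-1 * perron_kernel v s) - kernel_mass R N m * SJ).
    have -> : gridint N m (5 / 2) (fun s => regularized s * perron_kernel v s) =
       gridint N m (5 / 2) (fun s => - (Ld (s + hf) / L (s + hf)) * perron_kernel v s) +
       mo%:R * gridint N m (5 / 2) (fun s => s^-1 * perron_kernel v s).
      by rewrite -gridintZ -gridintD; apply: gridint_ext => t _; rewrite /regularized mulrDl -(mulrA mo%:R).
    by ring.
  rewrite (le_trans (nmB _ _)) // (le_trans (lerD (nmB _ _) (lexx _))) // nmM nm_nat.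
  by rewrite (le_trans (lerD (lerD B4 B1) B2)) // -!addrA lerD2l; clear - R q chi q0 hchi hG hd mo C0 e0 e00 hord; lra.
have B6 : nm (Lam_char_sum X + mo%:R * SJ) <= 5 * (K1 * Q + 8).
  rewrite nmM in B5; have := kernel_mass_ge R m N0; have := nm_ge0 (Lam_char_sum X + mo%:R * SJ).
  move: (nm _) (nm _) B5 => a b' h1 h2 h3; clear - R q chi q0 hchi hG hd mo C0 e0 e00 hord h1 h2 h3; nra.
have -> : Lam_char_sum X + mo%:R * cR v = Lam_char_sum X + mo%:R * SJ - mo%:R * (SJ - cR v) by ring.
rewrite (le_trans (nmB _ _)) // nmM nm_nat.
have := ler_wpM2l mo0 B3.
have : K1 <= K1 * Q by rewrite ler_peMr.
have : mo%:R <= mo%:R * Q by rewrite ler_peMr.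
rewrite (_ : (5 * (K1 + 10) + 2 * mo%:R) * Q = 5 * (K1 * Q) + 50 * Q + 2 * (mo%:R * Q)); last by ring.
move: B6 Q1; move: (K1 * Q) (mo%:R * Q) (mo%:R * nm _) (nm _) => a b' c d.
by clear - R q chi q0 hchi hG hd mo C0 e0 e00 hord; lra.
Qed.

End ExplicitFormula.

(** * From prime powers to primes *)

Section Mertens.
Variable R : realType.
Local Notation C := (Cx R).
Implicit Types (x v : R) (z w s c : C).
Local Notation tpow := (@tpow R).
Local Notation Lam := (@Lam R).

Lemma bounded_of_eventually (u : nat -> C) (B : R) N0 : (forall n, (N0 <= n)%N -> nm (u n) <= B) ->
  exists2 K : R, 0 <= K & forall n, nm (u n) <= K.
Proof.
move=> h; have S0 : 0 <= \sum_(0 <= i < N0) nm (u i) by apply: sumr_ge0 => i _; exact: nm_ge0.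
exists (\sum_(0 <= i < N0) nm (u i) + `|B|); first by rewrite addr_ge0.
move=> n; case: (leqP N0 n) => hn.
  by rewrite (le_trans (h n hn)) // (le_trans (ler_norm B)) // lerDr.
rewrite (@big_cat_nat _ _ _ n) //=; last exact: ltnW.
rewrite (big_ltn hn) addrA addrAC -addrA; set a := \sum_(0 <= i < n) _; set b := \sum_(n.+1 <= i < _) _.
have a0 : 0 <= a by apply: sumr_ge0 => i _; exact: nm_ge0.
have b0 : 0 <= b by apply: sumr_ge0 => i _; exact: nm_ge0.
by have := normr_ge0 B; lra.
Qed.

Lemma prime_power_split (V : zmodType) (phi : nat -> nat -> V) X : (1 < X)%N ->
  \sum_(0 <= p < X.+1 | prime p) \sum_(1 <= k < X.+1 | (p ^ k < X.+1)%N) phi p k =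
  \sum_(0 <= p < X.+1 | prime p) phi p 1%N +
  (\sum_(0 <= p < X.+1 | prime p) (if (p ^ 2 < X.+1)%N then phi p 2%N else 0) +
   \sum_(0 <= p < X.+1 | prime p) \sum_(3 <= k < X.+1 | (p ^ k < X.+1)%N) phi p k).
Proof.
move=> X1; rewrite -!big_split /= big_nat_cond [RHS]big_nat_cond; apply: eq_bigr => p /andP[/andP[_ pX] pp].
rewrite big_ltn_cond; last exact: ltnW.
rewrite expn1 pX; congr (_ + _).
by rewrite big_ltn_cond //; case: ifP; rewrite ?add0r.
Qed.

Lemma theta_le y : \sum_(0 <= p < y.+1 | prime p) ln p%:R <= 6 * y%:R :> R.
Proof.
case: (leqP y 1) => y1.
  rewrite big_nat_cond big1 ?mulr_ge0 // => p /andP[/andP[_ py]] /prime_gt1; lia.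
apply: le_trans (psi_le R y); rewrite /psi (@Lam_sum R R (fun _ x => x)) //.
rewrite prime_power_split // lerDl addr_ge0 //.
  by apply: sumr_ge0 => p _; case: ifP => // _; exact: ln_nat_ge0.
by apply: sumr_ge0 => p _; apply: sumr_ge0 => k _; exact: ln_nat_ge0.
Qed.

Lemma sqrt_floor X : exists y : nat, (y ^ 2 <= X < y.+1 ^ 2)%N.
Proof.
elim: X => [|X [y /andP[h1 h2]]]; first by exists 0%N.
case: (ltnP X.+1 (y.+1 ^ 2)) => h; first by exists y; rewrite h andbT ltnW.
exists y.+1; rewrite h /=; nia.
Qed.

Variables (q : nat).
Hypothesis q0 : (0 < q)%N.

Definition mertens_char_sum (chi : nat -> C) (y : nat) : C :=
  \sum_(0 <= p < y.+1 | prime p) cR (ln p%:R / p%:R) * chi p.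

(** The difference runs over the powers with k >= 2, which converge absolutely by [prime_power_tail]
    with sg = 1, j = 2, eta = 1/2. *)
Lemma mertens_char_sum_Lam : exists2 K : R, 0 <= K & forall chi : nat -> C, (forall n, nm (chi n) <= 1) ->
  forall y, (1 < y)%N -> nm (\sum_(1 <= d < y.+1) cR (Lam d / d%:R) * chi d - mertens_char_sum chi y) <= K.
Proof.
have h2 : (1 : R) *+ 2 = 1 + 2 * 2^-1 by rewrite mulfV //; ring.
have [K K0 hK] := prime_power_tail (@ltr01 R) (ltac:(rewrite invr_gt0 //) : (0 : R) < 2^-1) h2.
exists K => // chi hchi y y1.
rewrite (@Lam_sum R C (fun d x => cR (x / d%:R) * chi d)); first last.
- by move=> d a b; rewrite mulrDl cRD mulrDl.
- by move=> d; rewrite mul0r cR0 mul0r.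
rewrite prime_power_split // /mertens_char_sum.
have -> : \sum_(0 <= p < y.+1 | prime p) cR (ln p%:R / (p ^ 1)%:R) * chi (p ^ 1)%N = mertens_char_sum chi y.
  by apply: eq_bigr => p _; rewrite expn1.
rewrite addrAC subrr add0r (le_trans _ (hK y.+1)) //.
rewrite (le_trans (nmD _ _)) // (le_trans (lerD (nm_sum _ _ _) (nm_sum _ _ _))) //.
rewrite -big_split /=; apply: ler_sum => p pp.
have T k : nm (cR (ln p%:R / (p ^ k)%:R) * chi (p ^ k)%N) <= ln p%:R * tpow 1 p ^+ k.
  rewrite nmM nm_cR ger0_norm ?divr_ge0 ?ln_nat_ge0 // tpow1 ?prime_gt0 // natrX exprVn.
  by rewrite ler_piMr // divr_ge0 ?ln_nat_ge0 ?exprn_ge0.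
have T0 k : 0 <= ln p%:R * tpow 1 p ^+ k by rewrite mulr_ge0 ?ln_nat_ge0 ?exprn_ge0 ?tpow_ge0.
rewrite [leRHS]big_ltn //; apply: lerD; first by case: ifP => _; rewrite ?nm0.
rewrite (le_trans (nm_sum _ _ _)) // big_mkcond ler_sum // => k _; case: ifP => _ //; exact: T.
Qed.

(** Compared with Mertens' sum, only the primes dividing q are missing; they are at most q, so [K2]
    does not depend on y. *)
Lemma mertens_char_sum_principal : exists2 K : R, 0 <= K & forall y, (1 < y)%N ->
  nm (mertens_char_sum (@principal_char R q) y - cR (ln y%:R)) <= K.
Proof.
have [K K0 hK] := mertens_char_sum_Lam.
pose K2 := \sum_(0 <= p < q.+1) ln p%:R / p%:R : R.
have t0 p : 0 <= ln p%:R / p%:R :> R by rewrite divr_ge0 ?ln_nat_ge0.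
have K20 : 0 <= K2 by apply: sumr_ge0.
exists (K + 6 + K2); first by lra.
move=> y y1.
have n11 : forall n : nat, nm ((fun=> 1) n : C) <= 1 by move=> n; rewrite nm1.
have := hK (fun=> 1) n11 y y1.
set S := \sum_(1 <= d < y.+1) _.
have SE : S = cR (\sum_(1 <= d < y.+1) Lam d / d%:R).
  by rewrite cR_sum; apply: eq_bigr => d _; rewrite mulr1.
have := @Mertens_Lam R y (ltnW y1) => /andP[m1 m2] h.
have h2 : nm (S - cR (ln y%:R)) <= 6.
  by clear n11; rewrite SE -cRB nm_cR ler_norml; apply/andP; split; lra.
have h3 : nm (mertens_char_sum (fun=> 1) y - mertens_char_sum (@principal_char R q) y) <= K2.
  rewrite /mertens_char_sum -sumrB (le_trans (nm_sum _ _ _)) //.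
  have T p : prime p -> nm (cR (ln p%:R / p%:R) * 1 - cR (ln p%:R / p%:R) * @principal_char R q p) <=
     if (p < q.+1)%N then ln p%:R / p%:R else 0.
    move=> pp; rewrite /principal_char; case: ifP => cpq.
      by rewrite subrr nm0; case: ifP.
    rewrite mulr0 subr0 mulr1 nm_cR ger0_norm //.
    rewrite ltnS dvdn_leq //; by rewrite prime_coprime // in cpq; move/negbFE: cpq.
  apply: (@le_trans _ _ (\sum_(0 <= p < y.+1) (if (p < q.+1)%N then ln p%:R / p%:R else 0))).
    rewrite big_mkcond ler_sum // => p _; case: ifP => pp; first exact: T.
    by case: ifP.
  case: (leqP y q) => yq.
    apply: (@le_trans _ _ (\sum_(0 <= p < y.+1) (ln p%:R / p%:R))).
      by apply: ler_sum => p _; case: ifP.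
    rewrite /K2 (@big_cat_nat _ _ _ y.+1 0 q.+1) //= lerDl; exact: sumr_ge0.
  rewrite (@big_nat_cut _ 0 q.+1 y.+1) //; last 2 first.
  - by rewrite ltnS ltnW.
  - by move=> p /andP[qp _] _; rewrite ltnNge qp.
  rewrite /K2 big_nat_cond [leRHS]big_nat_cond ler_sum // => p /andP[/andP[_ ->] _] //.
have -> : mertens_char_sum (@principal_char R q) y - cR (ln y%:R) =
  (S - cR (ln y%:R)) - (S - mertens_char_sum (fun=> 1) y) - (mertens_char_sum (fun=> 1) y - mertens_char_sum (@principal_char R q) y) by ring.
rewrite (le_trans (nmB _ _)) // (le_trans (lerD (nmB _ _) (lexx _))) //; clear n11; lra.
Qed.

Hypothesis hG : forall chi, @nonprincipal_chars R q chi ->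
  forall s : C, 2^-1 < complex.Re s -> Lchi chi s != 0.

(** The partial sums of chi(n) ln n / n are bounded, since they converge. By [hyperbola] they equal
    the sum of Lambda(d) chi(d)/d times partial sums of L(1, chi), each of which is L(1, chi) +
    O(d/y), and the errors total O(psi(y)/y). Division is possible as L(1, chi) is nonzero, which is
    part of the hypothesis [hG]. *)
Lemma mertens_char_sum_nonprincipal chi : @nonprincipal_chars R q chi -> exists2 K : R, 0 <= K & forall y, (1 < y)%N ->
  nm (mertens_char_sum chi y) <= K.
Proof.
move=> hchi; have hd := hchi.1.
have r1 : (2^-1 : R) < complex.Re (1 : C) by rewrite /=; lra.
have L1 := hG hchi r1; have n1 : 0 < nm (Lchi chi 1) by rewrite nm_gt0.
have [K K0 hK] := mertens_char_sum_Lam.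
have p1 : (0 : R) < complex.Re (1 : C) by rewrite /=.
have [N0 hN0] := Dp'_cvg q0 hchi p1 (@ltr01 R).
have [B B0 hB] : exists2 B : R, 0 <= B & forall n, nm (Dp' chi n 1) <= B.
  apply: (@bounded_of_eventually _ (1 + nm (der (Lchi chi) 1)) N0) => n hn.
  have -> : Dp' chi n 1 = (Dp' chi n 1 - der (Lchi chi) 1) + der (Lchi chi) 1 by ring.
  by rewrite (le_trans (nmD _ _)) // lerD2r hN0.
pose k1 := Kq q (1 : R) * 2; have k10 : 0 <= k1 by rewrite mulr_ge0 // Kq_ge0.
exists (K + (B + k1 * 6) / nm (Lchi chi 1)).
  by rewrite addr_ge0 // divr_ge0 ?nm_ge0 // addr_ge0 // mulr_ge0.
move=> y y1; have y0 : (0 < y)%N by exact: ltnW.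
have Y0 : 0 < y%:R :> R by rewrite ltr0n.
have := hK chi (nm_chi_le1 q0 hd) y y1; set S := \sum_(1 <= d < y.+1) _ => hS.
have np m : (0 < m)%N -> npow_neg m 1 = cR m%:R^-1 :> C.
  by move=> m0; rewrite npow_negE mulN1r -cRN cexp_cR expRN lnK // posrE ltr0n.
have H : nm (S * Lchi chi 1 + Dp' chi y.+1 1) <= k1 * 6.
  have E : - Dp' chi y.+1 1 = \sum_(1 <= d < y.+1) cR (Lam d / d%:R) * chi d * Dp chi (y %/ d).+1 1.
    rewrite /Dp' -sumrN.
    transitivity (\sum_(1 <= n < y.+1) cR (ln n%:R) * (chi n * npow_neg n 1)).
      by apply: eq_bigr => n _; ring.
    rewrite (@hyperbola R C (fun n x => cR x * (chi n * npow_neg n 1))); first last.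
    - by move=> n a b; rewrite cRD mulrDl.
    - by move=> n; rewrite cR0 mul0r.
    apply: eq_big_nat => d /andP[d1 dy]; rewrite /Dp mulr_sumr.
    have hdy : ((y %/ d).+1 <= y.+1)%N by rewrite ltnS leq_div.
    rewrite (big_nat_widen _ _ _ _ _ hdy) [LHS]big_nat_cond [RHS]big_nat_cond /=.
    apply: eq_big => m; first by rewrite !ltnS leq_divRL // (mulnC m).
    move=> /andP[/andP[m1 _] _]; rewrite (chiM hd) !np ?muln_gt0 ?d1 // natrM invfM !cRM; ring.
  have -> : S * Lchi chi 1 + Dp' chi y.+1 1 =
     \sum_(1 <= d < y.+1) cR (Lam d / d%:R) * chi d * (Lchi chi 1 - Dp chi (y %/ d).+1 1).
    have -> : Dp' chi y.+1 1 = - - Dp' chi y.+1 1 by rewrite opprK.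
    by rewrite E mulr_suml -sumrB; apply: eq_bigr => d _; ring.
  apply: (@le_trans _ _ (\sum_(1 <= d < y.+1) Lam d * (k1 / y%:R))); last first.
    rewrite -mulr_suml mulrCA ler_wpM2l // ler_pdivrMr //; exact: psi_le.
  rewrite (le_trans (nm_sum _ _ _)) //.
  rewrite big_nat_cond [leRHS]big_nat_cond ler_sum // => d /andP[/andP[d1 dy] _].
  have d0 : 0 < d%:R :> R by rewrite ltr0n.
  rewrite !nmM nm_cR ger0_norm ?divr_ge0 ?Lam_ge0 // -(mulrA (Lam d / d%:R)) -(mulrA (Lam d)) ler_wpM2l ?Lam_ge0 //.
  have h1 : nm (Lchi chi 1 - Dp chi (y %/ d).+1 1) <= k1 * (d%:R / y%:R).
    have R1 : (1 : R) <= complex.Re (1 : C) by rewrite /=.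
    rewrite (le_trans (L_approx q0 hchi (@ltr01 R) R1 (ltn0Sn _))) // nm1.
    have -> : Kq q 1 * (1 + 1) = k1 by rewrite /k1; ring.
    rewrite ler_wpM2l // tpow1 // -[d%:R]invrK -invfM lef_pV2 ?posrE ?mulr_gt0 ?invr_gt0 //.
    by rewrite mulrC ler_pdivrMr // -natrM ler_nat ltnW // ltn_ceil.
  apply: (@le_trans _ _ (d%:R^-1 * (1 * (k1 * (d%:R / y%:R))))).
    by rewrite ler_wpM2l ?invr_ge0 // ler_pM ?nm_ge0 // (nm_chi_le1 q0 hd).
  by apply: eqW; field; apply/andP; split; exact: lt0r_neq0.
have hS2 : nm S <= (B + k1 * 6) / nm (Lchi chi 1).
  rewrite ler_pdivlMr // -nmM.
  have -> : S * Lchi chi 1 = (S * Lchi chi 1 + Dp' chi y.+1 1) - Dp' chi y.+1 1 by ring.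
  by rewrite (le_trans (nmB _ _)) // addrC lerD.
have -> : mertens_char_sum chi y = S - (S - mertens_char_sum chi y) by ring.
by rewrite (le_trans (nmB _ _)) // addrC lerD.
Qed.

Definition chi2 (chi : nat -> C) (n : nat) : C := chi n ^+ 2.
(* The weight with which the squares of primes contribute, i.e. the source of r(a) - r(b). *)
Definition eps2 (chi : nat -> C) : R := if `[< chi2 chi = @principal_char R q >] then 1 else 0.

Lemma is_dchar_chi2 chi : is_dchar q chi -> is_dchar q (chi2 chi).
Proof.
move=> [h1 h2 h3]; split; rewrite /chi2.
- by move=> n; rewrite h1.
- by move=> m n; rewrite h2 exprMn.
by move=> n; rewrite expf_eq0 /=.
Qed.

Lemma mertens_char_sum_chi2 chi : is_dchar q chi -> exists2 K : R, 0 <= K & forall y, (1 < y)%N ->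
  nm (mertens_char_sum (chi2 chi) y - cR (eps2 chi * ln y%:R)) <= K.
Proof.
move=> hd; rewrite /eps2; case: asboolP => h.
  have [K K0 hK] := mertens_char_sum_principal; exists K => // y y1.
  by rewrite h mul1r hK.
have [K K0 hK] := @mertens_char_sum_nonprincipal (chi2 chi) (conj (is_dchar_chi2 hd) h).
by exists K => // y y1; rewrite mul0r cR0 subr0 hK.
Qed.

Definition prime_square_sum (chi : nat -> C) (X : nat) : C :=
  \sum_(0 <= p < X.+1 | prime p) (if (p ^ 2 < X.+1)%N then
     cR (ln p%:R / p%:R * (1 - (p ^ 2)%:R / X%:R)) * chi (p ^ 2)%N else 0).

(** The primes involved are p <= y with y the integer part of the square root of X. The Fejer
    correction is at most theta(y) y / X = O(1), and ln y is (ln X)/2 up to 1. *)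
Lemma prime_square_sum_bound chi : is_dchar q chi -> exists2 K : R, 0 <= K & forall X, (3 < X)%N ->
  nm (prime_square_sum chi X - cR (eps2 chi / 2 * ln X%:R)) <= K.
Proof.
move=> hd; have [K K0 hK] := mertens_char_sum_chi2 hd.
have e01 : 0 <= eps2 chi <= 1 by rewrite /eps2; case: ifP => _; rewrite ?lexx ?ler01.
exists (K + 6 + 1); first by lra.
move=> X X3; have [y /andP[y1 y2]] := sqrt_floor X.
have yg : (1 < y)%N by nia.
have Y0 : 0 < y%:R :> R by rewrite ltr0n ltnW.
have X0 : 0 < X%:R :> R by rewrite ltr0n; lia.
have yX : (y.+1 <= X.+1)%N by nia.
have E : prime_square_sum chi X = mertens_char_sum (chi2 chi) y - \sum_(0 <= p < y.+1 | prime p) cR (ln p%:R * (p%:R / X%:R)) * chi2 chi p.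
  rewrite /prime_square_sum (@big_nat_cut _ 0 y.+1 X.+1) //; last first.
    by move=> p /andP[py _] _; case: ltnP => //; nia.
  rewrite /mertens_char_sum -sumrB big_nat_cond [RHS]big_nat_cond; apply: eq_bigr => p /andP[/andP[_ py] pp].
  have -> : (p ^ 2 < X.+1)%N by nia.
  have p0 : (p%:R : R) != 0 by rewrite pnatr_eq0 -lt0n prime_gt0.
  rewrite (chiX hd) /chi2 -mulrBl -cRB natrX; congr (cR _ * _); field.
  by rewrite p0 lt0r_neq0.
have H2 : nm (\sum_(0 <= p < y.+1 | prime p) cR (ln p%:R * (p%:R / X%:R)) * chi2 chi p) <= 6.
  apply: (@le_trans _ _ (\sum_(0 <= p < y.+1 | prime p) ln p%:R * (y%:R / X%:R))).
    rewrite (le_trans (nm_sum _ _ _)) // big_nat_cond [leRHS]big_nat_cond ler_sum // => p /andP[/andP[_ py] pp].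
    rewrite nmM nm_cR ger0_norm ?mulr_ge0 ?ln_nat_ge0 ?divr_ge0 //.
    rewrite -[leRHS]mulr1 ler_pM ?mulr_ge0 ?ln_nat_ge0 ?divr_ge0 ?nm_ge0 //.
      by rewrite ler_wpM2l ?ln_nat_ge0 // ler_wpM2r ?invr_ge0 ?(ltW X0) // ler_nat -ltnS.
    by rewrite /chi2 nmX exprn_ile1 ?nm_ge0 // (nm_chi_le1 q0 hd).
  rewrite -mulr_suml (le_trans (ler_wpM2r _ (theta_le y))) ?divr_ge0 //.
  rewrite -mulrA ler_piMr // mulrA ler_pdivrMr // mul1r -natrM ler_nat.
  by rewrite mulnn.
have H3 : `|ln y%:R - ln X%:R / 2| <= 1 :> R.
  have l2 := ln2_le1 R.
  have a1 : 2 * ln y%:R <= ln X%:R :> R.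
    have -> : 2 * ln y%:R = ln (y ^ 2)%:R :> R by rewrite natrX lnXn // mulr_natl.
    by rewrite ler_ln ?posrE ?ltr0n ?expn_gt0 ?(ltnW yg) ?ler_nat //; lia.
  have a2 : ln X%:R <= 2 * ln y%:R + 2 * ln 2 :> R.
    have -> : 2 * ln y%:R + 2 * ln 2 = ln ((2 * y) ^ 2)%:R :> R.
      by rewrite natrX lnXn ?natrM ?mulr_gt0 // lnM ?posrE // -mulr_natl; ring.
    by rewrite ler_ln ?posrE ?ltr0n ?expn_gt0 ?ler_nat //; nia.
  rewrite ler_norml; apply/andP; split; lra.
have -> : prime_square_sum chi X - cR (eps2 chi / 2 * ln X%:R) = (mertens_char_sum (chi2 chi) y - cR (eps2 chi * ln y%:R))
  - (\sum_(0 <= p < y.+1 | prime p) cR (ln p%:R * (p%:R / X%:R)) * chi2 chi p)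
  + cR (eps2 chi * (ln y%:R - ln X%:R / 2)).
  rewrite E mulrBr cRB; have -> : eps2 chi / 2 * ln X%:R = eps2 chi * (ln X%:R / 2) by ring.
  by ring.
rewrite (le_trans (nmD _ _)) // lerD //.
  by rewrite (le_trans (nmB _ _)) // lerD // hK.
move/andP: e01 => [e1 e2].
by rewrite nm_cR normrM (ger0_norm e1) -[leRHS]mul1r ler_pM.
Qed.

Definition prime_char_sum (chi : nat -> C) (X : nat) : C :=
  \sum_(0 <= p < X.+1 | prime p) cR (ln p%:R * (tpow 2^-1 p * (1 - p%:R / X%:R))) * chi p.

(** Cubes and higher powers converge absolutely: with weight exponent 1/2 and k >= 3 the decay is
    p^(-3/2), that is eta = 1/4 in [prime_power_tail]. *)
Lemma Lam_char_sum_split : exists2 K : R, 0 <= K & forall chi, is_dchar q chi -> forall X, (1 < X)%N ->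
  nm (Lam_char_sum chi X - prime_char_sum chi X - prime_square_sum chi X) <= K.
Proof.
have h3 : (2^-1 : R) *+ 3 = 1 + 2 * 4^-1 by field.
have [K K0 hK] := prime_power_tail (ltac:(rewrite invr_gt0 //) : (0 : R) < 2^-1) (ltac:(rewrite invr_gt0 //) : (0 : R) < 4^-1) h3.
exists K => // chi hd X X1.
have X0 : 0 < X%:R :> R by rewrite ltr0n; lia.
rewrite /Lam_char_sum (@Lam_sum R C (fun n x => cR (x * (tpow 2^-1 n * (1 - n%:R / X%:R))) * chi n)); first last.
- by move=> n a b; rewrite mulrDl cRD mulrDl.
- by move=> n; rewrite mul0r cR0 mul0r.
rewrite prime_power_split //.
have -> : \sum_(0 <= p < X.+1 | prime p) cR (ln p%:R * (tpow 2^-1 (p ^ 1) * (1 - (p ^ 1)%:R / X%:R))) * chi (p ^ 1)%N = prime_char_sum chi X.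
  by apply: eq_bigr => p _; rewrite expn1.
set Q := \sum_(0 <= p < X.+1 | prime p) (if _ then _ else _).
have -> : Q = prime_square_sum chi X.
  apply: eq_bigr => p pp; case: ifP => // _; congr (cR _ * _).
  by rewrite tpowX ?prime_gt0 // -tpow2 mulfV // tpow1 ?prime_gt0 // mulrA.
set Y := \sum_(0 <= p < X.+1 | prime p) \sum_(3 <= k < X.+1 | _) _.
have -> : prime_char_sum chi X + (prime_square_sum chi X + Y) - prime_char_sum chi X - prime_square_sum chi X = Y by ring.
rewrite (le_trans _ (hK X.+1)) // (le_trans (nm_sum _ _ _)) //.
apply: ler_sum => p pp; rewrite (le_trans (nm_sum _ _ _)) // big_mkcond ler_sum // => k _.
have T0 : 0 <= ln p%:R * tpow 2^-1 p ^+ k by rewrite mulr_ge0 ?ln_nat_ge0 ?exprn_ge0 ?tpow_ge0.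
case: ifP => // pk.
have [u0 u1] : 0 <= (p ^ k)%:R / X%:R :> R /\ (p ^ k)%:R / X%:R <= 1 :> R.
  by split; [rewrite divr_ge0|rewrite ler_pdivrMr // mul1r ler_nat -ltnS].
rewrite nmM nm_cR tpowX ?prime_gt0 // -[leRHS]mulr1 ler_pM ?nm_ge0 ?(nm_chi_le1 q0 hd) //.
rewrite mulrA normrM (ger0_norm T0) ler_piMr // ger0_norm; lra.
Qed.

(** The squares contribute (eps2/2) ln X to the sum over prime powers; taking them out lowers the
    main term -m ln X by this amount. *)
Lemma prime_char_sum_bound chi : @nonprincipal_chars R q chi -> exists2 K : R, 0 <= K & forall X, (3 < X)%N ->
  nm (prime_char_sum chi X + ((m_chi chi)%:R + cR (eps2 chi / 2)) * cR (ln X%:R)) <= K * (1 + ln (1 + ln X%:R)).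
Proof.
move=> hchi; have hd := hchi.1.
have [mo [D0 [r0 [hm1 hm2 r00 hord]]]] := L_order q0 hchi (hG hchi).
have -> : m_chi chi = mo.
  by rewrite /m_chi; case: xgetP => [y _ /hm2 //|/(_ mo)]; case.
have [K1 K10 h1] := Lam_char_sum_bound q0 hchi (hG hchi) r00 hord.
have [K2 K20 h2] := Lam_char_sum_split; have [K3 K30 h3] := prime_square_sum_bound hd.
exists (K1 + K2 + K3); first by lra.
move=> X X3.
have b1 := h1 X ltac:(lia); have b2 := h2 chi hd X ltac:(lia); have b3 := h3 X X3.
set Q := 1 + ln (1 + ln X%:R) in b1 *.
have Q1 : 1 <= Q by rewrite lerDl ln_ge0 // lerDl ln_nat_ge0.
have -> : prime_char_sum chi X + (mo%:R + cR (eps2 chi / 2)) * cR (ln X%:R) =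
  (Lam_char_sum chi X + mo%:R * cR (ln X%:R)) - (Lam_char_sum chi X - prime_char_sum chi X - prime_square_sum chi X) - (prime_square_sum chi X - cR (eps2 chi / 2 * ln X%:R)).
  by rewrite (cRM (eps2 chi / 2)); ring.
rewrite (le_trans (nmB _ _)) // (le_trans (lerD (nmB _ _) (lexx _))) //.
have : K2 <= K2 * Q by rewrite ler_peMr.
have : K3 <= K3 * Q by rewrite ler_peMr.
by rewrite 2!mulrDl; move: b1 b2 b3; move: (K1 * Q) (K2 * Q) (K3 * Q) => a b c; lra.
Qed.

End Mertens.

(** * Orthogonality of characters *)

Section Characters.
Variable R : realType.
Local Notation C := (Cx R).
Implicit Types (z w s c : C) (chi psi : nat -> C).
Variable q : nat.
Hypothesis q1 : (1 < q)%N.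
Let q0 : (0 < q)%N := ltnW q1.

(** Takes the default value 1 when n is not coprime to q; characters are set to 0 there. *)
Definition unit_of_nat (n : nat) : {unit 'Z_q} := insubd (1%g : {unit 'Z_q}) (n%:R : 'Z_q).

Lemma val_unit_of_nat n : coprime n q -> val (unit_of_nat n) = n%:R :> 'Z_q.
Proof. by move=> h; rewrite insubdK // unfold_in unitZpE // coprime_sym. Qed.

Lemma unit_of_natM m n : coprime m q -> coprime n q ->
  unit_of_nat (m * n) = (unit_of_nat m * unit_of_nat n)%g.
Proof.
move=> hm hn; apply: val_inj; rewrite FinRing.val_unitM !val_unit_of_nat //; first by rewrite natrM.
by rewrite coprimeMl hm.
Qed.

Lemma unit_of_nat_per n : unit_of_nat (n + q) = unit_of_nat n.
Proof. by rewrite /unit_of_nat natrD pchar_Zp // addr0. Qed.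

(** The irreducible characters of the abelian group of units are linear and their kernels intersect
    trivially, so one of them is not 1 at a. Its values are algebraic numbers; they are transported
    by sending powers of a primitive root of unity z to the same powers of a primitive root w in
    C. *)
Lemma chi_separates a : coprime a q -> a != 1 %[mod q] -> exists2 chi : nat -> C, is_dchar q chi & chi a != 1.
Proof.
move=> ca a1; pose G := [set: {unit 'Z_q}]%G.
have abG : abelian G by exact: units_Zp_abelian.
have lin i := char_abelianP G abG i.
have ua1 : unit_of_nat a != 1%g.
  apply: contra a1 => /eqP /(congr1 val); rewrite val_unit_of_nat // FinRing.val_unit1.
  by move=> /(congr1 (@nat_of_ord _)); rewrite val_Zp_nat // -[1]/(1%:R) val_Zp_nat // => ->.
have inG g : g \in G by rewrite inE.
have [i hi] : exists i : Iirr G, 'chi_i (unit_of_nat a) != 1.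
  apply: contrapT => h; move/negP: ua1; apply.
  have : unit_of_nat a \in (\bigcap_i cfker 'chi[G]_i)%SET.
    apply/bigcapP => i _; rewrite cfkerEirr inE lin_char1 ?lin //.
    by apply/negP => /negP h'; apply: h; exists i.
  by rewrite TI_cfker_irr inE.
set N := #|G|; have N0 : (0 < N)%N by exact: cardG_gt0.
have [z hz] := C_prim_root_exists N0.
have [w hw] := prim_root_ex R N0.
have xN g : 'chi_i g ^+ N = 1.
  by rewrite -(lin_charX (lin i)) // expg_cardG // lin_char1 ?lin.
pose k g : nat := sval (prim_rootP hz (xN g)).
have kE g : 'chi_i g = z ^+ k g by rewrite /k; case: prim_rootP.
pose chi n : C := if coprime n q then w ^+ k (unit_of_nat n) else 0.
exists chi; last first.
  rewrite /chi ca; apply: contra hi; rewrite kE -(expr0 w) -(expr0 z).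
  by rewrite (eq_prim_root_expr hw) (eq_prim_root_expr hz).
split; rewrite /chi.
- by move=> n; rewrite unit_of_nat_per -coprime_modl modnDr coprime_modl.
- move=> m n; rewrite coprimeMl; case: (boolP (coprime m q)) => cm; last by rewrite mul0r.
  case: (boolP (coprime n q)) => cn; last by rewrite mulr0.
  rewrite /= unit_of_natM // -exprD; apply/eqP; rewrite (eq_prim_root_expr hw) -(eq_prim_root_expr hz).
  by rewrite -kE exprD -!kE lin_charM ?lin.
move=> n; case: ifP => cn; last by rewrite eqxx.
split => // _; rewrite expf_neq0 //; apply/eqP => w0.
by have := prim_expr_order hw; rewrite w0 expr0n (gtn_eqF N0) => /esym/eqP; rewrite oner_eq0.
Qed.

(** A character is determined by its values on q residues, each 0 or one of totient q roots of
    unity; this encodes characters by a finite type, from which the true ones are filtered. *)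
Lemma dchar_seq : exists X : seq (nat -> C), uniq X /\ forall chi, (chi \in X) <-> is_dchar q chi.
Proof.
have N0 : (0 < totient q)%N by rewrite totient_gt0.
have [w hw] := prim_root_ex R N0.
pose dec (g : {ffun 'I_q -> option 'I_(totient q)}) (n : nat) : C :=
  if g (Ordinal (ltn_pmod n q0)) is Some i then w ^+ i else 0.
exists [seq f <- undup (map dec (enum {: {ffun 'I_q -> option 'I_(totient q)}})) | `[< is_dchar q f >]].
split; first by rewrite filter_uniq // undup_uniq.
move=> chi; rewrite mem_filter; split; first by move=> /andP[/asboolP].
move=> hd; apply/andP; split; first exact/asboolP.
rewrite mem_undup; apply/mapP.
exists [ffun i : 'I_q => if coprime i q then [pick j : 'I_(totient q) | chi i == w ^+ j] else None].
  by rewrite mem_enum.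
apply/funext => n; rewrite /dec ffunE /= coprime_modl.
case: (boolP (coprime n q)) => cn; last first.
  by apply/eqP; rewrite -[_ == _]negbK (chi_neq0 hd).
case: pickP => [j /eqP <-|h]; first by rewrite (chi_modn hd).
have [j hj] := prim_rootP hw (chi_root hd cn).
by have := h j; rewrite (chi_modn hd) hj eqxx.
Qed.

Variable X : seq (nat -> C).
Hypothesis Xu : uniq X.
Hypothesis XE : forall chi, (chi \in X) <-> is_dchar q chi.
Local Notation chi0 := (@principal_char R q).

Lemma is_dchar0 : is_dchar q chi0.
Proof.
split; rewrite /principal_char.
- by move=> n; rewrite -coprime_modl modnDr coprime_modl.
- by move=> m n; rewrite coprimeMl; case: (coprime m q); case: (coprime n q); rewrite /= ?mulr1 ?mul0r ?mulr0.
by move=> n; case: ifP => // _; rewrite ?oner_neq0 ?eqxx.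
Qed.

Lemma is_dcharM chi psi : is_dchar q chi -> is_dchar q psi -> is_dchar q (fun n => chi n * psi n).
Proof.
move=> [a1 a2 a3] [b1 b2 b3]; split.
- by move=> n; rewrite a1 b1.
- by move=> m n; rewrite a2 b2 mulrACA.
move=> n; rewrite mulf_eq0 negb_or; split; first by move=> /andP[/a3].
by move=> cn; apply/andP; split; [exact/a3|exact/b3].
Qed.

Lemma cj_eq0 z : (cj z == 0) = (z == 0).
Proof. by rewrite -!nm_eq0 nm_cj. Qed.

Lemma is_dchar_cj chi : is_dchar q chi -> is_dchar q (fun n => cj (chi n)).
Proof.
move=> [a1 a2 a3]; split.
- by move=> n; rewrite a1.
- by move=> m n; rewrite a2 cjM.
by move=> n; rewrite cj_eq0.
Qed.

Lemma cj_mul_chi chi n : is_dchar q chi -> coprime n q -> cj (chi n) * chi n = 1.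
Proof. by move=> hd cn; rewrite mulrC mul_cj (nm_chi q0 hd) // expr1n. Qed.

(** Multiplication by a character psi with psi(n) different from 1 permutes the characters, so the
    sum is fixed under multiplication by psi(n). *)
Lemma sum_chi_sep n : coprime n q -> n != 1 %[mod q] -> \sum_(chi <- X) chi n = 0.
Proof.
move=> cn n1; have [psi hp pn] := chi_separates cn n1.
have hcp := is_dchar_cj hp.
have P : perm_eq (map (fun chi k => psi k * chi k) X) X.
  apply: uniq_perm => //.
    rewrite map_inj_in_uniq // => f g /XE hf /XE hg /= E; apply/funext => k.
    case: (boolP (coprime k q)) => ck.
      have := congr1 (fun F => cj (psi k) * F k) E; rewrite /= !mulrA.
      by rewrite (cj_mul_chi hp ck) !mul1r.
    have := chi_neq0 hf k; have := chi_neq0 hg k; rewrite (negbTE ck) => /negbFE/eqP -> /negbFE/eqP -> //.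
  move=> f; apply/mapP/idP => [[g /XE hg ->]|/XE hf]; first by apply/XE; exact: is_dcharM.
  exists (fun k => cj (psi k) * f k); first by apply/XE; exact: is_dcharM.
  apply/funext => k; case: (boolP (coprime k q)) => ck.
    by rewrite mulrA (mulrC (psi k)) (cj_mul_chi hp ck) mul1r.
  have := chi_neq0 hf k; rewrite (negbTE ck) => /negbFE/eqP ->; by rewrite !mulr0.
have : \sum_(chi <- X) chi n = psi n * \sum_(chi <- X) chi n.
  by rewrite -{1}(perm_big _ P) big_map mulr_sumr.
set S := \sum_(_ <- _) _ => E.
have : (psi n - 1) * S = 0 by rewrite mulrBl mul1r -E subrr.
by move/eqP; rewrite mulf_eq0 subr_eq0 (negbTE pn) => /eqP.
Qed.

Lemma sum_chi_res chi : is_dchar q chi ->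
  \sum_(i < q) chi i = if `[< chi = chi0 >] then (totient q)%:R else 0.
Proof.
move=> hd; case: asboolP => h; last exact: (chi_sum0 q0 hd h).
rewrite h totient_count_coprime big_mkord natr_sum; apply: eq_bigr => i _.
by rewrite /principal_char coprime_sym; case: coprime.
Qed.

(** Double counting of the sum of chi(i) over all chi and i: summing over i first leaves the
    principal character, summing over chi first leaves i = 1. *)
Lemma size_chars : (size X)%:R = (totient q)%:R :> C.
Proof.
have E1 : \sum_(chi <- X) \sum_(i < q) chi i = (totient q)%:R.
  have -> : \sum_(chi <- X) \sum_(i < q) chi i = \sum_(chi <- X) (if chi == chi0 then (totient q)%:R else 0).
    rewrite big_seq [RHS]big_seq; apply: eq_bigr => chi /XE hd; rewrite sum_chi_res //.
  have h0 : chi0 \in X by apply/XE; exact: is_dchar0.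
  rewrite (bigD1_seq chi0) //= eqxx big1 ?addr0 // => chi; by case: eqP.
rewrite -E1 exchange_big /= (bigD1 (Ordinal q1)) //= [Y in _ = _ + Y]big1 ?addr0.
  rewrite big_seq; under eq_bigr => chi /XE hd do rewrite (chi1 hd).
  by rewrite -big_seq big_const_seq count_predT iter_addr_0.
move=> i i1; case: (boolP (coprime i q)) => ci.
  apply: sum_chi_sep => //; rewrite modn_small // modn_small //.
by rewrite big_seq big1 // => chi /XE hd; apply/eqP; rewrite -[_ == _]negbK (chi_neq0 hd).
Qed.

Lemma orthogonality a n : coprime a q -> \sum_(chi <- X) chi a * cj (chi n) =
  if (n == a %[mod q])%N then (totient q)%:R else 0.
Proof.
move=> ca; case: (boolP (coprime n q)) => cn; last first.
  rewrite big_seq big1; last first.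
    move=> chi /XE hd; have := chi_neq0 hd n; rewrite (negbTE cn) => /negbFE/eqP ->.
    by rewrite /cj /= oppr0 mulr0.
  case: eqP => // E; by rewrite -coprime_modl E coprime_modl ca in cn.
(* An inverse of n modulo q by Euler's theorem; chi(n') is the conjugate of chi(n). *)
pose n' := (n ^ (totient q).-1)%N.
have nn : (n' * n = n ^ totient q)%N by rewrite /n' mulnC -expnS prednK // totient_gt0.
have cn' : coprime n' q by rewrite coprimeXl.
have E : \sum_(chi <- X) chi a * cj (chi n) = \sum_(chi <- X) chi (a * n')%N.
  rewrite big_seq [RHS]big_seq; apply: eq_bigr => chi /XE hd; rewrite (chiM hd); congr (_ * _).
  have h1 : chi n' * chi n = 1 by rewrite -(chiM hd) nn (chiX hd) chi_root.
  by rewrite -[LHS]mulr1 -h1 (mulrC (chi n')) mulrA (cj_mul_chi hd cn) mul1r.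
rewrite E; have key : (a * n' == 1 %[mod q])%N = (n == a %[mod q])%N.
  have en : (n' * n = 1 %[mod q])%N by rewrite nn Euler_exp_totient.
  apply/eqP/eqP => h.
    have : (a * n' * n = 1 * n %[mod q])%N by rewrite -modnMml h modnMml.
    by rewrite -mulnA -modnMmr en modnMmr muln1 mul1n => ->.
  by rewrite mulnC -modnMmr -h modnMmr en.
rewrite -key; case: ifP => h; last by apply: sum_chi_sep; rewrite ?h // coprimeMl ca.
rewrite -size_chars big_seq; under eq_bigr => chi /XE hd do rewrite (chi_eqmod hd (eqP h)) (chi1 hd).
by rewrite -big_seq big_const_seq count_predT iter_addr_0.
Qed.

Lemma tot_neq0 : (totient q)%:R != 0 :> C.
Proof. by rewrite pnatr_eq0 -lt0n totient_gt0. Qed.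

(** The condition x^2 = a is detected by orthogonality; after exchange the sum over x of the
    conjugate of chi^2(x) is totient q or 0. *)
Lemma rsq_chars a : coprime a q -> (rsq q a)%:R = \sum_(chi <- X) chi a * cR (eps2 q chi).
Proof.
move=> ca; apply: (mulfI tot_neq0).
have -> : (rsq q a)%:R = \sum_(x < q) (if (x * x == a %[mod q])%N then 1 else 0) :> C.
  rewrite /rsq -sum1_card natr_sum big_mkcond /=; apply: eq_bigr => x _.
  have -> : (x \in [set x : 'I_q | coprime x q && (x * x == a %[mod q])%N]) = (x * x == a %[mod q])%N.
    apply/idP/idP => [/set_mem /andP[] //|h]; apply/mem_set; rewrite /= h andbT.
    have : coprime (x * x) q by rewrite -coprime_modl (eqP h) coprime_modl.
    by rewrite coprimeMl => /andP[].
  by case: ifP.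
transitivity (\sum_(x < q) \sum_(chi <- X) chi a * cj (chi (x * x)%N)).
  rewrite mulr_sumr; apply: eq_bigr => x _; rewrite orthogonality //.
  by case: ifP; rewrite ?mulr1 ?mulr0.
rewrite exchange_big mulr_sumr big_seq [RHS]big_seq; apply: eq_bigr => chi /XE hd.
rewrite -mulr_sumr mulrCA; congr (_ * _).
have -> : \sum_(x < q) cj (chi (x * x)%N) = cj (\sum_(x < q) chi2 chi x).
  by rewrite cj_sum; apply: eq_bigr => x _; rewrite (chiM hd).
rewrite sum_chi_res /eps2; last exact: is_dchar_chi2.
by case: asboolP => _; rewrite ?cR1 ?mulr1 ?cR0 ?mulr0 -?cR_nat ?cj_cR // -cR0 cj_cR.
Qed.

(** The principal character drops out because it takes the value 1 at both a and b, so r(a) - r(b)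
    joins the sum over non-principal characters as the term eps2/2. *)
Lemma Mqab_chars a b : coprime a q -> coprime b q ->
  @Mqab R q a b = ((totient q)%:R)^-1 * \sum_(chi <- X | chi != chi0) (chi a - chi b) * ((m_chi chi)%:R + cR (eps2 q chi / 2)).
Proof.
move=> ca cb; rewrite /Mqab.
have -> : \sum_(chi \in @nonprincipal_chars R q) (chi a - chi b) * (m_chi chi)%:R =
   \sum_(chi <- X | chi != chi0) (chi a - chi b) * (m_chi chi)%:R.
  rewrite -[RHS]big_filter [RHS]fsbig_seq; last exact: filter_uniq.
  apply: eq_fsbigl; apply/seteqP; split => chi /=.
    by move=> [h1 /eqP h2]; rewrite mem_filter h2; apply/XE.
  by rewrite mem_filter => /andP[/eqP h2 /XE h1].
have -> : (rsq q a)%:R - (rsq q b)%:R = \sum_(chi <- X | chi != chi0) (chi a - chi b) * cR (eps2 q chi) :> C.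
  rewrite !rsq_chars // -sumrB big_mkcond /=; rewrite [RHS]big_mkcond; apply: eq_bigr => chi _.
  rewrite -mulrBl; case: eqP => // ->; by rewrite /principal_char ca cb subrr mul0r.
rewrite mulr_sumr -big_split /= !mulr_sumr; apply: eq_bigr => chi _.
rewrite cRM cRV; have -> : cR 2 = 2 :> C by rewrite cR_nat.
by field; rewrite tot_neq0.
Qed.

Definition class_diff (a b n : nat) : R := (n == a %[mod q])%:R - (n == b %[mod q])%:R.

Definition prime_diff_sum (a b N : nat) : C :=
  \sum_(0 <= p < N.+1 | prime p) cR (ln p%:R * (tpow 2^-1 p * (1 - p%:R / N%:R)) * class_diff a b p).

Lemma class_diff_chars a b n : coprime a q -> coprime b q ->
  cR (class_diff a b n) = ((totient q)%:R)^-1 * \sum_(chi <- X | chi != chi0) (chi a - chi b) * cj (chi n).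
Proof.
move=> ca cb; apply: (mulfI tot_neq0); rewrite mulrA divff ?tot_neq0 // mul1r.
transitivity (\sum_(chi <- X) (chi a - chi b) * cj (chi n)).
  under eq_bigr do rewrite mulrBl; rewrite sumrB !orthogonality // /class_diff cRB mulrBr.
  by congr (_ - _); case: eqP => _; rewrite ?cR1 ?cR0 ?mulr1 ?mulr0.
rewrite [RHS]big_mkcond; apply: eq_bigr => chi _; case: eqP => // ->.
by rewrite /principal_char ca cb subrr mul0r.
Qed.

Hypothesis hG : forall chi, @nonprincipal_chars R q chi ->
  forall s : C, 2^-1 < complex.Re s -> Lchi chi s != 0.

(** The constant of [prime_char_sum_bound] depends on chi, so an induction over the finite list of
    characters accumulates the constants. *)
Lemma prime_diff_sum_bound a b : coprime a q -> coprime b q -> exists2 K : R, 0 <= K & forall N, (3 < N)%N ->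
  nm (prime_diff_sum a b N + @Mqab R q a b * cR (ln N%:R)) <= K * (1 + ln (1 + ln N%:R)).
Proof.
move=> ca cb.
have H : exists2 K : R, 0 <= K & forall N, (3 < N)%N ->
    nm (\sum_(chi <- X | chi != chi0) (chi a - chi b) *
      cj (prime_char_sum chi N + ((m_chi chi)%:R + cR (eps2 q chi / 2)) * cR (ln N%:R))) <= K * (1 + ln (1 + ln N%:R)).
  have : forall chi, chi \in X -> is_dchar q chi by move=> chi /XE.
  elim: (X) => [_|chi l IH hl].
    by exists 0 => // N _; rewrite big_nil nm0 mul0r.
  have [K K0 hK] := IH (fun f hf => hl f (@mem_behead _ (chi :: l) f hf)).
  case: (eqVneq chi chi0) => [E|nE].
    by exists K => // N N3; rewrite big_cons E eqxx hK.
  have hc : @nonprincipal_chars R q chi by split; [apply: hl; rewrite mem_head|exact/eqP].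
  have [K1 K10 h1] := prime_char_sum_bound q0 hG hc.
  exists (nm (chi a - chi b) * K1 + K); first by rewrite addr_ge0 // mulr_ge0 ?nm_ge0.
  move=> N N3; rewrite big_cons nE (mulrDl (nm (chi a - chi b) * K1)) (le_trans (nmD _ _)) // lerD ?hK //.
  by rewrite nmM nm_cj -mulrA ler_wpM2l ?nm_ge0 // h1.
have [K K0 hK] := H; exists (nm ((totient q)%:R^-1 : C) * K); first by rewrite mulr_ge0 ?nm_ge0.
move=> N N3.
have -> : prime_diff_sum a b N + @Mqab R q a b * cR (ln N%:R) = (totient q)%:R^-1 * \sum_(chi <- X | chi != chi0) (chi a - chi b) *
      cj (prime_char_sum chi N + ((m_chi chi)%:R + cR (eps2 q chi / 2)) * cR (ln N%:R)).
  rewrite Mqab_chars // /prime_diff_sum -mulrA mulr_suml.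
  under eq_bigr => p _ do rewrite cRM class_diff_chars //.
  have -> : \sum_(0 <= p < N.+1 | prime p) cR (ln p%:R * (tpow 2^-1 p * (1 - p%:R / N%:R))) *
     ((totient q)%:R^-1 * \sum_(chi <- X | chi != chi0) (chi a - chi b) * cj (chi p)) =
     (totient q)%:R^-1 * \sum_(chi <- X | chi != chi0) (chi a - chi b) * cj (prime_char_sum chi N).
    under eq_bigr => p _ do rewrite mulrCA mulr_sumr.
    rewrite -mulr_sumr exchange_big /=; congr (_ * _); apply: eq_bigr => chi _.
    rewrite /prime_char_sum cj_sum mulr_sumr; apply: eq_bigr => p _.
    by rewrite cjM cj_cR mulrCA.
  rewrite -mulrDr -big_split /=; congr (_ * _); apply: eq_bigr => chi _.
  rewrite cjD cjM cjD !cj_cR -cR_nat cj_cR; ring.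
by rewrite nmM -mulrA ler_wpM2l ?nm_ge0 // hK.
Qed.

End Characters.

(** * Partial summation *)

Section AbelSummation.
Variable R : realType.
Local Notation C := (Cx R).
Implicit Types (z c : C) (e : R).

Definition inv_ln (n : nat) : R := (ln n%:R)^-1.
(** Of the order of ln ln n for large n, but at least 1 everywhere, so that it absorbs bounded
    terms. *)
Definition lnln (n : nat) : R := 1 + ln (1 + ln n%:R).

Lemma ln_ge_half n : (2 <= n)%N -> 2^-1 <= ln n%:R :> R.
Proof.
move=> n2; have [_ _ h] := @lnS_bounds R 1 isT.
apply: (@le_trans _ _ (ln 2)); last by rewrite ler_ln ?posrE ?ltr0n ?ler_nat //; apply: leq_trans n2.
by move: h; rewrite mulr1 invr1 (_ : 1 + 1 = 2 :> R).
Qed.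

Lemma ln_nat_gt0 n : (2 <= n)%N -> 0 < ln n%:R :> R.
Proof. by move=> n2; apply: lt_le_trans (ln_ge_half n2); rewrite invr_gt0. Qed.

Lemma inv_ln_gt0 n : (2 <= n)%N -> 0 < inv_ln n. Proof. by move=> n2; rewrite invr_gt0 ln_nat_gt0. Qed.

Lemma inv_ln_le2 n : (2 <= n)%N -> inv_ln n <= 2.
Proof.
by move=> n2; rewrite -[2]invrK lef_pV2 ?posrE ?invr_gt0 ?ln_nat_gt0 // ln_ge_half.
Qed.

Lemma inv_ln_mono m n : (2 <= m)%N -> (m <= n)%N -> inv_ln n <= inv_ln m.
Proof.
move=> m2 mn; have n2 := leq_trans m2 mn; rewrite lef_pV2 ?posrE ?ln_nat_gt0 //.
by rewrite ler_ln ?posrE ?ltr0n ?ler_nat //; lia.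
Qed.

Lemma inv_ln_half n : (2 <= n)%N -> inv_ln n <= 2 * inv_ln n.+1.
Proof.
move=> n2; rewrite -[2]invrK -invfM lef_pV2 ?posrE ?mulr_gt0 ?invr_gt0 ?ln_nat_gt0 //; last by apply: leqW.
have : ln n.+1%:R <= ln (n ^ 2)%:R :> R by rewrite ler_ln ?posrE ?ltr0n ?ler_nat ?expn_gt0 //; nia.
by rewrite natrX lnXn ?ltr0n; [rewrite -mulr_natl; lra|lia].
Qed.

Lemma lnln_ge1 n : 1 <= lnln n.
Proof. by rewrite lerDl ln_ge0 // lerDl ln_nat_ge0. Qed.

Lemma lnln_mono m n : (0 < m)%N -> (m <= n)%N -> lnln m <= lnln n.
Proof.
move=> m0 mn; have h : ln m%:R <= ln n%:R :> R by rewrite ler_ln ?posrE ?ltr0n ?ler_nat //; lia.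
have := ln_nat_ge0 R m; have := ln_nat_ge0 R n => a b.
by rewrite lerD2l ler_ln ?posrE; lra.
Qed.

Lemma lnSn_bounds n : (0 < n)%N -> (n.+1%:R : R)^-1 <= ln (n.+1%:R : R) - ln (n%:R : R) <= (n%:R : R)^-1.
Proof.
move=> n0; have N0 : 0 < n%:R :> R by rewrite ltr0n.
have N1 : 0 < n.+1%:R :> R by rewrite ltr0n.
have i0 : 0 < n%:R^-1 :> R by rewrite invr_gt0.
have [E h _] := @lnS_bounds R n n0.
apply/andP; split; last by rewrite E; lra.
have i00 : 0 <= n%:R^-1 :> R by exact: ltW.
have := ln1_ge i00; rewrite E.
have -> : n%:R^-1 / (1 + n%:R^-1) = n.+1%:R^-1 :> R.
  by rewrite -natr1; field; rewrite natr1; apply/andP; split; exact: lt0r_neq0.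
by rewrite addrAC subrr add0r.
Qed.

Lemma lnln_S n : (2 <= n)%N -> lnln n.+1 <= 2 * lnln n.
Proof.
move=> n2; have h := inv_ln_half n2.
have l0 := ln_nat_gt0 n2; have l1 : 0 < ln n.+1%:R :> R by apply: ln_nat_gt0; exact: leqW.
have l2 : ln n.+1%:R <= 2 * ln n%:R :> R.
  by move: h; rewrite /inv_ln -[2]invrK -invfM lef_pV2 ?posrE ?mulr_gt0 ?invr_gt0 //; lra.
have : ln (1 + ln n.+1%:R) <= ln (2 * (1 + ln n%:R)) :> R by rewrite ler_ln ?posrE; lra.
rewrite lnM ?posrE; try lra.
by have := ln2_le1 R; have := lnln_ge1 n; rewrite /lnln; lra.
Qed.

Lemma inv_ln_diff n : (2 <= n)%N -> 0 <= inv_ln n - inv_ln n.+1 <= inv_ln n ^+ 2 / n%:R.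
Proof.
move=> n2; have n0 : (0 < n)%N by lia.
rewrite subr_ge0 inv_ln_mono //=.
have l0 := ln_nat_gt0 n2; have l1 : 0 < ln n.+1%:R :> R by apply: ln_nat_gt0; exact: leqW.
have -> : inv_ln n - inv_ln n.+1 = (ln n.+1%:R - ln n%:R) * (inv_ln n * inv_ln n.+1).
  by rewrite /inv_ln; field; apply/andP; split; exact: lt0r_neq0.
have /andP[_ h] := lnSn_bounds n0.
have w0 := inv_ln_gt0 n2; have w1 : 0 < inv_ln n.+1 by apply: inv_ln_gt0; exact: leqW.
rewrite mulrC ler_pM ?(mulr_ge0 (ltW w0) (ltW w1)) //.
  by rewrite subr_ge0 ler_ln ?posrE ?ltr0n // ler_nat.
by rewrite expr2 ler_wpM2l ?(ltW w0) // inv_ln_mono.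
Qed.

Lemma inv_half n : (1 <= n)%N -> n%:R^-1 <= 2 * n.+1%:R^-1 :> R.
Proof.
move=> n1; rewrite -[2]invrK -invfM lef_pV2 ?posrE ?mulr_gt0 ?invr_gt0 ?ltr0n //.
have : 1 <= n%:R :> R by rewrite ler1n.
by rewrite -(@natr1 _ n); lra.
Qed.

Lemma inv_ln_D1 n : (2 <= n)%N -> 0 <= inv_ln n - inv_ln n.+2 <= 9 * (inv_ln n.+1 ^+ 2 / n.+1%:R).
Proof.
move=> n2; have /andP[a0 a1] := inv_ln_diff n2; have /andP[b0 b1] := inv_ln_diff (leqW n2).
have h1 := inv_ln_half n2; have h2 : n%:R^-1 <= 2 * n.+1%:R^-1 :> R by apply: inv_half; lia.
have w0 := inv_ln_gt0 n2.
have n0 : 0 <= n%:R^-1 :> R by rewrite invr_ge0.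
have : inv_ln n ^+ 2 / n%:R <= (2 * inv_ln n.+1) ^+ 2 * (2 * n.+1%:R^-1).
  by rewrite ler_pM ?sqr_ge0 // lerXn2r ?nnegrE ?(ltW w0) // (le_trans (ltW w0)).
have -> : (2 * inv_ln n.+1) ^+ 2 * (2 * n.+1%:R^-1) = 8 * (inv_ln n.+1 ^+ 2 / n.+1%:R) by ring.
move: a0 a1 b0 b1; move: (inv_ln n ^+ 2 / _) (inv_ln n.+1 ^+ 2 / _) => a b; lra.
Qed.

(** The second difference is rewritten through the increments p and r of ln: p - r is O(n^(-2)) and
    r times a first difference of 1/ln is of the same order. The constant is 8 + 9 * 2, from 1/ln <=
    2. *)
Lemma inv_ln_D2 n : (2 <= n)%N -> `|inv_ln n - 2 * inv_ln n.+1 + inv_ln n.+2| <= 26 * (inv_ln n.+1 ^+ 2 / n.+1%:R ^+ 2).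
Proof.
move=> n2; have n0 : (0 < n)%N by lia.
have l0 := ln_nat_gt0 n2; have l1 := ln_nat_gt0 (leqW n2); have l2 := ln_nat_gt0 (leqW (leqW n2)).
have /andP[u0 u1] := lnSn_bounds n0; have /andP[v0 v1] := lnSn_bounds (ltn0Sn n).
have /andP[d0 d1] := inv_ln_D1 n2.
set p := ln n.+1%:R - ln n%:R in u0 u1; set r := ln n.+2%:R - ln n.+1%:R in v0 v1.
have -> : inv_ln n - 2 * inv_ln n.+1 + inv_ln n.+2 = inv_ln n.+1 * ((p - r) * inv_ln n + r * (inv_ln n - inv_ln n.+2)).
  by rewrite /inv_ln /p /r; field; apply/and3P; split; exact: lt0r_neq0.
have w1 := inv_ln_gt0 (leqW n2); have w0 := inv_ln_gt0 n2.
have N1 : 0 < n.+1%:R :> R by rewrite ltr0n.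
have N0 : 0 < n%:R :> R by rewrite ltr0n.
have i1 : 0 < n.+1%:R^-1 :> R by rewrite invr_gt0.
set X := inv_ln n.+1 ^+ 2 / n.+1%:R in d1.
have X0 : 0 <= X by rewrite divr_ge0 ?sqr_ge0 // ltW.
have pr : 0 <= p - r <= 4 / n.+1%:R ^+ 2.
  apply/andP; split; first by rewrite subr_ge0 (le_trans v1).
  have : p - r <= n%:R^-1 - n.+2%:R^-1 by rewrite lerB.
  have -> : n%:R^-1 - n.+2%:R^-1 = 2 / (n%:R * n.+2%:R) :> R.
    have E2 : n.+2%:R = n%:R + 2 :> R by rewrite -addn2 natrD.
    have : n%:R + 2 != 0 :> R by rewrite -E2 pnatr_eq0.
    by rewrite E2 => h; field; rewrite h lt0r_neq0.
  move=> h; apply: (le_trans h).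
  have -> : 4 / n.+1%:R ^+ 2 = 2 / (n.+1%:R ^+ 2 / 2) :> R by field; exact: lt0r_neq0.
  rewrite ler_wpM2l // lef_pV2 ?posrE ?mulr_gt0 ?divr_gt0 ?exprn_gt0 ?ltr0n //.
  have E2 : n.+2%:R = n%:R + 2 :> R by rewrite -addn2 natrD.
  have : 2 <= n%:R :> R by rewrite (ler_nat _ 2).
  by rewrite E2 -(@natr1 _ n) => ?; nra.
have wh := inv_ln_half n2; have wl2 : inv_ln n.+1 <= 2 by apply: inv_ln_le2; exact: leqW.
move/andP: pr => [p0 p1].
have r0 : 0 <= r by apply: le_trans v0; rewrite invr_ge0.
have A0 : 0 <= (p - r) * inv_ln n by rewrite mulr_ge0 // ltW.
have B0 : 0 <= r * (inv_ln n - inv_ln n.+2) by rewrite mulr_ge0.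
rewrite ger0_norm; last by rewrite mulr_ge0 ?(ltW w1) // addr_ge0.
have A1 : (p - r) * inv_ln n <= 4 / n.+1%:R ^+ 2 * (2 * inv_ln n.+1) by rewrite ler_pM // ltW.
have B1 : r * (inv_ln n - inv_ln n.+2) <= n.+1%:R^-1 * (9 * X) by rewrite ler_pM.
apply: (@le_trans _ _ (inv_ln n.+1 * (4 / n.+1%:R ^+ 2 * (2 * inv_ln n.+1) + n.+1%:R^-1 * (9 * X)))).
  by rewrite ler_wpM2l ?(ltW w1) // lerD.
have -> : inv_ln n.+1 * (4 / n.+1%:R ^+ 2 * (2 * inv_ln n.+1) + n.+1%:R^-1 * (9 * X)) =
   8 * (inv_ln n.+1 ^+ 2 / n.+1%:R ^+ 2) + 9 * inv_ln n.+1 * (inv_ln n.+1 ^+ 2 / n.+1%:R ^+ 2).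
  by rewrite /X; field; exact: lt0r_neq0.
have : 0 <= inv_ln n.+1 ^+ 2 / n.+1%:R ^+ 2 by rewrite divr_ge0 ?sqr_ge0.
move: (_ / _) => Y Y0; nra.
Qed.

(** Cut at the square root of N: above it 1/ln n <= 2/ln N, below it each term is at most 2 and
    there are too few to matter. *)
Lemma inv_ln_sum N : (2 <= N)%N -> \sum_(2 <= n < N.+1) inv_ln n <= 6 * (N%:R * inv_ln N).
Proof.
move=> N2; have [y /andP[y1 y2]] := sqrt_floor N.
have y0 : (0 < y)%N by nia.
have yN : (y <= N)%N by nia.
have w0 := inv_ln_gt0 N2; have l0 := ln_nat_gt0 N2.
have ly : ln N%:R <= 2 * ln y.+1%:R :> R.
  have -> : 2 * ln y.+1%:R = ln (y.+1 ^ 2)%:R :> R by rewrite natrX lnXn ?ltr0n // mulr_natl.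
  by rewrite ler_ln ?posrE ?ltr0n ?ler_nat ?expn_gt0 //; [exact: ltnW|lia].
have B1 : \sum_(2 <= n < y.+1) inv_ln n <= 2 * y%:R.
  apply: (@le_trans _ _ (\sum_(2 <= n < y.+1) 2)).
    rewrite big_nat_cond [leRHS]big_nat_cond ler_sum // => n /andP[/andP[n2 _] _]; exact: inv_ln_le2.
  rewrite sumr_const_nat -[_ *+ _]mulr_natl mulrC ler_wpM2l // ler_nat; lia.
have B2 : \sum_(y.+1 <= n < N.+1) inv_ln n <= N%:R * (2 * inv_ln N).
  apply: (@le_trans _ _ (\sum_(y.+1 <= n < N.+1) 2 * inv_ln N)).
    rewrite big_nat_cond [leRHS]big_nat_cond ler_sum // => n /andP[/andP[yn _] _].
    have n2 : (2 <= n)%N by exact: leq_trans yn.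
    rewrite /inv_ln -[2]invrK -invfM lef_pV2 ?posrE ?mulr_gt0 ?invr_gt0 ?ln_nat_gt0 //.
    have : ln y.+1%:R <= ln n%:R :> R by rewrite ler_ln ?posrE ?ltr0n ?ler_nat //; lia.
    lra.
  rewrite sumr_const_nat -[_ *+ _]mulr_natl ler_wpM2r ?mulr_ge0 ?(ltW w0) // ler_nat; lia.
have B3 : y%:R <= 2 * (N%:R * inv_ln N).
  rewrite mulrA ler_pdivlMr //.
  have : ln y.+1%:R <= y%:R :> R.
    by have := @le_ln1Dx R y%:R; rewrite nat1r; apply; have := ler0n R y; lra.
  have : y%:R * y%:R <= N%:R :> R by rewrite -natrM ler_nat -mulnn in y1 *.
  have : 0 <= y%:R :> R by [].
  move=> p0 p1 p2; clear - R p0 p1 p2 ly.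
  set a := ln y.+1%:R in ly p2; set b := ln N%:R in ly *; nra.
case: (leqP y 1) => y3.
  have E : y = 1%N by lia.
  rewrite E in B2; rewrite (le_trans B2) // mulrCA ler_wpM2r ?mulr_ge0 ?(ltW w0) //; lra.
rewrite (@big_cat_nat _ _ _ y.+1) //=.
by move: B1 B2 B3; rewrite mulrCA; move: (N%:R * inv_ln N) => a; lra.
Qed.

(** The function [G], modelled on (ln ln x + 1)/ln x with derivative -ln ln x / (x ln^2 x), drops at
    each step by at least a quarter of the term, so the sum telescopes. *)
Lemma lnln_tail N M : (2 <= N)%N -> (N <= M)%N ->
  \sum_(N <= m < M) lnln m * (inv_ln m ^+ 2 / m%:R) <= 8 * (lnln N * inv_ln N).
Proof.
move=> N2 NM; pose G n : R := (lnln n + 1) * inv_ln n.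
have step m : (2 <= m)%N -> lnln m * (inv_ln m ^+ 2 / m%:R) <= 4 * (G m - G m.+1).
  move=> m2; have l0 := ln_nat_gt0 m2; have l1 := ln_nat_gt0 (leqW m2).
  have m0 : (0 < m)%N by lia.
  have /andP[h1 h2] := lnSn_bounds m0.
  have wh := inv_ln_half m2; have w0 := inv_ln_gt0 m2; have w1 := inv_ln_gt0 (leqW m2).
  set l := ln m%:R in l0 h1 h2; set l' := ln m.+1%:R in l1 h1 h2.
  have lam : ln (1 + l') - ln (1 + l) <= (l' - l) / l.
    rewrite -ln_div ?posrE; try lra.
    have -> : (1 + l') / (1 + l) = 1 + (l' - l) / (1 + l) by field; apply: lt0r_neq0; lra.
    have i0 : 0 <= m.+1%:R^-1 :> R by rewrite invr_ge0.
    have ll : 0 <= l' - l := le_trans i0 h1.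
    have h0 : 0 <= (l' - l) / (1 + l) by rewrite divr_ge0 // addr_ge0 // ltW.
    apply: (le_trans (le_ln1Dx _)); first by lra.
    by rewrite ler_wpM2l ?lef_pV2 ?posrE; lra.
  have E : G m - G m.+1 = ((lnln m + 1) * (l' - l) - l * (ln (1 + l') - ln (1 + l))) * (inv_ln m * inv_ln m.+1).
    rewrite /G /lnln /inv_ln -/l -/l'; move: (ln (1 + l)) (ln (1 + l')) => a b.
    by field; apply/andP; split; exact: lt0r_neq0.
  have lam2 : l * (ln (1 + l') - ln (1 + l)) <= l' - l.
    by have := ler_wpM2l (ltW l0) lam; rewrite mulrCA divff ?mulr1 // lt0r_neq0.
  have L1 := lnln_ge1 m.
  have i1 := inv_half m0.
  have i0 : 0 < m%:R^-1 :> R by rewrite invr_gt0 ltr0n.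
  rewrite E; apply: (@le_trans _ _ (4 * ((lnln m * (m%:R^-1 / 2)) * (inv_ln m * (inv_ln m / 2))))).
    by apply: eqW; field; rewrite pnatr_eq0 -lt0n.
  rewrite ler_pM2l // ler_pM ?mulr_ge0 ?(ltW w0) ?(ltW i0) //; first by lra.
    have h3 : m%:R^-1 / 2 <= l' - l by rewrite ler_pdivrMr // mulrC (le_trans i1) // ler_wpM2l.
    have L0 : 0 <= lnln m by exact: le_trans L1.
    have -> : (lnln m + 1) * (l' - l) - l * (ln (1 + l') - ln (1 + l)) =
      lnln m * (l' - l) + ((l' - l) - l * (ln (1 + l') - ln (1 + l))) by ring.
    by rewrite (le_trans (ler_wpM2l L0 h3)) // lerDl subr_ge0.
  by rewrite ler_wpM2l ?(ltW w0) //; lra.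
apply: (@le_trans _ _ (\sum_(N <= m < M) 4 * (- G m.+1 - - G m))).
  rewrite big_nat_cond [leRHS]big_nat_cond ler_sum // => m /andP[/andP[Nm _] _].
  by rewrite opprK addrC step // (leq_trans N2).
rewrite -mulr_sumr telescope_sumr //.
have GM : 0 <= G M.
  by rewrite mulr_ge0 ?(ltW (inv_ln_gt0 _)) ?(leq_trans N2) //; have := lnln_ge1 M; lra.
have : G N <= 2 * (lnln N * inv_ln N).
  by rewrite /G mulrA ler_wpM2r ?(ltW (inv_ln_gt0 N2)) //; have := lnln_ge1 N; lra.
move: GM; move: (G M) (G N) (lnln N * inv_ln N) => a b d; lra.
Qed.

Lemma lnln_inv_ln_small e : 0 < e -> exists N, forall n, (N <= n)%N -> (2 <= n)%N /\ lnln n * inv_ln n <= e.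
Proof.
move=> e0; pose B : R := expR (1 + 16 / e ^+ 2).
exists (maxn 2 (Num.truncn B).+1) => n; rewrite geq_max => /andP[n2 nB]; split => //.
have l0 := ln_nat_gt0 n2.
have hl : 1 + 16 / e ^+ 2 <= ln n%:R.
  rewrite -[leLHS]expRK ler_ln ?posrE ?expR_gt0 ?ltr0n //; last by lia.
  apply: (@le_trans _ _ (Num.truncn B).+1%:R); last by rewrite ler_nat.
  by rewrite ltW // truncnS_gt.
set l := ln n%:R in l0 hl *.
have e2 : 0 < e ^+ 2 by rewrite exprn_gt0.
have q0 : 0 < 16 / e ^+ 2 by rewrite divr_gt0.
rewrite /inv_ln -/l ler_pdivrMr //.
pose s := Num.sqrt l; have s0 : 0 < s by rewrite sqrtr_gt0.
have s2 : s ^+ 2 = l by rewrite sqr_sqrtr // ltW.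
have s1 : 1 <= s by rewrite -[1]sqrtr1 ler_wsqrtr //; lra.
have L4 : lnln n <= 4 * s.
  rewrite /lnln -/l -s2.
  have : ln (1 + s ^+ 2) <= ln ((1 + s) * (1 + s)) by rewrite ler_ln ?posrE; nra.
  rewrite lnM ?posrE; try lra.
  have : ln (1 + s) <= s by apply: le_ln1Dx; lra.
  have : ln (1 + s) <= s by apply: le_ln1Dx; lra.
  lra.
apply: (le_trans L4).
have es : 4 <= e * s.
  rewrite -(ler_pXn2r (n := 2)) ?nnegrE ?mulr_ge0 ?(ltW e0) ?(ltW s0) // exprMn s2.
  have : e ^+ 2 * (16 / e ^+ 2) <= e ^+ 2 * l by rewrite ler_wpM2l ?(ltW e2) //; lra.
  rewrite mulrCA divff ?lt0r_neq0 // mulr1; lra.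
by rewrite -s2 expr2 mulrA ler_wpM2r ?(ltW s0).
Qed.

Lemma limit_rate (u : nat -> C) (rho : nat -> R) (N0 : nat) :
  (forall n m, (N0 <= n)%N -> (n <= m)%N -> nm (u m - u n) <= rho n) ->
  (forall e, 0 < e -> exists2 N, (N0 <= N)%N & rho N <= e) ->
  exists l, forall n, (N0 <= n)%N -> nm (u n - l) <= rho n.
Proof.
move=> h hr; have [l hl] : exists l, forall e, 0 < e -> exists N, forall n, (N <= n)%N -> nm (u n - l) <= e.
  apply: cauchy_nm => e e0; have e2 : 0 < e / 2 by rewrite divr_gt0.
  have [N NN0 hN] := hr _ e2; exists N => n m nN mN.
  have a1 := h N n NN0 nN; have a2 := h N m NN0 mN.
  have -> : u n - u m = (u n - u N) - (u m - u N) by ring.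
  by rewrite (le_trans (nmB _ _)) //; lra.
exists l => n nN; apply/ler_addgt0Pr => e e0; have [N hN] := hl e e0.
have a1 := hN (maxn n N) (leq_maxr _ _); have a2 := h n (maxn n N) nN (leq_maxl _ _).
have -> : u n - l = (u (maxn n N) - l) - (u (maxn n N) - u n) by ring.
by rewrite (le_trans (nmB _ _)) //; lra.
Qed.

Lemma abel_summation (S h : nat -> C) a N : (a <= N)%N ->
  \sum_(a <= n < N) (S n.+1 - S n) * h n = S N * h N - S a * h a - \sum_(a <= n < N) S n.+1 * (h n.+1 - h n).
Proof.
move=> aN; rewrite -(telescope_sumr (fun n => S n * h n) aN) -sumrB.
by apply: eq_bigr => n _; ring.
Qed.

Variable b : nat -> C.
Definition sum1 (n : nat) : C := \sum_(2 <= k < n) b k.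
Definition sum2 (N : nat) : C := \sum_(2 <= n < N.+1) sum1 n.

Lemma sum2S N : (1 <= N)%N -> sum2 N.+1 = sum2 N + sum1 N.+1.
Proof. by move=> N1; rewrite /sum2 big_nat_recr. Qed.

(** Summing twice produces the Fejer weight: sum2 N is N times the sum of b k (1 - k/N). This is why
    the weighted sums are the natural input for partial summation here. *)
Lemma sum2E N : sum2 N = \sum_(2 <= k < N) b k * cR (N%:R - k%:R).
Proof.
elim: N => [|N IH]; first by rewrite /sum2 !big_geq.
case: (leqP N 1) => N1.
  rewrite [RHS]big_geq // /sum2; case: N N1 {IH} => [|[|//]] _; first by rewrite big_geq.
  by rewrite big_nat1 /sum1 big_geq.
rewrite sum2S; last exact: ltnW.
rewrite IH /sum1 [X in _ + X = _]big_nat_recr //= [RHS]big_nat_recr //=.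
rewrite addrA -big_split /=; congr (_ + _).
  apply: eq_bigr => k _; have -> : N.+1%:R - k%:R = (N%:R - k%:R) + 1 :> R by rewrite -natr1; ring.
  by rewrite [cR (_ + 1)]cRD mulrDr mulr1.
have -> : N.+1%:R - N%:R = 1 :> R by rewrite -natr1; ring.
by rewrite cR1 mulr1.
Qed.

Definition D2 (m : nat) : R := inv_ln m.-1 - 2 * inv_ln m + inv_ln m.+1.
Definition D1 (m : nat) : R := inv_ln m.-1 - inv_ln m.+1.

(** Two Abel summations against h(n) = (N - n)/ln n, whose second difference at m is (N - m) D2 m +
    D1 m. Since h vanishes at N, the only boundary term is -h(N + 1) = 1/ln(N + 1). *)
Lemma second_abel N : (2 <= N)%N ->
  \sum_(2 <= n < N) b n * cR (inv_ln n * (N%:R - n%:R)) = sum2 N * cR (inv_ln N.+1) +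
  \sum_(3 <= m < N.+1) sum2 m * cR ((N%:R - m%:R) * D2 m + D1 m).
Proof.
move=> N2; pose h n : C := cR (inv_ln n * (N%:R - n%:R)).
have -> : \sum_(2 <= n < N) b n * cR (inv_ln n * (N%:R - n%:R)) = \sum_(2 <= n < N) (sum1 n.+1 - sum1 n) * h n.
  rewrite big_nat_cond [RHS]big_nat_cond; apply: eq_bigr => n /andP[/andP[n2 _] _].
  by rewrite /sum1 big_nat_recr //= addrAC subrr add0r.
rewrite (abel_summation _ _ N2) {1}/h subrr mulr0 cR0 mulr0 {1}/sum1 big_geq // mul0r subrr sub0r -sumrN.
pose e n : C := h n - h n.+1.
have -> : \sum_(2 <= n < N) - (sum1 n.+1 * (h n.+1 - h n)) = \sum_(2 <= n < N) (sum2 n.+1 - sum2 n) * e n.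
  rewrite big_nat_cond [RHS]big_nat_cond; apply: eq_bigr => n /andP[/andP[n2 _] _].
  have -> : sum2 n.+1 - sum2 n = sum1 n.+1 by rewrite sum2S ?(ltnW n2) // addrAC subrr add0r.
  by rewrite /e; ring.
rewrite (abel_summation _ _ N2).
have U22 : sum2 2 = 0 by rewrite /sum2 big_nat1 /sum1 big_geq.
rewrite U22 mul0r subr0; congr (_ + _).
  rewrite /e /h subrr mulr0 cR0 sub0r -cRN -natr1 opprD addrA subrr add0r mulrN opprK mulr1 //.
rewrite -sumrN [RHS]big_add1 /= big_nat_cond [RHS]big_nat_cond; apply: eq_bigr => n _.
rewrite -mulrN; congr (_ * _); rewrite /e /h /D2 /D1 /= -!cRB -cRN; congr cR.
by rewrite -(@natr1 _ n.+1) -(@natr1 _ n); ring.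
Qed.

Variable K : R.
Hypothesis K0 : 0 <= K.
Hypothesis hU : forall N, (2 <= N)%N -> nm (sum2 N) <= K * (N%:R * lnln N).

(** The constant is the full series of sum2 m * D2 m, which converges since sum2 m is O(m lnln m)
    and D2 m is O(1/(m ln m)^2); its tail is [lnln_tail]. The remaining terms D1 m - m D2 m carry a
    factor 1/N and average out to the same size by [inv_ln_sum]. *)
Lemma inv_ln_weighted_asymp : exists c, exists2 K' : R, 0 <= K' & forall N, (2 <= N)%N ->
  nm (\sum_(2 <= n < N) b n * cR (inv_ln n * (1 - n%:R / N%:R)) - c) <= K' * (lnln N * inv_ln N).
Proof.
have D2b m : (3 <= m)%N -> `|D2 m| <= 26 * (inv_ln m ^+ 2 / m%:R ^+ 2).
  by case: m => // m m3; exact: inv_ln_D2.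
have D1b m : (3 <= m)%N -> `|D1 m| <= 9 * (inv_ln m ^+ 2 / m%:R).
  by case: m => // m m3; have /andP[a1 a2] := inv_ln_D1 m3; rewrite ger0_norm.
have LLw0 n : (2 <= n)%N -> 0 <= lnln n * inv_ln n.
  by move=> n2; rewrite mulr_ge0 ?(ltW (inv_ln_gt0 n2)) //; have := lnln_ge1 n; lra.
have K26 : 0 <= K * 26 by rewrite mulr_ge0.
have UD m : (3 <= m)%N -> nm (sum2 m * cR (D2 m)) <= K * 26 * (lnln m * (inv_ln m ^+ 2 / m%:R)).
  move=> m3; rewrite nmM nm_cR; apply: (@le_trans _ _ (K * (m%:R * lnln m) * (26 * (inv_ln m ^+ 2 / m%:R ^+ 2)))).
    by rewrite ler_pM ?nm_ge0 ?D2b ?hU // ltnW.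
  by apply: eqW; field; rewrite pnatr_eq0; lia.
pose Rm M : C := \sum_(3 <= m < M) sum2 m * cR (D2 m).
have [l hl] : exists l, forall n, (3 <= n)%N -> nm (Rm n - l) <= K * 26 * (8 * (lnln n * inv_ln n)).
  apply: limit_rate => [n m n3 nm'|e e0].
    rewrite /Rm (@big_cat_nat _ _ _ n) //= addrAC subrr add0r (le_trans (nm_sum _ _ _)) //.
    apply: (@le_trans _ _ (\sum_(n <= k < m) K * 26 * (lnln k * (inv_ln k ^+ 2 / k%:R)))).
      by rewrite big_nat_cond [leRHS]big_nat_cond ler_sum // => k /andP[/andP[nk _] _]; rewrite UD // (leq_trans n3).
    by rewrite -mulr_sumr ler_wpM2l // lnln_tail // ltnW.
  have KK : 0 < 1 + K * 26 * 8 by rewrite ltr_pwDl // mulr_ge0.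
  have [N hN] := lnln_inv_ln_small (divr_gt0 e0 KK).
  exists (maxn 3 N); first exact: leq_maxl.
  have [n2 hN'] := hN (maxn 3 N) (leq_maxr _ _).
  rewrite mulrA (le_trans (ler_wpM2l _ hN')) ?mulr_ge0 //.
  by rewrite mulrCA ger_pMr // ler_pdivrMr // mul1r lerDr.
exists l; exists (K + K * 26 * 32 + K * 35 * 12); first by rewrite !addr_ge0 // !mulr_ge0.
move=> N N2; have N0 : 0 < N%:R :> R by rewrite ltr0n; lia.
have LN0 := LLw0 N N2.
have N3 : (3 <= N.+1)%N by [].
have L1 := lnln_ge1 N; have w0 := inv_ln_gt0 N2; have w1 := inv_ln_gt0 (leqW N2).
have wS : inv_ln N.+1 <= inv_ln N by exact: inv_ln_mono.
have E : \sum_(2 <= n < N) b n * cR (inv_ln n * (1 - n%:R / N%:R)) - l =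
   sum2 N * cR (inv_ln N.+1 / N%:R) + (Rm N.+1 - l) +
   \sum_(3 <= m < N.+1) sum2 m * cR ((D1 m - m%:R * D2 m) / N%:R).
  have -> : \sum_(2 <= n < N) b n * cR (inv_ln n * (1 - n%:R / N%:R)) =
     cR N%:R^-1 * \sum_(2 <= n < N) b n * cR (inv_ln n * (N%:R - n%:R)).
    rewrite mulr_sumr; apply: eq_bigr => n _; rewrite mulrCA -cRM; congr (_ * cR _).
    by field; exact: lt0r_neq0.
  rewrite second_abel // mulrDr mulr_sumr.
  have -> : \sum_(3 <= m < N.+1) cR N%:R^-1 * (sum2 m * cR ((N%:R - m%:R) * D2 m + D1 m)) =
    Rm N.+1 + \sum_(3 <= m < N.+1) sum2 m * cR ((D1 m - m%:R * D2 m) / N%:R).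
    rewrite /Rm -big_split; apply: eq_bigr => m _ /=.
    rewrite mulrCA -cRM -mulrDr -cRD; congr (_ * cR _); by field; exact: lt0r_neq0.
  by rewrite mulrCA -cRM (mulrC N%:R^-1); ring.
rewrite E (le_trans (nmD _ _)) // (le_trans (lerD (nmD _ _) (lexx _))) //.
have T1 : nm (sum2 N * cR (inv_ln N.+1 / N%:R)) <= K * (lnln N * inv_ln N).
  rewrite nmM nm_cR ger0_norm ?divr_ge0 ?(ltW w1) //.
  apply: (@le_trans _ _ (K * (N%:R * lnln N) * (inv_ln N / N%:R))).
    by rewrite ler_pM ?nm_ge0 ?divr_ge0 ?(ltW w1) ?hU // ler_wpM2r ?invr_ge0 ?(ltW N0).
  by apply: eqW; field; exact: lt0r_neq0.
have T2 : nm (Rm N.+1 - l) <= K * 26 * 32 * (lnln N * inv_ln N).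
  rewrite (le_trans (hl _ N3)) // -[K * 26 * 32 * _]mulrA ler_wpM2l //.
  have : lnln N.+1 * inv_ln N.+1 <= 2 * lnln N * inv_ln N.
    by rewrite ler_pM ?(ltW w1) ?lnln_S //; have := lnln_ge1 N.+1; lra.
  have -> : 32 * (lnln N * inv_ln N) = 8 * (4 * (lnln N * inv_ln N)) by ring.
  by rewrite ler_pM2l // -mulrA; move: LN0; move: (lnln N * inv_ln N) (lnln N.+1 * _) => x y; lra.
have T3 : nm (\sum_(3 <= m < N.+1) sum2 m * cR ((D1 m - m%:R * D2 m) / N%:R)) <= K * 35 * 12 * (lnln N * inv_ln N).
  apply: (@le_trans _ _ (\sum_(3 <= m < N.+1) K * 35 * lnln N * (2 * inv_ln m) / N%:R)).
    rewrite (le_trans (nm_sum _ _ _)) // big_nat_cond [leRHS]big_nat_cond ler_sum // => m /andP[/andP[m3 mN] _].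
    have m2 : (2 <= m)%N by exact: ltnW.
    have M0 : 0 < m%:R :> R by rewrite ltr0n (ltn_trans _ m2).
    have wm := inv_ln_gt0 m2; have wm2 := inv_ln_le2 m2.
    have -> : nm (sum2 m * cR ((D1 m - m%:R * D2 m) / N%:R)) = nm (sum2 m) * `|D1 m - m%:R * D2 m| / N%:R.
      by rewrite nmM nm_cR normrM normfV (ger0_norm (ltW N0)) -mulrA.
    rewrite ler_wpM2r ?invr_ge0 ?(ltW N0) //.
    have B : `|D1 m - m%:R * D2 m| <= 35 * (inv_ln m ^+ 2 / m%:R).
      rewrite (le_trans (ler_normB _ _)) // normrM (ger0_norm (ltW M0)).
      have := ler_wpM2l (ltW M0) (D2b m m3).
      have -> : m%:R * (26 * (inv_ln m ^+ 2 / m%:R ^+ 2)) = 26 * (inv_ln m ^+ 2 / m%:R) by field; exact: lt0r_neq0.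
      by have := D1b m m3; move: (inv_ln m ^+ 2 / m%:R) (`|D1 m|) (m%:R * `|D2 m|) => x y z; lra.
    apply: (@le_trans _ _ (K * (m%:R * lnln m) * (35 * (inv_ln m ^+ 2 / m%:R)))).
      by rewrite ler_pM ?nm_ge0 // hU.
    have -> : K * (m%:R * lnln m) * (35 * (inv_ln m ^+ 2 / m%:R)) = K * 35 * lnln m * inv_ln m ^+ 2.
      by field; exact: lt0r_neq0.
    have Lm := lnln_ge1 m.
    rewrite ler_pM ?sqr_ge0 ?mulr_ge0 //; try by clear - R b K K0 hU Lm; lra.
      by rewrite ler_wpM2l ?mulr_ge0 // lnln_mono // ltnW.
    by rewrite expr2 ler_wpM2r // ltW.
  rewrite -mulr_suml -mulr_sumr -mulr_sumr ler_pdivrMr //.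
  have S2 : \sum_(3 <= m < N.+1) inv_ln m <= 6 * (N%:R * inv_ln N).
    apply: le_trans (inv_ln_sum N2); rewrite [leRHS]big_ltn //.
    by rewrite lerDr ltW // inv_ln_gt0.
  have KL : 0 <= K * 35 * lnln N by rewrite !mulr_ge0 //; lra.
  rewrite (le_trans (ler_wpM2l KL (ler_wpM2l _ S2))) //.
  by apply: eqW; ring.
rewrite (mulrDl (K + K * 26 * 32)) (mulrDl K) !lerD //.
Qed.

End AbelSummation.

(** * Fejer-weighted sums of 1/(n ln n) *)

Section LogLog.
Variable R : realType.
Local Notation C := (Cx R).
Local Notation inv_ln := (@inv_ln R).

(** The defect r n between 1/(n ln n) and the increment of ln ln is nonnegative and bounded by a
    telescoping difference, so its sum converges with rate 1/(N ln N). The Fejer correction is the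
    mean of 1/ln n, which is O(1/ln N). *)
Lemma loglog_sum : exists c : C, forall N, (2 <= N)%N ->
  nm (cR (\sum_(2 <= n < N) inv_ln n / n%:R * (1 - n%:R / N%:R)) - (cR (ln (ln N%:R)) + c)) <= 8 * inv_ln N.
Proof.
have wn n : (2 <= n)%N -> [/\ (0 : R) < n%:R, 0 < ln n%:R :> R, 0 < inv_ln n & inv_ln n / n%:R <= inv_ln n].
  move=> n2; have n0 : (0 : R) < n%:R by rewrite ltr0n; lia.
  split => //; rewrite ?ln_nat_gt0 ?inv_ln_gt0 // ler_pdivrMr // ler_peMr ?(ltW (inv_ln_gt0 _ _)) //.
  by rewrite ler1n; lia.
pose r n : R := inv_ln n / n%:R - (ln (ln n.+1%:R) - ln (ln n%:R)).
have rb n : (2 <= n)%N -> 0 <= r n <= inv_ln n / n%:R - inv_ln n.+1 / n.+1%:R.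
  move=> n2; have [n0 l0 w0 _] := wn n n2; have [n0' l1 w1 _] := wn n.+1 (leqW n2).
  have /andP[h1 h2] := @lnSn_bounds R n ltac:(lia).
  have E : ln (ln n.+1%:R) - ln (ln n%:R) = ln (ln n.+1%:R / ln n%:R) :> R by rewrite ln_div ?posrE.
  set l := ln n%:R in l0 h1 h2 E; set l' := ln n.+1%:R in l1 h1 h2 E.
  have i0 : 0 <= n.+1%:R^-1 :> R by rewrite invr_ge0.
  have ll : 0 <= l' - l := le_trans i0 h1.
  have x0 : 0 <= (l' - l) / l by rewrite divr_ge0 // ltW.
  have E2 : l' / l = 1 + (l' - l) / l by field; exact: lt0r_neq0.
  have u1 : ln (l' / l) <= inv_ln n / n%:R.
    rewrite E2 (le_trans (le_ln1Dx _)) //; first by lra.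
    by rewrite mulrC ler_wpM2l ?(ltW w0).
  have u2 : inv_ln n.+1 / n.+1%:R <= ln (l' / l).
    rewrite E2 (le_trans _ (ln1_ge x0)) //.
    have -> : (l' - l) / l / (1 + (l' - l) / l) = l'^-1 * (l' - l).
      by field; apply/andP; split; apply: lt0r_neq0; lra.
    by rewrite ler_wpM2l ?(ltW w1).
  rewrite /r E; move: u1 u2; move: (ln (l' / l)) (inv_ln n / _) (inv_ln n.+1 / _) => x1 x2 x3 u1 u2.
  by rewrite subr_ge0 u1 /=; rewrite lerD2l lerN2.
have [l hl] : exists l : C, forall n, (2 <= n)%N -> nm ((\sum_(2 <= k < n) cR (r k)) - l) <= inv_ln n / n%:R.
  apply: limit_rate => [n m n2 nm'|e e0].
    rewrite (@big_cat_nat _ _ _ n) //= addrAC subrr add0r (le_trans (nm_sum _ _ _)) //.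
    apply: (@le_trans _ _ (\sum_(n <= k < m) (- (inv_ln k.+1 / k.+1%:R) - - (inv_ln k / k%:R)))).
      rewrite big_nat_cond [leRHS]big_nat_cond ler_sum // => k /andP[/andP[nk _] _].
      have /andP[a1 a2] := rb k (leq_trans n2 nk).
      by rewrite nm_cR ger0_norm // opprK addrC.
    rewrite (telescope_sumr (fun k => - (inv_ln k / k%:R))) //.
    have [m0 _ wm _] := wn m (leq_trans n2 nm').
    have : 0 <= inv_ln m / m%:R by rewrite divr_ge0 // ltW.
    by move: (inv_ln m / _) (inv_ln n / _) => x y; lra.
  have [N hN] := lnln_inv_ln_small e0; have [N2 h] := hN _ (leqnn N).
  exists N => //; have [_ _ w0 h2] := wn N N2; rewrite (le_trans h2) // (le_trans _ h) //.
  by rewrite ler_peMl ?(ltW w0) // lnln_ge1.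
exists (l - cR (ln (ln 2%:R))) => N N2; have [N0 l0 w0 w1] := wn N N2.
have S1 : \sum_(2 <= n < N) inv_ln n / n%:R * (1 - n%:R / N%:R) =
   \sum_(2 <= n < N) r n + (ln (ln N%:R) - ln (ln 2%:R)) - (\sum_(2 <= n < N) inv_ln n) / N%:R.
  rewrite -(telescope_sumr (fun n => ln (ln n%:R)) N2) -big_split /= mulr_suml -sumrB.
  rewrite big_nat_cond [RHS]big_nat_cond; apply: eq_bigr => n /andP[/andP[n2 _] _].
  have [n0 _ _ _] := wn n n2; rewrite /r; field.
  by apply/andP; split; exact: lt0r_neq0.
have -> : cR (\sum_(2 <= n < N) inv_ln n / n%:R * (1 - n%:R / N%:R)) - (cR (ln (ln N%:R)) + (l - cR (ln (ln 2%:R)))) =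
  (\sum_(2 <= k < N) cR (r k) - l) - cR ((\sum_(2 <= n < N) inv_ln n) / N%:R) :> C.
  by rewrite S1 cRB cRD cRB cR_sum; ring.
rewrite (le_trans (nmB _ _)) // nm_cR.
have S2 : \sum_(2 <= n < N) inv_ln n <= 6 * (N%:R * inv_ln N).
  by apply: le_trans (inv_ln_sum _ N2); rewrite [leRHS]big_nat_recr //= lerDl ltW.
have S0 : 0 <= \sum_(2 <= n < N) inv_ln n.
  by rewrite big_nat_cond sumr_ge0 // => n /andP[/andP[n2 _] _]; have [_ _ /ltW] := wn n n2.
rewrite ger0_norm ?divr_ge0 ?(ltW N0) //.
have : (\sum_(2 <= n < N) inv_ln n) / N%:R <= 6 * inv_ln N.
  by rewrite ler_pdivrMr // (le_trans S2) //; apply: eqW; ring.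
have := hl N N2; lra.
Qed.

End LogLog.

(** * The averaged difference *)

Section Final.
Variable R : realType.
Local Notation C := (Cx R).
Variables (q a b : nat) (Mc : C) (K0 : R).
Local Notation inv_ln := (@inv_ln R).
Local Notation lnln := (@lnln R).
Local Notation class_diff := (@class_diff R q a b).

Hypothesis K00 : 0 <= K0.
Hypothesis hPF : forall N, (3 < N)%N -> nm (prime_diff_sum R q a b N + Mc * cR (ln N%:R)) <= K0 * (1 + ln (1 + ln N%:R)).

Definition harm (N : nat) : R := \sum_(2 <= k < N) k%:R^-1 * (1 - k%:R / N%:R).

(** The weight removes (N - 2)/N <= 1 from a harmonic sum that lies between ln N - ln 2 and ln N. *)
Lemma harm_bound N : (2 <= N)%N -> `|harm N - ln N%:R| <= 2.
Proof.
move=> N2; have N0 : 0 < N%:R :> R by rewrite ltr0n ltnW.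
have E : harm N = \sum_(2 <= k < N) k%:R^-1 - (N - 2)%:R / N%:R.
  have -> : (N - 2)%:R / N%:R = \sum_(2 <= k < N) (N%:R)^-1 :> R by rewrite sumr_const_nat mulr_natl.
  rewrite /harm -sumrB big_nat_cond [RHS]big_nat_cond; apply: eq_bigr => k /andP[/andP[k2 _] _].
  have k0 : k%:R != 0 :> R by rewrite pnatr_eq0 -lt0n ltnW.
  by field; rewrite k0 lt0r_neq0.
have F0 : 0 <= (N - 2)%:R / N%:R :> R by rewrite divr_ge0 // ltW.
have F1 : (N - 2)%:R / N%:R <= 1 :> R by rewrite ler_pdivrMr // mul1r ler_nat leq_subr.
have lo : ln N%:R - ln 2 <= \sum_(2 <= k < N) (k%:R : R)^-1.
  rewrite -(telescope_sumr (fun k => ln k%:R) N2) big_nat_cond [leRHS]big_nat_cond ler_sum // => k /andP[/andP[k2 _] _].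
  by have /andP[_] := @lnSn_bounds R k (ltnW k2).
have up : \sum_(2 <= k < N) (k%:R : R)^-1 <= ln N%:R.
  case: N N2 {N0 E F0 F1 lo} => // N N1.
  rewrite big_add1 /=; apply: (@le_trans _ _ (\sum_(1 <= k < N) (ln k.+1%:R - ln k%:R))).
    rewrite big_nat_cond [leRHS]big_nat_cond ler_sum // => k /andP[/andP[k2 _] _].
    by have /andP[] := @lnSn_bounds R k k2.
  by rewrite telescope_sumr // ln1 subr0 ler_ln ?posrE ?ltr0n // ler_nat.
have l2 := ln2_le1 R.
move: E F0 F1 lo up l2; move: (harm N) (\sum_(_ <= _ < _) _) (_ / _) (ln N%:R) (ln 2) => x1 x2 x3 x4 x5.
by move=> E F0 F1 lo up l2; clear - R E F0 F1 lo up l2; rewrite ler_norml; apply/andP; split; lra.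
Qed.

(* Adding M/k cancels the main term -M ln N, so that the twice-summed sequence is O(N ln ln N). *)
Definition shifted_coef (k : nat) : C :=
  (if prime k then cR (ln k%:R * tpow 2^-1 k * class_diff k) else 0) + Mc * cR k%:R^-1.

Lemma sum2_prime_diff N : (2 <= N)%N -> sum2 shifted_coef N = cR N%:R * (prime_diff_sum R q a b N + Mc * cR (harm N)).
Proof.
move=> N2; have N0 : N%:R != 0 :> R by rewrite pnatr_eq0 -lt0n ltnW.
rewrite sum2E /shifted_coef mulrDr; under eq_bigr do rewrite mulrDl; rewrite big_split /=; congr (_ + _).
  have -> : prime_diff_sum R q a b N = \sum_(2 <= p < N)
      (if prime p then cR (ln p%:R * (tpow 2^-1 p * (1 - p%:R / N%:R)) * class_diff p) else 0).
    rewrite /prime_diff_sum big_mkcond /= big_nat_recr //= big_ltn ?(ltnW N2) // big_ltn //=.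
    by rewrite !add0r divff // subrr !mulr0 mul0r cR0 if_same addr0.
  rewrite mulr_sumr.
  apply: eq_bigr => k _; case: ifP => _; last by rewrite mul0r mulr0.
  by rewrite -!cRM; congr cR; field.
have ki (z y : R) : z * (N%:R - y) = N%:R * (z * (1 - y / N%:R)) by field.
by rewrite /harm cR_sum mulrCA !mulr_sumr; apply: eq_bigr => k _; rewrite -mulrA -!cRM ki.
Qed.

Lemma sum2_bound : exists2 K : R, 0 <= K & forall N, (2 <= N)%N -> nm (sum2 shifted_coef N) <= K * (N%:R * lnln N).
Proof.
pose K2 := nm (sum2 shifted_coef 2) + nm (sum2 shifted_coef 3).
have K20 : 0 <= K2 by rewrite addr_ge0 ?nm_ge0.
have M0 := nm_ge0 Mc.
exists (K0 + nm Mc * 2 + K2); first by apply: addr_ge0 => //; apply: addr_ge0 => //; exact: mulr_ge0.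
move=> N N2; have L1 := lnln_ge1 R N; have n1 : 1 <= N%:R :> R by rewrite ler1n ltnW.
have NL : 1 <= N%:R * lnln N by rewrite (le_trans n1) // ler_peMr.
(* The hypothesis [hPF] starts at 4; the two values left, 2 and 3, go into the constant [K2]. *)
case: (ltnP 3 N) => N3; last first.
  apply: (@le_trans _ _ K2).
    have /orP[/eqP->|/eqP->] : (N == 2%N) || (N == 3%N) by lia.
      by rewrite lerDl nm_ge0.
    by rewrite lerDr nm_ge0.
  by rewrite -[leLHS]mulr1 ler_pM // lerDr addr_ge0 // mulr_ge0.
rewrite sum2_prime_diff // nmM nm_cR ger0_norm // [leRHS]mulrCA ler_wpM2l //.
have -> : prime_diff_sum R q a b N + Mc * cR (harm N) = (prime_diff_sum R q a b N + Mc * cR (ln N%:R)) + Mc * cR (harm N - ln N%:R).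
  by rewrite cRB; ring.
rewrite (le_trans (nmD _ _)) // nmM nm_cR.
have h1 := hPF N3; have h2 := ler_wpM2l M0 (harm_bound N2).
have h3 : nm Mc * 2 <= nm Mc * 2 * lnln N by rewrite ler_peMr // mulr_ge0.
have h4 : 0 <= K2 * lnln N by rewrite mulr_ge0 // (le_trans ler01).
rewrite [leRHS]mulrDl [in leRHS](mulrDl K0).
apply: (@le_trans _ _ (K0 * lnln N + nm Mc * 2 * lnln N)); last by rewrite lerDl.
by rewrite lerD // (le_trans h2).
Qed.

Definition prime_avg (N : nat) : R := \sum_(2 <= n < N | prime n) tpow 2^-1 n * class_diff n * (1 - n%:R / N%:R).

(** Dividing the shifted coefficients by ln n restores the weight p^(-1/2) and leaves Mc/(n ln n);
    subtracting the latter by [loglog_sum] produces the main term with its sign. *)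
Lemma prime_avg_asymp : exists c : C, exists2 K : R, 0 <= K & forall N, (2 <= N)%N ->
  nm (cR (prime_avg N) - (- Mc * cR (ln (ln N%:R)) + c)) <= K * (lnln N * inv_ln N).
Proof.
have [K1 K10 hU] := sum2_bound; have [c1 [K2 K20 h1]] := inv_ln_weighted_asymp K10 hU.
have [c2 h2] := loglog_sum R; have M0 := nm_ge0 Mc.
exists (c1 - Mc * c2); exists (K2 + nm Mc * 8); first by rewrite addr_ge0 // mulr_ge0.
move=> N N2; have w0 := inv_ln_gt0 R N2.
have E : \sum_(2 <= n < N) shifted_coef n * cR (inv_ln n * (1 - n%:R / N%:R)) =
   cR (prime_avg N) + Mc * cR (\sum_(2 <= n < N) inv_ln n / n%:R * (1 - n%:R / N%:R)).
  have -> : prime_avg N = \sum_(2 <= n < N) (if prime n then tpow 2^-1 n * class_diff n * (1 - n%:R / N%:R) else 0).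
    by rewrite /prime_avg big_mkcond.
  rewrite !cR_sum mulr_sumr -big_split /= big_nat_cond [RHS]big_nat_cond.
  apply: eq_bigr => n /andP[/andP[n2 _] _]; rewrite /shifted_coef mulrDl; congr (_ + _).
    case: ifP => _; last by rewrite mul0r cR0.
    rewrite -cRM; congr cR; move: (1 - _) => t; rewrite /inv_ln; field.
    by apply: lt0r_neq0; exact: ln_nat_gt0.
  by rewrite -mulrA -cRM; congr (_ * cR _); ring.
have -> : cR (prime_avg N) - (- Mc * cR (ln (ln N%:R)) + (c1 - Mc * c2)) =
  (\sum_(2 <= n < N) shifted_coef n * cR (inv_ln n * (1 - n%:R / N%:R)) - c1) -
  Mc * (cR (\sum_(2 <= n < N) inv_ln n / n%:R * (1 - n%:R / N%:R)) - (cR (ln (ln N%:R)) + c2)).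
  by rewrite E; ring.
rewrite (le_trans (nmB _ _)) // nmM mulrDl lerD ?h1 //.
rewrite -mulrA ler_wpM2l // (le_trans (h2 N N2)) // ler_wpM2l //.
by rewrite ler_peMl ?(ltW w0) // lnln_ge1.
Qed.

Definition fejer_prime_sum (x : R) : R := \sum_(2 <= n < (Num.truncn x).+1 | prime n) tpow 2^-1 n * class_diff n * (1 - n%:R / x).

(* x * fejer_prime_sum x is affine in x between consecutive integers. *)
Lemma fejer_prime_sum_convex (x : R) : 2 <= x -> let N := Num.truncn x in exists l m : R,
  [/\ 0 <= l, 0 <= m, l + m = 1 & fejer_prime_sum x = l * prime_avg N + m * prime_avg N.+1].
Proof.
move=> x2 N; have x0 : 0 < x by apply: lt_le_trans x2.
have /andP[N1 N2] : N%:R <= x < N.+1%:R by apply: truncn_itv; exact: ltW.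
have n2 : (2 <= N)%N by rewrite -ltnS -(ltr_nat R) (le_lt_trans x2).
have n0 : 0 < N%:R :> R by rewrite ltr0n ltnW.
have n1 : 0 < N.+1%:R :> R by rewrite ltr0n.
pose t := x - N%:R.
have t0 : 0 <= t by rewrite subr_ge0.
have t1 : 0 <= 1 - t by rewrite /t; move: N2; rewrite -natr1; lra.
exists ((1 - t) * N%:R / x), (t * N.+1%:R / x); split.
- by apply: divr_ge0; [apply: mulr_ge0|exact: ltW].
- by apply: divr_ge0; [apply: mulr_ge0|exact: ltW].
- by rewrite /t -natr1; field; exact: lt0r_neq0.
have EN : prime_avg N = \sum_(2 <= n < N.+1 | prime n) tpow 2^-1 n * class_diff n * (1 - n%:R / N%:R).
  rewrite /prime_avg big_mkcond [RHS]big_mkcond [RHS]big_nat_recr //= divff ?subrr ?mulr0 ?if_same ?addr0 //.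
  exact: lt0r_neq0.
rewrite EN /prime_avg /fejer_prime_sum -/N !mulr_sumr -big_split /=; apply: eq_bigr => n _.
rewrite /t -natr1; field.
by rewrite nat1r !lt0r_neq0.
Qed.

Lemma lnln_step_bounds (x : R) N : (2 <= N)%N -> N%:R <= x -> x <= N.+1%:R ->
  [/\ 0 <= ln (ln x) - ln (ln (N%:R : R)), 0 <= ln (ln (N.+1%:R : R)) - ln (ln x) &
      ln (ln (N.+1%:R : R)) - ln (ln (N%:R : R)) <= inv_ln N].
Proof.
move=> N2 h1 h2; have l0 := ln_nat_gt0 R N2; have l1 := ln_nat_gt0 R (leqW N2).
have N0 : 0 < N%:R :> R by rewrite ltr0n ltnW.
have x0 : 0 < x by exact: lt_le_trans h1.
have lx : ln N%:R <= ln x by rewrite ler_ln ?posrE.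
have lx' : ln x <= ln N.+1%:R by rewrite ler_ln ?posrE // (lt_le_trans x0).
have lx0 : 0 < ln x by exact: lt_le_trans lx.
rewrite !subr_ge0 !ler_ln ?posrE //; split=> //.
rewrite -ln_div ?posrE //.
have -> : ln N.+1%:R / ln N%:R = 1 + (ln N.+1%:R - ln N%:R) / ln N%:R :> R by field; exact: lt0r_neq0.
have /andP[_ b2] := @lnSn_bounds R N (ltnW N2).
have c0 : 0 <= (ln N.+1%:R - ln N%:R) / ln N%:R :> R.
  by rewrite divr_ge0 ?(ltW l0) // subr_ge0 (le_trans lx).
apply: (le_trans (le_ln1Dx _)); first by apply: lt_le_trans c0; rewrite oppr_lt0.
rewrite -[leRHS]mul1r ler_wpM2r ?(ltW (inv_ln_gt0 R N2)) // (le_trans b2) // invf_le1 // ler1n.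
exact: ltnW.
Qed.

(** Interpolation between N and N + 1: ln ln varies by at most 1/ln N there, which is within the
    error. From e^e on one has ln ln x >= 1, so that [lnln N] is at most 3 ln ln x. *)
Lemma fejer_prime_sum_asymp : exists c : C, exists2 K : R, 0 <= K & forall x, expR (expR 1) <= x ->
  nm (cR (fejer_prime_sum x) - (- Mc * cR (ln (ln x)) + c)) <= K * (ln (ln x) / ln x).
Proof.
have [c [K K1 h]] := prime_avg_asymp; have M0 := nm_ge0 Mc.
exists c; exists (6 * (2 * K + nm Mc)); first by rewrite mulr_ge0 // addr_ge0 // mulr_ge0.
move=> x hx.
have e2 : (2 : R) <= expR 1 by have := @expR_ge1Dx R 1.
have e3 : (2 : R) <= expR (expR 1) by have := @expR_ge1Dx R (expR 1); lra.
have x2 : 2 <= x by exact: le_trans hx.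
have x0 : 0 < x by exact: lt_le_trans x2.
have [l [m [l0 m0 lm E]]] := fejer_prime_sum_convex x2.
set N := Num.truncn x in E.
have /andP[N1 N2] : N%:R <= x < N.+1%:R by apply: truncn_itv; exact: ltW.
have n2 : (2 <= N)%N by rewrite -ltnS -(ltr_nat R) (le_lt_trans x2).
have [d0 d1 d2] := lnln_step_bounds n2 N1 (ltW N2).
have w0 := inv_ln_gt0 R n2; have L1 := lnln_ge1 R N.
have lx : expR 1 <= ln x by rewrite -[leLHS]expRK ler_ln ?posrE ?expR_gt0.
have lx0 : 0 < ln x by apply: lt_le_trans lx; exact: expR_gt0.
have llx : 1 <= ln (ln x) by rewrite -[leLHS]expRK ler_ln ?posrE ?expR_gt0.
have B1 := h N n2; have B2 := h N.+1 (leqW n2).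
have LW : lnln N.+1 * inv_ln N.+1 <= 2 * (lnln N * inv_ln N).
  rewrite mulrA ler_pM ?lnln_S ?inv_ln_mono ?(ltW (inv_ln_gt0 R (leqW n2))) //.
  by rewrite (le_trans ler01) // lnln_ge1.
have Lw0 : 0 <= lnln N * inv_ln N by rewrite mulr_ge0 ?(ltW w0) // (le_trans ler01).
have main : nm (cR (fejer_prime_sum x) - (- Mc * cR (ln (ln x)) + c)) <= (2 * K + nm Mc) * (lnln N * inv_ln N).
  rewrite E; have -> : cR (l * prime_avg N + m * prime_avg N.+1) - (- Mc * cR (ln (ln x)) + c) =
    cR l * (cR (prime_avg N) - (- Mc * cR (ln (ln N%:R)) + c)) +
    cR m * (cR (prime_avg N.+1) - (- Mc * cR (ln (ln N.+1%:R)) + c)) +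
    Mc * cR (l * (ln (ln x) - ln (ln N%:R)) - m * (ln (ln N.+1%:R) - ln (ln x))).
    have -> : m = 1 - l by rewrite -lm addrAC subrr add0r.
    by rewrite !(cRN, cRM, cRD) cR1; ring.
  rewrite (le_trans (nmD _ _)) // mulrDl lerD //.
    rewrite (le_trans (nmD _ _)) // !nmM !nm_cR (ger0_norm l0) (ger0_norm m0).
    have -> : 2 * K * (lnln N * inv_ln N) = l * (K * (2 * (lnln N * inv_ln N))) + m * (K * (2 * (lnln N * inv_ln N))).
      by rewrite -mulrDl lm; ring.
    rewrite lerD // ler_wpM2l // (le_trans B1, le_trans B2) // ler_wpM2l //.
    by rewrite ler_peMl // ler1n.
  rewrite nmM nm_cR ler_wpM2l //.
  apply: (@le_trans _ _ (inv_ln N)); last by rewrite ler_peMl // ltW.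
  have m1 : m <= 1 by rewrite -lm lerDr.
  have l1 : l <= 1 by rewrite -lm lerDl.
  set A := ln (ln x) - _ in d0 *; set B := _ - ln (ln x) in d1 *.
  have AB : A + B <= inv_ln N by rewrite (le_trans _ d2) // /A /B; apply: eqW; ring.
  have lA : 0 <= l * A by rewrite mulr_ge0.
  have mB : 0 <= m * B by rewrite mulr_ge0.
  have lA1 : l * A <= A by rewrite ler_piMl.
  have mB1 : m * B <= B by rewrite ler_piMl.
  by clear - R AB lA mB lA1 mB1; rewrite ler_norml; apply/andP; split; lra.
apply: (le_trans main); rewrite (mulrC 6) -mulrA ler_wpM2l //; first by rewrite addr_ge0 // mulr_ge0.
have wx : inv_ln N <= 2 * (ln x)^-1.
  rewrite (le_trans (inv_ln_half R n2)) // ler_wpM2l // lef_pV2 ?posrE ?(ln_nat_gt0 R (leqW n2)) //.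
  by rewrite ler_ln ?posrE ?(ltW N2) // (lt_le_trans x0) // ltW.
have Lx : lnln N <= 3 * ln (ln x).
  have lNx : ln N%:R <= ln x by rewrite ler_ln ?posrE // ltr0n ltnW.
  have : ln (1 + ln N%:R) <= ln (2 * ln x).
    have lN := ln_nat_gt0 R n2.
    by rewrite ler_ln ?posrE; clear - R lNx lx0 lx e2 lN; lra.
  rewrite lnM ?posrE // /lnln; have := ln2_le1 R.
  move: (ln (1 + _)) (ln 2) (ln (ln x)) llx => u v w llx u1 u2; clear - R llx u1 u2; lra.
have -> : 6 * (ln (ln x) / ln x) = (3 * ln (ln x)) * (2 * (ln x)^-1) by ring.
by rewrite ler_pM // ?(ltW w0) // (le_trans ler01).
Qed.

End Final.

(** * The integral as a Fejer-weighted prime sum *)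

Section Average.
Variable R : realType.
Variables (q a b : nat).
Local Notation class_diff := (@class_diff R q a b).
Local Notation mu := (@lebesgue_measure R).

Lemma tpow_half n : (0 < n)%N -> (Num.sqrt (n%:R : R))^-1 = tpow 2^-1 n.
Proof.
move=> n0; have N0 : 0 < n%:R :> R by rewrite ltr0n.
rewrite /tpow mulNr expRN; congr (_^-1).
by rewrite -powR12_sqrt ?ler0n // /powR gt_eqF.
Qed.

(** The range of n no longer depends on u, the condition n <= u having moved into an indicator, so
    the integral can be taken term by term; each indicator integrates to x - n. *)
Lemma pi_half_diff (u x : R) : 0 <= u -> u <= x ->
  pi_half q a u - pi_half q b u =
  \sum_(2 <= n < (Num.truncn x).+1 | prime n) tpow 2^-1 n * class_diff n * \1_(`[n%:R, x]) u.
Proof.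
move=> u0 ux; have x0 := le_trans u0 ux.
have I (n : nat) : \1_(`[n%:R, x]%classic : set R) u = (n%:R <= u)%R%:R :> R.
  rewrite indicE; congr (nat_of_bool _)%:R; apply/idP/idP => [|h]; first by rewrite inE /= in_itv /= => /andP[].
  by rewrite inE /= in_itv /= h ux.
have E c : pi_half q c u = \sum_(0 <= n < (Num.truncn x).+1 | prime n)
    tpow 2^-1 n * (n == c %[mod q])%:R * \1_(`[n%:R, x]) u.
  have ti : (Num.truncn u <= Num.truncn x)%N by exact: le_truncn.
  rewrite /pi_half -(big_mkord (fun p => [&& prime p, (p%:R <= u) & (p == c %[mod q])%N]) (fun p => (Num.sqrt (p%:R : R))^-1)).
  rewrite [RHS](@big_cat_nat _ _ _ (Num.truncn u).+1) //= [X in _ = _ + X]big_nat_cond.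
  rewrite [X in _ = _ + X]big1 => [|n /andP[/andP[n1 _] _]]; last first.
    rewrite I leNgt.
    by have -> : u < n%:R; [apply: lt_le_trans (truncnS_gt u) _; rewrite ler_nat|rewrite mulr0].
  rewrite addr0 big_mkcond [RHS]big_mkcond; apply: eq_bigr => n _ /=.
  case: ifP => [/and3P[pn nu nc]|].
    by rewrite pn nc mulr1 I nu mulr1 tpow_half // prime_gt0.
  case: ifP => // pn /=; rewrite I.
  by case: (_ <= _); case: (_ == _) => //=; rewrite ?mulr0 ?mul0r.
rewrite !E -sumrB big_mkcond /= [RHS]big_mkcond /=.
case: (posnP (Num.truncn x)) => [->|t0]; first by rewrite big_nat1 big_geq.
rewrite big_ltn // big_ltn //= !add0r; apply: eq_bigr => n _; case: ifP => // _.
by rewrite /class_diff; ring.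
Qed.

Lemma integral_step (n : nat) (x : R) : (2 <= n)%N -> n%:R <= x ->
  mu.-integrable `[2%R, x] (EFin \o \1_(`[n%:R, x])) /\
  Rintegral mu `[2%R, x] \1_(`[n%:R, x]) = x - n%:R.
Proof.
move=> n2 nx; split.
  by apply: (@integrableS _ _ _ mu setT); [exact: measurableT|exact: measurable_itv| |exact: integrable_indic_itv].
rewrite /Rintegral integral_indic; [|exact: measurable_itv|exact: measurable_itv].
rewrite setIidl; last first.
  by move=> y /=; rewrite !in_itv /= => /andP[ny ->]; rewrite andbT (le_trans _ ny) // ler_nat.
have E : lebesgue_measure (`[n%:R, x]%classic : set R) = (x - n%:R)%:E.
  rewrite lebesgue_measure_itv /= lte_fin.
  by move: nx; rewrite le_eqVlt => /orP[/eqP ->|->] //; rewrite ltxx subrr.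
exact: (congr1 fine E).
Qed.

Lemma integral_steps (s : seq nat) (c : nat -> R) (x : R) :
  (forall n, n \in s -> (2 <= n)%N /\ n%:R <= x) ->
  mu.-integrable `[2%R, x] (EFin \o (fun u => \sum_(n <- s) c n * \1_(`[n%:R, x]) u)) /\
  Rintegral mu `[2%R, x] (fun u => \sum_(n <- s) c n * \1_(`[n%:R, x]) u) = \sum_(n <- s) c n * (x - n%:R).
Proof.
elim: s => [|n s IH] h.
  split; last by under eq_Rintegral do rewrite big_nil; rewrite big_nil Rintegral_cst ?mul0r //; exact: measurable_itv.
  rewrite (_ : _ \o _ = cst 0%E); first exact: integrable0.
  by apply/funext => u /=; rewrite big_nil.
have [|I1 E1] := IH; first by move=> k ks; apply: h; rewrite inE ks orbT.
have [|n2 nx] := h n; first by rewrite mem_head.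
have [I2 E2] := integral_step n2 nx.
have mI : measurable (`[2%R, x]%classic : set (measurableTypeR R)) by exact: measurable_itv.
have I3 : mu.-integrable `[2%R, x] (EFin \o (fun u => c n * \1_(`[n%:R, x]) u)).
  by have := integrableZl mI (c n) I2.
split.
  have := integrableD mI I3 I1; congr integrable.
  by apply/funext => u /=; rewrite big_cons EFinD.
under eq_Rintegral do rewrite big_cons.
by rewrite RintegralD // RintegralZl // E2 E1 big_cons.
Qed.

Lemma avg_diffE (x : R) : 2 <= x -> avg_diff q a b x = @fejer_prime_sum R q a b x.
Proof.
move=> x2; have x0 : 0 < x by exact: lt_le_trans x2.
rewrite /avg_diff (@eq_Rintegral _ _ _ mu _
  (fun u => \sum_(n <- [seq n <- index_iota 2 (Num.truncn x).+1 | prime n]) (tpow 2^-1 n * class_diff n) * \1_(`[n%:R, x]) u)).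
  have [|_ ->] := @integral_steps [seq n <- index_iota 2 (Num.truncn x).+1 | prime n] (fun n => tpow 2^-1 n * class_diff n) x.
    move=> n; rewrite mem_filter mem_index_iota => /and3P[_ n2 nx]; split=> //.
    by rewrite -truncn_ge_nat // ltW.
  rewrite big_filter /fejer_prime_sum mulr_sumr; apply: eq_bigr => n _.
  by field; exact: lt0r_neq0.
move=> u; rewrite inE /= in_itv /= => /andP[u2 ux]; rewrite big_filter (@pi_half_diff u x) //.
exact: le_trans u2.
Qed.

End Average.

Theorem theorem1p4 (R : realType) (q a b : nat) :
  (3 <= q)%N -> coprime a q -> coprime b q -> (a != b %[mod q])%N ->
  (* GRH for every non-principal character mod q *)
  (forall chi, @nonprincipal_chars R q chi ->
     forall s : Cx R, 2^-1 < complex.Re s -> Lchi chi s != 0) ->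
  exists C : Cx R, exists K : R, exists X0 : R, forall x : R, X0 <= x ->
    `| cR (avg_diff q a b x) - (- @Mqab R q a b * cR (ln (ln x)) + C) |
      <= cR (K * (ln (ln x) / ln x)).
Proof.
move=> q3 ca cb _ hG; have q1 : (1 < q)%N by exact: ltnW.
have [X [Xu XE]] := @dchar_seq R q q1.
have [K0 K00 hPF] := prime_diff_sum_bound q1 Xu XE hG ca cb.
have [c [K K1 h]] := fejer_prime_sum_asymp K00 hPF.
exists c, K, (expR (expR 1)) => x hx.
have x2 : 2 <= x.
  apply: le_trans hx; have := @expR_ge1Dx R (expR 1); have := @expR_ge1Dx R 1.
  by clear - R; lra.
by rewrite avg_diffE // normE ler_cR h.
Qed.
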